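(* Let $M$ be a closed connected smooth Riemannian manifold and let $DT^*M\subset T^*M$ be the open unit disc cotangent bundle. Let $\alpha$ be a nontrivial free homotopy class of loops in $M$, and let $\ell_\alpha$ be the infimum of the lengths of periodic geodesics in $M$ representing $\alpha$. Let $H\in C^\infty([0,1]\times DT^*M)$, $(t,z)\mapsto H_t(z)$, be compactly supported and suppose that $$\sup_{[0,1]\times M} H=:-c\le-\ell_\alpha ,$$ where $M\subset DT^*M$ denotes the zero section. Then the Hamiltonian system $(DT^*M,\Omega_{can},H)$ admits a 1-periodic orbit $z$, that is, a solution $z=(x,y):[0,1]\to DT^*M$ of $\dot z(t)=X_{H_t}(z(t))$ with $z(0)=z(1)$, such that $[\pi(z)]=\alpha$ and whose symplectic action satisfies $\mathcal{A}_H(z)\ge c$.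
   Context: $\pi:T^*M\to M$ is the cotangent bundle with Liouville form $\theta$ (locally $\theta=\sum_i y_i\,dx^i$) and canonical symplectic form $\Omega_{can}=-d\theta$. The Riemannian metric induces fibre norms on $T^*M$, and $DT^*M=\{(x,y)\in T^*M: |y|<1\}$. Points of $T^*M$ are written $(x,y)$ with $y\in T_x^*M$; $M$ is identified with the zero section. The Hamiltonian vector field $X_{H_t}$ is defined by $dH_t=\iota(X_{H_t})\Omega_{can}$. The symplectic action of a loop $z=(x,y)$ parametrized by $[0,1]$ is $$\mathcal{A}_H(x,y)=\int_0^1\big(\langle y(t),\dot x(t)\rangle-H_t(x(t),y(t))\big)\,dt.$$ A free homotopy class of loops in $M$ is a homotopy class of maps $S^1=\mathbb{R}/\mathbb{Z}\to M$ without base point; it is nontrivial if it is not the class of constant loops. A periodic geodesic representing $\alpha$ is $x\in C^\infty(S^1,M)$ with $\nabla_t\partial_t x\equiv 0$ and $[x]=\alpha$. *)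

(* Defs.v *)
From HB Require Import structures.
From mathcomp Require Import all_boot all_order all_algebra.
From mathcomp Require Import all_classical all_reals all_analysis.

Set Implicit Arguments.
Unset Strict Implicit.
Unset Printing Implicit Defensive.

Import Order.TTheory GRing.Theory Num.Theory.
Import numFieldNormedType.Exports.

Local Open Scope classical_set_scope.
Local Open Scope ring_scope.

(* C^k on U; meant for open U. *)
Fixpoint Ck_on (R : realType) (V W : normedModType R) (k : nat)
    (U : set V) (f : V -> W) : Prop :=
  match k with
  | 0 => forall x, U x -> {for x, continuous f}
  | k'.+1 => (forall x, U x -> differentiable f x) /\
             (forall v, Ck_on k' U ('D_v f))
  end.

(* C^oo on an arbitrary subset D: locally the restriction of a C^oo map defined
   on an open set.  This is what smoothness on the closed interval [0, 1]
   means. *)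
Definition smooth_on (R : realType) (V W : normedModType R)
    (D : set V) (f : V -> W) : Prop :=
  forall x, D x -> exists U : set V, exists g : V -> W,
    [/\ open U, U x, forall k, Ck_on k U g & forall y, U y -> D y -> g y = f y].

(* Derivative at t relative to D: one-sided at the end points of an interval. *)
Definition has_deriv_in (R : realType) (V : normedModType R)
    (D : set R) (f : R -> V) (t : R) (v : V) : Prop :=
  (fun s => (s - t)^-1 *: (f s - f t)) @ within D t^' --> v.

Definition deriv_in (R : realType) (V : normedModType R)
    (D : set R) (f : R -> V) (t : R) : V :=
  lim ((fun s => (s - t)^-1 *: (f s - f t)) @ within D t^').

Definition dotv (R : realType) (n : nat) (u v : 'rV[R]_n) : R :=
  (u *m v^T) 0 0.

(* The chart [chart_at x] is a preferred chart around x: it makes the charts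
   cover M and is used to represent covectors at x. [chart] and [chart_inv] are
   only meaningful on [chart_dom] and [chart_img]. *)
Record smooth_atlas (R : realType) (n : nat) (M : topologicalType) := SmoothAtlas {
  chart_index : Type;
  chart_dom : chart_index -> set M;
  chart : chart_index -> M -> 'rV[R]_n;
  chart_inv : chart_index -> 'rV[R]_n -> M;
  chart_at : M -> chart_index;
  chart_img := fun i => chart i @` chart_dom i;
  mem_chart_at : forall x, chart_dom (chart_at x) x;
  open_chart_dom : forall i, open (chart_dom i);
  open_chart_img : forall i, open (chart_img i);
  chartK : forall i x, chart_dom i x -> chart_inv i (chart i x) = x;
  chart_continuous : forall i x, chart_dom i x -> {for x, continuous (chart i)};
  chart_inv_continuous : forall i q, chart_img i q ->
    {for q, continuous (chart_inv i)};
  transition_smooth : forall i j,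
    smooth_on (chart i @` (chart_dom i `&` chart_dom j))
              (chart j \o chart_inv i) }.

Definition closed_connected_manifold (R : realType) (n : nat)
    (M : topologicalType) (A : smooth_atlas R n M) : Prop :=
  [/\ hausdorff_space M, compact [set: M] & connected [set: M]].

(* Jacobian at x of the change of charts from i to j.  Vectors are rows, so the
   components v_i, v_j of a tangent vector satisfy v_j = v_i *m J_ij, and those
   of a covector, which must keep dotv y_i v_i invariant, y_i = y_j *m J_ij^T. *)
Definition transition_jacobian (R : realType) (n : nat) (M : topologicalType)
    (A : smooth_atlas R n M) (i j : chart_index A) (x : M) : 'M[R]_n :=
  jacobian (chart j \o chart_inv i) (chart i x).

(* [metric i q] is the Gram matrix of the metric in chart i at the point with
   coordinates q. *)
Record riemannian_metric (R : realType) (n : nat) (M : topologicalType)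
    (A : smooth_atlas R n M) := RiemannianMetric {
  metric :> chart_index A -> 'rV[R]_n -> 'M[R]_n;
  metric_smooth : forall i, smooth_on (chart_img i) (metric i);
  metric_sym : forall i q, chart_img i q -> (metric i q)^T = metric i q;
  metric_pos : forall i q, chart_img i q ->
    forall v : 'rV[R]_n, v != 0 -> 0 < dotv (v *m metric i q) v;
  metric_transition : forall i j x, chart_dom i x -> chart_dom j x ->
    metric i (chart i x) =
      transition_jacobian i j x *m metric j (chart j x)
        *m (transition_jacobian i j x)^T }.

Section Curves.
Context (R : realType) (n : nat) (M : topologicalType).
Context (A : smooth_atlas R n M) (g : riemannian_metric A).
Implicit Types (i : chart_index A) (x : R -> M).

Definition smooth_curve x : Prop :=
  continuous x /\ forall i, smooth_on (x @^-1` chart_dom i) (chart i \o x).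

Definition curve_length x : R :=
  (\int[lebesgue_measure]_(t in `[0, 1]%classic)
    let i := chart_at A (x t) in
    let v := derive1 (chart i \o x) t in
    Num.sqrt (dotv (v *m g i (chart i (x t))) v))%R.

(* Christoffel symbol of the Levi-Civita connection, lower indices a b. *)
Definition christoffel i (q : 'rV[R]_n) (k a b : 'I_n) : R :=
  let partial (c : 'I_n) (G : 'rV[R]_n -> R) : R := 'D_(delta_mx 0 c) G q in
  2^-1 * \sum_l invmx (g i q) k l *
    (partial a (fun p => g i p b l) + partial b (fun p => g i p a l)
     - partial l (fun p => g i p a b)).

(* Components in chart i of the covariant derivative of the velocity of x. *)
Definition covariant_acceleration i x (t : R) : 'rV[R]_n :=
  let u := chart i \o x in
  \row_k (derive1n 2 u t 0 k
    + \sum_a \sum_b christoffel i (u t) k a b * derive1 u t 0 a * derive1 u t 0 b).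

(* Maps on the circle R/Z are 1-periodic maps on R. *)
Definition periodic_geodesic x : Prop :=
  [/\ forall t, x (t + 1) = x t,
      smooth_curve x &
      forall t i, chart_dom i (x t) -> covariant_acceleration i x t = 0].

End Curves.

Section FreeHomotopy.
Context (R : realType) (M : topologicalType).
Implicit Types (gamma delta : R -> M) (alpha : set (R -> M)).

Definition is_loop gamma : Prop :=
  continuous gamma /\ forall t, gamma (t + 1) = gamma t.

Definition freely_homotopic gamma delta : Prop :=
  exists F : R * R -> M,
    [/\ {within `[0, 1]%classic `*` [set: R], continuous F},
        forall s t, `[0, 1]%classic s -> F (s, t + 1) = F (s, t),
        forall t, F (0, t) = gamma t &
        forall t, F (1, t) = delta t].

Definition free_homotopy_class alpha : Prop :=
  exists2 gamma, is_loop gamma &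
    alpha = [set delta | is_loop delta /\ freely_homotopic gamma delta].

Definition nontrivial_class alpha : Prop := forall p : M, ~ alpha (cst p).

End FreeHomotopy.

Definition ell (R : realType) (n : nat) (M : topologicalType)
    (A : smooth_atlas R n M) (g : riemannian_metric A)
    (alpha : set (R -> M)) : \bar R :=
  ereal_inf [set (curve_length g x)%:E | x in
    [set x | periodic_geodesic g x /\ alpha x]].

(* [fib] lists the components of the covector in the chart
   [chart_at A base]. *)
Record cotangent (R : realType) (n : nat) (M : topologicalType)
    (A : smooth_atlas R n M) := Cotangent {
  base : M;
  fib : 'rV[R]_n }.

HB.instance Definition _ (R : realType) (n : nat) (M : topologicalType)
  (A : smooth_atlas R n M) := gen_eqMixin (cotangent A).
HB.instance Definition _ (R : realType) (n : nat) (M : topologicalType)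
  (A : smooth_atlas R n M) := gen_choiceMixin (cotangent A).

Section Cotangent.
Context (R : realType) (n : nat) (M : topologicalType) (A : smooth_atlas R n M).
Local Notation V := 'rV[R]_n.
Implicit Types (i : chart_index A) (z : cotangent A) (w : V * V).

(* Bundle chart z |-> (q, p) over chart i, and its inverse. *)
Definition cot_chart i z : V * V :=
  (chart i (base z),
   fib z *m (transition_jacobian i (chart_at A (base z)) (base z))^T).

Definition cot_chart_inv i w : cotangent A :=
  let x := chart_inv i w.1 in
  Cotangent A x (w.2 *m (transition_jacobian (chart_at A x) i x)^T).

Definition cot_open (U : set (cotangent A)) : Prop :=
  forall i, open [set w | chart_img i w.1 /\ U (cot_chart_inv i w)].

Lemma cot_openT : cot_open setT.
Proof.
move=> i.
have -> : [set w : V * V | chart_img i w.1 /\ setT (cot_chart_inv i w)]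
    = fst @^-1` chart_img i by apply/seteqP; split=> [w []|w].
by apply: open_comp => [w _|]; [exact: cvg_fst | exact: open_chart_img].
Qed.

Lemma cot_openI : setI_closed cot_open.
Proof.
move=> U U' oU oU' i.
have -> : [set w | chart_img i w.1 /\ (U `&` U') (cot_chart_inv i w)]
    = [set w | chart_img i w.1 /\ U (cot_chart_inv i w)]
      `&` [set w | chart_img i w.1 /\ U' (cot_chart_inv i w)].
  by apply/seteqP; split=> w /= [] => [iw [? ?]|[? ?] [? ?]].
exact: openI.
Qed.

Lemma cot_open_bigU (I : Type) (U : I -> set (cotangent A)) :
  (forall k, cot_open (U k)) -> cot_open (\bigcup_k U k).
Proof.
move=> oU i.
have -> : [set w | chart_img i w.1 /\ (\bigcup_k U k) (cot_chart_inv i w)]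
    = \bigcup_k [set w | chart_img i w.1 /\ U k (cot_chart_inv i w)].
  by apply/seteqP; split=> [w [iw [k _ ?]]|w [k _ [? ?]]]; [exists k|split=> //; exists k].
by apply: bigcup_open => k _; exact: oU.
Qed.

HB.instance Definition _ := isOpenTopological.Build (cotangent A)
  cot_openT cot_openI cot_open_bigU.

Definition zero_section (x : M) : cotangent A := Cotangent A x 0.

(* Liouville form y dx in a bundle chart, at (q, p) = w on the vector u. *)
Definition liouville (w u : V * V) : R := dotv w.2 u.1.

(* Exterior derivative of a 1-form on a vector space, evaluated on constant
   vector fields. *)
Definition ext_deriv1 (theta : V * V -> V * V -> R) (w u v : V * V) : R :=
  'D_u (fun w' => theta w' v) w - 'D_v (fun w' => theta w' u) w.

Definition omega_can (w u v : V * V) : R := - ext_deriv1 liouville w u v.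

(* X represents, in the bundle chart over i, the Hamiltonian vector field of h
   at z:  dh = iota(X) omega_can. *)
Definition hamiltonian_vector i (h : cotangent A -> R) z (X : V * V) : Prop :=
  forall v, 'd (h \o cot_chart_inv i) (cot_chart i z) v
            = omega_can (cot_chart i z) X v.

End Cotangent.

Section Hamiltonian.
Context (R : realType) (n : nat) (M : topologicalType).
Context (A : smooth_atlas R n M) (g : riemannian_metric A).
Implicit Types (H : R -> cotangent A -> R) (z : R -> cotangent A).

Definition cot_norm (y : cotangent A) : R :=
  let i := chart_at A (base y) in
  let p := (cot_chart i y).2 in
  Num.sqrt (dotv (p *m invmx (g i (chart i (base y)))) p).

Definition disc_cotangent : set (cotangent A) := [set y | cot_norm y < 1].

(* A Hamiltonian is given by a function on R x T^*M of which only the values on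
   [0, 1] x DT^*M are ever used. *)
Definition ham_domain : set (R * cotangent A) := `[0, 1]%classic `*` disc_cotangent.

Definition smooth_hamiltonian H : Prop :=
  forall i, smooth_on
    [set p : R * ('rV[R]_n * 'rV[R]_n) |
      chart_img i p.2.1 /\ ham_domain (p.1, cot_chart_inv i p.2)]
    (fun p => H p.1 (cot_chart_inv i p.2)).

(* The support is the closure relative to [0, 1] x DT^*M. *)
Definition compactly_supported H : Prop :=
  compact (closure [set p | ham_domain p /\ H p.1 p.2 != 0] `&` ham_domain).

Definition periodic_orbit H z : Prop :=
  [/\ {within `[0, 1]%classic, continuous z},
      forall t, `[0, 1]%classic t -> disc_cotangent (z t),
      z 0 = z 1 &
      forall t i, `[0, 1]%classic t -> chart_dom i (base (z t)) ->
        exists2 X, hamiltonian_vector i (H t) (z t) X &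
          has_deriv_in `[0, 1]%classic (cot_chart i \o z) t X].

Definition symplectic_action H z : R :=
  (\int[lebesgue_measure]_(t in `[0, 1]%classic)
    let i := chart_at A (base (z t)) in
    (dotv (cot_chart i (z t)).2
          (deriv_in `[0, 1]%classic (fun s => chart i (base (z s))) t)
     - H t (z t)))%R.

End Hamiltonian.

(* Submission.v *)
(** Ramp [H] up outside its support, with slope governed by the speed of a
geodesic shorter than [c / (rho' + a)]. A linking argument for the discrete
action gives almost critical loops of action at least about [c]; an ultrafilter
limit is an orbit of the ramped system, whose action forces it into the region
where the ramp vanishes. *)
From HB Require Import structures.
Require Import Defs.
From mathcomp Require Import all_boot all_order all_algebra.
From mathcomp Require Import all_classical all_reals all_analysis.
From mathcomp Require Import ring lra zify.

Set Implicit Arguments.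
Unset Strict Implicit.
Unset Printing Implicit Defensive.

Import Order.TTheory GRing.Theory Num.Theory.
Import numFieldNormedType.Exports.

Local Open Scope classical_set_scope.
Local Open Scope ring_scope.

(** Loops in M form no linear space, so M is embedded in a Euclidean space by [iota_emb], and the
    discrete action lives on nodes x in M and ambient covectors y, the Hamiltonian being pulled back
    along y -> y o d iota. This pullback ignores the part of y normal to M; an added term kappa (<y>
    - 1), with kappa tending to 0, controls it. The linking pair is {y = 0}, where the action is at
    least c since H <= -c on the zero section, and {x = discretized geodesic}, where <y, x'> <=
    speed |y| is absorbed by a ramp whose slope at time t is that speed, while the kappa term makes
    the action fall with y. Bounds on y uniform in kappa and in the mesh come from a dichotomy:
    either some node has norm at most rho and a discrete Gronwall inequality bounds the others, or
    all nodes lie beyond rho, where the action is at most about (rho' + a) times the length, below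
    c. Nontriviality of alpha gives c > 0, because very short loops are contractible. The ramp is
    only C^1 in space and continuous in time, so calculus is based on strict differentiability. *)

Local Notation CCM := closed_connected_manifold.
Local Notation cdom := chart_dom.
Local Notation cimg := chart_img.
Local Notation SA := smooth_atlas.
Local Notation RM := riemannian_metric.
Local Notation NM := normedModType.
Local Notation Top := topologicalType.
Local Notation cts z f := {for z, continuous f}.
Implicit Type R : realType.

(** * Parity count on labelled cubical grids *)

Section CubicalParity.
Variable d : nat.
Local Notation pt := {ffun 'I_d -> nat}.
Variables (F2 : fieldType)
 (addF2 : forall x : F2, x + x = 0).
Definition bump_pt (x : pt) (a : 'I_d) : pt := [ffun b => (x b + (b == a))%N].
Definition set_pt (x : pt) (a : 'I_d) (k : nat) : pt :=
 [ffun b => if b == a then k else x b].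
(** The cubical cup product, in characteristic two, of the coboundaries of the functions in [L], on
    the cube with lowest corner [x] and directions [A]: a sum over monotone edge paths of the
    product of the increments along the path. *)
Fixpoint cup (L : seq (pt -> F2)) (A : {set 'I_d}) (x : pt) : F2 :=
 if L is l :: L' then
 \sum_(b in A) (l (bump_pt x b) + l x) * cup L' (A :\ b) (bump_pt x b)
 else 1.
Let eqF2 (x y : F2) : x + y = 0 -> x = y.
by move=> xy;rewrite -[x]addr0 -(addF2 y) addrA xy add0r. Qed.
Lemma bump_ptC x a b : bump_pt (bump_pt x a) b = bump_pt (bump_pt x b) a.
by apply/ffunP => c;rewrite !ffunE addnAC. Qed.
Let sum_sym (A : {set 'I_d}) (G : 'I_d -> 'I_d -> F2) :
 (forall a b, G a b = G b a) -> \sum_(a in A) \sum_(b in A :\ a) G a b = 0.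
move=> Gsym.
have E : \sum_(a in A) \sum_(b in A :\ a) G a b
 = \sum_(a in A) \sum_(b in A | (a < b)%N) G a b
 + \sum_(a in A) \sum_(b in A | (b < a)%N) G a b.
 rewrite -big_split /=;apply: eq_bigr => a aA.
 rewrite (bigID (fun b : 'I_d => (a < b)%N)) /=;congr (_ + _);apply: eq_bigl => b;
 rewrite !inE;case: (b \in A);rewrite ?andbF ?andbT //= -val_eqE /=;
 have [->|/eqP nab] := eqVneq b a;rewrite ?ltnn ?eqxx //=;
 by case: ltngtP => // E;case: nab;apply: ord_inj.
rewrite E [X in _ + X](exchange_big_dep (fun a => a \in A)) /=;last by move=> a b _ /andP[].
rewrite -big_split /= big1// => a aA;rewrite -[RHS](addF2 (\sum_(b in A | (a < b)%N) G a b)).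
congr (_ + _);apply: eq_big => [b|b _];last exact: Gsym.
by rewrite aA.
Qed.
(** A cup product of exact cochains is closed. Induction on [L]: after expansion, the terms
    symmetric in the two removed directions cancel in pairs, and the mixed ones are instances of the
    induction hypothesis. *)
Lemma cup_closed (L : seq (pt -> F2)) (A : {set 'I_d}) x :
 #|A| = (size L).+1 ->
 \sum_(a in A) (cup L (A :\ a) (bump_pt x a) + cup L (A :\ a) x) = 0.
elim: L A x => [|l L IH] A x cA.
 by rewrite big1 // => a _ /=;exact: addF2.
have cA1 a : a \in A -> #|A :\ a| = (size L).+1.
 by move=> aA;apply/eqP;rewrite -eqSS -cA (cardsD1 a A) aA.
have D2 a b : A :\ a :\ b = A :\ b :\ a by rewrite !finset.setDDl finset.setUC.
pose T1 a b := l (bump_pt (bump_pt x a) b) * cup L (A :\ a :\ b) (bump_pt (bump_pt x a) b).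
pose T2 a b := l (bump_pt x a) * cup L (A :\ a :\ b) (bump_pt (bump_pt x a) b).
pose T3 a b := l (bump_pt x b) * cup L (A :\ a :\ b) (bump_pt x b).
pose T4 a b := l x * cup L (A :\ a :\ b) (bump_pt x b).
have -> : \sum_(a in A) (cup (l :: L) (A :\ a) (bump_pt x a) + cup (l :: L) (A :\ a) x)
 = \sum_(a in A) \sum_(b in A :\ a) T1 a b
 + (\sum_(a in A) \sum_(b in A :\ a) T2 a b
 + \sum_(a in A) \sum_(b in A :\ a) T3 a b)
 + \sum_(a in A) \sum_(b in A :\ a) T4 a b.
 rewrite -!big_split /=;apply: eq_bigr => a _;rewrite -!big_split /=.
 apply: eq_bigr => b _;rewrite /T1 /T2 /T3 /T4;ring.
have exc (G : 'I_d -> 'I_d -> F2) : \sum_(a in A) \sum_(b in A :\ a) G a b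
 = \sum_(a in A) \sum_(b in A :\ a) G b a.
 rewrite (exchange_big_dep (fun b => b \in A)) /=;last by move=> a b _;rewrite !inE => /andP[].
 apply: eq_bigr => b bA;apply: eq_bigl => a.
 by rewrite !inE bA andbT eq_sym andbC.
have -> : \sum_(a in A) \sum_(b in A :\ a) T1 a b = 0.
 by apply: sum_sym => a b;rewrite /T1 bump_ptC D2.
rewrite (exc T3) -big_split /= big1;last first.
 move=> a aA;rewrite -big_split /=.
 have := congr1 (fun z => l (bump_pt x a) * z) (IH (A :\ a) (bump_pt x a) (cA1 a aA)).
 rewrite mulr0 mulr_sumr;apply: etrans;apply: eq_bigr => b _.
 by rewrite /T2 /T3 mulrDr D2.
rewrite !add0r exc.
apply: etrans (_ : \sum_(a in A) \sum_(b in A :\ a)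
 l x * cup L (A :\ a :\ b) (bump_pt (bump_pt x a) b) = 0);last first.
 by apply: sum_sym => a b;rewrite bump_ptC D2.
apply: eq_bigr => a aA;rewrite -!mulr_sumr;congr (_ * _).
apply: eqF2;rewrite -big_split /=.
apply: etrans (IH (A :\ a) (bump_pt x a) (cA1 a aA));apply: eq_bigr => b _.
by rewrite addrC D2.
Qed.
(** A label constant on the face spanned by [A] has zero increment on whichever edge a path assigns
    to it, so every product has a zero factor. *)
Lemma cup_const (L : seq (pt -> F2)) (A : {set 'I_d}) (x : pt) (l : pt -> F2) v :
 List.In l L -> (forall y : pt, (forall b, b \notin A -> y b = x b) -> l y = v) ->
 cup L A x = 0.
elim: L A x => //= l' L IH A x lL lv;apply: big1 => b bA.
have bump_out c : c \notin A -> bump_pt x b c = x c.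
 by rewrite ffunE;case: eqP => [->|_ _];[rewrite bA|rewrite addn0].
case: lL => [->|lL];first by rewrite !lv // (addF2 v) mul0r.
rewrite (IH _ _ lL) ?mulr0 // => y hy;apply: lv => c cA.
by rewrite hy ?bump_out // !inE (negbTE cA) andbF.
Qed.
Lemma cup_neq0 (l : 'I_d -> pt -> F2) (s : seq 'I_d) (A : {set 'I_d}) (x : pt) :
 cup [seq l a | a <- s] A x != 0 ->
 forall a, a \in s -> exists y z : pt,
 [/\ l a y != l a z, forall b, (x b <= y b <= (x b).+1)%N
 & forall b, (x b <= z b <= (x b).+1)%N].
suff H (x0 : pt) : (forall b, b \in A -> x b = x0 b) -> (forall b, (x0 b <= x b <= (x0 b).+1)%N) ->
 cup [seq l a | a <- s] A x != 0 -> forall a, a \in s -> exists y z : pt,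
 [/\ l a y != l a z, forall b, (x0 b <= y b <= (x0 b).+1)%N
 & forall b, (x0 b <= z b <= (x0 b).+1)%N].
 by apply: H => // b;rewrite leqnn leqnSn.
elim: s A x => //= a s IH A x xA xb ne.
have [b bA nb] : exists2 b, b \in A & (l a (bump_pt x b) + l a x) * cup [seq l a | a <- s] (A :\ b) (bump_pt x b) != 0.
 apply: contrapT => nex;move: ne;rewrite big1 ?eqxx // => b bA.
 by apply/eqP;apply: contrapT => /negP h;apply: nex;exists b.
have bx c : (x0 c <= bump_pt x b c <= (x0 c).+1)%N.
 rewrite ffunE;case: eqP => [->|_];last by rewrite addn0.
 by rewrite xA // addn1 leqnSn leqnn.
move=> c;rewrite inE => /orP[/eqP->|cs].
 exists (bump_pt x b), x;split=> //;apply: contraNneq nb => ->.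
 by rewrite (addF2 (l a x)) mul0r.
apply: (IH (A :\ b) (bump_pt x b)) => //.
 by move=> e;rewrite !inE => /andP[eb eA];rewrite ffunE (negbTE eb) addn0 xA.
by apply: contraNneq nb => ->;rewrite mulr0.
Qed.
Fixpoint box_sum (K : nat) (s : seq 'I_d) (F : pt -> F2) (x : pt) : F2 :=
 if s is a :: s' then \sum_(i < K) box_sum K s' F (set_pt x a i) else F x.
Lemma set_ptC x a b i j : a != b -> set_pt (set_pt x a i) b j = set_pt (set_pt x b j) a i.
move=> nab;apply/ffunP => c;rewrite !ffunE;case: eqP => // ->.
by rewrite eq_sym (negbTE nab).
Qed.
Lemma bump_set x a k : bump_pt (set_pt x a k) a = set_pt x a k.+1.
by apply/ffunP => c;rewrite !ffunE;case: eqP => // _;rewrite ?addn1 ?addn0. Qed.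
Lemma eq_box_sum K s F G x : (forall y, F y = G y) -> box_sum K s F x = box_sum K s G x.
by move=> FG;elim: s x => //= a s IH x;apply: eq_bigr => i _. Qed.
Lemma box_sum_sum K s (I : finType) (P : pred I) (F : I -> pt -> F2) x :
 box_sum K s (fun y => \sum_(i | P i) F i y) x = \sum_(i | P i) box_sum K s (F i) x.
elim: s x => //= a s IH x;rewrite exchange_big /=;apply: eq_bigr => i _;exact: IH.
Qed.
Lemma box_sum_set K s a (G : pt -> F2) x k : a \notin s ->
 box_sum K s G (set_pt x a k) = box_sum K s (fun y => G (set_pt y a k)) x.
elim: s x => //= c s IH x;rewrite inE negb_or => /andP[nac ns].
by apply: eq_bigr => j _;rewrite set_ptC // IH.
Qed.
Lemma box_sum_rem K s a F x : uniq s -> a \in s ->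
 box_sum K s F x = box_sum K (rem a s) (fun y => \sum_(i < K) F (set_pt y a i)) x.
elim: s x => //= b s IH x /andP[bs us];rewrite inE;case: (eqVneq b a) => [ba|nba] /= => [_|].
 rewrite -ba box_sum_sum;apply: eq_bigr => i _;exact: box_sum_set.
move=> as_;apply: eq_bigr => i _;exact: IH.
Qed.
Let telescope2 K (h : nat -> F2) : \sum_(i < K) (h i.+1 + h i) = h K + h 0%N.
elim: K => [|K IH];first by rewrite big_ord0 addF2.
rewrite big_ord_recr /= IH addrC -addrA;congr (_ + _).
by rewrite addrA addF2 add0r.
Qed.
(** Stokes on the grid. The integrand is the coboundary of [l a] times the cup product of the other
    labels, so the sum telescopes to opposite faces. In a direction b other than a both faces
    contribute 0, as [l b] is constant on each; of the two a-faces only the one with [l a = 1]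
    survives, and it carries the same sum in one dimension less. *)
Lemma box_sum_cup K (l : 'I_d -> pt -> F2) s (x : pt) : uniq s ->
 (forall a (y : pt), y a = 0%N -> l a y = 0) -> (forall a (y : pt), y a = K -> l a y = 1) ->
 box_sum K s (cup [seq l a | a <- s] [set a in s]) x = 1.
move=> us l0 l1;elim: s us x => [|a s IH] //= /andP[nas us] x.
pose A := [set b in a :: s].
pose L := [seq l a | a <- s].
pose g b y := l a y * cup L (A :\ b) y.
have cA : #|A| = (size L).+1 by rewrite cardsE /= (card_uniqP _) /= ?nas // size_map.
have E y : cup (l a :: L) A y = \sum_(b in A) (g b (bump_pt y b) + g b y).
 (* Adding [l a y] times the closedness relation turns the cup product into an exact coboundary. *)
 have := congr1 (fun z => cup (l a :: L) A y + l a y * z) (cup_closed y cA).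
 rewrite mulr0 addr0 => <-;rewrite mulr_sumr -big_split /=.
 apply: eq_bigr => b _;rewrite /g mulrDl mulrDr addrA;congr (_ + _).
 by rewrite -addrA addF2 addr0.
have -> : \sum_(i < K) box_sum K s (cup [seq l a0 | a0 <- a :: s] A) (set_pt x a i)
 = box_sum K (a :: s) (fun y => \sum_(b in A) (g b (bump_pt y b) + g b y)) x.
 by apply: eq_bigr => i _;apply: eq_box_sum => y;exact: E.
rewrite box_sum_sum.
have B b : b \in A -> box_sum K (a :: s) (fun y => g b (bump_pt y b) + g b y) x =
 box_sum K (rem b (a :: s)) (fun y => g b (set_pt y b K) + g b (set_pt y b 0)) x.
 rewrite inE => bA;rewrite (@box_sum_rem K (a :: s) b) //=;last by rewrite nas.
 apply: eq_box_sum => y;rewrite -(telescope2 K (fun i => g b (set_pt y b i))).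
 by apply: eq_bigr => i _;rewrite bump_set.
have As b : b \in s -> A :\ b = [set c in rem b (a :: s)].
 move=> bs;apply/setP => c;rewrite !inE mem_rem_uniq ?inE //= nas //.
have one (G : 'I_d -> F2) : (forall b, (b \in A) && (b != a) -> G b = 0) -> \sum_(b in A) G b = G a.
 by move=> G0;rewrite (bigD1 a) /= ?big1 ?addr0 // /A inE /= inE eqxx.
rewrite one;last first.
 move=> b;rewrite /A !inE => /andP[/orP[/eqP->|bs] nb];first by rewrite eqxx in nb.
 rewrite B /A ?inE ?bs ?orbT //.
 rewrite (@eq_box_sum K _ _ (fun=> 0));last first.
 move=> y;have c0 k : (forall z : pt, z b = k -> exists v, forall z' : pt, z' b = k -> l b z' = v) ->
 cup L (A :\ b) (set_pt y b k) = 0.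
 case/(_ (set_pt y b k));first by rewrite ffunE eqxx.
 move=> v hv;apply: (@cup_const _ _ _ (l b) v).
 by apply/List.in_map_iff;exists b;split => //;move: bs;elim: (s) => //= c t IHt;
 rewrite inE => /orP[/eqP->|/IHt];[left|right].
 move=> z hz;apply: hv;rewrite hz;first by rewrite ffunE eqxx.
 by rewrite !inE eqxx.
 rewrite /g !c0 ?mulr0 ?addr0 //.
 by move=> _ _;exists 0 => z' /l0.
 by move=> _ _;exists 1 => z' /l1.
 by elim: (rem b _) x {B E} => //= c t IHt x;rewrite big1.
rewrite B /A ?inE ?eqxx //= eqxx.
have As0 : A :\ a = [set c in s].
 apply/setP => c;rewrite !inE;case: eqP => [->|] //=;by rewrite (negbTE nas).
rewrite (@eq_box_sum K _ _ (fun y => cup L [set c in s] (set_pt y a K)));last first.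
 by move=> y;rewrite /g l1 ?ffunE ?eqxx // l0 ?ffunE ?eqxx // mul0r addr0 mul1r As0.
by rewrite -box_sum_set // IH.
Qed.
Lemma box_sum_neq0 K s (F : pt -> F2) (x : pt) : box_sum K s F x != 0 ->
 exists2 y : pt, F y != 0 & forall a, if a \in s then (y a < K)%N else y a == x a.
elim: s x => /= [|a s IH] x ne;first by exists x => // a;rewrite in_nil.
have [i ni] : exists i : 'I_K, box_sum K s F (set_pt x a i) != 0.
 apply: contrapT => nex;move: ne;rewrite big1 ?eqxx // => i _.
 by apply/eqP;apply: contrapT => /negP h;apply: nex;exists i.
have [y Fy yP] := IH _ ni;exists y => // c;have := yP c;rewrite inE.
by case: (c \in s);rewrite ?orbT // orbF ffunE;case: (c == a) => // /eqP ->.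
Qed.
End CubicalParity.
(** The total parity is 1, so the cup product of all labels is nonzero on some cube, and there every
    label takes both values. *)
Lemma cubical_miranda d K (l : 'I_d -> {ffun 'I_d -> nat} -> bool) :
 (forall a (y : {ffun 'I_d -> nat}), y a = 0%N -> l a y = false) -> (forall a (y : {ffun 'I_d -> nat}), y a = K -> l a y = true) ->
 exists2 x : {ffun 'I_d -> nat}, forall a, (x a < K)%N & forall a, exists y z : {ffun 'I_d -> nat},
 [/\ l a y, ~~ l a z, forall b, (x b <= y b <= (x b).+1)%N
 & forall b, (x b <= z b <= (x b).+1)%N].
move=> l0 l1;have F2 (u : 'F_2) : u + u = 0 by apply: addrr_pchar2;rewrite inE.
pose lF a y : 'F_2 := (l a y)%:R.
have := @box_sum_cup d 'F_2 F2 K lF (enum 'I_d) [ffun=> 0%N] (enum_uniq _).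
move=> /(_ (fun a y h => congr1 (fun b : bool => b%:R) (l0 a y h))).
move=> /(_ (fun a y h => congr1 (fun b : bool => b%:R) (l1 a y h))) S.
have : box_sum K (enum 'I_d) (cup [seq lF a | a <- enum 'I_d] [set a in enum 'I_d]) [ffun=> 0%N] != 0.
 by rewrite S oner_eq0.
case/box_sum_neq0 => x cx xK;exists x => a;first by have := xK a;rewrite mem_enum.
have [//|y [z [yz yb zb]]] := cup_neq0 F2 cx (a := a);first by rewrite mem_enum.
move: yz;rewrite /lF;case ly: (l a y);case lz: (l a z);rewrite ?eqxx // => _.
 by exists y, z;rewrite ly lz;split.
by exists z, y;rewrite ly lz;split.
Qed.

(** * Sup norm estimates and the Poincare-Miranda theorem *)

Section MatrixNorm.
Variables (R : realType) (m n : nat).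
Lemma mx_entry_le (x : 'M[R]_(m, n)) i j : `|x i j| <= `|x|.
rewrite [leRHS]/Num.norm /= mx_normrE;apply/bigmax_geP;right => /=;by exists (i, j).
Qed.
Lemma mx_norm_le (x : 'M[R]_(m, n)) e : 0 <= e -> (forall i j, `|x i j| <= e) -> `|x| <= e.
move=> e0 xe;rewrite [leLHS]/Num.norm /= mx_normrE;by apply/bigmax_leP;split => //= -[i j] _;exact: xe.
Qed.
Lemma mx_norm_lt (x : 'M[R]_(m, n)) e : 0 < e -> (forall i j, `|x i j| < e) -> `|x| < e.
move=> e0 xe;rewrite [ltLHS]/Num.norm /= mx_normrE;by apply/bigmax_ltP;split => //= -[i j] _;exact: xe.
Qed.
End MatrixNorm.
Lemma closed_ball0_compact R n (r : R) :
 compact [set y : 'rV[R]_n | `|y| <= r].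
apply: bounded_closed_compact.
 exists r;split;first exact: num_real.
 by move=> M rM y /= yr;exact: le_trans yr (ltW rM).
apply: (@closed_comp _ _ (fun y : 'rV[R]_n => `|y|) [set x | x <= r]);last exact: closed_le.
by move=> y _;exact: norm_continuous.
Qed.
(** Without a zero, compactness gives a mesh such that around each point of the cube some coordinate
    of f keeps a strict sign. Labelling grid points by signs produces a cell in which every
    coordinate carries both labels, a contradiction. *)
Theorem poincare_miranda R (d : nat) (f : 'rV[R]_d -> 'rV[R]_d) (r : R) :
 0 < r -> continuous f ->
 (forall (y : 'rV[R]_d) a, `|y| <= r -> y 0 a = r -> 0 <= f y 0 a) ->
 (forall (y : 'rV[R]_d) a, `|y| <= r -> y 0 a = - r -> f y 0 a <= 0) ->
 exists y, f y = 0.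
move=> r0 fc fp fn;apply: contrapT => nz.
pose B := [set y : 'rV[R]_d | `|y| <= r].
have cB : compact B by exact: closed_ball0_compact.
pose mesh (K : nat) : R := 2 * r / K.+1%:R.
have mesh0 : mesh K @[K --> \oo] --> (0 : R).
 rewrite -(mulr0 (2 * r));apply: cvgM;first exact: cvg_cst.
 exact: cvg_harmonic.
have [K HK] : exists K, forall y, B y -> exists a,
 (forall y', `|y - y'| <= mesh K -> 0 < f y' 0 a) \/
 (forall y', `|y - y'| <= mesh K -> f y' 0 a < 0).
 suff : \forall K \near \oo, B `<=` [set y | exists a,
 (forall y', `|y - y'| <= mesh K -> 0 < f y' 0 a) \/
 (forall y', `|y - y'| <= mesh K -> f y' 0 a < 0)].
 by case=> K _ H;exists K => y /(H K (leqnn K)).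
 have /compact_near_coveringP := cB;apply => y _.
 have [a fa] : exists a, f y 0 a != 0.
 apply: contrapT => na;apply: nz;exists y;apply/rowP => a;rewrite mxE.
 by apply/eqP;apply: contrapT => /negP fa;apply: na;exists a.
 have fac : cts y (fun y => f y 0 a).
 by apply: (@continuous_comp _ _ _ f (fun z : 'rV[R]_d => z 0 a));[exact: fc|exact: coord_continuous].
 have [e e0 He] : exists2 e : R, 0 < e & (forall y', `|y - y'| < e -> 0 < f y' 0 a) \/
 (forall y', `|y - y'| < e -> f y' 0 a < 0).
 have [f0|f0] : (0 < f y 0 a) \/ (f y 0 a < 0) by apply/orP;rewrite orbC -neq_lt.
 have : \forall z \near y, 0 < f z 0 a.
 exact: cvgr_gt fac _ f0.
 by case/nbhs_ballP => e e0 h;exists e => //;left => y' yy';apply: h;rewrite -ball_normE.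
 have : \forall z \near y, f z 0 a < 0.
 exact: cvgr_lt fac _ f0.
 by case/nbhs_ballP => e e0 h;exists e => //;right => y' yy';apply: h;rewrite -ball_normE.
 have e20 : 0 < e / 2 by rewrite divr_gt0.
 exists (ball y (e / 2), [set K | mesh K < e / 2]).
 split => /=;first exact: nbhsx_ballx.
 exact: cvgr_lt mesh0 _ e20.
 case=> /= y1 K [yy1 Ke];exists a.
 have close y' : `|y1 - y'| <= mesh K -> `|y - y'| < e.
 move=> h;rewrite -(subrKA y1);apply: le_lt_trans (ler_normD _ _) _.
 rewrite -ball_normE /= in yy1;rewrite (splitr e);apply: ltr_leD => //.
 exact: le_trans h (ltW Ke).
 by case: He => He;[left|right] => y' /close /He.
pose P (x : {ffun 'I_d -> nat}) : 'rV[R]_d := \row_a (- r + mesh K * (x a)%:R).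
have K0 : 0 < (K.+1%:R : R) by rewrite ltr0n.
have m0 : 0 < mesh K by rewrite /mesh !mulr_gt0 // invr_gt0.
have PK (x : {ffun 'I_d -> nat}) a : x a = K.+1 -> P x 0 a = r.
 by move=> xa;rewrite mxE xa /mesh mulfVK ?gt_eqF //;lra.
have P0 (x : {ffun 'I_d -> nat}) a : x a = 0%N -> P x 0 a = - r.
 by move=> xa;rewrite mxE xa mulr0 addr0.
have BP (x : {ffun 'I_d -> nat}) : (forall a, (x a <= K.+1)%N) -> B (P x).
 move=> xK;apply: mx_norm_le => [|i a];first exact: ltW.
 rewrite ord1 mxE ler_norml;apply/andP;split.
 by rewrite lerDl mulr_ge0 // ltW.
 have : mesh K * (x a)%:R <= mesh K * K.+1%:R by rewrite ler_pM2l // ler_nat.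
 by rewrite [X in _ <= X](_ : _ = 2 * r) ?mulfVK ?gt_eqF // => h;lra.
(* On the two extreme layers the label is imposed, since the sign conditions there are only weak
   inequalities. *)
pose lab a (x : {ffun 'I_d -> nat}) := (x a == K.+1) || ((x a != 0)%N && (0 < f (P x) 0 a)).
have [||x xK xP] := @cubical_miranda d K.+1 lab.
- by move=> a y ya;rewrite /lab ya.
- by move=> a y ya;rewrite /lab ya eqxx.
have Bx : B (P x) by apply: BP => a;exact: ltnW.
have close (y : {ffun 'I_d -> nat}) : (forall b, (x b <= y b <= (x b).+1)%N) ->
 `|P x - P y| <= mesh K /\ B (P y).
 move=> xy;split;last first.
 by apply: BP => a;case/andP: (xy a) => _ h;exact: leq_trans h (xK a).
 apply: mx_norm_le => [|i a];first exact: ltW.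
 rewrite !mxE;case/andP: (xy a) => h1 h2.
 have -> : - r + mesh K * (x a)%:R - (- r + mesh K * (y a)%:R) = - (mesh K * (y a - x a)%:R).
 by rewrite natrB //;ring.
 rewrite normrN ger0_norm;last by rewrite mulr_ge0 // ltW.
 by rewrite -[leRHS]mulr1 ler_pM2l // (ler_nat _ _ 1) leq_subLR addn1.
have [a Ha] := HK _ Bx;have [y [z [ly lz xy xz]]] := xP a.
have [cy By] := close _ xy;have [cz Bz] := close _ xz.
case: Ha => Ha.
 move: lz (Ha _ cz);rewrite /lab negb_or negb_and negbK => /andP[_ /orP[/eqP z0|/negbTE ->//]].
 by rewrite ltNge fn // P0.
have := Ha _ cy;case/orP: ly => [/eqP yK|/andP[_ h]];first by rewrite ltNge fp // PK.
by rewrite ltNge ltW.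
Qed.

(** * Strict differentiability relative to a coordinate map *)

Section StrictDifferentiability.
Variable R : realType.
Definition blin (V W : NM R) (L : V -> W) : Prop :=
 [/\ forall u v, L (u + v) = L u + L v, forall a v, L (a *: v) = a *: L v
 & exists2 C : R, 0 <= C & forall v, `|L v| <= C * `|v|].
Lemma blin0 (V W : NM R) (L : V -> W) : blin L -> L 0 = 0.
by case=> _ LZ _;rewrite -(scale0r 0) LZ scale0r. Qed.
Lemma blinN (V W : NM R) (L : V -> W) v : blin L -> L (- v) = - L v.
by case=> _ LZ _;rewrite -scaleN1r LZ scaleN1r. Qed.
Lemma blinB (V W : NM R) (L : V -> W) u v : blin L -> L (u - v) = L u - L v.
by move=> bL;case: (bL) => LD _ _;rewrite LD blinN. Qed.
Lemma blin_id (V : NM R) : blin (@id V).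
by split=> //;exists 1 => // v;rewrite mul1r. Qed.
Lemma blin_cst0 (V W : NM R) : blin (fun _ : V => 0 : W).
split=> [u v|a v|];rewrite ?addr0 ?scaler0 //.
by exists 0 => // v;rewrite normr0 mul0r.
Qed.
Lemma blin_comp (U V W : NM R) (L : V -> W) (K : U -> V) :
 blin L -> blin K -> blin (L \o K).
move=> [LD LZ [C C0 LC]] [KD KZ [D D0 KC]];split=> /= [u v|a v|].
- by rewrite KD LD.
- by rewrite KZ LZ.
exists (C * D) => [|v];first exact: mulr_ge0.
by apply: le_trans (LC _) _;rewrite -mulrA ler_wpM2l.
Qed.
Lemma blinD (V W : NM R) (L K : V -> W) :
 blin L -> blin K -> blin (fun v => L v + K v).
move=> [LD LZ [C C0 LC]] [KD KZ [D D0 KC]];split=> /= [u v|a v|].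
- by rewrite KD LD addrACA.
- by rewrite KZ LZ scalerDr.
exists (C + D) => [|v];first exact: addr_ge0.
by apply: le_trans (ler_normD _ _) _;rewrite mulrDl lerD.
Qed.
(** Strict differentiability measured in the coordinate [c], on a space without linear structure. It
    applies directly to functions on M and on M times a vector space, follows from C^1 in a chart,
    is stable under products and composition, and makes derivatives continuous without a separate
    argument. *)
Definition sdif (X : Top) (V W : NM R) (c : X -> V)
 (F : X -> W) (x0 : X) (L : V -> W) : Prop :=
 blin L /\ forall e : R, 0 < e -> exists2 U, nbhs x0 U & forall x x', U x -> U x' ->
 `|F x' - F x - L (c x' - c x)| <= e * `|c x' - c x|.
(** The parameter [t] is not differentiated; only uniformity near [t0] is asked, which suits a ramp
    whose time dependence is merely continuous. *)
Definition sdift (T X : Top) (V W : NM R) (c : X -> V)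
 (F : T -> X -> W) (t0 : T) (x0 : X) (L : V -> W) : Prop :=
 blin L /\ forall e : R, 0 < e -> exists2 Q, nbhs (t0, x0) Q &
 forall t x x', Q (t, x) -> Q (t, x') ->
 `|F t x' - F t x - L (c x' - c x)| <= e * `|c x' - c x|.

Section Basics.
Variables (X : Top) (V : NM R) (c : X -> V) (x0 : X).
Lemma sdif_intro (W : NM R) (F : X -> W) (L : V -> W) (K : R) :
 blin L -> (forall e : R, 0 < e -> e < 1 -> exists2 U, nbhs x0 U &
 forall x x', U x -> U x' ->
 `|F x' - F x - L (c x' - c x)| <= K * e * `|c x' - c x|) -> sdif c F x0 L.
move=> bL H;split=> // e e0;pose M := `|K| + 1.
have M0 : 0 < M by rewrite ltr_pwDr.
pose d := Num.min (e / M) (1 / 2).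
have d0 : 0 < d by rewrite lt_min !divr_gt0.
have d1 : d < 1 by rewrite gt_min;apply/orP;right;lra.
have [U nU HU] := H d d0 d1;exists U => // x x' Ux Ux'.
apply: le_trans (HU _ _ Ux Ux') _;apply: ler_wpM2r => //.
have : K * d <= M * d.
 by apply: ler_wpM2r;[exact: ltW|apply: le_trans (ler_norm _) _;rewrite lerDl].
move=> h;apply: le_trans h _;rewrite mulrC -ler_pdivlMr //.
by rewrite /d ge_min lexx.
Qed.
Lemma sdif_lip (W : NM R) (F : X -> W) L : sdif c F x0 L ->
 exists2 C : R, 0 < C & exists2 U, nbhs x0 U & forall x x', U x -> U x' ->
 `|F x' - F x| <= C * `|c x' - c x|.
case=> [[LD LZ [C C0 LC]] H];have [U nU HU] := H 1 ltr01.
exists (C + 1);first by rewrite ltr_wpDl.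
exists U => // x x' Ux Ux';rewrite -[F x' - F x](subrK (L (c x' - c x))).
apply: le_trans (ler_normD _ _) _;rewrite mulrDl addrC;apply: lerD => //.
exact: HU.
Qed.
Lemma sdif_cvg (W : NM R) (F : X -> W) L : cts x0 c ->
 sdif c F x0 L -> cts x0 F.
move=> cc /sdif_lip[C C0 [U nU HU]];apply/cvgrPdist_lt => e e0.
have U0 : U x0 by exact: nbhs_singleton.
have eC : 0 < e / C by rewrite divr_gt0.
move/cvgrPdist_lt : cc => /(_ _ eC) cc;near=> x.
apply: le_lt_trans (HU x x0 _ _) _ => //;first by near: x.
rewrite mulrC -ltr_pdivlMr //;near: x;exact: cc.
Unshelve. all: by end_near. Qed.
Lemma sdif_cst (W : NM R) (w : W) : sdif c (fun=> w) x0 (fun=> 0).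
split;first exact: blin_cst0.
by move=> e e0;exists setT => [|x x' _ _];[exact: filterT|rewrite !subrr normr0 mulr_ge0 // ltW].
Qed.
Lemma sdif_coord : sdif c c x0 id.
split;first exact: blin_id.
by move=> e e0;exists setT => [|x x' _ _];[exact: filterT|rewrite !subrr normr0 mulr_ge0 // ltW].
Qed.
Lemma sdif_near (W : NM R) (F G : X -> W) L :
 (\forall x \near x0, F x = G x) -> sdif c F x0 L -> sdif c G x0 L.
move=> FG [bL H];split=> // e e0;have [U nU HU] := H e e0.
exists (U `&` [set x | F x = G x]);first exact: filterI.
by move=> x x' [Ux <-] [Ux' <-];exact: HU.
Qed.
Lemma sdif_eq (W : NM R) (F : X -> W) L K : L =1 K ->
 sdif c F x0 L -> sdif c F x0 K.
by move=> /funext ->. Qed.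
Lemma sdifD (W : NM R) (F G : X -> W) L K : sdif c F x0 L -> sdif c G x0 K ->
 sdif c (fun x => F x + G x) x0 (fun v => L v + K v).
move=> [bL HF] [bK HG];apply: (@sdif_intro _ _ _ 2);first exact: blinD.
move=> e e0 _;have [U nU HU] := HF e e0;have [U' nU' HU'] := HG e e0.
exists (U `&` U');first exact: filterI.
move=> x x' [Ux U'x] [Ux' U'x'].
rewrite (_ : _ - _ = (F x' - F x - L (c x' - c x)) + (G x' - G x - K (c x' - c x)));last first.
 by rewrite opprD addrACA opprD [LHS]addrACA.
apply: le_trans (ler_normD _ _) _;rewrite -mulrA mulr_natl mulr2n;apply: lerD;[exact: HU|exact: HU'].
Qed.
Lemma sdif_lin (W Z : NM R) (F : X -> W) L (K : W -> Z) : blin K ->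
 sdif c F x0 L -> sdif c (fun x => K (F x)) x0 (fun v => K (L v)).
move=> bK [bL HF];have [KD KZ [C C0 KC]] := bK.
apply: (@sdif_intro _ _ _ C);first exact: (blin_comp bK bL).
move=> e e0 _;have [U nU HU] := HF e e0;exists U => // x x' Ux Ux'.
rewrite -!blinB //;apply: le_trans (KC _) _;rewrite -mulrA ler_wpM2l //;exact: HU.
Qed.
Lemma sdif_bilin (U W Z : NM R) (F : X -> U) (G : X -> W) (B : U -> W -> Z) L K (C : R) :
 cts x0 c ->
 (forall u, blin (B u)) -> (forall w, blin (B ^~ w)) ->
 0 <= C -> (forall u w, `|B u w| <= C * `|u| * `|w|) ->
 sdif c F x0 L -> sdif c G x0 K ->
 sdif c (fun x => B (F x) (G x)) x0 (fun v => B (L v) (G x0) + B (F x0) (K v)).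
move=> cc Br Bl C0 BC dF dG;have [[LD LZ [CL CL0 LC]] HF] := dF.
have [bK HG] := dG;have [KD KZ [CK CK0 KC]] := bK.
have [CG CG0 [UG nUG HUG]] := sdif_lip dG.
pose M := C * ((`|G x0| + 1) + CL + CG + `|F x0|).
have BB u u' w w' : B u' w' - B u w = B (u' - u) w' + B u (w' - w).
 by rewrite (blinB _ _ (Br u)) (blinB _ _ (Bl w')) addrA subrK.
apply: (@sdif_intro _ _ _ M).
 apply: blinD;first exact: (blin_comp (Bl (G x0)) (proj1 dF)).
 exact: (blin_comp (Br (F x0)) bK).
move=> e e0 e1;have [U1 nU1 HU1] := HF e e0;have [U2 nU2 HU2] := HG e e0.
have /cvgrPdist_lt/(_ e e0) cF := sdif_cvg cc dF.
have /cvgrPdist_lt/(_ e e0) cG := sdif_cvg cc dG.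
exists (UG `&` U1 `&` U2 `&` [set x | `|F x0 - F x| < e] `&` [set x | `|G x0 - G x| < e]).
 by do !apply: filterI.
move=> x x' [[[[UGx U1x] U2x] Fx] Gx] [[[[UGx' U1x'] U2x'] Fx'] Gx'].
set dc := c x' - c x.
(* Four errors: the strict derivative errors of the two factors, and those made by freezing one
   factor at [x0], which are small by continuity of [F] and [G]. *)
have -> : B (F x') (G x') - B (F x) (G x) - (B (L dc) (G x0) + B (F x0) (K dc))
 = B (F x' - F x - L dc) (G x') + B (L dc) (G x' - G x0)
 + B (F x - F x0) (G x' - G x) + B (F x0) (G x' - G x - K dc).
 rewrite !(blinB _ _ (Br _)) !(blinB _ _ (Bl _)).
 move: (B (F x') (G x')) (B (F x) (G x)) (B (L dc) (G x0)) (B (F x0) (K dc))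
 (B (F x) (G x')) (B (L dc) (G x')) (B (F x0) (G x')) (B (F x0) (G x)).
 move=> a1 a2 a3 a4 a5 a6 a7 a8.
 rewrite subrKA (_ : a5 - a7 - (a2 - a8) = (a5 - a2) - (a7 - a8));last first.
 by rewrite !opprB addrACA [RHS]addrACA [- a7 - a2]addrC.
 by rewrite -[RHS]addrA subrKA [RHS]addrACA subrKA opprD.
have dc0 : 0 <= `|dc| by [].
have G1 : `|G x'| <= `|G x0| + 1.
 rewrite -[G x'](subrK (G x0)) addrC;apply: le_trans (ler_normD _ _) _.
 by rewrite lerD2l distrC;apply: ltW;apply: lt_trans Gx' e1.
rewrite [leRHS](_ : _ =
 C * (e * `|dc|) * (`|G x0| + 1) + C * (CL * `|dc|) * e + C * e * (CG * `|dc|)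
 + C * `|F x0| * (e * `|dc|));last by rewrite /M;ring.
apply: le_trans (ler_normD _ _) (lerD _ _);last first.
 by apply: le_trans (BC _ _) _;rewrite ler_wpM2l ?mulr_ge0 // HU2.
apply: le_trans (ler_normD _ _) (lerD _ _);last first.
 apply: le_trans (BC _ _) _;rewrite ler_pM ?mulr_ge0 //;last exact: HUG.
 by rewrite ler_wpM2l // distrC ltW.
apply: le_trans (ler_normD _ _) (lerD _ _).
 apply: le_trans (BC _ _) _;rewrite ler_pM ?mulr_ge0 // ler_wpM2l //;exact: HU1.
apply: le_trans (BC _ _) _;rewrite ler_pM ?mulr_ge0 //;last by rewrite distrC ltW.
by rewrite ler_wpM2l.
Qed.
Lemma sdif_comp (Y : Top) (W Z : NM R) (d : Y -> W) (h : X -> Y)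
 (G : Y -> Z) L K : cts x0 h ->
 sdif c (d \o h) x0 L -> sdif d G (h x0) K -> sdif c (G \o h) x0 (K \o L).
move=> hc dd [bK HG];have [bL HL] := dd;have [KD KZ [C C0 KC]] := bK.
have [Cd Cd0 [Ud nUd HUd]] := sdif_lip dd.
apply: (@sdif_intro _ _ _ (Cd + C));first exact: blin_comp.
move=> e e0 _;have [U nU HU] := HL e e0;have [U' nU' HU'] := HG e e0.
exists (Ud `&` U `&` h @^-1` U').
 by apply: filterI;[apply: filterI|exact: hc].
move=> x x' [[Udx Ux] U'x] [[Udx' Ux'] U'x'] /=.
rewrite (_ : _ - _ = (G (h x') - G (h x) - K (d (h x') - d (h x)))
 + K (d (h x') - d (h x) - L (c x' - c x)));last by rewrite (@blinB _ _ K (d (h x') - d (h x)) _ bK) subrKA.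
apply: le_trans (ler_normD _ _) _;rewrite !mulrDl;apply: lerD.
 apply: le_trans (HU' _ _ U'x U'x') _;rewrite -mulrA [leRHS]mulrCA;apply: ler_wpM2l;[exact: ltW|exact: HUd].
by apply: le_trans (KC _) _;rewrite -mulrA ler_wpM2l //;exact: HU.
Qed.
Lemma sdif_recoord (W Z : NM R) (d : X -> W) (G : X -> Z) L K :
 sdif c d x0 L -> sdif d G x0 K -> sdif c G x0 (K \o L).
by move=> dL dK;apply: (@sdif_comp X W Z d id) => //;exact: cvg_id. Qed.
End Basics.

Section ParametricStrict.
Variables (T X : Top) (V : NM R) (c : X -> V) (t0 : T) (x0 : X).
Lemma sdif_sdift (W : NM R) (F : X -> W) L :
 sdif c F x0 L -> sdift c (fun _ : T => F) t0 x0 L.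
case=> bL H;split=> // e e0;have [U nU HU] := H e e0.
exists [set p | U p.2];first exact: (@cvg_snd _ _ (nbhs t0) (nbhs x0) _ _ nU).
by move=> t x x' /= Ux Ux';exact: HU.
Qed.
Lemma sdiftD (W : NM R) (F G : T -> X -> W) L K :
 sdift c F t0 x0 L -> sdift c G t0 x0 K ->
 sdift c (fun t x => F t x + G t x) t0 x0 (fun v => L v + K v).
move=> [bL HF] [bK HG];split;first exact: blinD.
move=> e e0;have e2 : 0 < e / 2 by rewrite divr_gt0.
have [U nU HU] := HF _ e2;have [U' nU' HU'] := HG _ e2.
exists (U `&` U');first exact: filterI.
move=> t x x' [Ux U'x] [Ux' U'x'].
rewrite (_ : _ - _ = (F t x' - F t x - L (c x' - c x)) + (G t x' - G t x - K (c x' - c x)));last first.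
 by rewrite opprD addrACA opprD [LHS]addrACA.
apply: le_trans (ler_normD _ _) _;rewrite [e in leRHS]splitr mulrDl.
by apply: lerD;[exact: HU|exact: HU'].
Qed.
Lemma sdift_scale (W : NM R) (s : T -> R) (F : X -> W) L :
 cts t0 s -> sdif c F x0 L ->
 sdift c (fun t x => s t *: F x) t0 x0 (fun v => s t0 *: L v).
move=> sc [bL HF];have [LD LZ [C C0 LC]] := bL;split.
 split=> [u v|a v|];rewrite ?LD ?scalerDr // ?LZ ?scalerA 1?mulrC //.
 exists (`|s t0| * C) => [|v];first exact: mulr_ge0.
 by rewrite normrZ -mulrA ler_wpM2l.
move=> e0 e00;pose M := `|s t0| + 1 + C.
have M0 : 0 < M by rewrite /M addrAC ltr_wpDl // addr_ge0.
pose e := Num.min (e0 / M) 1.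
have e_gt0 : 0 < e by rewrite lt_min divr_gt0 //= ltr01.
have [U nU HU] := HF e e_gt0.
move/cvgrPdist_lt : sc => /(_ e e_gt0) sc.
exists ([set p | U p.2] `&` [set p | `|s t0 - s p.1| < e]).
 apply: filterI;first exact: (@cvg_snd _ _ (nbhs t0) (nbhs x0) _ _ nU).
 exact: (@cvg_fst _ _ (nbhs t0) (nbhs x0) _ _ sc).
move=> t x x' /= [Ux st] [Ux' _].
rewrite -scalerBr (_ : _ - _ = s t *: (F x' - F x - L (c x' - c x)) + (s t - s t0) *: L (c x' - c x));last first.
 by rewrite !scalerBr scalerBl subrKA.
apply: le_trans (ler_normD _ _) _;rewrite !normrZ.
have st1 : `|s t| <= `|s t0| + 1.
 rewrite -[s t](subrK (s t0)) addrC;apply: le_trans (ler_normD _ _) _.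
 by rewrite lerD2l distrC (le_trans (ltW st)) // /e ge_min lexx orbT.
apply: (@le_trans _ _ (M * e * `|c x' - c x|)).
 rewrite /M mulrDl mulrDl;apply: lerD.
 rewrite -mulrA;apply: ler_pM => //;exact: HU.
 rewrite mulrAC;apply: le_trans (_ : e * (C * `|c x' - c x|) <= _);last by rewrite [leRHS]mulrC mulrA.
 by apply: ler_pM => //;rewrite distrC ltW.
apply: ler_wpM2r => //;rewrite mulrC -ler_pdivlMr // /e ge_min lexx //.
Qed.
(** The coordinate moves in every direction by all small positive steps without leaving a given
    neighbourhood. This replaces openness of a coordinate domain and makes derivatives unique. *)
Definition lsurj (x : X) := forall v U, nbhs x U ->
 \forall s \near 0^'+, exists2 x', U x' & c x' = c x + s *: v.
(** Continuity of the derivative: the estimates at the base point and at the nearby point are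
    compared on one common increment [s *: v], supplied by [lsurj], and linearity removes [s]. *)
Lemma sdift_grad (W : NM R) (F : T -> X -> W) L (e : R) : 0 < e ->
 sdift c F t0 x0 L -> exists2 Q, nbhs (t0, x0) Q &
 forall t x L' v, Q (t, x) -> lsurj x -> sdift c F t x L' -> `|L' v - L v| <= e * `|v|.
move=> e0 [bL HF];have e2 : 0 < e / 2 by rewrite divr_gt0.
have [Q nQ HQ] := HF _ e2;exists Q^°;first by apply: nbhs_interior.
move=> t x L' v Qtx lx [bL' HF'];have [Q' nQ' HQ'] := HF' _ e2.
have : nbhs (t, x) (Q `&` Q') by apply: filterI.
case=> -[A B] /= [tA xB] AB.
have [s [s0 [x' Bx' cx']]] := filter_ex (filterI (nbhs_right_gt 0) (lx v B xB)).
have /AB [Qx Q'x] : (A `*` B) (t, x) by split => /=;exact: nbhs_singleton.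
have /AB [Qx' Q'x'] : (A `*` B) (t, x') by split => //=;exact: nbhs_singleton.
have h1 := HQ _ _ _ Qx Qx';have h2 := HQ' _ _ _ Q'x Q'x'.
have dc : c x' - c x = s *: v by rewrite cx' addrC addKr.
rewrite dc in h1 h2.
have [_ LZ _] := bL;have [_ LZ' _] := bL'.
have : `|s *: (L' v - L v)| <= e * `|s *: v|.
 rewrite scalerBr -LZ -LZ';set D := F t x' - F t x in h1 h2 *.
 have -> : L' (s *: v) - L (s *: v) = (D - L (s *: v)) - (D - L' (s *: v)).
 by rewrite opprB [RHS]addrC subrKA.
 apply: le_trans (ler_normB _ _) _;rewrite [e in leRHS]splitr mulrDl;exact: lerD.
by rewrite !normrZ gtr0_norm // mulrCA ler_pM2l.
Qed.
End ParametricStrict.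
Lemma sdif_grad (X : Top) (V W : NM R) (c : X -> V) (x0 : X)
 (F : X -> W) L (e : R) : 0 < e -> sdif c F x0 L ->
 exists2 U, nbhs x0 U & forall x L' v, U x -> lsurj c x -> sdif c F x L' ->
 `|L' v - L v| <= e * `|v|.
move=> e0 dF;have [Q nQ HQ] := sdift_grad e0 (sdif_sdift (0 : R) dF).
exists [set x | Q (0, x)].
 case: nQ => -[A B] [/= A0 Bx] AB;apply: filterS Bx => x Bx;apply: AB;split => //=.
 exact: nbhs_singleton.
by move=> x L' v Qx lx dF';apply: HQ Qx lx _;exact: sdif_sdift.
Qed.
Lemma mulmx_norm m n p (A : 'M[R]_(m, n)) (B : 'M[R]_(n, p)) :
 `|A *m B| <= n%:R * `|A| * `|B|.
apply: mx_norm_le => [|i j];first by rewrite !mulr_ge0.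
rewrite mxE;apply: le_trans (ler_norm_sum _ _ _) _.
apply: (@le_trans _ _ (\sum_(k < n) `|A| * `|B|)).
 by apply: ler_sum => k _;rewrite normrM ler_pM // mx_entry_le.
by rewrite sumr_const card_ord -mulrA mulr_natl.
Qed.
Lemma blin_mulmxr m n p (B : 'M[R]_(n, p)) : blin (fun A : 'M[R]_(m, n) => A *m B).
split=> [u v|a v|];rewrite ?mulmxDl ?scalemxAl //.
exists (n%:R * `|B|) => [|v];first exact: mulr_ge0.
by rewrite mulrAC;exact: mulmx_norm.
Qed.
Lemma blin_mulmxl m n p (A : 'M[R]_(m, n)) : blin (fun B : 'M[R]_(n, p) => A *m B).
split=> [u v|a v|];rewrite ?mulmxDr ?scalemxAr //.
exists (n%:R * `|A|) => [|v];[exact: mulr_ge0|exact: mulmx_norm].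
Qed.
Lemma blin_entry m n i j : blin (fun A : 'M[R]_(m, n) => A i j).
split=> [u v|a v|];rewrite ?mxE //.
by exists 1 => // v;rewrite mul1r mx_entry_le.
Qed.
Lemma blin_tr m n : blin (fun A : 'M[R]_(m, n) => A^T).
split=> [u v|a v|];rewrite ?linearD ?linearZ //.
by exists 1 => // v;apply: mx_norm_le => [|i j];rewrite mul1r // mxE mx_entry_le.
Qed.

Section MatrixStrict.
Variables (X : Top) (V : NM R) (c : X -> V) (x0 : X)
 (cc : cts x0 c).
Lemma sdif_mulmx m n p (F : X -> 'M[R]_(m, n)) (G : X -> 'M[R]_(n, p)) L K :
 sdif c F x0 L -> sdif c G x0 K ->
 sdif c (fun x => F x *m G x) x0 (fun v => L v *m G x0 + F x0 *m K v).
apply: (sdif_bilin (B := fun (A : 'M[R]_(m, n)) (B : 'M[R]_(n, p)) => A *m B) (C := n%:R)) => //.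
- by move=> A;exact: blin_mulmxl.
- by move=> B;exact: blin_mulmxr.
- by move=> A B;exact: mulmx_norm.
Qed.
Lemma blin_mx m n (L : V -> 'M[R]_(m, n)) : (forall i j, blin (fun v => L v i j)) -> blin L.
move=> H;split=> [u v|a v|].
- by apply/matrixP => i j;rewrite mxE;case: (H i j) => ->.
- by apply/matrixP => i j;rewrite mxE;case: (H i j) => _ ->.
have /choice[C HC] : forall p : 'I_m * 'I_n, exists C : R, 0 <= C /\ forall v, `|L v p.1 p.2| <= C * `|v|.
 by move=> [i j];case: (H i j) => _ _ [C C0 HC];exists C.
have C0 p : 0 <= C p by case: (HC p).
exists (\sum_p C p) => [|v];first exact: sumr_ge0.
apply: mx_norm_le => [|i j];first by rewrite mulr_ge0 // sumr_ge0.
have [_ /(_ v) h] := HC (i, j);apply: le_trans h _;rewrite ler_wpM2r //.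
by rewrite (bigD1 (i, j)) //= lerDl sumr_ge0.
Qed.
Lemma sdif_mx m n (F : X -> 'M[R]_(m, n)) (L : V -> 'M[R]_(m, n)) :
 (forall i j, sdif c (fun x => F x i j) x0 (fun v => L v i j)) -> sdif c F x0 L.
move=> H;split;first by apply: blin_mx => i j;case: (H i j).
move=> e e0.
have /choice[U HU] : forall p : 'I_m * 'I_n, exists U, nbhs x0 U /\ forall x x', U x -> U x' ->
 `|F x' p.1 p.2 - F x p.1 p.2 - L (c x' - c x) p.1 p.2| <= e * `|c x' - c x|.
 by move=> [i j];case: (H i j) => _ /(_ e e0)[U nU HU];exists U.
exists [set x | forall p, U p x].
 by apply: filter_forall => p;case: (HU p).
move=> x x' Ux Ux';apply: mx_norm_le => [|i j];first by rewrite mulr_ge0 // ltW.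
by rewrite !mxE;case: (HU (i, j)) => _;apply;[exact: Ux|exact: Ux'].
Qed.
Lemma sdif_entry m n (F : X -> 'M[R]_(m, n)) L i j : sdif c F x0 L ->
 sdif c (fun x => F x i j) x0 (fun v => L v i j).
by move=> dF;exact: (sdif_lin (blin_entry i j) dF). Qed.
Lemma sdif_tr m n (F : X -> 'M[R]_(m, n)) L : sdif c F x0 L ->
 sdif c (fun x => (F x)^T) x0 (fun v => (L v)^T).
by move=> dF;exact: (sdif_lin (blin_tr m n) dF). Qed.
(** Near [x0] an inequality |v| <= a |v F(x)| gives invertibility and a uniform bound on the
    inverse; the derivative then comes from the formula for a difference of inverses. *)
Lemma sdif_invmx n (F : X -> 'M[R]_n) L : sdif c F x0 L -> F x0 \in unitmx ->
 sdif c (fun x => invmx (F x)) x0 (fun v => - (invmx (F x0) *m L v *m invmx (F x0))).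
move=> dF u0;pose I0 := invmx (F x0).
pose nn : R := n%:R;have nn0 : 0 <= nn by [].
pose a := 2 * (nn * `|I0|).
have a0 : 0 <= a by rewrite !mulr_ge0.
(* Within this distance of [F x0] the perturbation costs at most half of |v|, which is why [a] is
   twice the unperturbed constant. *)
pose d := (nn * (nn * `|I0|) * 2 + 1)^-1.
have d0 : 0 < d by rewrite invr_gt0 ltr_wpDl // !mulr_ge0.
have Fc := sdif_cvg cc dF.
have bnd x : `|F x0 - F x| < d -> F x \in unitmx /\ `|invmx (F x)| <= a.
 move=> Fd;have key m (v : 'M[R]_(m, n)) : `|v| <= a * `|v *m F x|.
 have E : v = v *m F x *m I0 + v *m (F x0 - F x) *m I0.
 by rewrite -mulmxDl -mulmxDr addrC subrK mulmxK.
 have h : `|v| <= nn * `|v *m F x| * `|I0| + nn * (nn * `|v| * `|F x0 - F x|) * `|I0|.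
 rewrite {1}E;apply: le_trans (ler_normD _ _) (lerD _ _);first exact: mulmx_norm.
 apply: le_trans (mulmx_norm _ _) _;rewrite ler_wpM2r // ler_wpM2l //;exact: mulmx_norm.
 have h2 : nn * (nn * `|v| * `|F x0 - F x|) * `|I0| <= `|v| / 2.
 have -> : nn * (nn * `|v| * `|F x0 - F x|) * `|I0| = `|v| * (nn * (nn * `|I0|) * `|F x0 - F x|) by ring.
 apply: ler_wpM2l => //;set b := nn * (nn * `|I0|).
 have b0 : 0 <= b by rewrite !mulr_ge0.
 apply: le_trans (_ : b * d <= _);first by rewrite ler_wpM2l // ltW.
 rewrite /d -/b ler_pdivrMr ?ltr_wpDl ?mulr_ge0 //;lra.
 have -> : a * `|v *m F x| = 2 * (nn * `|v *m F x| * `|I0|) by rewrite /a;ring.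
 lra.
 have u : F x \in unitmx.
 rewrite -row_free_unit -kermx_eq0;apply/eqP.
 have := key _ (kermx (F x));rewrite mulmx_ker normr0 mulr0 normr_le0 => /eqP //.
 split=> //;have := key _ (invmx (F x));rewrite mulVmx // => h;apply: le_trans h _.
 rewrite -[leRHS]mulr1 ler_wpM2l //;apply: mx_norm_le => // i j.
 by rewrite mxE;case: (i == j);rewrite ?normr1 ?normr0.
have step x x' : F x \in unitmx -> F x' \in unitmx ->
 invmx (F x') - invmx (F x) = - (invmx (F x') *m (F x' - F x) *m invmx (F x)).
 by move=> u u';rewrite mulmxBr mulmxBl mulVmx // mul1mx mulmxK // opprB.
have [CF CF0 [UF nUF HUF]] := sdif_lip dF.
have [bL HF] := dF;have [LD LZ [CL CL0 LC]] := bL.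
have blinI : blin (fun v => - (I0 *m L v *m I0)).
 have := blin_comp (blin_mulmxr n I0) (blin_comp (blin_mulmxl n I0) bL).
 case=> h1 h2 [C C0 h3];split=> [u v|b v|].
 - by rewrite -opprD;congr (- _);exact: h1.
 - by rewrite scalerN;congr (- _);exact: h2.
 - by exists C => // v;rewrite normrN;exact: h3.
pose M := nn * (nn * a) * a + nn * (nn * (nn * a * a * nn) * CL) * a + nn * (nn * a * CL) * (nn * (nn * a) * a).
have M0 : 0 <= M by rewrite /M !(addr_ge0, mulr_ge0).
apply: (sdif_intro (K := M)) => // e e0 e1.
have [U nU HU] := HF e e0.
have ed : 0 < Num.min e d by rewrite lt_min e0.
move/cvgrPdist_lt : Fc => /(_ _ ed) Fc.
have Fx00 : F x0 \in unitmx /\ `|invmx (F x0)| <= a by apply: bnd;rewrite subrr normr0.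
exists (U `&` [set x | `|F x0 - F x| < Num.min e d]);first exact: filterI.
move=> x x' [Ux];rewrite /= lt_min => /andP[xe xd] [Ux'];rewrite /= lt_min => /andP[xe' xd'].
have [ux bx] := bnd _ xd;have [ux' bx'] := bnd _ xd'.
rewrite step //;set dc := c x' - c x;set J := invmx (F x);set J' := invmx (F x').
have -> : - (J' *m (F x' - F x) *m J) - - (I0 *m L dc *m I0) =
 - (J' *m (F x' - F x - L dc) *m J) - ((J' - I0) *m L dc *m J) - (I0 *m L dc *m (J - I0)).
 rewrite (_ : J' *m (F x' - F x - L dc) *m J = J' *m (F x' - F x) *m J - J' *m L dc *m J);last first.
 by rewrite [J' *m (F x' - F x - L dc)]mulmxBr mulmxBl.
 by rewrite !mulmxBl [I0 *m L dc *m (J - I0)]mulmxBr -!opprD !subrKA.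
have dJ y : F y \in unitmx -> `|invmx (F y)| <= a -> `|F x0 - F y| < e -> `|invmx (F y) - I0| <= nn * (nn * a) * a * e.
 move=> uy ay ye;rewrite step ?(proj1 Fx00) // normrN.
 apply: le_trans (mulmx_norm _ _) _.
 apply: le_trans (_ : nn * (nn * a * e) * a <= _);last by rewrite le_eqVlt;apply/orP;left;apply/eqP;ring.
 apply: ler_pM;rewrite ?mulr_ge0 //;last exact: (proj2 Fx00).
 apply: ler_wpM2l => //;apply: le_trans (mulmx_norm _ _) _.
 by apply: ler_pM;rewrite ?mulr_ge0 // ?ler_wpM2l // distrC ltW.
have h0 : 0 <= `|dc| by [].
have -> : M * e * `|dc| = nn * (nn * a * (e * `|dc|)) * a
 + nn * (nn * (nn * (nn * a) * a * e) * (CL * `|dc|)) * a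
 + nn * (nn * a * (CL * `|dc|)) * (nn * (nn * a) * a * e) by rewrite /M;ring.
apply: le_trans (ler_normD _ _) (lerD _ _);[apply: le_trans (ler_normD _ _) (lerD _ _)|];rewrite normrN;
 apply: le_trans (mulmx_norm _ _) _;apply: ler_pM => //;rewrite ?mulr_ge0 //;
 try (apply: ler_wpM2l => //;apply: le_trans (mulmx_norm _ _) _;apply: ler_pM => //;rewrite ?mulr_ge0 //;
 try apply: ler_wpM2l => //).
- exact: HU.
- exact: dJ.
- exact: (proj2 Fx00).
- exact: dJ.
Qed.
End MatrixStrict.
Lemma cvg_growth (W : NM R) (f : R -> W) s l :
 (forall e : R, 0 < e -> exists2 d, 0 < d & forall h, `|h| < d ->
 `|f (s + h) - f s - h *: l| <= e * `|h|) ->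
 is_derive s 1 f l.
move=> H;have cv : h^-1 *: ((f \o shift s) (h *: 1) - f s) @[h --> 0^'] --> l.
 apply/cvgrPdist_le => e e0;have [d d0 Hd] := H e e0.
 near=> h;have h0 : h != 0 by near: h;exact: nbhs_dnbhs_neq.
 have hd : `|h| < d by near: h;apply: dnbhs0_lt.
 rewrite /= [h *: 1]mulr1 [h + s]addrC.
 rewrite -[l](scalerK h0) -scalerBr normrZ normfV mulrC ler_pdivrMr ?normr_gt0 //.
 by rewrite distrC;apply: Hd.
by split;[apply/cvg_ex;exists l|exact: (cvg_lim (@norm_hausdorff _ _) cv)].
Unshelve. all: by end_near. Qed.
Lemma sdif_derive_line (V W : NM R) (F : V -> W) (q u : V) (k s : R) L :
 sdif id F (q + (s * k) *: u) L -> is_derive s 1 (fun s => F (q + (s * k) *: u)) (k *: L u).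
move=> [bL HF];apply: cvg_growth => e e0;have [LD LZ _] := bL.
pose M := `|k| * `|u| + 1;have M0 : 0 < M by rewrite ltr_wpDl // mulr_ge0.
have [U nU HU] := HF (e / M) (divr_gt0 e0 M0).
have [d /= d0 Hd] := (nbhs_ballP _ _).1 nU.
exists (d / M);first by rewrite divr_gt0.
move=> h hd;have E : q + ((s + h) * k) *: u - (q + (s * k) *: u) = (h * k) *: u.
 by rewrite mulrDl scalerDl addrA [_ + (h * k) *: u]addrC addrK.
have Mk : `|(h * k) *: u| <= `|h| * M.
 by rewrite normrZ normrM -mulrA ler_wpM2l // lerDl.
have := HU (q + (s * k) *: u) (q + ((s + h) * k) *: u) _ _.
rewrite /= E LZ -[(h * k) *: L u]scalerA => H;apply: le_trans (H _ _) _.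
- exact: nbhs_singleton.
- apply: Hd;rewrite -ball_normE /= -normrN opprB E.
 by apply: le_lt_trans Mk _;rewrite -ltr_pdivlMr.
apply: le_trans (ler_wpM2l _ Mk) _;first by rewrite divr_ge0 // ltW.
by rewrite mulrCA divfK ?gt_eqF // mulrC.
Qed.
Lemma MVT_line (f df : R -> R) : (forall s : R, 0 <= s <= 1 -> is_derive s 1 f (df s)) ->
 exists2 s, 0 < s < 1 & f 1 - f 0 = df s.
move=> H;have [||s s01 ->] := @MVT R f df 0 1 ltr01.
- by move=> x;rewrite in_itv /= => /andP[/ltW a /ltW b];apply: H;rewrite a.
- apply: derivable_within_continuous => x;rewrite in_itv /= => x01.
 by have [] := H x x01.
by exists s;rewrite ?subr0 ?mulr1 //;move: s01;rewrite in_itv.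
Qed.
(** The mean value theorem on segments, with continuous partial derivatives. The map [j] selects the
    directions of the increments: the identity for ordinary strict differentiability, v -> (0, v)
    when the first variable is a parameter. *)
Lemma C1_strict (Z V : NM R) (j : V -> Z) (d : nat) (ee : 'I_d -> V)
 (co : V -> 'I_d -> R) (f : Z -> R) (z0 : Z) : blin j ->
 (forall v, v = \sum_a co v a *: ee a) -> (forall v a, `|co v a| <= `|v|) ->
 (\forall z \near z0, differentiable f z) ->
 (forall a, cts z0 ('D_(j (ee a)) f)) ->
 blin (fun v => 'D_(j v) f z0) /\
 forall e : R, 0 < e -> exists2 r : R, 0 < r & forall z v, `|z - z0| < r -> `|z + j v - z0| < r ->
 `|f (z + j v) - f z - 'D_(j v) f z0| <= e * `|v|.
move=> bj vE co_le df dc;have [jD jZ _] := bj.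
have df0 : differentiable f z0 by exact: (nbhs_singleton df).
have jsum v : j v = \sum_a co v a *: j (ee a).
 rewrite {1}(vE v);elim/big_rec2 : _ => [|a y1 y2 _ <-];first exact: blin0.
 by rewrite jD jZ.
have Dsum z v : differentiable f z -> 'D_(j v) f z = \sum_a co v a * 'D_(j (ee a)) f z.
 move=> dfz;rewrite deriveE // jsum linear_sum /=;apply: eq_bigr => a _.
 by rewrite linearZ /= deriveE.
split.
 split=> [u v|a v|].
 - by rewrite !deriveE // jD linearD.
 - by rewrite !deriveE // jZ linearZ.
 exists (\sum_a `|'D_(j (ee a)) f z0|) => [|v];first exact: sumr_ge0.
 rewrite Dsum //;apply: le_trans (ler_norm_sum _ _ _) _;rewrite mulr_suml.
 by apply: ler_sum => a _;rewrite normrM mulrC ler_wpM2l.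
move=> e e0;pose e' := e / (d%:R + 1).
have d1 : 0 < d%:R + 1 :> R by rewrite ltr_wpDl.
have e'0 : 0 < e' by rewrite divr_gt0.
have : \forall z \near z0, differentiable f z /\
 forall a, `|'D_(j (ee a)) f z0 - 'D_(j (ee a)) f z| < e'.
 near=> z;split;first by near: z.
 near: z;apply: filter_forall => a;have /cvgrPdist_lt := dc a;exact.
case/nbhs_ballP => r /= r0 Hr;exists r => // z v zr zvr.
have seg s : 0 <= s <= 1 -> ball z0 r (z + s *: j v).
 move=> /andP[s0 s1];rewrite -ball_normE /= distrC.
 have -> : z + s *: j v - z0 = (1 - s) *: (z - z0) + s *: (z + j v - z0).
 rewrite scalerBl scale1r addrAC [z + j v - z0]addrAC [s *: (_ + j v)]scalerDr.
 by rewrite addrA subrK.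
 apply: le_lt_trans (ler_normD _ _) _;rewrite !normrZ !ger0_norm ?subr_ge0 //.
 have [->|s_gt0] := eqVneq s 0;first by rewrite subr0 mul1r mul0r addr0.
 rewrite (_ : r = (1 - s) * r + s * r);last by ring.
 apply: ler_ltD;first by rewrite ler_wpM2l ?subr_ge0 // ltW.
 by rewrite ltr_pM2l // lt_def s_gt0.
have der (s' : R) : 0 <= s' <= 1 ->
 is_derive s' 1 (fun s => f (z + s *: j v)) ('D_(j v) f (z + s' *: j v)).
 move=> s'01;have [dfs _] := Hr _ (seg s' s'01).
 have /cvg_ex[/= l Hl] : derivable f (z + s' *: j v) (j v) by exact: diff_derivable.
 have El : l = 'D_(j v) f (z + s' *: j v).
 by apply/esym;exact: (cvg_lim (@norm_hausdorff _ _) Hl).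
 have Hl' : h^-1 *: (((fun s => f (z + s *: j v)) \o shift s') (h *: 1) - f (z + s' *: j v)) @[h --> 0^'] --> l.
 apply: cvg_trans Hl;apply: near_eq_cvg;near=> h => /=.
 by rewrite [h *: 1]mulr1 scalerDl addrCA.
 by split;[apply/cvg_ex;exists l|rewrite -El;exact: (cvg_lim (@norm_hausdorff _ _) Hl')].
have [s /andP[/ltW s0 /ltW s1] Es] := MVT_line der.
rewrite scale1r scale0r addr0 in Es;rewrite Es.
have [dfs Hs] := Hr _ (seg s (introT andP (conj s0 s1))).
rewrite !Dsum // -sumrB;apply: le_trans (ler_norm_sum _ _ _) _.
apply: (@le_trans _ _ (\sum_(a < d) e' * `|v|)).
 apply: ler_sum => a _;rewrite -mulrBr normrM mulrC;apply: ler_pM => //.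
 by rewrite distrC ltW.
rewrite sumr_const card_ord -mulr_natl mulrA ler_wpM2r // /e' mulrCA ger_pMr //.
by rewrite ler_pdivrMr // mul1r lerDl.
Unshelve. all: by end_near. Qed.
Lemma rV_delta n (v : 'rV[R]_n) : v = \sum_a v 0 a *: delta_mx 0 a.
exact: row_sum_delta. Qed.
Lemma C1_sdif n (f : 'rV[R]_n -> R) (U : set 'rV[R]_n) q : open U -> U q ->
 Ck_on 1 U f -> sdif id f q (fun v => 'D_v f q).
move=> oU Uq [df dD];have nU : nbhs q U by exact: open_nbhs_nbhs.
have [|||||bL H] := @C1_strict _ 'rV[R]_n id n (fun a => delta_mx 0 a) (fun v a => v 0 a) f q.
- exact: blin_id.
- exact: rV_delta.
- by move=> v a;exact: mx_entry_le.
- by apply: filterS nU => z;exact: df.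
- by move=> a;exact: dD.
split=> // e e0;have [r r0 Hr] := H e e0;exists (ball q r);first exact: nbhsx_ballx.
move=> x x';rewrite -!ball_normE /= => xr x'r.
by have := Hr x (x' - x);rewrite /= [x + (x' - x)]addrC subrK;apply;rewrite distrC.
Qed.
Lemma C1_sdift n m (f : R * ('rV[R]_n * 'rV[R]_m) -> R) (U : set (R * ('rV[R]_n * 'rV[R]_m))) t w :
 open U -> U (t, w) -> Ck_on 1 U f ->
 sdift id (fun t w => f (t, w)) t w (fun v => 'D_(0, v) f (t, w)).
move=> oU Uq [df dD];have nU : nbhs (t, w) U by exact: open_nbhs_nbhs.
pose ee (a : 'I_(n + m)) : 'rV[R]_n * 'rV[R]_m :=
 match fintype.split a with inl b => (delta_mx 0 b, 0) | inr b => (0, delta_mx 0 b) end.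
pose co (v : 'rV[R]_n * 'rV[R]_m) (a : 'I_(n + m)) : R :=
 match fintype.split a with inl b => v.1 0 b | inr b => v.2 0 b end.
have [|||||bL H] := @C1_strict (R * ('rV[R]_n * 'rV[R]_m))%type ('rV[R]_n * 'rV[R]_m)%type (fun v => (0, v)) (n + m) ee co f (t, w).
- split=> [u v|a v|];[by congr (_, _);rewrite addr0|by congr (_, _);rewrite scaler0|].
 by exists 1 => // v;rewrite mul1r prod_normE /= normr0 ge_max lexx normr_ge0.
- move=> [v1 v2];rewrite big_split_ord /= /ee /co.
 under eq_bigr => i _ do rewrite -[lshift _ _]/(unsplit (inl i)) unsplitK.
 under [X in _ = _ + X]eq_bigr => i _ do rewrite -[rshift _ _]/(unsplit (inr i)) unsplitK.
 rewrite [v1 in LHS]rV_delta [v2 in LHS]rV_delta /=.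
 have E1 (I : finType) (F : I -> 'rV[R]_n * 'rV[R]_m) : \sum_i F i = (\sum_i (F i).1, \sum_i (F i).2).
 by elim/big_rec3 : _ => // i y1 y2 y3 _ ->.
 rewrite !E1 /=;congr (_, _).
 by rewrite [X in _ + X]big1 ?addr0 // => i _;rewrite scaler0.
 by rewrite [X in X + _]big1 ?add0r // => i _;rewrite scaler0.
- move=> [v1 v2] a;rewrite /co prod_normE /= le_max;case: (fintype.split a) => b;
 by rewrite mx_entry_le ?orbT.
- by apply: filterS nU => z;exact: df.
- by move=> a;exact: dD.
split=> // e e0;have [r r0 Hr] := H e e0;exists (ball (t, w) r);first exact: nbhsx_ballx.
move=> t' x x';rewrite -!ball_normE /= => xr x'r.
have := Hr (t', x) (x' - x).
have -> : (t', x) + (0, x' - x) = (t', x') by congr (_, _);rewrite ?addr0 // addrC subrK.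
by apply;rewrite distrC.
Qed.
(** The second difference over the parallelogram with sides s u, s v does not depend on the order of
    the sides. The mean value theorem along one side evaluates it as s^2 times [D2] up to o(s^2),
    and exchanging the sides exchanges the arguments of [D2]. *)
Lemma sdif_Schwarz (V : NM R) (F : V -> R) (DF : V -> V -> R) (q0 : V) (D2 : V -> V -> R) :
 (\forall q \near q0, sdif id F q (DF q)) ->
 (forall u, sdif id (fun q => DF q u) q0 (D2 u)) ->
 forall u v, D2 u v = D2 v u.
move=> dF d2 u v.
suff key u' v' : forall e : R, 0 < e -> \forall s \near 0^'+,
 `|F (q0 + s *: u' + s *: v') - F (q0 + s *: u') - F (q0 + s *: v') + F q0 - s ^+ 2 * D2 v' u'|
 <= e * s ^+ 2.
 apply/eqP;rewrite -subr_eq0 -normr_eq0;apply/eqP;apply/eqP;rewrite eq_le normr_ge0 andbT.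
 apply/ler_addgt0Pl => e e0;rewrite addr0.
 have e2 : 0 < e / 2 by rewrite divr_gt0.
 have h1 := key u v _ e2;have h2 := key v u _ e2.
 near (0 : R)^'+ => s.
 have s0 : 0 < s by near: s;exact: nbhs_right_gt.
 have := near h1 s;have := near h2 s => /(_ _)H2 /(_ _)H1.
 have {H1}H1 : `|F (q0 + s *: u + s *: v) - F (q0 + s *: u) - F (q0 + s *: v) + F q0 - s ^+ 2 * D2 v u| <= e / 2 * s ^+ 2 by near: s.
 have {H2}H2 : `|F (q0 + s *: v + s *: u) - F (q0 + s *: v) - F (q0 + s *: u) + F q0 - s ^+ 2 * D2 u v| <= e / 2 * s ^+ 2 by near: s.
 have s2 : 0 < s ^+ 2 by rewrite exprn_gt0.
 rewrite -(ler_pM2r s2) -[X in `|_| * X](gtr0_norm s2) -normrM.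
 rewrite (_ : (D2 u v - D2 v u) * s ^+ 2 =
 (F (q0 + s *: u + s *: v) - F (q0 + s *: u) - F (q0 + s *: v) + F q0 - s ^+ 2 * D2 v u) -
 (F (q0 + s *: v + s *: u) - F (q0 + s *: v) - F (q0 + s *: u) + F q0 - s ^+ 2 * D2 u v)).
 apply: le_trans (ler_normB _ _) _;lra.
 by rewrite [q0 + s *: v + _]addrAC;ring.
move=> e e0;pose M := `|u'| + `|v'| + 1;have M0 : 0 < M by rewrite ltr_pwDr // addr_ge0.
have [bL H] := d2 v';have [U nU HU] := H (e / M) (divr_gt0 e0 M0).
have [LD LZ _] := bL.
have nUF : nbhs q0 (U `&` [set q | sdif id F q (DF q)]) by apply: filterI.
have [r /= r0 Hr] := (nbhs_ballP _ _).1 nUF.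
near=> s;have s0 : 0 < s by near: s;exact: nbhs_right_gt.
have sr : s * M < r by rewrite -ltr_pdivlMr //;near: s;apply: nbhs_right_lt;rewrite divr_gt0.
have inb (x y : R) : 0 <= x <= 1 -> 0 <= y <= 1 -> ball q0 r (q0 + (x * s) *: u' + (y * s) *: v').
 move=> /andP[x0 x1] /andP[y0 y1];rewrite -ball_normE /= -addrA opprD addrA subrr add0r normrN.
 apply: le_lt_trans sr;apply: le_trans (ler_normD _ _) _;rewrite !normrZ.
 rewrite (ger0_norm x0) (ger0_norm y0) (gtr0_norm s0).
 have -> : s * M = s * `|u'| + s * `|v'| + s by rewrite /M;ring.
 apply: le_trans (_ : s * `|u'| + s * `|v'| <= _);last by rewrite lerDl ltW.
 by apply: lerD;apply: ler_wpM2r => //;rewrite ger_pMl.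
pose g y := F (q0 + s *: u' + (y * s) *: v') - F (q0 + (y * s) *: v').
pose dg y := s * (DF (q0 + s *: u' + (y * s) *: v') v' - DF (q0 + (y * s) *: v') v').
have line q y : sdif id F (q + (y * s) *: v') (DF (q + (y * s) *: v')) ->
 is_derive y 1 (fun y => F (q + (y * s) *: v')) (s * DF (q + (y * s) *: v') v').
 exact: sdif_derive_line.
have [|y /andP[y0 y1] Ey] := @MVT_line g dg.
 move=> y y01;rewrite /dg mulrBr;apply: is_deriveB;apply: line.
 by have [] := Hr _ (inb 1 y _ y01);rewrite ?mul1r ?ler01 ?lexx.
 by have [] := Hr _ (inb 0 y _ y01);rewrite ?mul0r ?scale0r ?addr0 ?ler01 ?lexx.
have -> : F (q0 + s *: u' + s *: v') - F (q0 + s *: u') - F (q0 + s *: v') + F q0 = dg y.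
 by rewrite -Ey /g !mul1r !mul0r !scale0r !addr0;ring.
have y01 : 0 <= y <= 1 by rewrite !ltW.
have z01 : 0 <= (0 : R) <= 1 by rewrite lexx ler01.
have o01 : 0 <= (1 : R) <= 1 by rewrite lexx ler01.
have := HU _ _ (proj1 (Hr _ (inb 0 y z01 y01))) (proj1 (Hr _ (inb 1 y o01 y01))).
rewrite mul0r scale0r addr0 mul1r.
have -> : q0 + s *: u' + (y * s) *: v' - (q0 + (y * s) *: v') = s *: u'.
 by rewrite opprD addrACA subrr addr0 addrAC subrr add0r.
rewrite LZ => h.
have -> : dg y - s ^+ 2 * D2 v' u' = s * (DF (q0 + s *: u' + (y * s) *: v') v' - DF (q0 + (y * s) *: v') v' - s * D2 v' u').
 by rewrite /dg;ring.
rewrite normrM gtr0_norm //.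
apply: le_trans (_ : s * (e / M * `|s *: u'|) <= _).
 by rewrite ler_pM2l.
rewrite normrZ gtr0_norm // (_ : s * (e / M * (s * `|u'|)) = e * s ^+ 2 * (`|u'| / M));last by ring.
rewrite ger_pMr ?mulr_gt0 ?exprn_gt0 // ler_pdivrMr // mul1r /M -addrA lerDl addr_ge0 //.
Unshelve. all: by end_near. Qed.
(* Functions of [max 0 r] inherit strict differentiability from a divided difference. *)
Lemma sdif_maxr (phi : R -> R) (Q : R -> R -> R) (r0 : R) :
 (forall p p' : R, 0 <= p -> 0 <= p' -> phi p' - phi p = (p' - p) * Q p p') ->
 Q 0 0 = 0 ->
 (forall e : R, 0 < e -> exists2 d : R, 0 < d & forall p p' : R, 0 <= p -> 0 <= p' ->
 `|p - Num.max 0 r0| < d -> `|p' - Num.max 0 r0| < d ->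
 `|Q p p' - Q (Num.max 0 r0) (Num.max 0 r0)| <= e) ->
 sdif id (fun r : R => phi (Num.max 0 r)) r0 (fun v => v * Q (Num.max 0 r0) (Num.max 0 r0)).
move=> phiQ Q0 Qc;split.
 split=> [u v|a v|];rewrite ?mulrDl // /GRing.scale /= ?mulrA //.
 by exists `|Q (Num.max 0 r0) (Num.max 0 r0)| => // v;rewrite normrM mulrC.
move=> e e0;have [d d0 Hd] := Qc e e0.
have maxlip (a b : R) : `|Num.max 0 a - Num.max 0 b| <= `|a - b|.
 have [a0|a0] := leP a 0;have [b0|b0] := leP b 0;rewrite ?(max_l a0) ?(max_r (ltW a0)) ?(max_l b0) ?(max_r (ltW b0)) ?subrr ?normr0 //.
 rewrite sub0r normrN (gtr0_norm b0) distrC;apply: le_trans (ler_norm _);lra.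
 rewrite subr0 (gtr0_norm a0);apply: le_trans (ler_norm _);lra.
have [r00|r00] := leP r0 0.
 rewrite (max_l r00) Q0 in Hd *;exists (ball r0 d);first exact: nbhsx_ballx.
 move=> x x';rewrite -!ball_normE /= => xd xd';rewrite mulr0 subr0.
 rewrite phiQ ?le_max ?lexx // normrM mulrC.
 have B (y : R) : `|r0 - y| < d -> `|Num.max 0 y - 0| < d.
 move=> h;have := maxlip y r0;rewrite (max_l r00) => h1.
 by apply: le_lt_trans h1 _;rewrite distrC.
 apply: ler_pM => //.
 by rewrite -[Q _ _]subr0;apply: Hd;rewrite ?le_max ?lexx //;exact: B.
rewrite (max_r (ltW r00)) in Hd *.
have dr : 0 < Num.min d r0 by rewrite lt_min d0.
exists (ball r0 (Num.min d r0));first exact: nbhsx_ballx.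
move=> x x';rewrite -!ball_normE /= !lt_min => /andP[xd xr] /andP[xd' xr'].
have x0 : 0 < x by move: xr;rewrite ltr_norml => /andP[_];lra.
have x0' : 0 < x' by move: xr';rewrite ltr_norml => /andP[_];lra.
rewrite (max_r (ltW x0)) (max_r (ltW x0')) (phiQ _ _ (ltW x0) (ltW x0')) -mulrBr normrM [leRHS]mulrC.
apply: ler_pM => //;apply: Hd;rewrite ?ltW // distrC //.
Qed.
Lemma sdif_max2 (r0 : R) :
 sdif id (fun r : R => Num.max 0 r ^+ 2) r0 (fun v => v * (2 * Num.max 0 r0)).
rewrite (_ : 2 * _ = Num.max 0 r0 + Num.max 0 r0);last ring.
apply: (@sdif_maxr (fun p => p ^+ 2) (fun p p' => p + p')) => [p p' _ _||e e0];[ring|by rewrite addr0|].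
exists (e / 2) => [|p p' _ _ h h'];first by rewrite divr_gt0.
set m := Num.max 0 r0 in h h' *;rewrite (_ : _ - _ = (p - m) + (p' - m));last ring.
by apply: le_trans (ler_normD _ _) _;rewrite [e]splitr lerD // ltW.
Qed.
Lemma sdif_max3 (r0 : R) :
 sdif id (fun r : R => Num.max 0 r ^+ 3) r0 (fun v => v * (3 * Num.max 0 r0 ^+ 2)).
set m := Num.max 0 r0;have m0 : 0 <= m by rewrite le_max lexx.
rewrite (_ : 3 * m ^+ 2 = m ^+ 2 + m * m + m ^+ 2);last ring.
apply: (@sdif_maxr (fun p => p ^+ 3) (fun p p' => p ^+ 2 + p * p' + p' ^+ 2)) => [p p' _ _||e e0];
 [ring|by rewrite !expr2 !mul0r !addr0|rewrite -/m].
pose M := 6 * m + 3;have M0 : 0 < M by rewrite ltr_wpDl // mulr_ge0.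
pose d := Num.min 1 (e / M);have d0 : 0 < d by rewrite lt_min ltr01 divr_gt0.
exists d => // p p' _ _;rewrite !ltr_norml => /andP[h1 h2] /andP[h3 h4].
have d1 : d <= 1 by rewrite /d ge_min lexx.
have dM : d * M <= e by rewrite -ler_pdivlMr // /d ge_min lexx orbT.
rewrite /M in dM;rewrite ler_norml;apply/andP;split;nra.
Qed.
(* convex, of slope in [0, 1], zero on [0, rho] *)
Definition hramp (rho a r : R) : R := Num.max 0 (r - rho) ^+ 2 / (Num.max 0 (r - rho) + a).
Definition hramp' (rho a r : R) : R :=
 (Num.max 0 (r - rho) ^+ 2 + 2 * a * Num.max 0 (r - rho)) / (Num.max 0 (r - rho) + a) ^+ 2.
Lemma sdif_hramp (rho a r0 : R) : 0 < a ->
 sdif id (hramp rho a) r0 (fun v => v * hramp' rho a r0).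
move=> a0;pose phi (p : R) := p ^+ 2 / (p + a).
pose Q (p p' : R) := (p * p' + a * (p + p')) / ((p + a) * (p' + a)).
have pa p : 0 <= p -> p + a != 0 by move=> p0;rewrite gt_eqF // ltr_wpDl.
have mx0 r : 0 <= Num.max 0 r :> R by rewrite le_max lexx.
have QE p : 0 <= p -> Q p p = (p ^+ 2 + 2 * a * p) / (p + a) ^+ 2.
 by move=> p0;rewrite /Q;field;rewrite pa.
suff : sdif id (fun r : R => phi (Num.max 0 r)) (r0 - rho) (fun v => v * hramp' rho a r0).
 case=> bL HF;split=> // e e0;have [U nU HU] := HF e e0.
 exists [set r | U (r - rho)].
 have : cts r0 (fun r => r - rho).
 by apply: cvgB;[exact: cvg_id|exact: cvg_cst].
 exact.
 move=> x x' Ux Ux';have := HU _ _ Ux Ux';rewrite /= /phi /hramp.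
 by rewrite (_ : x' - rho - (x - rho) = x' - x) //;ring.
have -> : hramp' rho a r0 = Q (Num.max 0 (r0 - rho)) (Num.max 0 (r0 - rho)) by rewrite QE.
apply: (@sdif_maxr phi Q).
- by move=> p p' p0 p'0;rewrite /phi /Q;field;rewrite !pa.
- by rewrite /Q !mulr0 addr0 mulr0 add0r mul0r.
move=> e e0;set p0 := Num.max 0 (r0 - rho).
have Qc : {for (p0, p0), continuous (fun z : R * R => Q z.1 z.2)}.
 have c1 : (fun z : R * R => z.1) @ (p0, p0) --> p0 by exact: cvg_fst.
 have c2 : (fun z : R * R => z.2) @ (p0, p0) --> p0 by exact: cvg_snd.
 rewrite /Q;apply: cvgM.
 by apply: cvgD;[exact: cvgM|apply: cvgM;[exact: cvg_cst|exact: cvgD]].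
 apply: cvgV;first by rewrite /= mulf_neq0 // pa // /p0 mx0.
 by apply: cvgM;apply: cvgD => //;exact: cvg_cst.
have /cvgrPdist_le/(_ e e0) := Qc.
case=> -[A B] /= [/nbhs_ballP[d d0 Ad] /nbhs_ballP[d' d'0 Bd']] AB.
exists (Num.min d d');first by rewrite lt_min d0.
move=> p p' _ _;rewrite !lt_min => /andP[pd _] /andP[_ pd'].
rewrite distrC;apply: (AB (p, p'));split => /=;[apply: Ad|apply: Bd'];by rewrite -ball_normE /= distrC.
Qed.
Lemma hramp0 (rho a r : R) : r <= rho -> hramp rho a r = 0.
by move=> h;rewrite /hramp max_l ?subr_le0 // expr0n mul0r. Qed.
(** The ramp lies above its asymptote. This is what lets it absorb a pairing of size speed times
    norm up to a constant. *)
Lemma hramp_ge (rho a r : R) : 0 < a -> r - (rho + a) <= hramp rho a r.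
move=> a0;rewrite /hramp;set p := Num.max 0 (r - rho).
have pr : r - rho <= p by rewrite le_max lexx orbT.
have p0 : 0 <= p by rewrite le_max lexx.
apply: le_trans (_ : p - a <= _);first lra.
rewrite ler_pdivlMr ?ltr_wpDl //;nra.
Qed.
Lemma hramp_bounds (rho a r : R) : 0 < a -> 0 <= hramp' rho a r <= 1.
move=> a0;rewrite /hramp';set p := Num.max 0 (r - rho).
have p0 : 0 <= p by rewrite le_max lexx.
have pa : 0 < (p + a) ^+ 2 by rewrite exprn_gt0 // ltr_wpDl.
apply/andP;split;first by rewrite divr_ge0 ?(ltW pa) // addr_ge0 ?exprn_ge0 // !mulr_ge0 // ltW.
rewrite ler_pdivrMr // mul1r;nra.
Qed.
(** The left side is minus the intercept of a tangent line of a convex function whose asymptote is r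
    - (rho + a). It is the action density in the ramp, per unit of speed. *)
Lemma hramp_action (rho a r : R) : 0 < a -> 0 <= rho ->
 r * hramp' rho a r - hramp rho a r <= rho + a.
move=> a0 rho0;rewrite /hramp' /hramp;set p := Num.max 0 (r - rho).
have p0 : 0 <= p by rewrite le_max lexx.
have pa : 0 < p + a by rewrite ltr_wpDl.
have [rr|rr] := leP r rho.
 have -> : p = 0 by rewrite /p max_l // subr_le0.
 by rewrite expr0n /= !(mulr0, addr0, mul0r, subr0) addr_ge0 // ltW.
have pE : p = r - rho by rewrite /p max_r // subr_ge0 ltW.
have -> : r = p + rho by rewrite pE subrK.
rewrite (_ : _ - _ = ((p + rho) * (p ^+ 2 + 2 * a * p) - p ^+ 2 * (p + a)) / (p + a) ^+ 2);last first.
 by field;rewrite gt_eqF.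
rewrite ler_pdivrMr ?exprn_gt0 //.
have : 0 <= p * a * a by rewrite !mulr_ge0 // ltW.
have : 0 <= rho * a * a by rewrite !mulr_ge0 // ltW.
have : 0 <= a * a * a by rewrite !mulr_ge0 // ltW.
nra.
Qed.
End StrictDifferentiability.

(** * Continuity rules and dot products *)

Section ContinuityRules.
Variables (R : realType) (Z : Top) (z : Z).
Lemma ct_cst (T : Top) (a : T) : cts z (fun _ : Z => a).
exact: cvg_cst. Qed.
Lemma ct_comp (T U : Top) (f : T -> U) (a : Z -> T) :
 {for a z, continuous f} -> cts z a -> cts z (fun z => f (a z)).
by move=> fc ac;apply: (@continuous_comp _ _ _ a f). Qed.
Lemma ct_comp2 (T U S : Top) (f : T -> U -> S) (a : Z -> T) (b : Z -> U) :
 {for (a z, b z), continuous (fun p : T * U => f p.1 p.2)} ->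
 cts z a -> cts z b -> cts z (fun z => f (a z) (b z)).
move=> fc ac bc;apply: (@continuous_comp _ _ _ (fun z => (a z, b z)) (fun p => f p.1 p.2)) => //.
exact: (cvg_pair (F := nbhs z) ac bc).
Qed.
Lemma ct_pair (T U : Top) (a : Z -> T) (b : Z -> U) :
 cts z a -> cts z b -> cts z (fun z => (a z, b z)).
by move=> ac bc;exact: (cvg_pair (F := nbhs z) ac bc). Qed.
Lemma ctD (V : NM R) (f g : Z -> V) : cts z f ->
 cts z g -> cts z (fun z => f z + g z).
by move=> fc gc;exact: (cvgD fc gc). Qed.
Lemma ctN (V : NM R) (f : Z -> V) : cts z f ->
 cts z (fun z => - f z).
by move=> fc;exact: (cvgN fc). Qed.
Lemma ctB (V : NM R) (f g : Z -> V) : cts z f ->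
 cts z g -> cts z (fun z => f z - g z).
by move=> fc gc;exact: (cvgB fc gc). Qed.
Lemma ctM (f g : Z -> R) : cts z f ->
 cts z g -> cts z (fun z => f z * g z).
by move=> fc gc;exact: (cvgM fc gc). Qed.
Lemma ctZ (V : NM R) (f : Z -> R) (g : Z -> V) : cts z f ->
 cts z g -> cts z (fun z => f z *: g z).
by move=> fc gc;exact: (cvgZ fc gc). Qed.
Lemma ct_norm (V : NM R) (f : Z -> V) : cts z f ->
 cts z (fun z => `|f z|).
by move=> fc;exact: (cvg_norm fc). Qed.
Lemma ct_max (f g : Z -> R) : cts z f ->
 cts z g -> cts z (fun z => Num.max (f z) (g z)).
by move=> fc gc;exact: continuous_max. Qed.
Lemma ct_min (f g : Z -> R) : cts z f ->
 cts z g -> cts z (fun z => Num.min (f z) (g z)).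
by move=> fc gc;exact: continuous_min. Qed.
End ContinuityRules.

Section DotProduct.
Variables (R : realType) (n : nat).
Implicit Types u v w : 'rV[R]_n.
Lemma dotvE u v : dotv u v = \sum_i u 0 i * v 0 i.
by rewrite /dotv mxE;apply: eq_bigr => i _;rewrite mxE. Qed.
Lemma dotvC u v : dotv u v = dotv v u.
by rewrite !dotvE;apply: eq_bigr => i _;rewrite mulrC. Qed.
Lemma dotvDl u v w : dotv (u + v) w = dotv u w + dotv v w.
by rewrite /dotv mulmxDl mxE. Qed.
Lemma dotvDr u v w : dotv u (v + w) = dotv u v + dotv u w.
by rewrite dotvC dotvDl !(dotvC u). Qed.
Lemma dotvNl u v : dotv (- u) v = - dotv u v.
by rewrite /dotv mulNmx mxE. Qed.
Lemma dotvNr u v : dotv u (- v) = - dotv u v.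
by rewrite dotvC dotvNl dotvC. Qed.
Lemma dotvBl u v w : dotv (u - v) w = dotv u w - dotv v w.
by rewrite dotvDl dotvNl. Qed.
Lemma dotvBr u v w : dotv u (v - w) = dotv u v - dotv u w.
by rewrite dotvDr dotvNr. Qed.
Lemma dotvZl a u v : dotv (a *: u) v = a * dotv u v.
by rewrite /dotv -scalemxAl mxE. Qed.
Lemma dotvZr a u v : dotv u (a *: v) = a * dotv u v.
by rewrite dotvC dotvZl dotvC. Qed.
Lemma dotv0l v : dotv 0 v = 0.
by rewrite /dotv mul0mx mxE. Qed.
Lemma dotv0r v : dotv v 0 = 0.
by rewrite dotvC dotv0l. Qed.
Lemma dotv_norm u v : `|dotv u v| <= n%:R * `|u| * `|v|.
rewrite dotvE;apply: le_trans (ler_norm_sum _ _ _) _.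
apply: (@le_trans _ _ (\sum_(i < n) `|u| * `|v|)).
 by apply: ler_sum => i _;rewrite normrM ler_pM // mx_entry_le.
by rewrite sumr_const card_ord -mulrA mulr_natl.
Qed.
Lemma dotv_delta a v : dotv (delta_mx 0 a) v = v 0 a.
by rewrite /dotv -rowE !mxE. Qed.
Lemma dotv_mul m (u : 'rV[R]_m) (A : 'M[R]_(m, n)) v : dotv (u *m A) v = dotv u (v *m A^T).
by rewrite /dotv trmx_mul trmxK mulmxA. Qed.
Lemma continuous_sum_ord (T : Top) (V : NM R) (I : finType) (f : I -> T -> V) (t : T) :
 (forall i, cts t (f i)) -> cts t (fun t => \sum_i f i t).
move=> fc;rewrite (_ : (fun _ => _) = \sum_i f i).
 by elim/big_ind : _ => [|g h gc hc|i _];[exact: cst_continuous|exact: cvgD|exact: fc].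
by apply/funext => u;elim/big_rec2 : _ => // i a b _ ->.
Qed.
Lemma continuous_mx (T : Top) p q (f : T -> 'M[R]_(p, q)) (t : T) :
 (forall i j, cts t (fun t => f t i j)) -> cts t f.
move=> fc;apply/cvgrPdist_lt => e e0.
have : \forall s \near t, forall k : 'I_p * 'I_q, `|f t k.1 k.2 - f s k.1 k.2| < e.
 apply: filter_forall => -[i j];have /cvgrPdist_lt := fc i j;exact.
by apply: filterS => s Hs;apply: mx_norm_lt => // i j;rewrite !mxE;exact: (Hs (i, j)).
Qed.
Lemma continuous_entry (T : Top) p q (f : T -> 'M[R]_(p, q)) (t : T) i j :
 cts t f -> cts t (fun t => f t i j).
move=> fc;apply/cvgrPdist_lt => e e0;move/cvgrPdist_lt : fc => /(_ e e0).
by apply: filterS => s;apply: le_lt_trans;have := mx_entry_le (f t - f s) i j;rewrite !mxE.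
Qed.
Lemma continuous_dotv (T : Top) (f g : T -> 'rV[R]_n) (t : T) :
 cts t f -> cts t g ->
 cts t (fun t => dotv (f t) (g t)).
move=> fc gc;rewrite (_ : (fun _ => _) = (fun t => \sum_i f t 0 i * g t 0 i));last first.
 by apply/funext => s;rewrite dotvE.
by apply: continuous_sum_ord => i;apply: cvgM;exact: continuous_entry.
Qed.
End DotProduct.
Lemma sub_split (V : zmodType) (a b a' b' : V) :
 a' - b' = a - b + ((a' - a) - (b' - b)).
by rewrite addrA [a - b + _]addrC subrKA opprB subrKA. Qed.

(** * Linking for an abstract discrete action *)

Section Deformation.
Variables (R : realType) (M : Top) (K N L : nat).
Local Notation Y := 'rV[R]_K.
Variables (iota : M -> Y) (W : 'I_N -> M -> Y -> R) (Gy : 'I_N -> M -> Y -> Y)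
 (Xi : 'I_L -> M -> Y) (XW : 'I_L -> 'I_N -> M -> Y -> R) (Phi : 'I_L -> R -> M -> M).
Implicit Types (x : 'I_N -> M) (y : 'I_N -> Y) (q : M) (p : Y).
Definition chord x j : Y := iota (x (ordS j)) - iota (x j).
Definition action x y : R := \sum_j (dotv (y j) (chord x j) - W j (x j) (y j)).
Definition act_y x y j : Y := chord x j - Gy j (x j) (y j).
Definition act_x k x y j : R :=
 dotv (y (ord_pred j) - y j) (Xi k (x j)) - XW k j (x j) (y j).
Lemma actionE x y :
 action x y = \sum_j (dotv (y (ord_pred j) - y j) (iota (x j)) - W j (x j) (y j)).
rewrite /action !big_split /=;congr (_ + _).
under eq_bigr do rewrite /chord dotvBr;under [RHS]eq_bigr do rewrite dotvBl.
rewrite !big_split /=;congr (_ + _).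
rewrite (reindex (@ord_pred N)) /=;last by apply: onW_bij;exact: ord_pred_bij.
by apply: eq_bigr => j _;rewrite ord_predK.
Qed.
(** [eta] is the criticality tolerance, [delta] the bound on chords, [delta'] the displacement under
    which [P] persists, and [r0] the radius of the cube of covectors over [x0]. The linking data are
    [act0], [act_max] and [act_far]. *)
Variables (eta c delta delta' s0 CX CG r0 Smax : R) (x0 : 'I_N -> M) (P : ('I_N -> M) -> Prop)
 (eta01 : 0 < eta <= 1)
 (delta'0 : 0 < delta')
 (s0_gt0 : 0 < s0)
 (r0_gt0 : 0 < r0)
 (CX0 : 0 <= CX)
 (iota_cont : continuous iota)
 (W_cont : forall j, continuous (fun p : M * Y => W j p.1 p.2))
 (Gy_cont : forall j, continuous (fun p : M * Y => Gy j p.1 p.2))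
 (Xi_cont : forall k, continuous (Xi k))
 (XW_cont : forall k j, continuous (fun p : M * Y => XW k j p.1 p.2))
 (Phi_cont : forall k s q, `|s| < s0 ->
 {for (s, q), continuous (fun p : R * M => Phi k p.1 p.2)})
 (Phi0 : forall k q, Phi k 0 q = q)
 (iota_step : forall k (e : R), 0 < e -> exists2 d : R, 0 < d & forall (s : R) q, `|s| < d ->
 `|iota (Phi k s q) - iota q - s *: Xi k q| <= e * `|s|)
 (W_step : forall k j (r e : R), 0 < e -> exists2 d : R, 0 < d & forall (s : R) q p, `|s| < d ->
 `|p| <= r -> `|W j (Phi k s q) p - W j q p - s * XW k j q p| <= e * `|s|)
 (W_ystep : forall j (r e : R), 0 < e -> exists2 d : R, 0 < d & forall q p (v : Y), `|v| < d ->
 `|p| <= r -> `|W j q (p + v) - W j q p - dotv (Gy j q p) v| <= e * `|v|)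
 (Xi_unif : forall k (e : R), 0 < e -> exists2 d : R, 0 < d & forall q q', `|iota q' - iota q| < d ->
 `|Xi k q' - Xi k q| <= e)
 (XW_unif : forall k j (r e : R), 0 < e -> exists2 d : R, 0 < d & forall q q' p p',
 `|iota q' - iota q| < d -> `|p' - p| < d -> `|p| <= r -> `|p'| <= r ->
 `|XW k j q' p' - XW k j q p| <= e)
 (Xi_bnd : forall k q, `|Xi k q| <= CX)
 (Gy_bnd : forall j q p, `|Gy j q p| <= CG)
 (CG_delta : CG + eta < delta / 4)
 (P0 : P x0)
 (Pstep : forall x x', P x -> (forall j, `|iota (x' j) - iota (x j)| < delta') ->
 (forall j, `|chord x j| < delta) -> (forall j, `|chord x' j| < delta) -> P x')
 (chord0 : forall j, `|chord x0 j| < delta)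
 (act0 : forall x, c <= action x (fun=> 0))
 (act_max : forall y, action x0 y <= Smax)
 (act_far : forall y j, r0 <= `|y j| -> action x0 y <= c - eta).
Let clip01 (u : R) : R := Num.max 0 (Num.min 1 u).
(** A step size with the sign of d, bounded by 1 and zero for |d| <= eta / 2. The dead zone makes
    the gain theta(d) d at least eta / 2 times |theta(d)|, so errors proportional to |theta(d)| can
    be absorbed. *)
Let theta (d : R) : R := clip01 (d - eta / 2) - clip01 (- d - eta / 2).
Let clip01_itv u : 0 <= clip01 u <= 1.
by rewrite /clip01 le_max lexx /= ge_max ler01 /= ge_min lexx. Qed.
Let clip01_le0 u : u <= 0 -> clip01 u = 0.
by move=> u0;rewrite /clip01 max_l // ge_min u0 orbT. Qed.
Let clip01_ge1 u : 1 <= u -> clip01 u = 1.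
by move=> u1;rewrite /clip01 min_l // max_r // ler01. Qed.
Let clip01_ge u : u <= 1 -> u <= clip01 u.
by move=> u1;rewrite /clip01 min_r // le_max lexx orbT. Qed.
Let theta_le1 d : `|theta d| <= 1.
have /andP[a b] := clip01_itv (d - eta / 2).
have /andP[a' b'] := clip01_itv (- d - eta / 2).
by rewrite ler_norml /theta;apply/andP;split;lra.
Qed.
Let theta_mul d : eta / 2 * `|theta d| <= theta d * d.
have /andP[e0 e1] := eta01;rewrite /theta.
have [dp|dn] := leP 0 d.
 rewrite [clip01 (- d - _)]clip01_le0 ?subr0;last lra.
 have /andP[a b] := clip01_itv (d - eta / 2);rewrite ger0_norm // mulrC.
 have [h|h] := leP (d - eta / 2) 0;first by rewrite clip01_le0 // !mul0r.
 by rewrite ler_wpM2l //;lra.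
rewrite [clip01 (d - _)]clip01_le0 ?sub0r;last lra.
have /andP[a b] := clip01_itv (- d - eta / 2);rewrite normrN ger0_norm // mulrC mulNr -mulrN.
have [h|h] := leP (- d - eta / 2) 0;first by rewrite clip01_le0 // !mul0r.
by rewrite ler_wpM2l //;lra.
Qed.
Let theta_big d : 3 / 4 * eta <= `|d| -> eta / 4 <= `|theta d|.
have /andP[e0 e1] := eta01;rewrite /theta;have [dp|dn] := leP 0 d => h.
 rewrite (ger0_norm dp) in h;rewrite [clip01 (- d - _)]clip01_le0 ?subr0;last lra.
 apply: le_trans (ler_norm _);have [h1|h1] := leP (d - eta / 2) 1.
 by apply: le_trans (clip01_ge h1);lra.
 by rewrite clip01_ge1 ?ltW //;lra.
rewrite (ltr0_norm dn) in h;rewrite [clip01 (d - _)]clip01_le0 ?sub0r ?normrN;last lra.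
apply: le_trans (ler_norm _);have [h1|h1] := leP (- d - eta / 2) 1.
 by apply: le_trans (clip01_ge h1);lra.
by rewrite clip01_ge1 ?ltW //;lra.
Qed.

Section Steps.
Variable eps : R.
Definition cutoff (v : Y) : R := clip01 (2 - `|v| / (delta / 4)).
(** A node is frozen when one of its two chords has length at least delta / 2, and free when both
    have length at most delta / 4. *)
Definition lam x j := cutoff (chord x j) * cutoff (chord x (ord_pred j)).
(** Stops the descent below the level c - eta and lets it run fully above c - eta / 2. *)
Definition zeta x y := clip01 ((action x y - (c - eta)) / (eta / 2)).
(** The step has size at most eps (1 + |y|), so |y| grows at most exponentially in the total descent
    time, with a bound that does not involve eps. *)
Definition ystep (z : R) x y : 'I_N -> Y := fun j =>
 y j + \row_a (- (eps * z * (1 + `|y j|) * theta ((1 + `|y j|) * act_y x y j 0 a))).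
Definition xshift (z : R) k x y j : R := - (eps * z * lam x j * theta (act_x k x y j)).
Definition xstep (z : R) y x k : 'I_N -> M := fun j => Phi k (xshift z k x y j) (x j).
(** One descent cycle: all covectors, then the fields in succession. The level cutoff is evaluated
    once, at the start. *)
Definition cycle1 (u : ('I_N -> M) * ('I_N -> Y)) :=
 let z := zeta u.1 u.2 in
 let y := ystep z u.1 u.2 in
 (foldl (xstep z y) u.1 (enum 'I_L), y).
Let e_ge0 : 0 <= eta. by case/andP: eta01 => /ltW. Qed.
Let e_gt0 : 0 < eta. by case/andP: eta01. Qed.
Variables (r : R)
 (r_ge0 : 0 <= r)
 (eps0 : 0 < eps)
 (eps_s0 : eps < s0)
 (CG_ge0 : 0 <= CG).
Let C1 := CX + 1.
Variables (W_y : forall j q p (v : Y), `|v| <= eps * (1 + r) -> `|p| <= r ->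
 `|W j q (p + v) - W j q p - dotv (Gy j q p) v| <= eta / (4 * (1 + r)) * `|v|).
(** Chosen so that the expansion error of [iota], paired with a difference of covectors of norm at
    most 2 r, and that of [W] cost together eta / 4. *)
Let e2 := eta / (4 * (K%:R * (2 * r) + 1)).
Variables (iota_s : forall k s q, `|s| <= eps -> `|iota (Phi k s q) - iota q - s *: Xi k q| <= e2 * `|s|)
 (W_s : forall k j s q p, `|s| <= eps -> `|p| <= r ->
 `|W j (Phi k s q) p - W j q p - s * XW k j q p| <= e2 * `|s|)
 (iota_lip : forall k s q, `|s| <= eps -> `|iota (Phi k s q) - iota q| <= C1 * `|s|).
Let D := L%:R * (C1 * eps).
Variables (Xi_u : forall k q q', `|iota q' - iota q| <= D -> `|Xi k q' - Xi k q| * (K%:R * (2 * r)) <= eta / 16)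
 (XW_u : forall k j q q' p p', `|iota q' - iota q| <= D -> `|p' - p| <= eps * (1 + r) ->
 `|p| <= r -> `|p'| <= r -> `|XW k j q' p' - XW k j q p| <= eta / 16)
 (eps_y : K%:R * (2 * (eps * (1 + r))) * CX <= eta / 8)
 (eps_chord : CG + eta + 2 * D <= delta / 4)
 (eps_delta' : C1 * eps < delta')
 (eps_delta : 2 * (C1 * eps) <= delta / 2).
Let C1_ge0 : 0 <= C1. by rewrite addr_ge0. Qed.
Let e2_ge0 : 0 <= e2. by rewrite divr_ge0 // mulr_ge0 // addr_ge0 // !mulr_ge0. Qed.
Let delta_gt0 : 0 < delta. by have h := CG_delta;have h1 := CG_ge0;have h2 := e_gt0;lra. Qed.
Let ez_ge0 z : 0 <= z <= 1 -> 0 <= eps * z * (eta / 4).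
by move=> /andP[z0 _];rewrite mulr_ge0 ?divr_ge0 ?mulr_ge0 // ltW. Qed.
Lemma zeta_itv x y : 0 <= zeta x y <= 1. exact: clip01_itv. Qed.
Lemma lam_itv x j : 0 <= lam x j <= 1.
have /andP[a b] := clip01_itv (2 - `|chord x j| / (delta / 4)).
have /andP[a' b'] := clip01_itv (2 - `|chord x (ord_pred j)| / (delta / 4)).
by rewrite /lam /cutoff mulr_ge0 //= mulr_ile1.
Qed.
Lemma cutoff_big p : delta / 2 <= `|p| -> cutoff p = 0.
have d0 := delta_gt0;move=> h;apply: clip01_le0;rewrite subr_le0 ler_pdivlMr;[lra|by rewrite divr_gt0].
Qed.
Lemma cutoff_small p : `|p| <= delta / 4 -> cutoff p = 1.
have d0 : 0 < delta / 4 by rewrite divr_gt0.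
move=> h;apply: clip01_ge1;have : `|p| / (delta / 4) <= 1 by rewrite ler_pdivrMr // mul1r.
by move=> h1;lra.
Qed.
Let th x y j a := theta ((1 + `|y j|) * act_y x y j 0 a).
Lemma ystep_norm z x y j : 0 <= z <= 1 ->
 `|ystep z x y j - y j| <= eps * z * (1 + `|y j|) * \sum_a `|th x y j a|
 /\ `|ystep z x y j - y j| <= eps * (1 + `|y j|).
move=> /andP[z0 z1];rewrite /ystep [y j + _]addrC addrK.
have y0 : 0 <= 1 + `|y j| by rewrite addr_ge0.
have A0 : 0 <= eps * z * (1 + `|y j|) by rewrite !mulr_ge0 // ltW.
split;apply: mx_norm_le => [|i a].
- by rewrite mulr_ge0 // sumr_ge0.
- rewrite mxE normrN normrM (ger0_norm A0) ler_wpM2l // (bigD1 a) //= -/(th x y j a) lerDl sumr_ge0 //.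
- by rewrite mulr_ge0 // ltW.
rewrite mxE normrN normrM (ger0_norm A0) -/(th x y j a).
rewrite (_ : eps * z * _ * _ = eps * (1 + `|y j|) * (z * `|th x y j a|));last ring.
by rewrite ler_piMr ?mulr_ge0 ?mulr_ile1 // ?theta_le1 // ltW.
Qed.
(** For fixed x the action is a sum of functions of the single covectors. The first-order gain is
    eta / 2 per unit of |theta|, and the Taylor error of [W] takes back at most half of it. *)
Lemma ystep_decrease z x y : 0 <= z <= 1 -> (forall j, `|y j| <= r) ->
 action x (ystep z x y) <= action x y - eps * z * (eta / 4) * \sum_j \sum_a `|th x y j a|.
move=> z01 yr;have /andP[z0 z1] := z01.
rewrite mulr_sumr /action -sumrB;apply: ler_sum => j _.
set v := ystep z x y j - y j;have -> : ystep z x y j = y j + v by rewrite addrC subrK.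
have [v1 v2] := ystep_norm x y j z01;rewrite -/v in v1 v2.
have r1 : 0 < 1 + r by rewrite ltr_wpDr.
have vr : `|v| <= eps * (1 + r) by apply: le_trans v2 _;rewrite ler_pM2l // lerD2l.
have := W_y j (x j) vr (yr j);rewrite ler_norml => /andP[w1 _].
set T := \sum_a _ in v1 *.
have T0 : 0 <= T by rewrite sumr_ge0.
have vB : eta / (4 * (1 + r)) * `|v| <= eps * z * (eta / 4) * T.
 apply: le_trans (_ : eta / (4 * (1 + r)) * (eps * z * (1 + r) * T) <= _);last first.
 by rewrite le_eqVlt;apply/orP;left;apply/eqP;field;rewrite gt_eqF.
 have r10 : 0 <= eta / (4 * (1 + r)) by rewrite divr_ge0 // mulr_ge0 // ltW.
 apply: ler_wpM2l => //;apply: le_trans v1 _;apply: ler_wpM2r => //.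
 by apply: ler_wpM2l;rewrite ?lerD2l // mulr_ge0 // ltW.
have : dotv v (act_y x y j) <= - (eps * z * (eta / 2) * T).
 rewrite dotvE -mulrN /T -sumrN mulr_sumr;apply: ler_sum => a _.
 rewrite /v /ystep [y j + _]addrC addrK mxE.
 rewrite (_ : _ * act_y x y j 0 a = - (eps * z * (th x y j a * ((1 + `|y j|) * act_y x y j 0 a))));last by rewrite /th;ring.
 rewrite [leRHS](_ : _ = - (eps * z * (eta / 2 * `|th x y j a|)));last ring.
 rewrite lerN2;apply: ler_wpM2l;[by rewrite mulr_ge0 // ltW|exact: theta_mul].
rewrite /act_y dotvBr [dotv v (Gy _ _ _)]dotvC dotvDl => h;lra.
Qed.
Lemma xshift_norm z x y k j : 0 <= z <= 1 ->
 `|xshift z k x y j| = eps * z * lam x j * `|theta (act_x k x y j)| /\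
 `|xshift z k x y j| <= eps.
move=> /andP[z0 z1];have /andP[l0 l1] := lam_itv x j.
have A0 : 0 <= eps * z * lam x j by exact: mulr_ge0 (mulr_ge0 (ltW eps0) z0) l0.
rewrite /xshift normrN normrM (ger0_norm A0);split=> //.
rewrite (_ : eps * z * _ * _ = eps * (z * (lam x j * `|theta (act_x k x y j)|)));last ring.
have t1 := theta_le1 (act_x k x y j).
have l2 : lam x j * `|theta (act_x k x y j)| <= 1 by exact: mulr_ile1.
by rewrite ler_piMr ?(ltW eps0) //;apply: mulr_ile1 => //;exact: mulr_ge0 l0 (normr_ge0 _).
Qed.
Lemma xstep_disp z y x k j : 0 <= z <= 1 -> `|iota (xstep z y x k j) - iota (x j)| <= C1 * eps.
move=> z01;have [_ h] := xshift_norm x y k j z01.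
apply: le_trans (iota_lip _ _ h) _;exact: ler_wpM2l.
Qed.
(** The nodes decouple by [actionE]; the choice of [e2] limits the error to half of the first-order
    gain. *)
Lemma xstep_decrease z y x k : 0 <= z <= 1 -> (forall j, `|y j| <= r) ->
 action (xstep z y x k) y <=
 action x y - eps * z * (eta / 4) * \sum_j lam x j * `|theta (act_x k x y j)|.
move=> z01 yr;have /andP[z0 z1] := z01.
rewrite mulr_sumr !actionE -sumrB;apply: ler_sum => j _.
have [s1 s2] := xshift_norm x y k j z01.
set s := xshift z k x y j in s1 s2;set dy := y (ord_pred j) - y j.
rewrite /xstep -/s.
have := W_s k j (x j) s2 (yr j);rewrite ler_norml => /andP[w1 _].
have i1 := iota_s k (x j) s2.
have dy2 : `|dy| <= 2 * r.
 by apply: le_trans (ler_normB _ _) _;have := yr j;have := yr (ord_pred j);lra.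
set E := iota (Phi k s (x j)) - iota (x j) - s *: Xi k (x j) in i1.
have EE : iota (Phi k s (x j)) = E + s *: Xi k (x j) + iota (x j) by rewrite !subrK.
rewrite EE;clearbody E;rewrite !dotvDr dotvZr {EE}.
have dE : dotv dy E <= K%:R * (2 * r) * (e2 * `|s|).
 apply: le_trans (ler_norm _) _;apply: le_trans (dotv_norm _ _) _.
 by apply: ler_pM;[rewrite mulr_ge0|by []|rewrite ler_wpM2l|by []].
have e2E : e2 * (K%:R * (2 * r) + 1) = eta / 4.
 by rewrite /e2;field;rewrite gt_eqF // ltr_wpDl // !mulr_ge0.
have sA : s * act_x k x y j <= - (eps * z * (eta / 2) * (lam x j * `|theta (act_x k x y j)|)).
 have /andP[l0 l1] := lam_itv x j.
 rewrite /s /xshift (_ : _ * act_x k x y j = - (eps * z * lam x j * (theta (act_x k x y j) * act_x k x y j)));last ring.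
 rewrite (_ : eps * z * (eta / 2) * _ = eps * z * lam x j * (eta / 2 * `|theta (act_x k x y j)|));last ring.
 rewrite lerN2;apply: ler_wpM2l;last exact: theta_mul.
 exact: mulr_ge0 (mulr_ge0 (ltW eps0) z0) l0.
have sB : K%:R * (2 * r) * (e2 * `|s|) + e2 * `|s| = eps * z * (eta / 4) * (lam x j * `|theta (act_x k x y j)|).
 rewrite (_ : _ + _ = e2 * (K%:R * (2 * r) + 1) * `|s|);last ring.
 by rewrite e2E s1;ring.
by rewrite /act_x -/dy in sA *;lra.
Qed.
(** A chord of length at least delta / 2 has both ends frozen and does not change; a shorter one
    cannot reach delta in one step. *)
Lemma xstep_chord z y x k : 0 <= z <= 1 -> (forall j, `|chord x j| < delta) ->
 forall j, `|chord (xstep z y x k) j| < delta.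
move=> z01 cx j;have [h|h] := leP (delta / 2) `|chord x j|.
 have l1 : lam x j = 0 by rewrite /lam cutoff_big ?mul0r.
 have l2 : lam x (ordS j) = 0 by rewrite /lam ordSK (cutoff_big h) mulr0.
 by rewrite /chord /xstep /xshift l1 l2 !(mulr0, mul0r, oppr0) !Phi0;exact: cx.
have -> : chord (xstep z y x k) j = chord x j +
 ((iota (xstep z y x k (ordS j)) - iota (x (ordS j))) - (iota (xstep z y x k j) - iota (x j))).
 exact: sub_split.
apply: le_lt_trans (ler_normD _ _) _.
have := ler_normB (iota (xstep z y x k (ordS j)) - iota (x (ordS j))) (iota (xstep z y x k j) - iota (x j)).
have := xstep_disp y x k j z01;have := xstep_disp y x k (ordS j) z01.
have := eps_delta;move=> *;lra.
Qed.
Lemma fold_inv z y s x : 0 <= z <= 1 -> (forall j, `|y j| <= r) ->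
 P x -> (forall j, `|chord x j| < delta) ->
 let x' := foldl (xstep z y) x s in
 [/\ P x', forall j, `|chord x' j| < delta, action x' y <= action x y
 & forall j, `|iota (x' j) - iota (x j)| <= (size s)%:R * (C1 * eps)].
move=> z01 yr;elim: s x => [|k s IH] x Px cx /=.
 by split=> // j;rewrite subrr normr0 mul0r.
have cx' := xstep_chord y k z01 cx.
have Px' : P (xstep z y x k).
 by apply: Pstep Px _ cx cx' => j;apply: le_lt_trans (xstep_disp y x k j z01) _.
have [h1 h2 h3 h4] := IH _ Px' cx';split=> // [|j].
 apply: le_trans h3 _;apply: le_trans (xstep_decrease x k z01 yr) _.
 rewrite gerBl mulr_ge0 ?ez_ge0 //;apply: sumr_ge0 => j _.
 by rewrite mulr_ge0 //;case/andP: (lam_itv x j).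
rewrite -(subrKA (iota (xstep z y x k j)));apply: le_trans (ler_normD _ _) _.
rewrite -natr1 mulrDl mul1r;apply: lerD => //;exact: xstep_disp.
Qed.
Lemma ystep_le z x y : 0 <= z <= 1 -> (forall j, `|y j| <= r) ->
 action x (ystep z x y) <= action x y.
move=> z01 yr;apply: le_trans (ystep_decrease x z01 yr) _.
by rewrite gerBl mulr_ge0 ?ez_ge0 //;apply: sumr_ge0 => j _;apply: sumr_ge0.
Qed.
(** If a y-gradient is large, the y-step alone gives the gain. Otherwise every chord is close to
    [Gy], hence short, and no node is frozen; a large x-gradient then loses at most eta / 4 before
    its own field acts, which leaves it above the threshold of [theta_big]. *)
Lemma cycle_progress x y : P x -> (forall j, `|chord x j| < delta) ->
 (forall j, `|y j| + eps * (1 + `|y j|) <= r) ->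
 let u' := cycle1 (x, y) in
 [/\ P u'.1, forall j, `|chord u'.1 j| < delta,
 forall j, `|u'.2 j| <= `|y j| + eps * (1 + `|y j|) &
 action u'.1 u'.2 <= action x y /\
 ((exists j a, eta < `|(1 + `|y j|) * act_y x y j 0 a|) \/
 (exists k j, eta < `|act_x k x y j|) ->
 action u'.1 u'.2 <= action x y - eps * zeta x y * (eta / 4) ^+ 2)].
move=> Px cx yr1 u'.
have z01 := zeta_itv x y;have /andP[z0 z1] := z01.
have yr j : `|y j| <= r by apply: le_trans (yr1 j);rewrite lerDl mulr_ge0 ?addr_ge0 // ltW.
set z := zeta x y in z01 z0 z1 u' *.
have y'le j : `|ystep z x y j| <= `|y j| + eps * (1 + `|y j|).
 have [_ h] := ystep_norm x y j z01.
 rewrite -[ystep z x y j](subrK (y j)) addrC;apply: le_trans (ler_normD _ _) _.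
 by rewrite lerD2l.
have y'r j : `|ystep z x y j| <= r by exact: le_trans (y'le j) (yr1 j).
set y' := ystep z x y in y'le y'r *.
have [h1 h2 h3 h4] := fold_inv (enum 'I_L) z01 y'r Px cx.
split=> //;split;first exact: le_trans h3 (ystep_le _ z01 yr).
have ez0 : 0 <= eps * z by rewrite mulr_ge0 // ltW.
case=> [[j [a hja]]|[k [j hkj]]].
 apply: le_trans h3 _;apply: le_trans (ystep_decrease x z01 yr) _.
 rewrite lerD2l lerN2 expr2 mulrA ler_wpM2l ?ez_ge0 //.
 rewrite (bigD1 j) //= (bigD1 a) //=;apply: le_trans (_ : `|th x y j a| <= _).
 by apply: theta_big;apply: le_trans (ltW hja);have := e_gt0;lra.
 rewrite -addrA lerDl addr_ge0 ?sumr_ge0 // => i _;exact: sumr_ge0.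
have [[j' [a' h']]|hy] := pselect (exists j a, eta < `|(1 + `|y j|) * act_y x y j 0 a|).
 apply: le_trans h3 _;apply: le_trans (ystep_decrease x z01 yr) _.
 rewrite lerD2l lerN2 expr2 mulrA ler_wpM2l ?ez_ge0 //.
 rewrite (bigD1 j') //= (bigD1 a') //=;apply: le_trans (_ : `|th x y j' a'| <= _).
 by apply: theta_big;apply: le_trans (ltW h');have := e_gt0;lra.
 rewrite -addrA lerDl addr_ge0 ?sumr_ge0 // => i _;exact: sumr_ge0.
have cs i : `|chord x i| <= CG + eta.
 have ay : `|act_y x y i| <= eta.
 apply: mx_norm_le => // b a;rewrite ord1;rewrite leNgt;apply/negP => h;apply: hy.
 exists i, a;apply: lt_le_trans h _;rewrite normrM ler_peMl //.
 by rewrite ger0_norm ?addr_ge0 // lerDl.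
 rewrite -[chord x i](subrK (Gy i (x i) (y i))) addrC;apply: le_trans (ler_normD _ _) _.
 exact: lerD.
(* The fields [s1] act before [k]; together they displace each node by at most [D]. *)
have [s1 [s2 Ep]] : exists s1 s2, enum 'I_L = s1 ++ k :: s2.
 have kI : k \in enum 'I_L by rewrite mem_enum.
 by case/splitPr: kI => s1 s2;exists s1, s2.
rewrite /u' /cycle1 /= -/z -/y' Ep foldl_cat /=.
have szp : (size s1 <= L)%N.
 by rewrite -[X in (_ <= X)%N](size_enum_ord) Ep size_cat leq_addr.
have [q1 q2 q3 q4] := fold_inv s1 z01 y'r Px cx.
set x1 := foldl _ x s1 in q1 q2 q3 q4 *.
have d1 i : `|iota (x1 i) - iota (x i)| <= D.
 by apply: le_trans (q4 i) _;rewrite ler_wpM2r ?ler_nat // mulr_ge0 // ltW.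
have cs1 i : `|chord x1 i| <= delta / 4.
 have -> : chord x1 i = chord x i + ((iota (x1 (ordS i)) - iota (x (ordS i))) - (iota (x1 i) - iota (x i))).
 exact: sub_split.
 apply: le_trans (ler_normD _ _) _.
 have := ler_normB (iota (x1 (ordS i)) - iota (x (ordS i))) (iota (x1 i) - iota (x i)).
 by have := d1 i;have := d1 (ordS i);have := cs i;have := eps_chord;move=> *;lra.
have l1 : lam x1 j = 1 by rewrite /lam !cutoff_small ?mulr1.
have dyr i : `|y' i - y i| <= eps * (1 + r).
 have [_ h] := ystep_norm x y i z01;apply: le_trans h _.
 by rewrite ler_pM2l // lerD2l.
have da : `|act_x k x1 y' j - act_x k x y j| <= eta / 4.
 have -> : act_x k x1 y' j - act_x k x y j =
 dotv ((y' (ord_pred j) - y (ord_pred j)) - (y' j - y j)) (Xi k (x j))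
 + dotv (y' (ord_pred j) - y' j) (Xi k (x1 j) - Xi k (x j))
 - (XW k j (x1 j) (y' j) - XW k j (x j) (y j)).
 by rewrite /act_x !(dotvBl, dotvBr);ring.
 apply: le_trans (ler_normB _ _) _.
 have w := XW_u k j (d1 j) (dyr j) (yr j) (y'r j).
 have xx := Xi_u k (d1 j).
 have t1 : `|dotv (y' (ord_pred j) - y (ord_pred j) - (y' j - y j)) (Xi k (x j))| <= eta / 8.
 apply: le_trans (dotv_norm _ _) _;apply: le_trans eps_y;apply: ler_pM;[by rewrite mulr_ge0|by []| |exact: Xi_bnd].
 rewrite ler_wpM2l //;apply: le_trans (ler_normB _ _) _.
 by have := dyr j;have := dyr (ord_pred j);lra.
 have t2 : `|dotv (y' (ord_pred j) - y' j) (Xi k (x1 j) - Xi k (x j))| <= eta / 16.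
 apply: le_trans (dotv_norm _ _) _;apply: le_trans xx;rewrite mulrC ler_wpM2l //.
 rewrite ler_wpM2l //;apply: le_trans (ler_normB _ _) _.
 by have := y'r j;have := y'r (ord_pred j);lra.
 have := ler_normD (dotv (y' (ord_pred j) - y (ord_pred j) - (y' j - y j)) (Xi k (x j))) (dotv (y' (ord_pred j) - y' j) (Xi k (x1 j) - Xi k (x j))).
 by move=> ?;lra.
have big : eta / 4 <= `|theta (act_x k x1 y' j)|.
 apply: theta_big;have := ler_normB (act_x k x1 y' j) (act_x k x1 y' j - act_x k x y j).
 by rewrite opprB addrC subrK => ?;lra.
have Px2 := xstep_chord y' k z01 q2.
have P2 : P (xstep z y' x1 k).
 by apply: Pstep q1 _ q2 Px2 => i;apply: le_lt_trans (xstep_disp y' x1 k i z01) _.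
have [_ _ g3 _] := fold_inv s2 z01 y'r P2 Px2.
apply: le_trans g3 _;apply: le_trans (xstep_decrease x1 k z01 y'r) _.
apply: lerB;first exact: le_trans q3 (ystep_le _ z01 yr).
rewrite expr2 mulrA ler_wpM2l ?ez_ge0 //.
rewrite (bigD1 j) //= l1 mul1r;apply: le_trans big _;rewrite lerDl sumr_ge0 // => i _.
by rewrite mulr_ge0 //;case/andP: (lam_itv x1 i).
Qed.
End Steps.
(* A family of states depending continuously on a parameter. *)
Definition cont_state (Z : Top) (u : Z -> ('I_N -> M) * ('I_N -> Y)) :=
 forall z j, cts z (fun z => (u z).1 j) /\ cts z (fun z => (u z).2 j).
Let cont_clip (Z : Top) (f : Z -> R) z :
 cts z f -> cts z (fun z => clip01 (f z)).
by move=> fc;apply: ct_max;[exact: ct_cst|apply: ct_min => //;exact: ct_cst]. Qed.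
Let cont_theta (Z : Top) (f : Z -> R) z :
 cts z f -> cts z (fun z => theta (f z)).
move=> fc;apply: ctB;apply: cont_clip;apply: ctB;try exact: ct_cst;first exact: fc.
exact: ctN.
Qed.

Section ContState.
Variables (Z : Top) (x : Z -> 'I_N -> M) (y : Z -> 'I_N -> Y) (z : Z)
 (xc : forall j, cts z (fun z => x z j))
 (yc : forall j, cts z (fun z => y z j)).
Lemma cont_iota j : cts z (fun z => iota (x z j)).
by apply: ct_comp;[exact: iota_cont|exact: xc]. Qed.
Lemma cont_chord j : cts z (fun z => chord (x z) j).
by apply: ctB;exact: cont_iota. Qed.
Lemma cont_action : cts z (fun z => action (x z) (y z)).
apply: continuous_sum_ord => j;apply: ctB.
 by apply: continuous_dotv;[exact: yc|exact: cont_chord].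
by apply: (ct_comp2 (f := W j));[exact: W_cont|exact: xc|exact: yc].
Qed.
Lemma cont_act_y j a : cts z (fun z => act_y (x z) (y z) j 0 a).
apply: (continuous_entry (f := fun z => act_y (x z) (y z) j));apply: ctB;first exact: cont_chord.
by apply: (ct_comp2 (f := Gy j));[exact: Gy_cont|exact: xc|exact: yc].
Qed.
Lemma cont_act_x k j : cts z (fun z => act_x k (x z) (y z) j).
apply: ctB.
 apply: continuous_dotv;first by apply: ctB;exact: yc.
 by apply: ct_comp;[exact: Xi_cont|exact: xc].
by apply: (ct_comp2 (f := XW k j));[exact: XW_cont|exact: xc|exact: yc].
Qed.
Lemma cont_cutoff (f : Z -> Y) : cts z f -> cts z (fun z => cutoff (f z)).
move=> fc;apply: cont_clip;apply: ctB;first exact: ct_cst.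
by apply: ctM;[exact: ct_norm|exact: ct_cst].
Qed.
Lemma cont_lam j : cts z (fun z => lam (x z) j).
by apply: ctM;apply: cont_cutoff;exact: cont_chord. Qed.
Lemma cont_zeta : cts z (fun z => zeta (x z) (y z)).
apply: cont_clip;apply: ctM;last exact: ct_cst.
by apply: ctB;[exact: cont_action|exact: ct_cst].
Qed.
Lemma cont_ystep eps (w : Z -> R) j : cts z w ->
 cts z (fun z => ystep eps (w z) (x z) (y z) j).
move=> wc;apply: ctD;first exact: yc.
have nc : cts z (fun z => 1 + `|y z j|).
 by apply: ctD;[exact: ct_cst|exact: ct_norm].
apply: continuous_mx => i a;rewrite (_ : (fun _ => _) =
 (fun z => - (eps * w z * (1 + `|y z j|) * theta ((1 + `|y z j|) * act_y (x z) (y z) j 0 a))));last first.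
 by apply/funext => t;rewrite mxE.
apply: ctN;apply: ctM;last by apply: cont_theta;apply: ctM nc _;exact: cont_act_y.
by apply: ctM nc;apply: ctM wc;exact: ct_cst.
Qed.
Lemma cont_xstep eps (w : Z -> R) k j : cts z w -> 0 < eps < s0 -> 0 <= w z <= 1 ->
 cts z (fun z => xstep eps (w z) (y z) (x z) k j).
move=> wc /andP[e0 es] /andP[w0 w1];rewrite /xstep.
have sc : cts z (fun z => xshift eps (w z) k (x z) (y z) j).
 apply: ctN;apply: ctM;last by apply: cont_theta;exact: cont_act_x.
 by apply: ctM;[apply: ctM wc;exact: ct_cst|exact: cont_lam].
apply: (ct_comp2 (f := Phi k));[|exact: sc|exact: xc].
apply: Phi_cont;have /andP[l0 l1] := lam_itv (x z) j.
have A0 : 0 <= eps * w z * lam (x z) j by exact: mulr_ge0 (mulr_ge0 (ltW e0) w0) l0.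
rewrite /xshift normrN normrM (ger0_norm A0);apply: le_lt_trans es.
rewrite (_ : _ * _ * _ * _ = eps * (w z * (lam (x z) j * `|theta (act_x k (x z) (y z) j)|)));last ring.
have t1 := theta_le1 (act_x k (x z) (y z) j).
have l2 : lam (x z) j * `|theta (act_x k (x z) (y z) j)| <= 1 by exact: mulr_ile1.
by rewrite ler_piMr ?(ltW e0) //;apply: mulr_ile1 => //;exact: mulr_ge0 l0 (normr_ge0 _).
Qed.
End ContState.
Lemma cont_cycle (Z : Top) eps (u : Z -> ('I_N -> M) * ('I_N -> Y)) : 0 < eps < s0 ->
 cont_state u -> cont_state (fun z => cycle1 eps (u z)).
move=> es uc.
have xc0 z j : cts z (fun z => (u z).1 j) by case: (uc z j).
have yc0 z j : cts z (fun z => (u z).2 j) by case: (uc z j).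
have zc z : cts z (fun z => zeta (u z).1 (u z).2) by exact: cont_zeta.
have yc z j : cts z (fun z => ystep eps (zeta (u z).1 (u z).2) (u z).1 (u z).2 j).
 exact: cont_ystep.
move=> z0 j0;split;last exact: yc.
pose w z := zeta (u z).1 (u z).2;pose y' z := ystep eps (w z) (u z).1 (u z).2.
suff H s (x : Z -> 'I_N -> M) : (forall z j, cts z (fun z => x z j)) ->
 forall z j, cts z (fun z => foldl (xstep eps (w z) (y' z)) (x z) s j).
 exact: (H (enum 'I_L) (fun z => (u z).1)).
elim: s x => [|k s IH] x xc //=;apply: (IH (fun z => xstep eps (w z) (y' z) (x z) k)) => z j.
by apply: cont_xstep;[exact: xc|move=> i;exact: yc|exact: zc|exact: es|exact: zeta_itv].
Qed.
Lemma cycle_fixed eps x y : action x y <= c - eta -> cycle1 eps (x, y) = (x, y).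
move=> h;have z0 : zeta x y = 0.
 by apply: clip01_le0;rewrite pmulr_lle0 ?subr_le0 // invr_gt0 divr_gt0 //;case/andP: eta01.
rewrite /cycle1 /= z0;congr (_, _);last first.
 apply/funext => j;rewrite /ystep (_ : \row__ _ = 0) ?addr0 //.
 by apply/rowP => a;rewrite !mxE mulr0 !mul0r oppr0.
have stepE y' k : xstep eps 0 y' x k = x.
 by apply/funext => j;rewrite /xstep /xshift mulr0 !mul0r oppr0 Phi0.
by elim: (enum _) => //= k s IH;rewrite stepE.
Qed.
Let near0 (C d : R) : 0 <= C -> 0 < d -> \forall e \near 0^'+, C * e < d.
move=> C0 d0;have C1 : 0 < C + 1 by rewrite ltr_wpDl.
near=> e;have e0 : 0 < e by near: e;exact: nbhs_right_gt.
have : e * (C + 1) < d.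
 by rewrite -ltr_pdivlMr //;near: e;apply: nbhs_right_lt;rewrite divr_gt0.
by apply: le_lt_trans;rewrite mulrC ler_pM2l // lerDl.
Unshelve. all: by end_near. Qed.
Variables (CG_ge0 : 0 <= CG).
(** Otherwise each cycle lowers the action at a definite rate until it is below c. Running the
    cycles from (x0, y) and reading off the final covectors gives a continuous map which is the
    identity on the boundary of a cube, so it has a zero; there the covectors vanish and [act0] puts
    the action at or above c, against the descent. *)
Theorem exists_almost_critical : exists x y,
 [/\ P x, forall j, `|chord x j| < delta, c - eta <= action x y,
 forall j a, `|(1 + `|y j|) * act_y x y j 0 a| <= eta
 & forall k j, `|act_x k x y j| <= eta].
apply: contrapT => nex.
have NC x y : P x -> (forall j, `|chord x j| < delta) -> c - eta <= action x y ->
 (exists j a, eta < `|(1 + `|y j|) * act_y x y j 0 a|) \/ (exists k j, eta < `|act_x k x y j|).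
 move=> Px cx ca;apply: contrapT => /not_orP[h1 h2];apply: nex;exists x, y;split => //.
 by move=> j a;rewrite leNgt;apply/negP => h;apply: h1;exists j, a.
 by move=> k j;rewrite leNgt;apply/negP => h;apply: h2;exists k, j.
have e0 : 0 < eta by case/andP: eta01.
pose mu := (eta / 4) ^+ 2;have mu0 : 0 < mu by rewrite exprn_gt0 // divr_gt0.
(* Descent time that suffices to fall from [Smax] below c at rate [mu]. *)
pose T0 := (`|Smax - c| + 1) / mu;have T00 : 0 <= T0 by rewrite divr_ge0 ?addr_ge0 // ltW.
(* Bound for 1 + |y| during time T0 + 1 from the radius r0. It is independent of eps, which can
   therefore be chosen afterwards; doubling it leaves room for one more step. *)
pose R0 := expR (T0 + 1) * (1 + r0).
have r00 : 0 <= 1 + r0 by rewrite addr_ge0 // ltW.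
have R00 : 0 <= R0 by rewrite mulr_ge0 // ltW // expR_gt0.
pose r := R0 *+ 2;have r_ge0 : 0 <= r by rewrite mulrn_wge0.
have r1 : 0 < 1 + r by rewrite ltr_wpDr.
pose e2 := eta / (4 * (K%:R * (2 * r) + 1)).
have Kr0 : 0 <= K%:R * (2 * r) by rewrite !mulr_ge0.
have e20 : 0 < e2 by rewrite divr_gt0 // mulr_gt0 // ltr_wpDl.
pose C1 := CX + 1;have C10 : 0 <= C1 by rewrite addr_ge0.
have dd0 : 0 < delta by have := CG_delta;have := CG_ge0;move=> *;lra.
have : \forall eps \near 0^'+, [/\ 0 < eps, eps < s0, eps < 1 & [/\
 forall j q p (v : Y), `|v| <= eps * (1 + r) -> `|p| <= r ->
 `|W j q (p + v) - W j q p - dotv (Gy j q p) v| <= eta / (4 * (1 + r)) * `|v|,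
 forall k s q, `|s| <= eps -> `|iota (Phi k s q) - iota q - s *: Xi k q| <= e2 * `|s|,
 forall k j s q p, `|s| <= eps -> `|p| <= r ->
 `|W j (Phi k s q) p - W j q p - s * XW k j q p| <= e2 * `|s|
 & forall k s q, `|s| <= eps -> `|iota (Phi k s q) - iota q| <= C1 * `|s|]].
 near=> eps;have ep : 0 < eps by near: eps;exact: nbhs_right_gt.
 split;[by []|by near: eps;exact: nbhs_right_lt|by near: eps;exact: nbhs_right_lt|split].
 - near: eps;apply: filter_forall => j.
 have [d d0 Hd] := @W_ystep j r (eta / (4 * (1 + r))) (divr_gt0 e0 (mulr_gt0 (ltr0n _ 4) r1)).
 near=> eps => q p v hv hp;apply: Hd => //;apply: le_lt_trans hv _;rewrite mulrC.
 by near: eps;apply: near0 => //;exact: ltW.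
 - near: eps;apply: filter_forall => k;have [d d0 Hd] := @iota_step k e2 e20.
 near=> eps => s q hs;apply: Hd;apply: le_lt_trans hs _.
 by near: eps;exact: nbhs_right_lt.
 - near: eps;apply: filter_forall => k;apply: filter_forall => j.
 have [d d0 Hd] := @W_step k j r e2 e20.
 near=> eps => s q p hs hp;apply: Hd => //;apply: le_lt_trans hs _.
 by near: eps;exact: nbhs_right_lt.
 - near: eps;apply: filter_forall => k;have [d d0 Hd] := @iota_step k 1 ltr01.
 near=> eps => s q hs;have := Hd s q.
 have sd : `|s| < d by apply: le_lt_trans hs _;near: eps;exact: nbhs_right_lt.
 move=> /(_ sd) h;rewrite -[_ - iota q](subrK (s *: Xi k q)).
 apply: le_trans (ler_normD _ _) _;rewrite /C1 mulrDl addrC lerD //.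
 by rewrite normrZ mulrC ler_wpM2r.
move=> near1.
have : \forall eps \near 0^'+, [/\
 forall k q q', `|iota q' - iota q| <= L%:R * (C1 * eps) -> `|Xi k q' - Xi k q| * (K%:R * (2 * r)) <= eta / 16,
 forall k j q q' p p', `|iota q' - iota q| <= L%:R * (C1 * eps) -> `|p' - p| <= eps * (1 + r) ->
 `|p| <= r -> `|p'| <= r -> `|XW k j q' p' - XW k j q p| <= eta / 16 & [/\
 K%:R * (2 * (eps * (1 + r))) * CX <= eta / 8,
 CG + eta + 2 * (L%:R * (C1 * eps)) <= delta / 4, C1 * eps < delta'
 & 2 * (C1 * eps) <= delta / 2]].
 have LC : 0 <= L%:R * C1 by rewrite mulr_ge0.
 near=> eps;have ep : 0 < eps by near: eps;exact: nbhs_right_gt.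
 split.
 - near: eps;apply: filter_forall => k.
 have e16 : 0 < eta / 16 / (K%:R * (2 * r) + 1) by rewrite !divr_gt0 // ltr_wpDl.
 have [d d0 Hd] := @Xi_unif k _ e16;near=> eps => q q' h.
 apply: le_trans (_ : eta / 16 / (K%:R * (2 * r) + 1) * (K%:R * (2 * r)) <= _).
 apply: ler_wpM2r => //;apply: Hd;apply: le_lt_trans h _;rewrite mulrA.
 by near: eps;exact: near0.
 by rewrite mulrAC ler_pdivrMr ?ltr_wpDl // ler_wpM2l ?divr_ge0 ?lerDl // ltW.
 - near: eps;apply: filter_forall => k;apply: filter_forall => j.
 have e16 : 0 < eta / 16 by rewrite divr_gt0.
 have [d d0 Hd] := @XW_unif k j r _ e16;near=> eps => q q' p p' h1 h2 h3 h4.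
 apply: Hd => //.
 by apply: le_lt_trans h1 _;rewrite mulrA;near: eps;exact: near0.
 by apply: le_lt_trans h2 _;rewrite mulrC;near: eps;apply: near0 => //;exact: ltW.
 split.
 - rewrite (_ : _ * _ * CX = K%:R * 2 * (1 + r) * CX * eps);last ring.
 by apply: ltW;near: eps;apply: near0;[rewrite !mulr_ge0 // ltW|rewrite divr_gt0].
 - rewrite -lerBrDl (_ : 2 * (L%:R * (C1 * eps)) = 2 * (L%:R * C1) * eps);last ring.
 by apply: ltW;near: eps;apply: near0;[rewrite mulr_ge0|rewrite subr_gt0].
 - by near: eps;exact: near0.
 - by rewrite mulrA;apply: ltW;near: eps;apply: near0;[rewrite mulr_ge0|rewrite divr_gt0].
move=> near2.
have [eps [[ep es ep1 [h1 h2 h3 h4]] [g1 g2 [g3 g4 g5 g6]]]] := filter_ex (filterI near1 near2).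
have prog := @cycle_progress eps r r_ge0 ep CG_ge0 h1 h2 h3 h4 g1 g2 g3 g4 g5 g6.
pose n := (Num.truncn (T0 / eps)).+1.
have T0e : 0 <= T0 / eps by rewrite divr_ge0 // ltW.
have /andP[nlo nhi] := truncn_itv T0e.
have nT : T0 <= n%:R * eps by rewrite -ler_pdivrMr // ltW.
have nT1 : n%:R * eps <= T0 + 1.
 rewrite /n -natr1 mulrDl mul1r;apply: lerD;last exact: ltW.
 by rewrite -ler_pdivlMr.
pose rows (z : 'rV[R]_(N * K)) : 'I_N -> Y := fun j => row j (vec_mx z).
pose u i (z : 'rV[R]_(N * K)) := iter i (cycle1 eps) (x0, rows z).
(* The first alternative of the last clause persists because the action never increases. *)
have inv z i : (i <= n)%N -> (forall j, `|rows z j| <= r0) ->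
 [/\ P (u i z).1, forall j, `|chord (u i z).1 j| < delta,
 forall j, 1 + `|(u i z).2 j| <= (1 + eps) ^+ i * (1 + r0) &
 action (u i z).1 (u i z).2 < c \/ action (u i z).1 (u i z).2 <= Smax - i%:R * eps * mu].
 move=> + zr;elim: i => [|i IH] ilt.
 split=> //=;first by move=> j;rewrite expr0 mul1r lerD2l.
 by right;rewrite !mul0r subr0.
 have [q1 q2 q3 q4] := IH (ltnW ilt).
 have exi j : 1 + `|(u i z).2 j| <= R0.
 apply: le_trans (q3 j) _;rewrite ler_wpM2r //.
 apply: le_trans (_ : expR eps ^+ i <= _).
 by rewrite lerXn2r ?nnegrE ?expR_ge1Dx // ?ltW ?expR_gt0 // ltr_wpDl // ltW.
 rewrite -expRM_natl ler_expR;apply: le_trans nT1;rewrite ler_pM2r // ler_nat;exact: ltnW.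
 have yr j : `|(u i z).2 j| + eps * (1 + `|(u i z).2 j|) <= r.
 have E1 : eps * (1 + `|(u i z).2 j|) <= 1 + `|(u i z).2 j| by rewrite ler_piMl ?ltW // addr_ge0.
 by have := exi j;rewrite /r mulr2n;lra.
 have [p1 p2 p3 [p4 p5]] := prog _ _ q1 q2 yr.
 rewrite /u iterS -/(u i z) (surjective_pairing (u i z));split=> //.
 move=> j;apply: le_trans (_ : (1 + eps) * (1 + `|(u i z).2 j|) <= _).
 by have := p3 j;lra.
 by rewrite exprS -mulrA ler_wpM2l // addr_ge0 // ltW.
 have [ac|ac] := ltP (action (u i z).1 (u i z).2) c.
 by left;apply: le_lt_trans p4 ac.
 right;case: q4 => [|q4];first by rewrite ltNge ac.
 have /p5 : (exists j a, eta < `|(1 + `|(u i z).2 j|) * act_y (u i z).1 (u i z).2 j 0 a|) \/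
 (exists k j, eta < `|act_x k (u i z).1 (u i z).2 j|).
 by apply: NC => //;apply: le_trans ac;rewrite gerBl ltW.
 have -> : zeta (u i z).1 (u i z).2 = 1.
 apply: clip01_ge1;rewrite ler_pdivlMr ?divr_gt0 // mul1r;lra.
 move=> h;apply: le_trans h _;rewrite -/mu.
 rewrite (_ : Smax - _ = Smax - i%:R * eps * mu - eps * 1 * mu);last by rewrite -natr1;ring.
 exact: lerB.
have fixed z j : r0 <= `|rows z j| -> u n z = (x0, rows z).
 move=> zj;rewrite /u;elim: (n) => //= i ->;apply: cycle_fixed;exact: act_far zj.
have low z : (forall j, `|rows z j| <= r0) -> action (u n z).1 (u n z).2 < c.
 move=> zr;have [_ _ _ []//] := inv z n (leqnn n) zr;move/le_lt_trans;apply.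
 have : T0 * mu <= n%:R * eps * mu by rewrite ler_pM2r.
 rewrite /T0 divfK ?gt_eqF //;have := ler_norm (Smax - c);lra.
pose f (z : 'rV[R]_(N * K)) := mxvec (\matrix_(j, a) (u n z).2 j 0 a).
have fE (z : 'rV[R]_(N * K)) j a : f z 0 (mxvec_index j a) = (u n z).2 j 0 a by rewrite /f mxvecE mxE.
have rowsE (z : 'rV[R]_(N * K)) j a : rows z j 0 a = z 0 (mxvec_index j a) by rewrite /rows !mxE.
have rows_le (z : 'rV[R]_(N * K)) : `|z| <= r0 -> forall j, `|rows z j| <= r0.
 move=> zr j;apply: mx_norm_le => [|i a];first exact: ltW.
 by rewrite ord1 rowsE;apply: le_trans zr;exact: mx_entry_le.
(* A boundary point of the cube has a covector of norm at least r0, so by [act_far] it starts at a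
   level where the descent is switched off. *)
have fix_bd (z : 'rV[R]_(N * K)) i : `|z| <= r0 -> `|z 0 i| = r0 -> f z = z.
 move=> zr;case/mxvec_indexP: i => j a zi.
 have /fixed E : r0 <= `|rows z j| by rewrite -zi -rowsE mx_entry_le.
 by apply/rowP => i;case/mxvec_indexP: i => j' a';rewrite fE E /= rowsE.
have fc : continuous f.
 have uc i : cont_state (u i).
 elim: i => [|i IH].
 move=> z j;split;first exact: ct_cst.
 apply: continuous_mx => i a;rewrite (_ : (fun _ => _) = (fun z : 'rV[R]_(N * K) => z 0 (mxvec_index j a))).
 exact: coord_continuous.
 by apply/funext => w;rewrite ord1 rowsE.
 by apply: cont_cycle => //;rewrite ep.
 move=> z;apply: continuous_mx => i l;rewrite ord1;case/mxvec_indexP: l => j a.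
 rewrite (_ : (fun _ => _) = (fun z => (u n z).2 j 0 a));last by apply/funext => w;rewrite fE.
 by apply: (continuous_entry (f := fun z => (u n z).2 j));case: (uc n z j).
have [z fz] : exists z, f z = 0.
 apply: (poincare_miranda r0_gt0 fc) => z i zr zi.
 by rewrite (fix_bd z i) // zi ?ger0_norm ?ltW.
 by rewrite (fix_bd z i) // zi ?normrN ?ger0_norm // ?oppr_le0 ltW.
have y0 : (u n z).2 = fun=> 0.
 apply/funext => j;apply/rowP => a;have := congr1 (fun w : 'rV_(N * K) => w 0 (mxvec_index j a)) fz.
 by rewrite fE !mxE.
(* The zero may lie outside the cube, but such a starting point is never moved, and its covectors
   would be nonzero. *)
have [zr|/existsNP[j /negP]] := pselect (forall j, `|rows z j| <= r0).
 by have := low z zr;rewrite y0 ltNge act0.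
rewrite -ltNge => /ltW h;move: y0;rewrite (fixed z j h) /= => E.
by move: h;rewrite E normr0 leNgt r0_gt0.
Unshelve. all: by end_near. Qed.
End Deformation.

(** * Smooth maps and changes of charts *)

Section SmoothFunctions.
Variables (R : realType) (V W : NM R).
Lemma near_differentiable (f f' : V -> W) x : (\forall y \near x, f y = f' y) ->
 differentiable f x -> differentiable f' x.
move=> ff' df;have fx : f x = f' x by exact: (nbhs_singleton ff').
have [dc /eqaddoP de] := (diff_locallyP _ _).1 df.
have E : f' \o shift x = cst (f' x) + 'd f x +o_ (0 : V) id.
 apply/eqaddoP => e e0;have h := de e e0.
 have n0 : \forall h \near (0 : V), f (h + x) = f' (h + x).
 have : (fun h : V => h + x) @ 0 --> x.
 by rewrite -[X in _ --> X]add0r;apply: cvgD;[exact: cvg_id|exact: cvg_cst].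
 by move=> /(_ _ ff').
 near=> y;have := near h y;move=> /(_ _) hy.
 have yE : f (y + x) = f' (y + x) by near: y.
 have : `|(f \o shift x - (cst (f x) + 'd f x)) y| <= e * `|y| by near: y.
 by rewrite /GRing.add /= /GRing.opp /= yE fx.
by apply/diff_locallyP;rewrite (diff_unique dc E).
Unshelve. all: by end_near. Qed.
Lemma Ck_on_ext k (U : set V) (f f' : V -> W) : open U ->
 (forall x, U x -> f x = f' x) -> Ck_on k U f -> Ck_on k U f'.
move=> oU;elim: k f f' => [|k IH] f f' ff' /=.
 move=> fc x Ux;have fcx := fc x Ux.
 have E : \forall y \near x, f y = f' y.
 by apply: filterS (open_nbhs_nbhs (conj oU Ux)) => y;exact: ff'.
 have Ex : f x = f' x by exact: ff'.
 rewrite /continuous_at /prop_for -Ex;apply: cvg_trans fcx.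
 by apply: near_eq_cvg;apply: filterS E => y ->.
have near_ff x : U x -> {near x, f =1 f'}.
 by move=> Ux;apply: filterS (open_nbhs_nbhs (conj oU Ux)) => y;exact: ff'.
case=> df dD;split=> [x Ux|v].
 have := df x Ux.
 have E := near_ff x Ux.
 exact: near_differentiable.
apply: (IH ('D_v f)) (dD v) => x Ux.
have [->|v0] := eqVneq v 0;first by rewrite !derive0.
by apply: near_eq_derive => //;exact: near_ff.
Qed.
Lemma Ck_on_sub k (U U' : set V) (f : V -> W) : U' `<=` U -> Ck_on k U f -> Ck_on k U' f.
move=> UU;elim: k f => [|k IH] f /=;first by move=> h x /UU;exact: h.
by case=> h1 h2;split=> [x /UU|v];[exact: h1|exact: IH].
Qed.
(** On an open domain the local extensions agree with [f] near each point, so [f] itself is C^k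
    there. *)
Lemma smooth_on_open (D : set V) (f : V -> W) x : open D -> smooth_on D f -> D x ->
 exists U : set V, [/\ open U, U x, U `<=` D & forall k, Ck_on k U f].
move=> oD fs Dx;have [U [g [oU Ux gk gf]]] := fs x Dx.
exists (U `&` D);split;[exact: openI|by []|by move=> y []|move=> k].
apply: (@Ck_on_ext k _ g);[exact: openI|by move=> y [Uy Dy];exact: gf|].
by apply: Ck_on_sub (gk k) => y [].
Qed.
End SmoothFunctions.
Lemma Ck_on_entry R (V : NM R) m n k (U : set V) (f : V -> 'M[R]_(m, n)) i j :
 open U -> Ck_on k U f -> Ck_on k U (fun x => f x i j).
move=> oU;elim: k f => [|k IH] f /=.
 by move=> h x Ux;apply: (continuous_entry (f := f));exact: h.
case=> h1 h2;split=> [x Ux|v].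
 apply: (@differentiable_comp _ _ _ _ f (fun M : 'M[R]_(m, n) => M i j));first exact: h1.
 exact: differentiable_coord.
apply: (@Ck_on_ext _ _ _ _ _ (fun x => 'D_v f x i j) _ oU);last exact: IH.
move=> x Ux;have df : derivable f x v by apply: diff_derivable;exact: h1.
by rewrite derive_mx // mxE.
Qed.

Section Charts.
Variables (R : realType) (n : nat) (M : Top) (A : SA R n M).
Local Notation V := 'rV[R]_n.
Implicit Types (i j : chart_index A) (x : M).
Lemma nbhs_chart_dom i x : cdom i x -> nbhs x (cdom i).
by move=> ix;apply: open_nbhs_nbhs;split=> //;exact: open_chart_dom. Qed.
Lemma chart_imgP i x : cdom i x -> cimg i (chart i x).
by move=> ix;exists x. Qed.
Lemma chart_invK i q : cimg i q -> chart i (chart_inv i q) = q.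
by case=> x ix <-;rewrite chartK. Qed.
Lemma chart_inv_dom i q : cimg i q -> cdom i (chart_inv i q).
by case=> x ix <-;rewrite chartK. Qed.
Lemma chart_ct i x : cdom i x -> cts x (chart i).
exact: chart_continuous. Qed.
Lemma lsurj_chart i x : cdom i x -> lsurj (chart i) x.
move=> ix v U nU.
have oimg : nbhs (chart i x) (cimg i).
 by apply: open_nbhs_nbhs;split;[exact: open_chart_img|exact: chart_imgP].
have invc := chart_inv_continuous (chart_imgP ix).
have nU' : nbhs (chart i x) [set q | cimg i q /\ U (chart_inv i q)].
 by apply: filterI => //;apply: invc;rewrite chartK.
have cl : (fun s : R => chart i x + s *: v) @ (0 : R) --> chart i x.
 have : {for (0 : R), continuous (fun s : R => chart i x + s *: v)}.
 by apply: ctD;[exact: ct_cst|apply: ctZ;[exact: cvg_id|exact: ct_cst]].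
 by rewrite /prop_for /continuous_at scale0r addr0.
have : \forall s \near (0 : R), cimg i (chart i x + s *: v) /\ U (chart_inv i (chart i x + s *: v)).
 exact: cl nU'.
move=> /nbhs_ballP[e /= e0 He];near=> s.
have s0 : 0 < s by near: s;exact: nbhs_right_gt.
have [h1 h2] : cimg i (chart i x + s *: v) /\ U (chart_inv i (chart i x + s *: v)).
 apply: He;rewrite -ball_normE /= sub0r normrN gtr0_norm //;near: s;exact: nbhs_right_lt.
by exists (chart_inv i (chart i x + s *: v));rewrite ?chart_invK.
Unshelve. all: by end_near. Qed.
(** Continuity of the derivative, applied at the base point itself, makes the difference smaller
    than any multiple of |v|. *)
Lemma sdif_uniq (W : NM R) (T : Top) (U : NM R) (c : T -> U)
 (f : T -> W) (x : T) L L' : lsurj c x -> sdif c f x L -> sdif c f x L' -> L =1 L'.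
move=> ls d d' v;apply/eqP;rewrite -subr_eq0 -normr_le0;apply/ler_addgt0Pl => e e0.
have e1 : 0 < e / (`|v| + 1) by rewrite divr_gt0 // ltr_wpDl.
have [Q nQ HQ] := sdif_grad e1 d'.
apply: le_trans (HQ x L v (nbhs_singleton nQ) ls d) _.
by rewrite addr0 mulrAC ler_pdivrMr ?ltr_wpDl // ler_wpM2l ?lerDl // ltW.
Qed.
Lemma sdif_of_chart (W : NM R) (F : V -> W) i x L : cdom i x ->
 sdif id F (chart i x) L -> sdif (chart i) (F \o chart i) x L.
move=> ix dF;apply: (@sdif_comp _ _ _ (chart i) x V _ _ id (chart i) F id L) => //.
 exact: chart_ct.
exact: sdif_coord.
Qed.
Lemma sdif_in_chart (W : NM R) (f : M -> W) i x L : cdom i x ->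
 sdif (chart i) f x L -> sdif id (f \o chart_inv i) (chart i x) L.
move=> ix df;rewrite -{1}(chartK ix) in df.
apply: (@sdif_comp _ _ _ id (chart i x) M _ _ (chart i) (chart_inv i) f id L) => //.
 exact: chart_inv_continuous (chart_imgP ix).
apply: (@sdif_near _ _ _ _ _ _ id) (sdif_coord _ _).
have oimg : nbhs (chart i x) (cimg i).
 by apply: open_nbhs_nbhs;split;[exact: open_chart_img|exact: chart_imgP].
by apply: filterS oimg => q iq /=;rewrite chart_invK.
Qed.
Lemma transition_dom_open i j : open (chart i @` (cdom i `&` cdom j)).
have -> : chart i @` (cdom i `&` cdom j)
 = [set q | cimg i q /\ cdom j (chart_inv i q)].
 apply/seteqP;split=> [_ [x [ix jx] <-]|q [iq jq]] /=.
 by split;[exact: chart_imgP|rewrite chartK].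
 by exists (chart_inv i q);[split=> //;exact: chart_inv_dom|exact: chart_invK].
rewrite openE => q [iq jq];rewrite /interior;apply: filterI.
 by apply: open_nbhs_nbhs;split=> //;exact: open_chart_img.
by apply: (chart_inv_continuous iq);exact: nbhs_chart_dom.
Qed.
Lemma transition_Ck i j x : cdom i x -> cdom j x ->
 exists U : set V, [/\ open U, U (chart i x),
 U `<=` chart i @` (cdom i `&` cdom j)
 & forall k, Ck_on k U (chart j \o chart_inv i)].
move=> ix jx;apply: smooth_on_open;first exact: transition_dom_open.
 exact: transition_smooth.
by exists x.
Qed.
Lemma derive_transition i j x v b : cdom i x -> cdom j x ->
 'D_v (fun q => (chart j \o chart_inv i) q 0 b) (chart i x)
 = (v *m transition_jacobian i j x) 0 b.
move=> ix jx;have [U [oU Uq _ Uk]] := transition_Ck ix jx.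
have df : differentiable (chart j \o chart_inv i) (chart i x) by case: (Uk 1%N) => h _;exact: h.
rewrite /transition_jacobian -deriveEjacobian //.
by rewrite derive_mx ?mxE //;exact: diff_derivable.
Qed.
Lemma sdif_transition i j x : cdom i x -> cdom j x ->
 sdif (chart i) (chart j) x (fun v => v *m transition_jacobian i j x).
move=> ix jx;have [U [oU Uq UD Uk]] := transition_Ck ix jx.
apply: (@sdif_near _ _ _ _ _ _ (chart j \o chart_inv i \o chart i)).
 by apply: filterS (nbhs_chart_dom ix) => y iy /=;rewrite chartK.
apply: sdif_of_chart => //;apply: sdif_mx => a b;rewrite ord1.
apply: sdif_eq (C1_sdif oU Uq (Ck_on_entry 0 b oU (Uk 1%N))) => v.
exact: derive_transition.
Qed.
Lemma sdif_jacobian i j x : cdom i x -> cdom j x ->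
 exists L, sdif (chart i) (transition_jacobian i j) x L.
move=> ix jx;have [U [oU Uq UD Uk]] := transition_Ck ix jx.
pose T b q := (chart j \o chart_inv i) q 0 b.
exists (fun v => \matrix_(a, b) 'D_v ('D_(delta_mx 0 a) (T b)) (chart i x)).
apply: sdif_mx => a b.
apply: (@sdif_near _ _ _ _ _ _ ('D_(delta_mx 0 a) (T b) \o chart i)).
 near=> y;have Uy : U (chart i y).
 by near: y;apply: (chart_ct ix);exact: open_nbhs_nbhs.
 have [y' [iy' jy'] E] := UD _ Uy.
 have iy : cdom i y by near: y;exact: nbhs_chart_dom.
 have yy : y' = y by rewrite -(chartK iy') E chartK.
 rewrite /= derive_transition // -?yy // /mulmx mxE (bigD1 a) //= !mxE !eqxx mul1r.
 by rewrite big1 ?addr0 // => c /negbTE ca;rewrite !mxE ca andbF mul0r.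
have [_ /(_ (delta_mx 0 a)) C1D] := Ck_on_entry 0 b oU (Uk 2%N).
have dT := C1_sdif oU Uq C1D.
apply: sdif_eq (sdif_of_chart ix dT) => v;by rewrite mxE.
Unshelve. all: by end_near. Qed.
(** Chain rule from chart i to chart j and back, with uniqueness of derivatives. *)
Lemma transition_jacobianK i j x : cdom i x -> cdom j x ->
 transition_jacobian i j x *m transition_jacobian j i x = 1%:M.
move=> ix jx.
have h1 := sdif_recoord (sdif_transition ix jx) (sdif_transition jx ix).
have h2 : sdif (chart i) (chart i) x id by exact: sdif_coord.
have E := sdif_uniq (lsurj_chart ix) h1 h2.
apply/row_matrixP => a;rewrite !rowE -[RHS]/(id _) mulmx1 mulmxA;exact: E.
Qed.
Lemma transition_jacobian_comp i j k x : cdom i x -> cdom j x -> cdom k x ->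
 transition_jacobian i j x *m transition_jacobian j k x = transition_jacobian i k x.
move=> ix jx kx.
have h1 := sdif_recoord (sdif_transition ix jx) (sdif_transition jx kx).
have E := sdif_uniq (lsurj_chart ix) h1 (sdif_transition ix kx).
apply/row_matrixP => a;rewrite !rowE mulmxA;exact: E.
Qed.
End Charts.

(** * A C^2 embedding of M in a Euclidean space *)

Section Embedding.
Variables (R : realType) (n : nat) (M : Top) (A : SA R n M)
 (HM : CCM A).
Local Notation V := 'rV[R]_n.
Let hM : hausdorff_space M. by case: HM. Qed.
Let cM : compact [set: M]. by case: HM. Qed.
Lemma dotv_ge_norm d (u : 'rV[R]_d) : `|u| ^+ 2 <= dotv u u.
have d0 : 0 <= dotv u u by rewrite dotvE sumr_ge0 // => i _;rewrite -expr2 sqr_ge0.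
rewrite -(sqr_sqrtr d0) lerXn2r ?nnegrE ?sqrtr_ge0 //;apply: mx_norm_le => [|i j];first exact: sqrtr_ge0.
rewrite ord1 -sqrtr_sqr ler_wsqrtr // dotvE (bigD1 j) //= -expr2 lerDl sumr_ge0 // => k _.
by rewrite -expr2 sqr_ge0.
Qed.
Lemma dotv_ge0 d (u : 'rV[R]_d) : 0 <= dotv u u.
by apply: le_trans (dotv_ge_norm u);rewrite exprn_ge0. Qed.
Lemma ct_chart (T : Top) (t : T) (f : T -> M) (i : chart_index A) : cdom i (f t) ->
 cts t f -> cts t (fun t => chart i (f t)).
by move=> it fc;apply: ct_comp fc;exact: chart_ct. Qed.
Lemma ct_near (S T : Top) (t : S) (f g : S -> T) : (\forall s \near t, f s = g s) ->
 cts t f -> cts t g.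
move=> fg fc;rewrite /prop_for /continuous_at -(nbhs_singleton fg).
by apply: cvg_trans fc;apply: near_eq_cvg;apply: filterS fg => s ->.
Qed.
(** [cr k] is a squared radius. The closed balls lie in the chart images, and the concentric open
    balls of squared radius [cr k / 2] already cover M. *)
Definition good_cover m (ci : 'I_m -> chart_index A) (cc : 'I_m -> V) (cr : 'I_m -> R) : Prop :=
 [/\ forall k, 0 < cr k,
 forall k q, dotv (q - cc k) (q - cc k) <= cr k -> cimg (ci k) q
 & forall x, exists2 k, cdom (ci k) x
 & dotv (chart (ci k) x - cc k) (chart (ci k) x - cc k) < cr k / 2].
Lemma good_cover_ex : exists m ci cc cr, @good_cover m ci cc cr.
have /choice[rr Hrr] : forall x : M, exists r : R, 0 < r /\ forall q,
 dotv (q - chart (chart_at A x) x) (q - chart (chart_at A x) x) <= r -> cimg (chart_at A x) q.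
 move=> x;have ix := mem_chart_at A x.
 have : nbhs (chart (chart_at A x) x) (cimg (chart_at A x)).
 by apply: open_nbhs_nbhs;split;[exact: open_chart_img|exact: chart_imgP].
 case/nbhs_ballP => e /= e0 He;exists ((e / 2) ^+ 2);split;first by rewrite exprn_gt0 ?divr_gt0.
 move=> q hq;apply: He;rewrite -ball_normE /= distrC.
 have h : `|q - chart (chart_at A x) x| <= e / 2.
 have e2 : 0 <= e / 2 by rewrite divr_ge0 // ltW.
 by rewrite -ler_sqr ?nnegrE //;exact: le_trans (dotv_ge_norm _) hq.
 by apply: le_lt_trans h _;lra.
pose W x := [set y | cdom (chart_at A x) y /\
 dotv (chart (chart_at A x) y - chart (chart_at A x) x) (chart (chart_at A x) y - chart (chart_at A x) x) < rr x / 2].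
have oW x : open (W x).
 rewrite openE => y [iy hy];rewrite /interior;apply: filterI;first exact: nbhs_chart_dom.
 have dc : cts y (fun y => dotv (chart (chart_at A x) y - chart (chart_at A x) x) (chart (chart_at A x) y - chart (chart_at A x) x)).
 by apply: continuous_dotv;apply: ctB;try exact: ct_cst;exact: chart_ct.
 exact: cvgr_lt dc _ hy.
(* The finite subcover is extracted from the near-covering form of compactness, for the filter of
   finite sequences ordered by inclusion. *)
pose F : set_system (seq M) := filter_from [set: seq M] (fun s => [set s' : seq M | {subset s <= s'}]).
have FF : ProperFilter F.
 apply: filter_from_proper;last by move=> s _;exists s.
 apply: filter_from_filter;first by exists [::].
 move=> s s' _ _;exists (s ++ s') => // t st;split=> y ys;apply: st;rewrite mem_cat ys ?orbT //.
have : \forall s \near F, [set: M] `<=` [set y | exists2 x, x \in s & W x y].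
 have /compact_near_coveringP := cM;apply => x _.
 exists (W x, [set s : seq M | x \in s]);last by move=> [y s] /= [Wy xs];exists x.
 split=> /=;last by exists [:: x] => // s;apply;rewrite inE.
 apply: open_nbhs_nbhs;split=> //;split;first exact: mem_chart_at.
 by rewrite subrr dotv0l divr_gt0 //;case: (Hrr x).
move=> Fs;have [s DW] := @filter_ex _ F FF _ Fs;pose p (k : 'I_(size s)) : M := tnth (in_tuple s) k.
exists _, (fun k => chart_at A (p k)), (fun k => chart (chart_at A (p k)) (p k)), (fun k => rr (p k)).
split=> [k|k q|x];[by case: (Hrr (p k))|by case: (Hrr (p k)) => _;exact|].
have [y ys [iy hy]] := DW x I.
have ylt : (index y s < size s)%N by rewrite index_mem.
have py : p (Ordinal ylt) = y by rewrite /p (tnth_nth y) /= nth_index.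
by exists (Ordinal ylt);rewrite py.
Qed.
Variables (m : nat) (ci : 'I_m -> chart_index A) (cc : 'I_m -> V) (cr : 'I_m -> R)
 (gc : good_cover ci cc cr).
Implicit Types (i : chart_index A) (x : M) (k : 'I_m).
Let cr0 k : 0 < cr k. by case: gc. Qed.
Definition height k (q : V) : R := cr k - dotv (q - cc k) (q - cc k).
Definition supp k : set M := [set x | cdom (ci k) x /\ 0 <= height k (chart (ci k) x)].
Lemma height_cont k q : cts q (height k).
apply: ctB;first exact: ct_cst.
by apply: continuous_dotv;apply: ctB;try exact: ct_cst;exact: cvg_id.
Qed.
(** A compact image in a Hausdorff space; this is what allows bump functions to be extended by
    zero. *)
Lemma supp_closed k : closed (supp k).
apply: compact_closed => //.
have -> : supp k = chart_inv (ci k) @` [set q | 0 <= height k q].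
 apply/seteqP;split=> [x [ix hx]|_ [q hq <-]] /=.
 by exists (chart (ci k) x) => //;rewrite chartK.
 have iq : cimg (ci k) q by case: gc => _ h _;apply: h;rewrite -subr_ge0.
 by split;[exact: chart_inv_dom|rewrite chart_invK].
apply: continuous_compact.
 apply: continuous_in_subspaceT => q;rewrite inE /= => hq.
 by apply: chart_inv_continuous;case: gc => _ h _;apply: h;rewrite -subr_ge0.
apply: bounded_closed_compact;last first.
 apply: (@closed_comp _ _ (height k) [set u | 0 <= u]);last exact: closed_ge.
 by move=> q _;exact: height_cont.
exists (`|cc k| + (cr k + 1));split;first exact: num_real.
move=> B hB q /= hq;apply: le_trans (ltW hB).
have h1 : `|q - cc k| ^+ 2 <= cr k.
 by apply: le_trans (dotv_ge_norm _) _;rewrite -subr_ge0.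
have h2 : `|q - cc k| <= cr k + 1.
 rewrite leNgt;apply/negP => h;have := cr0 k;nra.
rewrite -[q in `|q|](subrK (cc k)) addrC;apply: le_trans (ler_normD _ _) _.
by rewrite lerD2l.
Qed.
Lemma supp_cases k x : cdom (ci k) x \/ \forall y \near x, ~ supp k y.
have [h|h] := pselect (supp k x);first by left;case: h.
right;apply: (@open_nbhs_nbhs _ x (~` supp k));split=> //.
by apply: closed_openC;exact: supp_closed.
Qed.
Definition beta k x : R := if `[< cdom (ci k) x >] then Num.max 0 (height k (chart (ci k) x)) else 0.
Lemma betaE k x : cdom (ci k) x -> beta k x = Num.max 0 (height k (chart (ci k) x)).
by move=> h;rewrite /beta asboolT. Qed.
Lemma beta_ge0 k x : 0 <= beta k x.
by rewrite /beta;case: ifP => // _;rewrite le_max lexx. Qed.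
Lemma beta_gt0 k x : 0 < beta k x -> cdom (ci k) x /\ beta k x = height k (chart (ci k) x).
rewrite /beta;case: ifP => [/asboolP h|];last by rewrite ltxx.
by rewrite lt_max ltxx /= => h1;split=> //;rewrite max_r // ltW.
Qed.
Lemma beta_out k x : ~ supp k x -> beta k x = 0.
move=> h;apply/eqP;rewrite eq_le beta_ge0 andbT leNgt;apply/negP => b0.
by have [ix bE] := beta_gt0 b0;apply: h;split=> //;rewrite -bE ltW.
Qed.
Lemma beta_cont k : continuous (beta k).
move=> x;case: (supp_cases k x) => [ix|nx].
 apply: (@ct_near _ _ _ (fun y => Num.max 0 (height k (chart (ci k) y)))).
 by apply: filterS (nbhs_chart_dom ix) => y iy;rewrite betaE.
 apply: ct_max;first exact: ct_cst.
 by apply: ct_comp;[exact: height_cont|exact: chart_ct].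
apply: (@ct_near _ _ _ (fun=> 0));last exact: ct_cst.
by apply: filterS nx => y /beta_out ->.
Qed.
Lemma beta_cover x : exists k, cr k / 2 < beta k x.
case: gc => _ _ /(_ x)[k ix hk];exists k;rewrite betaE // lt_max;apply/orP;right.
rewrite /height;lra.
Qed.
Lemma sdifZ (X : Top) (U W : NM R) (c : X -> U) (x0 : X) (F : X -> R) (G : X -> W) L K :
 cts x0 c -> sdif c F x0 L -> sdif c G x0 K ->
 sdif c (fun y : X => F y *: G y) x0 (fun v => L v *: G x0 + F x0 *: K v).
move=> cc0;apply: (sdif_bilin (B := fun (a : R) (w : W) => a *: w) (C := 1)) => //.
- move=> a;split=> [u v|b v|];rewrite ?scalerDr // ?scalerA 1?mulrC //.
 by exists `|a| => // v;rewrite normrZ.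
- move=> w;split=> [u v|b v|];rewrite ?scalerDl // ?scalerA //.
 by exists `|w| => // v;rewrite normrZ mulrC.
- by move=> a w;rewrite mul1r normrZ.
Qed.
Lemma sdif_height k q : sdif id (height k) q (fun v => - (2 * dotv v (q - cc k))).
have d1 : sdif id (fun q : V => q - cc k) q id.
 by apply: sdif_eq (sdifD (sdif_coord _ _) (sdif_cst _ _ _)) => v /=;rewrite addr0.
have := sdif_mulmx (@cvg_id _ _) d1 (sdif_tr d1).
move=> /(sdif_entry 0 0) d2.
have d3 := sdif_lin (K := fun a : R => - a) _ d2.
have d4 : blin (fun a : R => - a).
 split=> [u v|a v|];rewrite ?opprD // ?scalerN //.
 by exists 1 => // v;rewrite normrN mul1r.
apply: sdif_eq (sdifD (sdif_cst id q (cr k)) (d3 d4)) => v /=.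
rewrite add0r mxE;congr (- _);rewrite -[(_ *m _) 0 0]/(dotv v (q - cc k)).
by rewrite -[X in _ + X]/(dotv (q - cc k) v) [dotv (q - cc k) v]dotvC;ring.
Qed.
Definition pheight e k q : R := Num.max 0 (height k q) ^+ e.
Lemma sdif_pheight3 k q :
 sdif id (pheight 3 k) q (fun v => - (2 * dotv v (q - cc k)) * (3 * pheight 2 k q)).
exact: (sdif_comp (d := @id R) (h := height k) (G := fun u : R => Num.max 0 u ^+ 3)
 (@height_cont k q) (sdif_height k q) (sdif_max3 _)).
Qed.
Lemma sdif_pheight2 k q :
 sdif id (pheight 2 k) q (fun v => - (2 * dotv v (q - cc k)) * (2 * Num.max 0 (height k q))).
exact: (sdif_comp (d := @id R) (h := height k) (G := fun u : R => Num.max 0 u ^+ 2)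
 (@height_cont k q) (sdif_height k q) (sdif_max2 _)).
Qed.
Definition hom (q : V) : 'rV[R]_(1 + n) := row_mx 1%:M q.
Lemma sdif_hom q : sdif id hom q (fun v => row_mx 0 v).
split.
 split=> [u v|a v|].
 - by rewrite add_row_mx addr0.
 - by rewrite scale_row_mx scaler0.
 exists 1 => // v;rewrite mul1r;apply: mx_norm_le => // i j;rewrite mxE.
 by case: splitP => l _;rewrite ?mxE ?normr0 // mx_entry_le.
move=> e e0;exists setT => [|x x' _ _];first exact: filterT.
rewrite (_ : _ - _ = 0);first by rewrite normr0 mulr_ge0 // ltW.
by apply/matrixP => i j;rewrite !mxE;case: splitP => l _;rewrite !mxE;ring.
Qed.
(** The classical embedding block: a bump times (1, q). The third power of the truncated height
    makes the block C^2 across the boundary of the ball. *)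
Definition phi k q : 'rV[R]_(1 + n) := pheight 3 k q *: hom q.
Definition dphi k q : 'M[R]_(n, 1 + n) :=
 (- 6 * pheight 2 k q) *: ((q - cc k)^T *m hom q) + pheight 3 k q *: row_mx 0 1%:M.
Lemma sdif_phi k q : sdif id (phi k) q (fun v => v *m dphi k q).
apply: sdif_eq (sdifZ (@cvg_id _ _) (sdif_pheight3 k q) (sdif_hom q)) => v.
rewrite /dphi mulmxDr -!scalemxAr mulmxA [v *m row_mx 0 1%:M]mul_mx_row mulmx0 mulmx1;congr (_ + _).
have -> : v *m (q - cc k)^T = (dotv v (q - cc k))%:M.
 by apply/matrixP => i j;rewrite !ord1 [RHS]mxE eqxx mulr1n.
by rewrite mul_scalar_mx scalerA;congr (_ *: _);ring.
Qed.
Lemma sdif_dphi k q : exists L, sdif id (dphi k) q L.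
have idc : cts q (@id V) by exact: cvg_id.
have d1 : sdif id (fun q : V => q - cc k) q id.
 by apply: sdif_eq (sdifD (sdif_coord _ _) (sdif_cst _ _ _)) => v /=;rewrite addr0.
have d2 := sdif_mulmx idc (sdif_tr d1) (sdif_hom q).
have d3 := sdifZ idc (sdif_cst id q (- 6 : R)) (sdif_pheight2 k q).
have d4 := sdifZ idc d3 d2.
have d5 := sdifZ idc (sdif_pheight3 k q) (sdif_cst id q (row_mx 0 1%:M : 'M[R]_(n, 1 + n))).
by eexists;exact: (sdifD d4 d5).
Qed.
Lemma phi_out k x : cdom (ci k) x -> ~ supp k x -> phi k (chart (ci k) x) = 0 /\ dphi k (chart (ci k) x) = 0.
move=> ix nx;have := beta_out nx;rewrite betaE // => m0.
by rewrite /phi /dphi /pheight m0 !expr0n /= mulr0 !scale0r addr0.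
Qed.
Definition block k x : 'rV[R]_(1 + n) := if `[< cdom (ci k) x >] then phi k (chart (ci k) x) else 0.
Definition dblock i x k : 'M[R]_(n, 1 + n) :=
 if `[< cdom (ci k) x >] then transition_jacobian i (ci k) x *m dphi k (chart (ci k) x) else 0.
Lemma sdif_block k i x : cdom i x -> sdif (chart i) (block k) x (fun v => v *m dblock i x k).
move=> ix;case: (supp_cases k x) => [kx|nx].
 apply: (@sdif_near _ _ _ _ _ _ (phi k \o chart (ci k))).
 by apply: filterS (nbhs_chart_dom kx) => y ky;rewrite /block asboolT.
 apply: sdif_eq (sdif_recoord (sdif_transition ix kx) (sdif_of_chart kx (sdif_phi k (chart (ci k) x)))) => v /=.
 by rewrite /dblock asboolT // mulmxA.
apply: (@sdif_near _ _ _ _ _ _ (fun=> 0)).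
 apply: filterS nx => y ny;rewrite /block;case: asboolP => // ky.
 by case: (phi_out ky ny) => ->.
apply: sdif_eq (sdif_cst _ _ _) => v;rewrite /dblock;case: asboolP;rewrite ?mulmx0 // => kx.
by case: (phi_out kx (nbhs_singleton nx)) => _ ->;rewrite !mulmx0.
Qed.
Lemma sdif_dblock k i x : cdom i x -> exists L, sdif (chart i) (fun y => dblock i y k) x L.
move=> ix;case: (supp_cases k x) => [kx|nx].
 have [L1 d1] := sdif_jacobian ix kx;have [L2 d2] := sdif_dphi k (chart (ci k) x).
 have d3 := sdif_recoord (sdif_transition ix kx) (sdif_of_chart kx d2).
 eexists;apply: sdif_near (sdif_mulmx (chart_ct ix) d1 d3).
 by apply: filterS (nbhs_chart_dom kx) => y ky;rewrite /dblock asboolT.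
exists (fun=> 0);apply: (@sdif_near _ _ _ _ _ _ (fun=> 0));last exact: sdif_cst.
apply: filterS nx => y ny;rewrite /dblock;case: asboolP => // ky.
by case: (phi_out ky ny) => _ ->;rewrite mulmx0.
Qed.
Definition iota_emb x : 'rV[R]_(m * (1 + n)) := mxvec (\matrix_(k, b) block k x 0 b).
Definition d_iota i x : 'M[R]_(n, m * (1 + n)) :=
 \matrix_(a, l) mxvec (\matrix_(k, b) dblock i x k a b) 0 l.
Lemma mul_d_iota i x (v : V) k b : (v *m d_iota i x) 0 (mxvec_index k b) = (v *m dblock i x k) 0 b.
by rewrite !mxE;apply: eq_bigr => a _;rewrite mxE mxvecE mxE. Qed.
Lemma sdif_iota i x : cdom i x -> sdif (chart i) iota_emb x (fun v => v *m d_iota i x).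
move=> ix;apply: sdif_mx => a l;rewrite ord1;case/mxvec_indexP: l => k b.
apply: (@sdif_near _ _ _ _ _ _ (fun y => block k y 0 b)).
 by apply: nearW => y;rewrite mxvecE mxE.
by apply: sdif_eq (sdif_entry 0 b (sdif_block k ix)) => v;rewrite mul_d_iota.
Qed.
Lemma sdif_d_iota i x : cdom i x -> exists L, sdif (chart i) (d_iota i) x L.
move=> ix;have /choice[L HL] : forall k, exists L, sdif (chart i) (fun y => dblock i y k) x L.
 by move=> k;exact: sdif_dblock.
exists (fun v => \matrix_(a, l) mxvec (\matrix_(k, b) L k v a b) 0 l).
apply: sdif_mx => a l;case/mxvec_indexP: l => k b.
apply: (@sdif_near _ _ _ _ _ _ (fun y => dblock i y k a b)).
 by apply: nearW => y;rewrite mxE mxvecE mxE.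
by apply: sdif_eq (sdif_entry a b (HL k)) => v;rewrite mxE mxvecE mxE.
Qed.
(** In a chart where the bump is positive, the first component says that the bump has zero
    derivative along v; the remaining ones then say that the bump times v is zero. *)
Lemma d_iota_inj i x (v : V) : cdom i x -> v *m d_iota i x = 0 -> v = 0.
move=> ix h;have [k hk] := beta_cover x.
have b0 : 0 < beta k x by apply: lt_trans hk;rewrite divr_gt0.
have [kx bE] := beta_gt0 b0.
have p3 : pheight 3 k (chart (ci k) x) != 0.
 by rewrite /pheight -betaE // gt_eqF // exprn_gt0.
pose w := v *m transition_jacobian i (ci k) x.
have : w *m dphi k (chart (ci k) x) = 0.
 have -> : w *m dphi k (chart (ci k) x) = v *m dblock i x k by rewrite /dblock asboolT // mulmxA.
 by apply/rowP => b;rewrite -mul_d_iota h !mxE.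
rewrite /dphi mulmxDr -!scalemxAr mulmxA [w *m row_mx 0 1%:M]mul_mx_row mulmx0 mulmx1 /hom mul_mx_row mulmx1.
rewrite scale_row_mx [X in _ + X]scale_row_mx add_row_mx scaler0 addr0 -[X in _ = X -> _]row_mx0.
case/eq_row_mx => h1;rewrite scalemxAl h1 mul0mx add0r => /eqP.
rewrite scaler_eq0 (negbTE p3) /= => /eqP w0.
by rewrite -[v]mulmx1 -(transition_jacobianK ix kx) mulmxA -/w w0 mul0mx.
Qed.
Lemma iota_cont : continuous iota_emb.
move=> x;have ix := mem_chart_at A x.
exact: sdif_cvg (chart_ct ix) (sdif_iota ix).
Qed.
(** The first component recovers the value of the bump, which puts both points in one chart ball;
    the others then recover the coordinates. *)
Lemma iota_inj : injective iota_emb.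
move=> x y xy;have bxy k : block k x = block k y.
 apply/rowP => b;have := congr1 (fun u : 'rV_(m * (1 + n)) => u 0 (mxvec_index k b)) xy.
 by rewrite !mxvecE !mxE.
have [k hk] := beta_cover x.
have b0 : 0 < beta k x by apply: lt_trans hk;rewrite divr_gt0.
have [kx bE] := beta_gt0 b0.
have p3 : pheight 3 k (chart (ci k) x) != 0.
 by rewrite /pheight -betaE // gt_eqF // exprn_gt0.
have := bxy k;rewrite /block asboolT //;case: asboolP => ky;last first.
 rewrite /phi /hom scale_row_mx -row_mx0 => /eq_row_mx[/matrixP/(_ 0 0)].
 by rewrite !mxE mulr1 => h;rewrite h eqxx in p3.
rewrite /phi /hom !scale_row_mx => /eq_row_mx[/matrixP/(_ 0 0)].
rewrite !mxE !mulr1 => <- /(scalerI p3) E.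
by rewrite -(chartK kx) E chartK.
Qed.
End Embedding.
Lemma compact_ub R (Z : Top) (K : set Z) (f : Z -> R) : compact K ->
 (forall z, K z -> exists C : R, \forall z' \near z, f z' <= C) ->
 exists2 C : R, 0 < C & forall z, K z -> f z <= C.
move=> cK fC.
have : \forall C \near +oo, K `<=` [set z | f z <= C].
 have /compact_near_coveringP := cK;apply => z Kz;have [C HC] := fC z Kz.
 exists ([set z' | f z' <= C], [set C' | C <= C']).
 by split=> //;apply: nbhs_pinfty_ge;exact: num_real.
 by move=> [z' C'] /= [h1 h2];exact: le_trans h2.
move=> h;have [C [HC C0]] : exists C : R, (K `<=` [set z | f z <= C]) /\ 0 < C.
 near (+oo : set_system R) => C;exists C;split;near: C => //;apply: nbhs_pinfty_gt;exact: num_real.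
by exists C.
Unshelve. all: by end_near. Qed.
Lemma near_lt R (Z : Top) (f : Z -> R) (z : Z) (a : R) : cts z f ->
 f z < a -> \forall z' \near z, f z' < a.
by move=> fc;exact: cvgr_lt fc a. Qed.
Lemma near_dist R (Z : Top) (W : NM R) (f : Z -> W) (z : Z) (r : R) :
 cts z f -> 0 < r -> \forall z' \near z, `|f z' - f z| < r.
move=> fc r0;apply: (near_lt (f := fun z' => `|f z' - f z|));last by rewrite subrr normr0.
by apply: ct_norm;apply: ctB => //;exact: ct_cst.
Qed.
Lemma ct_p1 (S T : Top) (z : S * T) : cts z (fun z : S * T => z.1).
by case: z => s t;exact: cvg_fst. Qed.
Lemma ct_p2 (S T : Top) (z : S * T) : cts z (fun z : S * T => z.2).
by case: z => s t;exact: cvg_snd. Qed.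
Lemma ct_p21 (S T U : Top) (z : S * (T * U)) : cts z (fun z : S * (T * U) => z.2.1).
by apply: (ct_comp (f := fst) (a := snd));[exact: ct_p1|exact: ct_p2]. Qed.
Lemma ct_p22 (S T U : Top) (z : S * (T * U)) : cts z (fun z : S * (T * U) => z.2.2).
by apply: (ct_comp (f := snd) (a := snd));[exact: ct_p2|exact: ct_p2]. Qed.

(** * Uniformity over compact sets, with distances read through the embedding *)

Section Uniform.
Variables (R : realType) (M : Top) (k : nat).
Local Notation Y := 'rV[R]_k.
Variables (hM : hausdorff_space M) (cM : compact [set: M])
 (iota : M -> Y)
 (iota_cont : continuous iota) (iota_inj : injective iota).
(** Off the interior of U, a compact set, the distance to [iota x0] is positive by injectivity,
    hence bounded below. *)
Lemma iota_ball x0 (U : set M) : nbhs x0 U ->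
 exists2 d : R, 0 < d & forall x, `|iota x - iota x0| < d -> U x.
move=> nU;have cK : compact (~` (U^°)).
 apply: (subclosed_compact _ cM) => //;apply: open_closedC;exact: open_interior.
have : \forall d \near (0 : R)^'+, ~` (U^°) `<=` [set x | d <= `|iota x - iota x0|].
 have /compact_near_coveringP := cK;apply => x Kx.
 have r0 : 0 < `|iota x - iota x0|.
 rewrite normr_gt0 subr_eq0;apply/eqP => /iota_inj xE;apply: Kx;rewrite xE.
 exact: nbhs_singleton (nbhs_interior nU).
 have fc : cts x (fun x => `|iota x - iota x0|).
 by apply: ct_norm;apply: ctB;[exact: iota_cont|exact: ct_cst].
 exists ([set x' | `|iota x - iota x0| / 2 < `|iota x' - iota x0|], [set d | d <= `|iota x - iota x0| / 2]).
 split;first by apply: cvgr_gt fc _ _;lra.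
 by apply: nbhs_right_le;rewrite divr_gt0.
 by move=> [x' d] /= [h1 h2];exact: le_trans h2 (ltW h1).
move=> h;near (0 : R)^'+ => d;exists d;first by near: d;exact: nbhs_right_gt.
move=> x xd;apply: contrapT => nUx.
have /(_ x) : ~` (U^°) `<=` [set x | d <= `|iota x - iota x0|] by near: d.
move=> /(_ _) h1;have : d <= `|iota x - iota x0| by apply: h1 => /interior_subset.
by rewrite leNgt xd.
Unshelve. all: by end_near. Qed.
Lemma nbhs3 (t0 : R) (x0 : M) (y0 : Y) (U : set (R * (M * Y))) : nbhs (t0, (x0, y0)) U ->
 exists2 d : R, 0 < d & forall t x y, `|t - t0| < d -> `|iota x - iota x0| < d -> `|y - y0| < d -> U (t, (x, y)).
case=> [[U1 U2]] /= [nU1 [[V1 V2] /= [nV1 nV2] HV]] HU.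
have [d1 d10 h1] := iota_ball nV1.
move: nU1 => /nbhs_ballP[d2 /= d20 h2];move: nV2 => /nbhs_ballP[d3 /= d30 h3].
exists (Num.min d1 (Num.min d2 d3));first by rewrite !lt_min d10 d20 d30.
move=> t x y;rewrite !lt_min => /and3P[_ ht _] /and3P[hx _ _] /and3P[_ _ hy].
apply: HU;split=> /=;first by apply: h2;rewrite -ball_normE /= distrC.
by apply: HV;split=> /=;[exact: h1|apply: h3;rewrite -ball_normE /= distrC].
Qed.
(** A Lebesgue number argument. *)
Lemma unif_near (K : set (R * (M * Y))) (Q : R * (M * Y) -> R * (M * Y) -> Prop) : compact K ->
 (forall z, K z -> exists2 U, nbhs z U & forall z1 z2, U z1 -> U z2 -> Q z1 z2) ->
 exists2 d : R, 0 < d & forall z1 z2, K z1 -> `|z2.1 - z1.1| < d ->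
 `|iota z2.2.1 - iota z1.2.1| < d -> `|z2.2.2 - z1.2.2| < d -> Q z1 z2.
move=> cK HQ.
have : \forall d \near (0 : R)^'+, K `<=` [set z1 | forall z2, `|z2.1 - z1.1| < d ->
 `|iota z2.2.1 - iota z1.2.1| < d -> `|z2.2.2 - z1.2.2| < d -> Q z1 z2].
 have /compact_near_coveringP := cK;apply => -[t0 [x0 y0]] K0.
 have [U nU HU] := HQ _ K0;have [r r0 Hr] := nbhs3 nU.
 have r2 : 0 < r / 2 by rewrite divr_gt0.
 exists ([set z : R * (M * Y) | `|z.1 - t0| < r / 2] `&` ([set z | `|iota z.2.1 - iota x0| < r / 2]
 `&` [set z | `|z.2.2 - y0| < r / 2]), [set d : R | d <= r / 2]).
 split;last exact: nbhs_right_le.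
 apply: filterI;last apply: filterI.
 - exact: near_dist (@ct_p1 _ _ (t0, (x0, y0))) r2.
 - apply: near_dist (ct_comp (f := iota) (a := fun z : R * (M * Y) => z.2.1) (@iota_cont _) _) r2.
 exact: (@ct_p21 _ _ _ (t0, (x0, y0))).
 - exact: near_dist (@ct_p22 _ _ _ (t0, (x0, y0))) r2.
 move=> [[t [x y]] d] /= [[h1 [h2 h3]] h4] [t' [x' y']] /= e1 e2 e3.
 apply: HU;apply: Hr;try by apply: lt_trans (_ : r / 2 < r) => //;lra.
 - by rewrite -(subrK t t') -addrA;apply: le_lt_trans (ler_normD _ _) _;lra.
 - by rewrite -(subrK (iota x) (iota x')) -addrA;apply: le_lt_trans (ler_normD _ _) _;lra.
 - by rewrite -(subrK y y') -addrA;apply: le_lt_trans (ler_normD _ _) _;lra.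
move=> h;near (0 : R)^'+ => d;exists d;first by near: d;exact: nbhs_right_gt.
move=> z1 z2 Kz;have : K `<=` [set z1 | forall z2, `|z2.1 - z1.1| < d ->
 `|iota z2.2.1 - iota z1.2.1| < d -> `|z2.2.2 - z1.2.2| < d -> Q z1 z2] by near: d.
by apply.
Unshelve. all: by end_near. Qed.
Definition box (r : R) : set (R * (M * Y)) := `[0, 1]%classic `*` ([set: M] `*` [set y | `|y| <= r]).
Lemma box_compact r : compact (box r).
apply: compact_setX;first exact: segment_compact.
by apply: compact_setX => //;exact: closed_ball0_compact.
Qed.
Lemma unif_box r (Q : R * (M * Y) -> R * (M * Y) -> Prop) :
 (forall (t : R) (x : M) (y : Y), 0 <= t <= 1 -> exists2 U : set (R * (M * Y)), nbhs (t, (x, y)) U & forall z1 z2, U z1 -> U z2 -> Q z1 z2) ->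
 exists2 d : R, 0 < d & forall (t t' : R) x x' (y y' : Y), 0 <= t <= 1 -> `|y| <= r -> `|t' - t| < d ->
 `|iota x' - iota x| < d -> `|y' - y| < d -> Q (t, (x, y)) (t', (x', y')).
move=> HQ;have [|d d0 Hd] := @unif_near (box r) Q (@box_compact r);last first.
 exists d => // t t' x x' y y' t01 yr ht hx hy.
 have Kz : box r (t, (x, y)) by rewrite /box /= in_itv.
 exact: (Hd (t, (x, y)) (t', (x', y')) Kz ht hx hy).
by move=> [t [x y]] /= [] /=;rewrite in_itv /= => t01 _;exact: HQ.
Qed.
Lemma unif_base (Q : M -> M -> Prop) :
 (forall x : M, exists2 U : set M, nbhs x U & forall x1 x2, U x1 -> U x2 -> Q x1 x2) ->
 exists2 d : R, 0 < d & forall x x', `|iota x' - iota x| < d -> Q x x'.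
move=> HQ;have [|d d0 Hd] := @unif_box 0 (fun z1 z2 => Q z1.2.1 z2.2.1);last first.
 by exists d => // x x' hx;apply: (Hd 0 0 x x' 0 0);rewrite ?lexx ?ler01 ?normr0 ?subrr ?normr0.
move=> t x y _;have [U nU HU] := HQ x;exists [set z | U z.2.1];last by move=> z1 z2;exact: HU.
exact: (@ct_p21 _ _ _ (t, (x, y)) _ nU).
Qed.
Lemma unif_cont (W : NM R) (f : M -> W) (e : R) : 0 < e -> continuous f ->
 exists2 d : R, 0 < d & forall x x', `|iota x' - iota x| < d -> `|f x' - f x| < e.
move=> e0 fc;apply: unif_base => x;exists [set x' | `|f x' - f x| < e / 2].
 by apply: near_dist;[exact: fc|rewrite divr_gt0].
move=> x1 x2 /= h1 h2;rewrite -(subrK (f x) (f x2)) -addrA.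
apply: le_lt_trans (ler_normD _ _) _;rewrite [`|f x - _|]distrC;lra.
Qed.
Lemma bnd_cont (W : NM R) (f : M -> W) : continuous f ->
 exists2 C : R, 0 < C & forall x, `|f x| <= C.
move=> fc;have [|C C0 HC] := @compact_ub R M setT (fun x => `|f x|) cM.
 move=> x _;exists (`|f x| + 1);have := ct_norm (fc x) => fn.
 by apply: filterS (near_lt fn (_ : _ < `|f x| + 1)) => [x' /ltW //|];rewrite ltrDl.
by exists C => // x;exact: HC.
Qed.
End Uniform.

(** * Gradients in the charts of M times a vector space *)

Section Gradient.
Variables (R : realType) (Z : Top) (V W : NM R).
Implicit Types (c : Z -> V) (F : Z -> W).
(** A derivative picked by choice, the zero map when there is none; wherever [lsurj] holds it is the
    only one. *)
Definition gradL c F z : V -> W := xget (fun=> 0) [set L | sdif c F z L].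
Lemma gradLP c F z : (exists L, sdif c F z L) -> sdif c F z (gradL c F z).
by move=> h;rewrite /gradL;case: xgetP => [L -> //|];case: h => L hL /(_ L). Qed.
Lemma gradLE c F z L : lsurj c z -> sdif c F z L -> gradL c F z =1 L.
move=> ls d v;have d' : sdif c F z (gradL c F z) by apply: gradLP;exists L.
exact: (sdif_uniq ls d' d). Qed.
Lemma gradL_cont c F z0 v : (\forall z \near z0, lsurj c z /\ exists L, sdif c F z L) ->
 cts z0 (fun z => gradL c F z v).
move=> h;apply/cvgrPdist_le => e e0.
have e1 : 0 < e / (`|v| + 1) by rewrite divr_gt0 // ltr_wpDl.
have [U nU HU] := sdif_grad e1 (gradLP (nbhs_singleton h).2).
near=> z;rewrite distrC;have Uz : U z by near: z.
have [lz dz] : lsurj c z /\ exists L, sdif c F z L by near: z.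
apply: le_trans (HU z _ v Uz lz (gradLP dz)) _.
by rewrite mulrAC ler_pdivrMr ?ltr_wpDl // ler_wpM2l ?lerDl // ltW.
Unshelve. all: by end_near. Qed.
End Gradient.
Lemma norm_pair R (V W : NM R) (a : V) (b : W) : `|(a, b)| = Num.max `|a| `|b|.
by []. Qed.
Lemma norm_pair0 R (V W : NM R) (a : V) : `|((a, 0) : V * W)| = `|a|.
by rewrite norm_pair normr0 max_l. Qed.
Lemma norm_0pair R (V W : NM R) (b : W) : `|((0, b) : V * W)| = `|b|.
by rewrite norm_pair normr0 max_r. Qed.

Section ProductChart.
Variables (R : realType) (n : nat) (M : Top) (A : SA R n M) (Y : NM R).
Local Notation V := 'rV[R]_n.
Implicit Types (i j : chart_index A) (z : M * Y).
Definition pchart i z : V * Y := (chart i z.1, z.2).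
Lemma pchart_ct i z : cdom i z.1 -> cts z (pchart i).
move=> iz;apply: ct_pair;last exact: ct_p2.
by apply: ct_comp;[exact: chart_ct|exact: ct_p1].
Qed.
Lemma near_pdom i z : cdom i z.1 -> \forall z' \near z, cdom i z'.1.
move=> iz;exact: (@ct_p1 _ _ z _ (nbhs_chart_dom iz)). Qed.
Lemma lsurj_pchart i z : cdom i z.1 -> lsurj (pchart i) z.
case: z => x y /= ix [v1 v2] U nU.
have oimg : nbhs (chart i x) (cimg i).
 by apply: open_nbhs_nbhs;split;[exact: open_chart_img|exact: chart_imgP].
have cl (W : NM R) (a v : W) : {for (0 : R), continuous (fun s : R => a + s *: v)}.
 by apply: ctD;[exact: ct_cst|apply: ctZ;[exact: cvg_id|exact: ct_cst]].
have c1 := cl _ (chart i x) v1.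
have E0 (W : NM R) (a v : W) : a + (0 : R) *: v = a by rewrite scale0r addr0.
have c2 : {for (0 : R), continuous (fun s : R => (chart_inv i (chart i x + s *: v1), y + s *: v2) : M * Y)}.
 apply: ct_pair;last exact: cl.
 by apply: ct_comp => //;rewrite E0;apply: chart_inv_continuous;exact: chart_imgP.
have n1 : \forall s \near (0 : R), cimg i (chart i x + s *: v1).
 by apply: c1;rewrite E0.
have n2 : \forall s \near (0 : R), U (chart_inv i (chart i x + s *: v1), y + s *: v2).
 by apply: c2;rewrite /= !E0 chartK.
have n12 : \forall s \near (0 : R), cimg i (chart i x + s *: v1) /\
 U (chart_inv i (chart i x + s *: v1), y + s *: v2) by exact: filterI.
case/nbhs_ballP: n12 => e /= e0 He;near=> s.
have s0 : 0 < s by near: s;exact: nbhs_right_gt.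
have [h1 h2] : (cimg i (chart i x + s *: v1)) /\ U (chart_inv i (chart i x + s *: v1), y + s *: v2).
 apply: He;rewrite -ball_normE /= sub0r normrN gtr0_norm //;near: s;exact: nbhs_right_lt.
by exists (chart_inv i (chart i x + s *: v1), y + s *: v2) => //;rewrite /pchart /= chart_invK.
Unshelve. all: by end_near. Qed.
Lemma sdif_ptransition i j z : cdom i z.1 -> cdom j z.1 ->
 sdif (pchart i) (pchart j) z (fun v => (v.1 *m transition_jacobian i j z.1, v.2)).
move=> iz jz;have [[h1 h2 [C C0 h3]] hd] := sdif_transition iz jz;split.
 split=> [u v|a v|];rewrite /= ?h1 ?h2 //.
 exists (C + 1) => [|[v1 v2] /=];first by rewrite addr_ge0.
 rewrite !norm_pair ge_max mulrDl mul1r;apply/andP;split.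
 by apply: le_trans (h3 v1) _;rewrite ler_wpDr // ?le_max ?normr_ge0 // ler_wpM2l // le_max lexx.
 by rewrite ler_wpDl // ?le_max ?lexx ?orbT // mulr_ge0 // le_max normr_ge0.
move=> e e0;have [U nU HU] := hd e e0;exists [set z | U z.1];first exact: (@ct_p1 _ _ z _ nU).
move=> [x y] [x' y'] /= Ux Ux'.
rewrite (_ : _ - _ = (chart j x' - chart j x - (chart i x' - chart i x) *m transition_jacobian i j z.1, 0));last first.
 by rewrite /pchart /= [LHS]surjective_pairing /= subrr.
rewrite norm_pair0;apply: le_trans (HU _ _ Ux Ux') _.
rewrite ler_wpM2l ?(ltW e0) // -[X in _ <= X]/(Num.max _ _) /= le_max;by rewrite lexx.
Qed.
Variables (W : NM R) (F : M * Y -> W)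
 (SD : forall i z, cdom i z.1 -> exists L, sdif (pchart i) F z L).
Lemma gradL_transition i j z v u : cdom i z.1 -> cdom j z.1 ->
 gradL (pchart i) F z (v, u) = gradL (pchart j) F z (v *m transition_jacobian i j z.1, u).
move=> iz jz;apply: (gradLE (lsurj_pchart iz) (sdif_recoord (sdif_ptransition iz jz) (gradLP (SD jz)))).
Qed.
Lemma pgrad_cont i z0 v : cdom i z0.1 -> cts z0 (fun z => gradL (pchart i) F z v).
move=> iz;apply: gradL_cont;apply: filterS (near_pdom iz) => z iz'.
by split;[exact: lsurj_pchart|exact: SD].
Qed.
Lemma pgrad_blin i z : cdom i z.1 -> blin (gradL (pchart i) F z).
by move=> iz;have [] := gradLP (SD iz). Qed.
End ProductChart.
Lemma fin_pos_lb R (I : finType) (f : I -> R) : (forall i, 0 < f i) ->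
 exists2 d : R, 0 < d & forall i, d <= f i.
move=> f0;have S0 : 0 <= \sum_i (f i)^-1 by apply: sumr_ge0 => i _;rewrite invr_ge0 ltW.
exists (1 + \sum_i (f i)^-1)^-1;first by rewrite invr_gt0 ltr_wpDr.
move=> i;rewrite -[leRHS]invrK lef_pV2 ?posrE ?invr_gt0 ?ltr_wpDr // (bigD1 i) //= addrCA lerDl.
by apply: addr_ge0 => //;apply: sumr_ge0 => j _;rewrite invr_ge0 ltW.
Qed.
Lemma near0_lt R (a : R) : 0 < a -> \forall s \near (0 : R), `|s| < a.
move=> a0;apply: (near_lt (f := fun s : R => `|s|));last by rewrite normr0.
by apply: ct_norm;exact: cvg_id.
Qed.

(** * Localized coordinate moves *)

Section Moves.
Variables (R : realType) (n : nat) (M : Top) (A : SA R n M)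
 (HM : CCM A)
 (m : nat) (ci : 'I_m -> chart_index A) (cc : 'I_m -> 'rV[R]_n) (cr : 'I_m -> R)
 (gc : good_cover ci cc cr).
Local Notation V := 'rV[R]_n.
Implicit Types (i : chart_index A) (x : M) (k : 'I_m).
Local Notation beta := (beta ci cc cr).
Let cr0 k : 0 < cr k. by case: gc. Qed.
Let hM : hausdorff_space M. by case: HM. Qed.
Let cM : compact [set: M]. by case: HM. Qed.
Let io_c := iota_cont HM gc.
Let io_i := iota_inj gc.
(** A cutoff equal to 1 where the bump exceeds [cr k / 2], which happens for some k at every point,
    and to 0 where it is at most [cr k / 4]. *)
Definition xi k x : R := Num.max 0 (Num.min 1 (4 / cr k * beta k x - 1)).
Lemma xi_itv k x : 0 <= xi k x <= 1.
by rewrite /xi le_max lexx /= ge_max ler01 /= ge_min lexx. Qed.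
Lemma xi_cont k : continuous (xi k).
move=> x;suff : cts x (fun y => Num.max 0 (Num.min 1 (4 / cr k * beta k y - 1))) by [].
apply: ct_max;first exact: ct_cst.
apply: ct_min;first exact: ct_cst.
apply: ctB;last exact: ct_cst.
by apply: ctM;[exact: ct_cst|exact: (beta_cont HM gc)].
Qed.
Lemma xi1 k x : cr k / 2 < beta k x -> xi k x = 1.
move=> h;have c0 := cr0 k;rewrite /xi min_l;first by rewrite max_r.
have : 4 / cr k * (cr k / 2) <= 4 / cr k * beta k x by rewrite ler_wpM2l ?divr_ge0 // ltW.
have -> : 4 / cr k * (cr k / 2) = 2 by field;rewrite gt_eqF.
lra.
Qed.
Lemma xi_supp k x : xi k x != 0 -> cdom (ci k) x /\
 dotv (chart (ci k) x - cc k) (chart (ci k) x - cc k) < 3 / 4 * cr k.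
move=> h;have c0 := cr0 k;have b4 : cr k / 4 < beta k x.
 rewrite ltNge;apply/negP => b4;move/eqP: h;apply;rewrite /xi max_l // ge_min;apply/orP;right.
 have : 4 / cr k * beta k x <= 4 / cr k * (cr k / 4) by rewrite ler_wpM2l ?divr_ge0 // ltW.
 have -> : 4 / cr k * (cr k / 4) = 1 by field;rewrite gt_eqF.
 lra.
have b0 : 0 < beta k x by apply: lt_trans b4;rewrite divr_gt0.
have [kx bE] := beta_gt0 b0;split=> //;rewrite bE /height in b4;lra.
Qed.
Lemma xi_near0 k x : beta k x = 0 -> \forall y \near x, xi k y = 0.
move=> b0;have c0 := cr0 k.
have bc : cts x (beta k) by exact: (beta_cont HM gc).
have : \forall y \near x, beta k y < cr k / 4 by apply: near_lt bc _;rewrite b0 divr_gt0.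
apply: filterS => y hy;rewrite /xi max_l // ge_min;apply/orP;right.
have : 4 / cr k * beta k y <= 4 / cr k * (cr k / 4) by rewrite ler_wpM2l ?divr_ge0 // ltW.
have -> : 4 / cr k * (cr k / 4) = 1 by field;rewrite gt_eqF.
lra.
Qed.
Definition gmove k x (w : V) : M :=
 if `[< cdom (ci k) x >] then chart_inv (ci k) (chart (ci k) x + w) else x.
Lemma gmove0 k x : gmove k x 0 = x.
by rewrite /gmove;case: asboolP => // kx;rewrite addr0 chartK. Qed.
Lemma gmove_cont (T : Top) (t : T) k (f : T -> M) (w : T -> V) :
 cts t f -> cts t w -> cdom (ci k) (f t) ->
 cimg (ci k) (chart (ci k) (f t) + w t) -> cts t (fun t => gmove k (f t) (w t)).
move=> fc wc kf img.
apply: (@ct_near _ _ _ (fun t => chart_inv (ci k) (chart (ci k) (f t) + w t))).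
 have h : \forall s \near t, cdom (ci k) (f s) by exact: (fc _ (nbhs_chart_dom kf)).
 apply: filterS h => s /= ks.
 by rewrite /gmove asboolT.
apply: ct_comp;first exact: chart_inv_continuous.
by apply: ctD => //;exact: ct_chart.
Qed.
Lemma gmove_cont0 (T : Top) (t : T) k (f : T -> M) (w : T -> V) :
 cts t f -> (\forall s \near t, w s = 0) -> cts t (fun t => gmove k (f t) (w t)).
move=> fc w0;apply: ct_near fc;apply: filterS w0 => s ->;by rewrite gmove0.
Qed.
(** Damped coordinate translations, extended by the identity. They stand in for finitely many flows
    whose velocities span every tangent space. *)
Definition move k (a : 'I_n) (s : R) x : M := gmove k x ((s * xi k x) *: delta_mx 0 a).
Lemma move0 k a x : move k a 0 x = x.
by rewrite /move mul0r scale0r gmove0. Qed.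
(** The cutoff lives on squared radius below 3/4 e, and the bound on s makes the step raise the
    squared radius by at most e / 4, so a move stays in the ball of the cover. *)
Lemma dotv_dist_delta (q : V) a (s e : R) : 0 < e -> dotv q q < 3 / 4 * e -> `|s| <= Num.min 1 (e / (4 * (3 + 2 * e))) ->
 dotv (q + s *: delta_mx 0 a) (q + s *: delta_mx 0 a) <= e.
move=> e0 hq;rewrite le_min => /andP[s1 s2].
have d0 : 0 < 4 * (3 + 2 * e) by lra.
have s3 : `|s| * (3 + 2 * e) <= e / 4.
 have := ler_wpM2r (ltW d0) s2;rewrite divfK ?gt_eqF //;lra.
rewrite dotvDl !dotvDr !dotvZl !dotvZr [dotv q (delta_mx 0 a)]dotvC !dotv_delta mxE !eqxx /=.
have qa : `|q 0 a| <= 1 + e.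
 have : `|q 0 a| ^+ 2 <= dotv q q.
 apply: le_trans (dotv_ge_norm q);rewrite lerXn2r ?nnegrE //;exact: mx_entry_le.
 have := normr_ge0 (q 0 a);nra.
have h1 : s * q 0 a <= `|s| * (1 + e).
 by apply: le_trans (ler_norm _) _;rewrite normrM ler_wpM2l.
have h2 : s * (s * 1) <= `|s|.
 rewrite mulr1;apply: le_trans (ler_norm _) _;rewrite normrM;have := normr_ge0 s;nra.
have := normr_ge0 s;nra.
Qed.
Lemma move_img : exists2 s0 : R, 0 < s0 & forall k a (s : R) x, `|s| < s0 -> xi k x != 0 ->
 cimg (ci k) (chart (ci k) x + (s * xi k x) *: delta_mx 0 a).
have [|s0 s00 Hs] := @fin_pos_lb R 'I_m (fun k => Num.min 1 (cr k / (4 * (3 + 2 * cr k)))).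
 move=> k;have := cr0 k => c0;rewrite lt_min ltr01 /= divr_gt0 //;lra.
exists s0 => // k a s x ss xk;have [kx hx] := xi_supp xk.
case: gc => _ h _;apply: h;rewrite addrAC.
apply: dotv_dist_delta => //;apply: le_trans (Hs k).
rewrite normrM;apply: le_trans (ltW ss);have /andP[x0 x1] := xi_itv k x.
by rewrite [`|xi k x|]ger0_norm // ler_piMr.
Qed.
Lemma move_cont : exists2 s0 : R, 0 < s0 & forall k a (s : R) x, `|s| < s0 ->
 {for (s, x), continuous (fun p : R * M => move k a p.1 p.2)}.
have [s0 s00 Hs] := move_img;exists s0 => // k a s x ss.
have wc : {for (s, x), continuous (fun p : R * M => (p.1 * xi k p.2) *: (delta_mx 0 a : V))}.
 apply: ctZ;last exact: ct_cst.
 apply: ctM;first exact: ct_p1.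
 by apply: (ct_comp (f := xi k) (a := fun p : R * M => p.2));[exact: xi_cont|exact: ct_p2].
have [b0|b0] := eqVneq (beta k x) 0.
 apply: gmove_cont0;first exact: ct_p2.
 have h : \forall p \near (s, x), xi k p.2 = 0 by exact: (@ct_p2 _ _ (s, x) _ (xi_near0 b0)).
 apply: filterS h => p /= ->.
 by rewrite mulr0 scale0r.
have [kx _] : cdom (ci k) x /\ beta k x = height cc cr k (chart (ci k) x).
 by apply: beta_gt0;rewrite lt_neqAle eq_sym b0 beta_ge0.
apply: gmove_cont => //=;first exact: ct_p2.
have [->|xk] := eqVneq (xi k x) 0;last exact: Hs.
by rewrite mulr0 scale0r addr0;exact: chart_imgP.
Qed.

Section Derivative.
Variables (Y W : NM R) (F : M * Y -> W)
 (SD : forall i z, cdom i z.1 -> exists L, sdif (pchart i) F z L).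
(** Derivative of [F] along [move k a] at [s = 0], the second variable being fixed. *)
Definition dmove k (a : 'I_n) (z : M * Y) : W :=
 if `[< cdom (ci k) z.1 >] then xi k z.1 *: gradL (pchart (ci k)) F z (delta_mx 0 a, 0) else 0.
Lemma dmove_cont k a : continuous (dmove k a).
move=> z;have [b0|b0] := eqVneq (beta k z.1) 0.
 apply: (@ct_near _ _ _ (fun=> 0));last exact: ct_cst.
 have h : \forall p \near z, xi k p.1 = 0 by exact: (@ct_p1 _ _ z _ (xi_near0 b0)).
 apply: filterS h => p /= xp.
 by rewrite /dmove xp scale0r;case: ifP.
have [kx _] : cdom (ci k) z.1 /\ beta k z.1 = height cc cr k (chart (ci k) z.1).
 by apply: beta_gt0;rewrite lt_neqAle eq_sym b0 beta_ge0.
apply: (@ct_near _ _ _ (fun z => xi k z.1 *: gradL (pchart (ci k)) F z (delta_mx 0 a, 0))).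
 by apply: filterS (near_pdom kx) => p kp;rewrite /dmove asboolT.
apply: ctZ;last exact: pgrad_cont.
by apply: (ct_comp (f := xi k) (a := fst));[exact: xi_cont|exact: ct_p1].
Qed.
(** Where the bump vanishes, the cutoff vanishes nearby and nothing moves. Elsewhere the strict
    derivative at [z0] applies to both ends of the move and is replaced by the derivative at z by
    continuity. *)
Lemma dmove_step k a (z0 : M * Y) (e : R) : 0 < e ->
 \forall z \near z0 & s \near (0 : R), `|F (move k a s z.1, z.2) - F z - s *: dmove k a z| <= e * `|s|.
move=> e0;have [b0|b0] := eqVneq (beta k z0.1) 0.
 near=> z s;have xz : xi k z.1 = 0 by near: z;exact: (@ct_p1 _ _ z0 _ (xi_near0 b0)).
 rewrite /move xz mulr0 scale0r gmove0 -surjective_pairing subrr sub0r normrN.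
 by rewrite /dmove xz scale0r;case: ifP => _;rewrite scaler0 normr0 mulr_ge0 // ltW.
have [kx _] : cdom (ci k) z0.1 /\ beta k z0.1 = height cc cr k (chart (ci k) z0.1).
 by apply: beta_gt0;rewrite lt_neqAle eq_sym b0 beta_ge0.
have [bL dL] := gradLP (SD kx);set L0 := gradL _ _ _ in bL dL.
have e2 : 0 < e / 2 by rewrite divr_gt0.
have [U nU HU] := dL _ e2.
have gcont : cts z0 (fun z => gradL (pchart (ci k)) F z (delta_mx 0 a, 0)) by exact: pgrad_cont.
have [s0 s00 Hs] := move_img;have [s1 s10 Hc] := move_cont.
have mc : {for ((z0, 0) : (M * Y) * R), continuous (fun p : (M * Y) * R => (move k a p.2 p.1.1, p.1.2) : M * Y)}.
 apply: ct_pair;last first.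
 by apply: (ct_comp (f := snd) (a := fst));[exact: ct_p2|exact: ct_p1].
 apply: (ct_comp (f := fun p : R * M => move k a p.1 p.2) (a := fun p : (M * Y) * R => (p.2, p.1.1))).
 by apply: Hc;rewrite normr0.
 apply: ct_pair;first exact: ct_p2.
 by apply: (ct_comp (f := fst) (a := fst));[exact: ct_p1|exact: ct_p1].
have nU' : \forall z \near z0 & s \near (0 : R), U (move k a s z.1, z.2).
 by apply: mc;rewrite /= move0 -surjective_pairing.
have nd : \forall z \near z0, `|gradL (pchart (ci k)) F z (delta_mx 0 a, 0) - L0 (delta_mx 0 a, 0)| < e / 2.
 exact: near_dist gcont e2.
case: nU' => -[A1 B1] /= [nA1 nB1] HAB.
near=> z s.
have kz : cdom (ci k) z.1 by near: z;exact: near_pdom.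
have Uz : U z by near: z.
have Um : U (move k a s z.1, z.2) by apply: (HAB (z, s));split=> /=;[near: z|near: s].
have sl : `|s| < s0 by near: s;exact: near0_lt.
have cE : pchart (ci k) (move k a s z.1, z.2) - pchart (ci k) z = ((s * xi k z.1) *: delta_mx 0 a, 0).
 rewrite /pchart /move /gmove /= asboolT //.
 have img : cimg (ci k) (chart (ci k) z.1 + (s * xi k z.1) *: delta_mx 0 a).
 have [->|xk] := eqVneq (xi k z.1) 0;last exact: Hs.
 by rewrite mulr0 scale0r addr0;exact: chart_imgP.
 by rewrite chart_invK // [LHS]surjective_pairing /= subrr addrC addKr.
have := HU _ _ Uz Um;rewrite cE norm_pair0 normrZ normrM.
have /andP[x0 x1] := xi_itv k z.1.
have -> : `|delta_mx 0 a : V| = 1.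
 apply/eqP;rewrite eq_le;apply/andP;split.
 by apply: mx_norm_le => // i j;rewrite mxE;case: (_ && _);rewrite ?normr1 ?normr0.
 by have := mx_entry_le (delta_mx 0 a : V) 0 a;rewrite mxE !eqxx normr1.
rewrite mulr1 [`|xi k z.1|]ger0_norm // => h1.
have -> : s *: dmove k a z = (s * xi k z.1) *: gradL (pchart (ci k)) F z (delta_mx 0 a, 0).
 by rewrite /dmove asboolT // scalerA.
have h2 : `|gradL (pchart (ci k)) F z (delta_mx 0 a, 0) - L0 (delta_mx 0 a, 0)| <= e / 2.
 by apply: ltW;near: z.
have LZ : L0 ((s * xi k z.1) *: delta_mx 0 a, 0) = (s * xi k z.1) *: L0 (delta_mx 0 a, 0).
 by case: bL => _ <- _;congr L0;rewrite [RHS]surjective_pairing /= scaler0.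
rewrite LZ in h1.
set gL := gradL _ _ _ _ in h2 *;set l0 := L0 _ in h1 h2.
rewrite (_ : _ - _ - _ = (F (move k a s z.1, z.2) - F z - (s * xi k z.1) *: l0) - (s * xi k z.1) *: (gL - l0));last first.
 by rewrite scalerBr opprB addrA subrK.
apply: le_trans (ler_normB _ _) _;rewrite normrZ normrM [`|xi k z.1|]ger0_norm //.
have s_ge := normr_ge0 s.
have h3 : `|s| * xi k z.1 <= `|s| by rewrite ler_piMr.
have h4 : `|s| * xi k z.1 * `|gL - l0| <= `|s| * (e / 2).
 by apply: ler_pM => //;rewrite mulr_ge0.
nra.
Unshelve. all: by end_near. Qed.
End Derivative.
End Moves.

(** * Free homotopies between close loops *)

Section Homotopies.
Variables (R : realType) (M : Top).
Implicit Types (f g h : R -> M).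
Lemma ct_glue (Z : Top) (a b : Z -> M) (h : Z -> R) (z : Z) : cts z a -> cts z b ->
 cts z h -> (h z = 0 -> a z = b z) -> cts z (fun z => if h z <= 0 then a z else b z).
move=> ac bc hc ab;have [h0|h0|h0] := ltgtP (h z) 0.
- apply: ct_near ac;apply: filterS (near_lt hc h0) => s hs;by rewrite ltW.
- apply: ct_near bc.
 have hn : cts z (fun z => - h z) by exact: ctN.
 have : \forall s \near z, - h s < 0 by apply: near_lt hn _;rewrite oppr_lt0.
 by apply: filterS => s hs;rewrite leNgt -oppr_lt0 hs.
- have E := ab h0;move=> U;rewrite /prop_for /continuous_at h0 lexx => nU.
 have n1 : \forall s \near z, U (a s) by exact: ac.
 have n2 : \forall s \near z, U (b s) by apply: bc;rewrite -E.
 by apply: filterS2 n1 n2 => s h1 h2 /=;case: ifP.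
Qed.
Definition clip (s : R) : R := Num.max 0 (Num.min 1 s).
Lemma clip_itv s : 0 <= clip s <= 1.
by rewrite /clip le_max lexx /= ge_max ler01 /= ge_min lexx. Qed.
Lemma clip_id s : 0 <= s <= 1 -> clip s = s.
by case/andP => s0 s1;rewrite /clip min_r // max_r. Qed.
Lemma clip_le0 s : s <= 0 -> clip s = 0.
by move=> s0;rewrite /clip max_l // ge_min s0 orbT. Qed.
Lemma clip_ge1 s : 1 <= s -> clip s = 1.
by move=> s1;rewrite /clip min_l // max_r // ler01. Qed.
Lemma ct_clip (Z : Top) (f : Z -> R) (z : Z) : cts z f -> cts z (fun z => clip (f z)).
by move=> fc;apply: ct_max;[exact: ct_cst|apply: ct_min => //;exact: ct_cst]. Qed.
Lemma ct_within (Z T : Top) (B : set T) (F : T -> M) (a : Z -> T) z : {within B, continuous F} ->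
 (forall z, B (a z)) -> cts z a -> cts z (fun z => F (a z)).
move=> /subspace_continuousP Fc Ba ac U /= nU;have nB := Fc (a z) (Ba z) U nU.
have h : \forall s \near z, B (a s) -> U (F (a s)) by exact: (ac _ nB).
by apply: filterS h => s;apply;exact: Ba.
Qed.
(** Constant extension beyond [0, 1], so that homotopies are glued as globally continuous maps. *)
Lemma homotopic_clip f g : freely_homotopic f g -> exists F : R * R -> M,
 [/\ continuous F, forall s t, F (s, t + 1) = F (s, t), forall s t, s <= 0 -> F (s, t) = f t
 & forall s t, 1 <= s -> F (s, t) = g t].
case=> F [Fc Fp F0 F1];exists (fun p => F (clip p.1, p.2));split=> [p|s t|s t s0|s t s1] /=.
- apply: (ct_within Fc);first by move=> q;split=> //=;rewrite in_itv /= clip_itv.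
 by apply: ct_pair;[apply: ct_clip;exact: ct_p1|exact: ct_p2].
- by rewrite Fp //= in_itv /= clip_itv.
- by rewrite clip_le0.
- by rewrite clip_ge1.
Qed.
Lemma homotopic_intro f g (F : R * R -> M) : (forall s t, 0 <= s <= 1 -> {for (s, t), continuous F}) ->
 (forall s t, F (s, t + 1) = F (s, t)) -> (forall t, F (0, t) = f t) -> (forall t, F (1, t) = g t) ->
 freely_homotopic f g.
move=> Fc Fp F0 F1;exists F;split=> //.
apply: continuous_in_subspaceT => -[s t];rewrite inE /= in_itv /= => -[st _];exact: Fc.
Qed.
Lemma homotopic_refl f : is_loop f -> freely_homotopic f f.
case=> fc fp;apply: (homotopic_intro (F := fun p => f p.2)) => // s t _.
by apply: (ct_comp (f := f) (a := snd));[exact: fc|exact: ct_p2].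
Qed.
Lemma homotopic_trans f g h : freely_homotopic f g -> freely_homotopic g h -> freely_homotopic f h.
move=> /homotopic_clip[F [Fc Fp F0 F1]] /homotopic_clip[G [Gc Gp G0 G1]].
pose H (p : R * R) := if 2 * p.1 - 1 <= 0 then F (2 * p.1, p.2) else G (2 * p.1 - 1, p.2).
apply: (homotopic_intro (F := H));rewrite /H /=.
- move=> s t _.
 have c1 : {for (s, t), continuous (fun p : R * R => 2 * p.1)} by apply: ctM;[exact: ct_cst|exact: ct_p1].
 have c2 : {for (s, t), continuous (fun p : R * R => 2 * p.1 - 1)} by apply: ctB => //;exact: ct_cst.
 apply: (ct_glue (a := fun p : R * R => F (2 * p.1, p.2)) (b := fun p : R * R => G (2 * p.1 - 1, p.2)) (h := fun p : R * R => 2 * p.1 - 1));[| |exact: c2|].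
 + by apply: (ct_comp (f := F));[exact: Fc|apply: ct_pair;[exact: c1|exact: ct_p2]].
 + by apply: (ct_comp (f := G));[exact: Gc|apply: ct_pair;[exact: c2|exact: ct_p2]].
 + by move=> /= E;rewrite E G0 // F1 //;lra.
- by move=> s t;case: ifP => _;rewrite ?Fp ?Gp.
- by move=> t;rewrite mulr0 sub0r lerN10 F0.
- by move=> t;rewrite ifF ?G1 //;lra.
Qed.
End Homotopies.

Section CloseLoops.
Variables (R : realType) (n : nat) (M : Top) (A : SA R n M)
 (HM : CCM A)
 (m : nat) (ci : 'I_m -> chart_index A) (cc : 'I_m -> 'rV[R]_n) (cr : 'I_m -> R)
 (gc : good_cover ci cc cr).
Local Notation V := 'rV[R]_n.
Implicit Types (i : chart_index A) (x y : M) (k : 'I_m) (f g : R -> M).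
Local Notation beta := (beta ci cc cr).
Local Notation iota := (iota_emb ci cc cr).
Local Notation gmove := (gmove ci).
Let cr0 k : 0 < cr k. by case: gc. Qed.
Let hM : hausdorff_space M. by case: HM. Qed.
Let cM : compact [set: M]. by case: HM. Qed.
Let io_c := iota_cont HM gc.
Let io_i := iota_inj gc.
Definition toward k x y (s : R) : M := gmove k x (s *: (chart (ci k) y - chart (ci k) x)).
Lemma toward_close k (e : R) : 0 < e -> exists2 d : R, 0 < d & forall x y, `|iota y - iota x| < d -> cr k / 8 < beta k y ->
 [/\ cdom (ci k) x, cdom (ci k) y & forall s : R, 0 <= s <= 1 ->
 cimg (ci k) (chart (ci k) x + s *: (chart (ci k) y - chart (ci k) x)) /\
 `|iota y - iota (toward k x y s)| < e].
move=> e0;pose Q x y := cr k / 8 < beta k y ->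
 [/\ cdom (ci k) x, cdom (ci k) y & forall s : R, 0 <= s <= 1 ->
 cimg (ci k) (chart (ci k) x + s *: (chart (ci k) y - chart (ci k) x)) /\
 `|iota y - iota (toward k x y s)| < e].
have [|d d0 Hd] := @unif_base _ _ _ cM _ io_c io_i Q;last by exists d.
move=> x0.
have [b0|b0] := eqVneq (beta k x0) 0.
 have bc : cts x0 (beta k) by exact: (beta_cont HM gc).
 have c8 : 0 < cr k / 8 by rewrite divr_gt0.
 exists [set y | beta k y < cr k / 8];first by apply: near_lt bc _;rewrite b0.
 by move=> x y _ /= h1 h2;have := lt_trans h1 h2;rewrite ltxx.
have [kx0 _] : cdom (ci k) x0 /\ beta k x0 = height cc cr k (chart (ci k) x0).
 by apply: beta_gt0;rewrite lt_neqAle eq_sym b0 beta_ge0.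
have img0 := chart_imgP kx0;have e2 : 0 < e / 2 by rewrite divr_gt0.
have n1 : \forall q \near chart (ci k) x0, cimg (ci k) q.
 by apply: open_nbhs_nbhs;split=> //;exact: open_chart_img.
have n2 : \forall q \near chart (ci k) x0, `|iota (chart_inv (ci k) q) - iota x0| < e / 2.
 have ic : {for chart (ci k) x0, continuous (fun q : V => iota (chart_inv (ci k) q))}.
 by apply: (ct_comp (f := iota) (a := chart_inv (ci k)));[exact: io_c|exact: chart_inv_continuous].
 have := near_dist ic e2;rewrite chartK;[exact|exact: kx0].
have n12 : \forall q \near chart (ci k) x0, cimg (ci k) q /\ `|iota (chart_inv (ci k) q) - iota x0| < e / 2.
 exact: filterI.
case/nbhs_ballP: n12 => r /= r0 Hr.
exists [set y | [/\ cdom (ci k) y, `|chart (ci k) y - chart (ci k) x0| < r & `|iota y - iota x0| < e / 2]].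
 have h1 := nbhs_chart_dom kx0;have h2 := near_dist (chart_ct kx0) r0.
 have h3 : \forall y \near x0, `|iota y - iota x0| < e / 2 by apply: near_dist e2;exact: io_c.
 by near=> y;split;near: y.
move=> x y [kx xr _] [ky yr ye] _;split=> // s /andP[s0 s1].
have [h1 h2] : cimg (ci k) (chart (ci k) x + s *: (chart (ci k) y - chart (ci k) x)) /\
 `|iota (chart_inv (ci k) (chart (ci k) x + s *: (chart (ci k) y - chart (ci k) x))) - iota x0| < e / 2.
 apply: Hr;rewrite -ball_normE /= distrC.
 set a := chart _ x in xr *;set b := chart _ y in yr *;set o := chart _ x0 in xr yr *.
 have -> : a + s *: (b - a) - o = (1 - s) *: (a - o) + s *: (b - o).
 by apply/rowP => l;rewrite !mxE;ring.
 apply: le_lt_trans (ler_normD _ _) _;rewrite !normrZ [`|s|]ger0_norm // [`|1 - s|]ger0_norm ?subr_ge0 //.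
 have := normr_ge0 (a - o);have := normr_ge0 (b - o);have [h|h] := leP s (1 / 2);nra.
split;first exact: h1.
rewrite /toward /gmove asboolT;last exact: kx.
rewrite -(subrK (iota x0) (iota y)) -addrA;apply: le_lt_trans (ler_normD _ _) _.
rewrite [`|iota x0 - _|]distrC;lra.
Unshelve. all: by end_near. Qed.
Lemma toward0 k x y : toward k x y 0 = x.
by rewrite /toward scale0r gmove0. Qed.
Lemma toward1 k x y : cdom (ci k) x -> cdom (ci k) y -> toward k x y 1 = y.
by move=> kx ky;rewrite /toward /gmove asboolT // scale1r addrC subrK chartK. Qed.
Lemma toward_id k x s : toward k x x s = x.
by rewrite /toward subrr scaler0 gmove0. Qed.
Lemma toward_cont (T : Top) (t : T) k (f g : T -> M) (w : T -> R) :
 cts t f -> cts t g -> cts t w ->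
 cdom (ci k) (f t) -> cdom (ci k) (g t) ->
 cimg (ci k) (chart (ci k) (f t) + w t *: (chart (ci k) (g t) - chart (ci k) (f t))) ->
 cts t (fun t => toward k (f t) (g t) (w t)).
move=> fc gc' wc kf kg img;apply: (gmove_cont fc _ kf img).
apply: ctZ;first exact: wc.
by apply: ctB;exact: ct_chart.
Qed.
(** In chart k, f is pushed along segments toward g by the fraction [xi k (g t)]. Segments are
    available where the bump exceeds cr / 8 and the fraction vanishes below cr / 4, so the push is
    continuous; above cr / 2 the fraction is 1 and g is reached. *)
Lemma loop_stage k (e : R) : 0 < e -> exists2 d : R, 0 < d & forall f g, is_loop f -> is_loop g ->
 (forall t, `|iota (g t) - iota (f t)| < d) -> exists h, [/\ is_loop h, freely_homotopic f h,
 forall t, `|iota (g t) - iota (h t)| < e, forall t, f t = g t -> h t = g t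
 & forall t, cr k / 2 < beta k (g t) -> h t = g t].
move=> e0;have [d d0 Hd] := toward_close k e0;exists (Num.min d e);first by rewrite lt_min d0.
move=> f g [fc fp] [gc' gp] fg;have fgd t : `|iota (g t) - iota (f t)| < d by have := fg t;rewrite lt_min => /andP[].
pose F (p : R * R) := toward k (f p.2) (g p.2) (clip p.1 * xi ci cc cr k (g p.2)).
have xib t : beta k (g t) <= cr k / 8 -> \forall s \near t, xi ci cc cr k (g s) = 0.
 move=> b8;have bc : cts t (fun s => beta k (g s)).
 by apply: (ct_comp (f := beta k));[exact: (beta_cont HM gc)|exact: gc'].
 have c0 := cr0 k;have : \forall s \near t, beta k (g s) < cr k / 4 by apply: near_lt bc _;lra.
 apply: filterS => s hs;rewrite /xi max_l // ge_min;apply/orP;right.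
 have : 4 / cr k * beta k (g s) <= 4 / cr k * (cr k / 4) by rewrite ler_wpM2l ?divr_ge0 // ltW.
 have -> : 4 / cr k * (cr k / 4) = 1 by field;rewrite gt_eqF.
 lra.
have xi01 (s t : R) : 0 <= clip s * xi ci cc cr k (g t) <= 1.
 have /andP[a b] := clip_itv s;have /andP[a' b'] := xi_itv ci cc cr k (g t).
 by rewrite mulr_ge0 //= mulr_ile1.
have Fc : continuous F.
 case=> s t;have f2 : {for (s, t), continuous (fun p : R * R => f p.2)}.
 by apply: (ct_comp (f := f));[exact: fc|exact: ct_p2].
 have g2 : {for (s, t), continuous (fun p : R * R => g p.2)}.
 by apply: (ct_comp (f := g));[exact: gc'|exact: ct_p2].
 have [b8|b8] := leP (beta k (g t)) (cr k / 8).
 apply: (gmove_cont0 (w := fun p : R * R => (clip p.1 * xi ci cc cr k (g p.2)) *: (chart (ci k) (g p.2) - chart (ci k) (f p.2))));first exact: f2.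
 have h : \forall p \near (s, t), xi ci cc cr k (g p.2) = 0 by exact: (@ct_p2 _ _ (s, t) _ (xib _ b8)).
 by apply: filterS h => p ->;rewrite mulr0 scale0r.
 have [kx ky Hs] := Hd _ _ (fgd t) b8.
 apply: (toward_cont (w := fun p : R * R => clip p.1 * xi ci cc cr k (g p.2)) f2 g2 _ kx ky);last by case: (Hs _ (xi01 s t)).
 apply: ctM;first by apply: ct_clip;exact: ct_p1.
 by apply: (ct_comp (f := xi ci cc cr k) (a := fun p : R * R => g p.2)) => //;exact: (xi_cont HM gc).
exists (fun t => F (1, t));split=> [||t|t fgt|t bt].
- split=> [t|t];last by rewrite /F /= fp gp.
 apply: (ct_comp (f := F) (a := fun t => (1, t)));first exact: Fc.
 by apply: ct_pair;[exact: ct_cst|exact: cvg_id].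
- apply: (homotopic_intro (F := F)) => [s t _|s t|t|//];first exact: Fc.
 by rewrite /F /= fp gp.
 by rewrite /F /= clip_le0 // mul0r toward0.
- have [b8|b8] := leP (beta k (g t)) (cr k / 8).
 rewrite /F /= (nbhs_singleton (xib _ b8)) mulr0 toward0.
 by have := fg t;rewrite lt_min => /andP[].
 by have [_ _ /(_ _ (xi01 1 t))[]] := Hd _ _ (fgd t) b8.
- by rewrite /F /= fgt toward_id.
- have b8 : cr k / 8 < beta k (g t) by apply: le_lt_trans bt;have := cr0 k;lra.
 have [kx ky _] := Hd _ _ (fgd t) b8.
 by rewrite /F /= (xi1 gc) // clip_ge1 // mulr1 toward1.
Qed.
(** After one stage per chart the loop is g, since at every point some bump exceeds cr / 2. The
    tolerances are chosen backwards: the closeness required by a stage is demanded of the earlier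
    ones. *)
Lemma close_loops_homotopic : exists2 d : R, 0 < d & forall f g, is_loop f -> is_loop g ->
 (forall t, `|iota (g t) - iota (f t)| < d) -> freely_homotopic f g.
suff key j (e : R) : (j <= m)%N -> 0 < e -> exists2 d : R, 0 < d & forall f g, is_loop f -> is_loop g ->
 (forall t, `|iota (g t) - iota (f t)| < d) -> exists h, [/\ is_loop h, freely_homotopic f h,
 forall t, `|iota (g t) - iota (h t)| < e
 & forall t k, (k < j)%N -> cr k / 2 < beta k (g t) -> h t = g t].
 have [d d0 Hd] := key m 1 (leqnn _) ltr01;exists d => // f g lf lg fg.
 have [h [lh fh _ hg]] := Hd f g lf lg fg.
 suff -> : g = h by [].
 by apply/funext => t;have [k hk] := beta_cover gc (g t);rewrite (hg t k).
elim: j e => [|j IH] e jm e0.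
 by exists e => // f g lf lg fg;exists f;split=> //;exact: homotopic_refl.
pose k := Ordinal jm;have [d1 d10 H1] := loop_stage k e0.
have [d2 d20 H2] := IH d1 (ltnW jm) d10;exists d2 => // f g lf lg fg.
have [h [lh fh hd hg]] := H2 f g lf lg fg;have [h' [lh' hh' hd' hg' hk']] := H1 h g lh lg hd.
exists h';split=> //;first exact: homotopic_trans fh hh'.
move=> t k';rewrite ltnS leq_eqVlt => /orP[/eqP kj|kj] b;last by apply: hg';exact: hg b.
by apply: hk';rewrite (_ : k = k') //;exact: val_inj.
Qed.
End CloseLoops.

(** * Discrete loops and their homotopy classes *)

Section CyclicIndex.
Variable N : nat.
Definition cyc (z : int) : 'I_N.+1 := inord `|(z %% N.+1)%Z|%N.
Lemma cycE z : exists2 a : nat, (a < N.+1)%N & (z %% N.+1)%Z = a%:Z.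
exists `|(z %% N.+1)%Z|%N;last by rewrite gez0_abs // modz_ge0.
by rewrite -ltz_nat gez0_abs ?modz_ge0 // ltz_pmod.
Qed.
Lemma cyc_nat (a : nat) : (a < N.+1)%N -> cyc a = inord a.
by move=> aN;rewrite /cyc modz_nat modn_small. Qed.
Lemma cyc_ord (j : 'I_N.+1) : cyc (val j) = j.
by rewrite cyc_nat ?ltn_ord // inord_val. Qed.
Lemma cycD z : cyc (z + N.+1%:Z) = cyc z.
by rewrite /cyc modzDr. Qed.
Lemma cycS z : cyc (z + 1) = ordS (cyc z).
have [a aN za] := cycE z;rewrite /cyc -modzDml za;apply: val_inj => /=.
rewrite -PoszD modz_nat !absz_nat addn1 !inordK //.
by rewrite ltn_mod.
Qed.
End CyclicIndex.

Section Interpolation.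
Variables (R : realType) (n : nat) (M : Top) (A : SA R n M)
 (HM : CCM A)
 (m : nat) (ci : 'I_m -> chart_index A) (cc : 'I_m -> 'rV[R]_n) (cr : 'I_m -> R)
 (gc : good_cover ci cc cr).
Local Notation V := 'rV[R]_n.
Implicit Types (i : chart_index A) (x y : M) (k : 'I_m) (f g : R -> M).
Local Notation beta := (beta ci cc cr).
Local Notation iota := (iota_emb ci cc cr).
Let cr0 k : 0 < cr k. by case: gc. Qed.
Let io_c := iota_cont HM gc.
Lemma short_paths (e : R) : 0 < e -> exists2 d : R, 0 < d & forall x y, `|iota y - iota x| < d ->
 exists p : R -> M, [/\ continuous p, forall s, s <= 0 -> p s = x, forall s, 1 <= s -> p s = y
 & forall s, `|iota y - iota (p s)| < e].
move=> e0;have /choice[dd Hdd] : forall k, exists d : R, 0 < d /\ forall x y, `|iota y - iota x| < d -> cr k / 8 < beta k y ->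
 [/\ cdom (ci k) x, cdom (ci k) y & forall s : R, 0 <= s <= 1 ->
 cimg (ci k) (chart (ci k) x + s *: (chart (ci k) y - chart (ci k) x)) /\
 `|iota y - iota (toward ci k x y s)| < e].
 by move=> k;have [d d0 Hd] := toward_close HM gc k e0;exists d.
have [k|d d0 Hd] := @fin_pos_lb R 'I_m dd;first by case: (Hdd k).
exists d => // x y xy;have [k hk] := beta_cover gc y.
have b8 : cr k / 8 < beta k y by apply: lt_trans hk;have := cr0 k;lra.
have [kx ky Hs] := (Hdd k).2 _ _ (lt_le_trans xy (Hd k)) b8.
exists (fun s => toward ci k x y (clip s));split=> [s|s s0|s s1|s].
- suff : cts s (fun s0 : R => toward ci k x y (clip s0)) by [].
 have cx : cts s (fun _ : R => x) by exact: ct_cst.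
 have cy : cts s (fun _ : R => y) by exact: ct_cst.
 have cw : cts s (fun u : R => clip u) by apply: ct_clip;exact: cvg_id.
 exact: (toward_cont cx cy cw kx ky (Hs _ (clip_itv s)).1).
- by rewrite clip_le0 // toward0.
- by rewrite clip_ge1 // toward1.
- by case: (Hs _ (clip_itv s)).
Qed.
Lemma interpolate (e : R) : 0 < e -> exists2 d : R, 0 < d & forall N (x : 'I_N.+1 -> M),
 (forall j, `|iota (x (ordS j)) - iota (x j)| < d) -> exists2 f, is_loop f &
 forall (j : 'I_N.+1) (t : R), j%:R <= N.+1%:R * t <= j%:R + 1 -> `|iota (f t) - iota (x j)| < e.
move=> e0;have e2 : 0 < e / 2 by rewrite divr_gt0.
have [d d0 Hd] := short_paths e2;exists (Num.min d (e / 2));first by rewrite lt_min d0.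
move=> N x xd;have xd1 j : `|iota (x (ordS j)) - iota (x j)| < d by have := xd j;rewrite lt_min => /andP[].
have xd2 j : `|iota (x (ordS j)) - iota (x j)| < e / 2 by have := xd j;rewrite lt_min => /andP[].
have /choice[p Hp] := fun j => Hd _ _ (xd1 j).
pose P (z : int) (u : R) := p (cyc N z) (u - z%:~R).
have Pc z : continuous (P z).
 move=> u;have [pc _ _ _] := Hp (cyc N z).
 apply: (ct_comp (f := p (cyc N z)) (a := fun u : R => u - z%:~R));first exact: pc.
 by apply: ctB;[exact: cvg_id|exact: ct_cst].
have P0 z : P z z%:~R = x (cyc N z) by rewrite /P subrr;case: (Hp (cyc N z)) => _ ->.
have P1 z : P z (z + 1)%:~R = x (cyc N (z + 1)).
 by rewrite /P cycS intrD addrAC subrr add0r;case: (Hp (cyc N z)) => _ _ ->.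
have P1' z : P (z - 1) z%:~R = P z z%:~R by have := P1 (z - 1);rewrite subrK -P0.
pose f u := P (Num.floor u) u.
have fc : continuous f.
 move=> u;set z := Num.floor u.
 have zu : z%:~R <= u by exact: floor_le.
 have uz : u < (z + 1)%:~R by exact: floorD1_gt.
 suff : cts u f by [].
 (* Near u only the cells z - 1 and z occur, and both pieces pass through the same node at the
    integer z. *)
 apply: (@ct_near _ _ _ (fun v : R => if v - z%:~R <= 0 then P (z - 1) v else P z v)).
 have n1 : \forall v \near u, (z - 1)%:~R < v.
 by apply: lt_nbhsr;apply: lt_le_trans zu;rewrite ltr_int;lia.
 have n2 : \forall v \near u, v < (z + 1)%:~R by apply: (near_lt (f := id)) uz;exact: cvg_id.
 apply: filterS2 n1 n2 => v v1 v2;rewrite /f subr_le0;have [h|h] := leP v z%:~R;last first.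
 by rewrite (@floor_def _ v z) // ltW.
 move: h;rewrite le_eqVlt => /orP[/eqP ->|h].
 by rewrite intrKfloor P1'.
 by rewrite (@floor_def _ v (z - 1)) // subrK h ltW.
 apply: ct_glue;[exact: Pc|exact: Pc| |].
 by apply: ctB;[exact: cvg_id|exact: ct_cst].
 by move/eqP;rewrite subr_eq0 => /eqP ->;rewrite P1'.
have fper u : f (u + N.+1%:R) = f u.
 have E : Num.floor (u + N.+1%:R) = Num.floor u + N.+1%:Z.
 by rewrite floorDrz ?natr_int // -[N.+1%:R]/(N.+1%:Z%:~R) intrKfloor.
 by rewrite /f /P E cycD intrD;congr p;rewrite -[N.+1%:R]/(N.+1%:Z%:~R);ring.
exists (fun t => f (N.+1%:R * t)).
 split=> [t|t];last by rewrite mulrDr mulr1 fper.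
 by apply: (ct_comp (f := f));[exact: fc|apply: ctM;[exact: ct_cst|exact: cvg_id]].
move=> j t /andP[t0];rewrite le_eqVlt => /orP[/eqP ->|t1].
 have -> : j%:R + 1 = (j%:Z + 1)%:~R :> R by rewrite intrD.
 rewrite /f intrKfloor P0 cycS cyc_ord;apply: lt_trans (xd2 j) _;lra.
rewrite /f (@floor_def _ _ j%:Z);last by rewrite t0 intrD.
rewrite /P cyc_ord;have [_ _ _ /(_ (N.+1%:R * t - j%:R)) h] := Hp j.
rewrite -(subrK (iota (x (ordS j))) (iota (p _ _))) -addrA;apply: le_lt_trans (ler_normD _ _) _.
rewrite distrC;have := xd2 j;lra.
Qed.
Lemma periodic_int (f : R -> M) (z : int) t : (forall t, f (t + 1) = f t) -> f (t + z%:~R) = f t.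
move=> fp;have key (a : nat) u : f (u + a%:R) = f u.
 by elim: a u => [|a IH] u;rewrite ?addr0 // -natr1 addrA fp IH.
case: z => a;first exact: key.
by rewrite NegzE mulrNz -[in RHS](subrK (a.+1%:R) t) key.
Qed.
Lemma loop_cell N (f g : R -> M) (Q : M -> M -> Prop) : (forall t, f (t + 1) = f t) -> (forall t, g (t + 1) = g t) ->
 (forall (j : 'I_N.+1) (t : R), j%:R <= N.+1%:R * t <= j%:R + 1 -> Q (f t) (g t)) -> forall t, Q (f t) (g t).
move=> fp gp H t;pose s := t - (Num.floor t)%:~R.
have -> : t = s + (Num.floor t)%:~R by rewrite subrK.
rewrite !periodic_int //;have s0 : 0 <= s by rewrite subr_ge0 floor_le.
have s1 : s < 1 by rewrite ltrBlDl -[X in _ + X]/(1%:~R) -intrD;exact: floorD1_gt.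
have N0 : 0 < N.+1%:R :> R by rewrite ltr0n.
have u0 : 0 <= N.+1%:R * s by rewrite mulr_ge0 // ltW.
have jN : (`|Num.floor (N.+1%:R * s)| < N.+1)%N.
 rewrite -ltz_nat gez0_abs ?floor_ge0 // floor_lt_int.
 by rewrite -[X in _ < X]mulr1 ltr_pM2l.
apply: (H (Ordinal jN)) => /=.
have E : (`|Num.floor (N.+1%:R * s)|%N)%:R = (Num.floor (N.+1%:R * s))%:~R :> R.
 by rewrite -[LHS]/((`|Num.floor (N.+1%:R * s)|%N : int)%:~R) gez0_abs ?floor_ge0.
rewrite E floor_le /= -[X in _ + X]/(1%:~R) -intrD ltW //;exact: floorD1_gt.
Qed.
Variables (alpha : set (R -> M))
 (alpha_class : free_homotopy_class alpha).
Lemma class_loop f : alpha f -> is_loop f.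
by case: alpha_class => g _ -> []. Qed.
Lemma class_homotopic f g : alpha f -> is_loop g -> freely_homotopic f g -> alpha g.
by case: alpha_class => h _ -> [] _ hf lg fg;split=> //;exact: homotopic_trans hf fg. Qed.
(** During the time cell of node j the loop stays near that node; this ties a discrete loop to a
    homotopy class. *)
Definition follows (e : R) N (f : R -> M) (x : 'I_N.+1 -> M) := forall (j : 'I_N.+1) (t : R),
 j%:R <= N.+1%:R * t <= j%:R + 1 -> `|iota (f t) - iota (x j)| < e.
Lemma class_close : exists2 d : R, 0 < d & forall f g, alpha f -> is_loop g ->
 (forall t, `|iota (g t) - iota (f t)| < d) -> alpha g.
have [d d0 Hd] := close_loops_homotopic HM gc;exists d => // f g af lg fg.
by apply: (class_homotopic af lg);apply: Hd => //;exact: class_loop.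
Qed.
(** The tolerance is a third of the distance at which loops are homotopic, so loops following node
    sequences less than d / 3 apart are d-close. The second half is the persistence condition for
    the homotopy class during the descent. *)
Lemma class_follow : exists2 e : R, 0 < e & (forall N f g (x : 'I_N.+1 -> M), alpha f -> is_loop g ->
 follows e f x -> follows e g x -> alpha g) /\
 exists2 d : R, 0 < d & forall N (x x' : 'I_N.+1 -> M), (exists2 f, alpha f & follows e f x) ->
 (forall j, `|iota (x' j) - iota (x j)| < d) -> (forall j, `|iota (x' (ordS j)) - iota (x' j)| < d) ->
 exists2 f, alpha f & follows e f x'.
have [d d0 Hd] := class_close;exists (d / 3);first by rewrite divr_gt0.
have d3 : 0 < d / 3 by rewrite divr_gt0.
have key N f g (x x' : 'I_N.+1 -> M) : alpha f -> is_loop g -> (forall j, `|iota (x' j) - iota (x j)| < d / 3) ->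
 follows (d / 3) f x -> follows (d / 3) g x' -> alpha g.
 move=> af lg xx ff fg;apply: (Hd f g af lg).
 have [_ fp] := class_loop af;have [_ gp] := lg.
 apply: (loop_cell (N := N) (Q := fun a b => `|iota b - iota a| < d)) => // j t jt.
 have := ff j t jt;have := fg j t jt;have := xx j => h1 h2 h3.
 have t1 := ler_distD (iota (x' j)) (iota (g t)) (iota (f t)).
 have t2 := ler_distD (iota (x j)) (iota (x' j)) (iota (f t)).
 rewrite [`|iota (x j) - iota (f t)|]distrC in t2;lra.
split=> [N f g x af lg ff fg|].
 by apply: (key N f g x x) => // j;rewrite subrr normr0.
have [d1 d10 Hd1] := interpolate d3;exists (Num.min d1 (d / 3));first by rewrite lt_min d10.
move=> N x x' [f af ff] xx xd;have [|g lg fg] := Hd1 N x'.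
 by move=> j;have := xd j;rewrite lt_min => /andP[].
exists g => //;apply: (key N f g x x') => // j.
by have := xx j;rewrite lt_min => /andP[].
Qed.
End Interpolation.
Lemma compact_step R (Z : Top) (U : NM R) (K : set Z) (P : Z -> U -> Prop) : compact K ->
 (forall z0, K z0 -> \forall z \near z0 & s \near (0 : U), P z s) ->
 exists2 d : R, 0 < d & forall s z, K z -> `|s| < d -> P z s.
move=> cK H;have : \forall s \near (0 : U), K `<=` [set z | P z s].
 have /compact_near_coveringP := cK;apply => z Kz.
 by case: (H z Kz) => -[A B] /= AB HAB;exists (A, B).
case/nbhs_ballP => d /= d0 Hd;exists d => // s z Kz sd;apply: (Hd s) => //.
by rewrite -ball_normE /= sub0r normrN.
Qed.
Lemma blin_dotv R K (f : 'rV[R]_K -> R) u : blin f -> f u = dotv (\row_a f (delta_mx 0 a)) u.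
move=> bf;have [hD hZ _] := bf;rewrite {1}[u]rV_delta.
have -> (g : 'I_K -> 'rV[R]_K) : f (\sum_a g a) = \sum_a f (g a).
 by elim/big_ind2: _ => [|v v' w w' <- <-|//];rewrite ?blin0 // hD.
by rewrite dotvE;apply: eq_bigr => a _;rewrite hZ mxE mulrC.
Qed.
Lemma blin_0pair R (V W : NM R) : blin (fun u : W => (0, u) : V * W).
split=> [u v|a v|];first by rewrite -[RHS]/(0 + 0, u + v) addr0.
 by rewrite -[RHS]/(a *: 0, a *: v) scaler0.
by exists 1 => // v;rewrite norm_0pair mul1r.
Qed.
Lemma dist_halves R (a b c e v : R) : `|a - b| <= e / 2 * v -> `|c - b| <= e / 2 * v -> `|a - c| <= e * v.
move=> h1 h2;have := ler_distD b a c;rewrite [`|b - c|]distrC;lra. Qed.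
Lemma dist_halves_lt R (V : NM R) (a b c : V) (e : R) : `|a - b| < e / 2 -> `|c - b| < e / 2 -> `|a - c| <= e.
move=> h1 h2;have := ler_distD b a c;rewrite [`|b - c|]distrC;lra. Qed.

(** * Almost critical discrete loops on M *)

Section Criticality.
Variables (R : realType) (n : nat) (M : Top) (A : SA R n M)
 (HM : CCM A)
 (m : nat) (ci : 'I_m -> chart_index A) (cc : 'I_m -> 'rV[R]_n) (cr : 'I_m -> R)
 (gc : good_cover ci cc cr).
Local Notation V := 'rV[R]_n.
Implicit Types (i : chart_index A) (x y : M) (k : 'I_m).
Local Notation iota := (iota_emb ci cc cr).
Local Notation KY := (m * (1 + n))%N.
Local Notation Y := 'rV[R]_KY.
Let cM : compact [set: M]. by case: HM. Qed.
Let io_c := iota_cont HM gc.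
Let io_i := iota_inj gc.
Definition iotap (z : M * Y) : Y := iota z.1.
Lemma sdif_iotap i z : cdom i z.1 -> sdif (pchart i) iotap z (fun v => v.1 *m d_iota ci cc cr i z.1).
move=> iz;have [[h1 h2 [C C0 h3]] hd] := sdif_iota HM gc iz;split.
 split=> [u v|a v|];rewrite /= ?h1 ?h2 //;exists C => // -[v u] /=.
 apply: le_trans (h3 v) _;rewrite ler_wpM2l // norm_pair le_max lexx //.
move=> e e0;have [U nU HU] := hd e e0;exists [set z | U z.1];first exact: (@ct_p1 _ _ z _ nU).
move=> [x y] [x' y'] /= Ux Ux';apply: le_trans (HU _ _ Ux Ux') _.
by rewrite ler_wpM2l ?(ltW e0) // -[X in _ <= X]/(Num.max _ _) /= le_max lexx.
Qed.
Lemma SD_iotap i z : cdom i z.1 -> exists L, sdif (pchart i) iotap z L.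
by move=> iz;eexists;exact: sdif_iotap. Qed.
Definition field k (a : 'I_n) x : Y := dmove ci cc cr iotap k a (x, 0).
Lemma fieldE k a x : cdom (ci k) x -> field k a x = xi ci cc cr k x *: (delta_mx 0 a *m d_iota ci cc cr (ci k) x).
move=> kx;rewrite /field /dmove asboolT //=;congr (_ *: _).
by rewrite (gradLE _ (sdif_iotap _)) //;exact: lsurj_pchart.
Qed.
Lemma field_cont k a : continuous (field k a).
move=> x;suff : cts x (fun x => dmove ci cc cr iotap k a (x, 0)) by [].
apply: (ct_comp (f := dmove ci cc cr iotap k a));first exact: (dmove_cont HM gc SD_iotap).
by apply: ct_pair;[exact: cvg_id|exact: ct_cst].
Qed.

Section Vertical.
Variables (F : M * Y -> R)
 (SD : forall i z, cdom i z.1 -> exists L, sdif (pchart i) F z L).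
(** Gradient in the vector variable. Changes of charts fix vertical vectors, so any chart around the
    point computes it, see [vgradE]. *)
Definition vgrad (z : M * Y) : Y := \row_a gradL (pchart (chart_at A z.1)) F z (0, delta_mx 0 a).
Lemma vgrad_blin i z : cdom i z.1 -> blin (fun u : Y => gradL (pchart i) F z (0, u)).
by move=> iz;exact: (blin_comp (K := fun u : Y => ((0, u) : V * Y)) (pgrad_blin SD iz) (blin_0pair V Y)). Qed.
Lemma vgradE1 i z u : cdom i z.1 -> gradL (pchart i) F z (0, u) = dotv (\row_a gradL (pchart i) F z (0, delta_mx 0 a)) u.
by move=> iz;exact: (blin_dotv (f := fun u : Y => gradL (pchart i) F z (0, u)) u (vgrad_blin iz)). Qed.
Lemma vgradE2 i z (a : 'I_KY) : cdom i z.1 -> gradL (pchart i) F z (0, delta_mx 0 a) = gradL (pchart (chart_at A z.1)) F z (0, delta_mx 0 a).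
move=> iz;have := gradL_transition SD 0 (delta_mx 0 a) iz (mem_chart_at A z.1).
by rewrite mul0mx.
Qed.
Lemma vgradE i z u : cdom i z.1 -> gradL (pchart i) F z (0, u) = dotv (vgrad z) u.
move=> iz.
have E := vgradE1 u iz.
apply: etrans E _.
apply: (congr1 (fun w : Y => dotv w u)).
apply/rowP => a.
have E := vgradE2 a iz.
apply: etrans (mxE _ _ _ _) _.
apply: etrans E _.
apply: esym.
exact: mxE.
Qed.
Lemma vgrad_cont : continuous vgrad.
move=> z0;have iz := mem_chart_at A z0.1;set i := chart_at A z0.1 in iz.
apply: (@ct_near _ _ _ (fun z => \row_a gradL (pchart i) F z (0, delta_mx 0 a))).
 apply: filterS (near_pdom iz) => z iz';apply/rowP => a.
 have E : gradL (pchart i) F z (0, delta_mx 0 a) = vgrad z 0 a.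
 by apply: etrans (vgradE2 a iz') _;apply: esym;exact: mxE.
 by apply: etrans (mxE _ _ _ _) E.
apply: continuous_mx => b a.
rewrite (_ : (fun z => _) = (fun z => gradL (pchart i) F z (0, delta_mx 0 a)));last first.
 by apply/funext => z;rewrite mxE.
exact: pgrad_cont.
Qed.
Lemma vgrad_step (r e : R) : 0 < e -> exists2 d : R, 0 < d & forall x (p v : Y), `|v| < d ->
 `|p| <= r -> `|F (x, p + v) - F (x, p) - dotv (vgrad (x, p)) v| <= e * `|v|.
move=> e0;have cK : compact ([set: M] `*` [set y : Y | `|y| <= r]).
 by apply: compact_setX => //;exact: closed_ball0_compact.
have e2 : 0 < e / 2 by rewrite divr_gt0.
have [|d d0 Hd] := @compact_step R _ Y _ (fun z v => `|F (z.1, z.2 + v) - F z - dotv (vgrad z) v| <= e * `|v|) cK;last first.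
 by exists d => // x p v vd pr;apply: (Hd v (x, p)).
move=> z0 _;have iz := mem_chart_at A z0.1;set i := chart_at A z0.1 in iz.
have [bL dL] := gradLP (SD iz);set L0 := gradL _ _ _ in bL dL.
have [U nU HU] := dL _ e2.
have [U' nU' HU'] := sdif_grad e2 (gradLP (SD iz));rewrite -/L0 in HU'.
have mc : {for ((z0, 0) : (M * Y) * Y), continuous (fun p : (M * Y) * Y => (p.1.1, p.1.2 + p.2) : M * Y)}.
 apply: ct_pair;first by apply: (ct_comp (f := fst) (a := fst));[exact: ct_p1|exact: ct_p1].
 apply: ctD;last exact: ct_p2.
 by apply: (ct_comp (f := snd) (a := fst));[exact: ct_p2|exact: ct_p1].
have : \forall z \near z0 & s \near (0 : Y), U (z.1, z.2 + s).
 by apply: mc;rewrite /= addr0 -surjective_pairing.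
case=> -[A1 B1] /= [nA1 nB1] HAB;have nd := near_pdom iz.
near=> z v;have kz : cdom i z.1 by near: z.
have Uz : U z by near: z.
have Uz' : U' z by near: z.
have Um : U (z.1, z.2 + v) by apply: (HAB (z, v));split=> /=;[near: z|near: v].
have := HU _ _ Uz Um;rewrite (_ : pchart i _ - _ = (0, v));last first.
 by rewrite /pchart [LHS]surjective_pairing /= subrr addrC addKr.
have h2 := HU' z _ (0, v) Uz' (lsurj_pchart kz) (gradLP (SD kz)).
move=> h1;rewrite norm_0pair in h1;rewrite norm_0pair in h2.
change (`|F (z.1, z.2 + v) - F z - dotv (vgrad z) v| <= e * `|v|);rewrite -(vgradE v kz).
set gL := gradL _ _ _ _ in h2 *;set l0 := L0 _ in h1 h2.
exact: dist_halves h1 h2.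
Unshelve. all: by end_near. Qed.
End Vertical.
Variables (N : nat) (G : 'I_N -> M * Y -> R)
 (SD : forall j i z, cdom i z.1 -> exists L, sdif (pchart i) (G j) z L).
Theorem almost_critical (eta c delta delta' r0 Smax CG : R) (x0 : 'I_N -> M) (P : ('I_N -> M) -> Prop) :
 let W j (x : M) (y : Y) := G j (x, y) in
 0 < eta <= 1 -> 0 < delta' -> 0 < r0 -> 0 <= CG ->
 (forall j z, `|vgrad (G j) z| <= CG) -> CG + eta < delta / 4 -> P x0 ->
 (forall x x' : 'I_N -> M, P x -> (forall j, `|iota (x' j) - iota (x j)| < delta') ->
 (forall j, `|chord iota x j| < delta) -> (forall j, `|chord iota x' j| < delta) -> P x') ->
 (forall j, `|chord iota x0 j| < delta) ->
 (forall x : 'I_N -> M, c <= action iota W x (fun=> 0)) ->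
 (forall y : 'I_N -> Y, action iota W x0 y <= Smax) ->
 (forall (y : 'I_N -> Y) j, r0 <= `|y j| -> action iota W x0 y <= c - eta) ->
 exists (x : 'I_N -> M) (y : 'I_N -> Y), [/\ P x, forall j, `|chord iota x j| < delta, c - eta <= action iota W x y,
 forall j a, `|(1 + `|y j|) * (chord iota x j - vgrad (G j) (x j, y j)) 0 a| <= eta
 & forall k a j, `|dotv (y (ord_pred j) - y j) (field k a (x j)) - dmove ci cc cr (G j) k a (x j, y j)| <= eta].
move=> W eta01 d'0 r00 CG0 Gbnd CGd P0 Pst ch0 a0 amax afar.
(* The moves, indexed by a chart and a direction, are enumerated to fit the abstract deformation. *)
pose L := #|{: 'I_m * 'I_n}|;pose k_ (l : 'I_L) := (enum_val l).1;pose a_ (l : 'I_L) := (enum_val l).2.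
have [s0 s00 Hs] := move_cont HM gc.
have FF0 : forall l, exists C : R, forall q, `|field (k_ l) (a_ l) q| <= C.
 move=> l;have [C _ HC] := bnd_cont cM (field_cont (k := k_ l) (a := a_ l));by exists C.
have /choice[CF HCF] := FF0.
have cB r : compact ([set: M] `*` [set y : Y | `|y| <= r]).
 by apply: compact_setX => //;exact: closed_ball0_compact.
have DC k a j := dmove_cont HM gc (@SD j) (k := k) (a := a).
have Wc j : continuous (fun p : M * Y => G j (p.1, p.2)).
 move=> z;have iz := mem_chart_at A z.1;have [L1 dL] := SD j iz.
 rewrite (_ : (fun p : M * Y => _) = G j);last by apply/funext => p;rewrite -surjective_pairing.
 exact: sdif_cvg (pchart_ct iz) dL.
have Gyc j : continuous (fun p : M * Y => vgrad (G j) (p.1, p.2)).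
 rewrite (_ : (fun p : M * Y => _) = vgrad (G j));last by apply/funext => p;rewrite -surjective_pairing.
 exact: (vgrad_cont (@SD j)).
have XWc l j : continuous (fun p : M * Y => dmove ci cc cr (G j) (k_ l) (a_ l) (p.1, p.2)).
 rewrite (_ : (fun p : M * Y => _) = dmove ci cc cr (G j) (k_ l) (a_ l));last by apply/funext => p;rewrite -surjective_pairing.
 exact: DC.
have step (F : M * Y -> Y) : (forall i z, cdom i z.1 -> exists L, sdif (pchart i) F z L) -> forall l (e : R), 0 < e ->
 exists2 d : R, 0 < d & forall (s : R) q, `|s| < d ->
 `|F (move ci cc cr (k_ l) (a_ l) s q, 0) - F (q, 0) - s *: dmove ci cc cr F (k_ l) (a_ l) (q, 0)| <= e * `|s|.
 move=> SDF l e e0;have [|d d0 Hd] := @compact_step R _ R _ (fun z s => `|F (move ci cc cr (k_ l) (a_ l) s z.1, z.2) - F z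
 - s *: dmove ci cc cr F (k_ l) (a_ l) z| <= e * `|s|) (cB 0).
 by move=> z0 _;exact: (dmove_step HM gc SDF).
 exists d => // s q sd;apply: (Hd s (q, 0)) => //;by split=> //=;rewrite normr0.
have Ist l (e : R) : 0 < e -> exists2 d : R, 0 < d & forall (s : R) q, `|s| < d ->
 `|iota (move ci cc cr (k_ l) (a_ l) s q) - iota q - s *: field (k_ l) (a_ l) q| <= e * `|s|.
 exact: step SD_iotap l e.
have Wst l j (r e : R) : 0 < e -> exists2 d : R, 0 < d & forall (s : R) q (p : Y), `|s| < d -> `|p| <= r ->
 `|G j (move ci cc cr (k_ l) (a_ l) s q, p) - G j (q, p) - s * dmove ci cc cr (G j) (k_ l) (a_ l) (q, p)| <= e * `|s|.
 move=> e0;have [|d d0 Hd] := @compact_step R _ R _ (fun z s => `|G j (move ci cc cr (k_ l) (a_ l) s z.1, z.2) - G j z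
 - s *: dmove ci cc cr (G j) (k_ l) (a_ l) z| <= e * `|s|) (cB r).
 by move=> z0 _;exact: (dmove_step HM gc (@SD j)).
 by exists d => // s q p sd pr;apply: (Hd s (q, p)).
have Xu l (e : R) : 0 < e -> exists2 d : R, 0 < d & forall q q', `|iota q' - iota q| < d ->
 `|field (k_ l) (a_ l) q' - field (k_ l) (a_ l) q| <= e.
 move=> e0;have [d d0 Hd] := unif_cont cM io_c io_i e0 (field_cont (k := k_ l) (a := a_ l)).
 by exists d => // q q' h;apply: ltW;exact: Hd.
have XWu l j (r e : R) : 0 < e -> exists2 d : R, 0 < d & forall q q' (p p' : Y), `|iota q' - iota q| < d -> `|p' - p| < d ->
 `|p| <= r -> `|p'| <= r -> `|dmove ci cc cr (G j) (k_ l) (a_ l) (q', p') - dmove ci cc cr (G j) (k_ l) (a_ l) (q, p)| <= e.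
 move=> e0;pose Q (z1 z2 : R * (M * Y)) := `|dmove ci cc cr (G j) (k_ l) (a_ l) z2.2 - dmove ci cc cr (G j) (k_ l) (a_ l) z1.2| <= e.
 have [|d d0 Hd] := @unif_box R M KY cM iota io_c io_i r Q.
 move=> t x y _;exists [set z : R * (M * Y) | `|dmove ci cc cr (G j) (k_ l) (a_ l) z.2 - dmove ci cc cr (G j) (k_ l) (a_ l) (x, y)| < e / 2].
 have e2 : 0 < e / 2 by rewrite divr_gt0.
 have fc : {for (t, (x, y)), continuous (fun z : R * (M * Y) => dmove ci cc cr (G j) (k_ l) (a_ l) z.2)}.
 apply: (ct_comp (f := dmove ci cc cr (G j) (k_ l) (a_ l)) (a := snd));first exact: DC.
 exact: ct_p2.
 exact: near_dist fc e2.
 by move=> z1 z2 h1 h2;exact: dist_halves_lt h2 h1.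
 exists d => // q q' p p' h1 h2 h3 _;apply: (Hd 0 0) => //;first by rewrite lexx ler01.
 by rewrite subrr normr0.
have [C0 HC0] : exists C0 : R, forall l q, `|field (k_ l) (a_ l) q| <= C0.
 exists (\sum_l `|CF l|) => l q;apply: le_trans (HCF l q) _;rewrite (bigD1 l) //=.
 by rewrite ler_wpDr ?ler_norm // sumr_ge0.
have Xb l q : `|field (k_ l) (a_ l) q| <= Num.max 0 C0 by rewrite le_max HC0 orbT.
have C00 : 0 <= Num.max 0 C0 by rewrite le_max lexx.
have [x [y [Px cx ax ay axk]]] := @exists_almost_critical R M KY N L iota W
 (fun j (x : M) (y : Y) => vgrad (G j) (x, y)) (fun l => field (k_ l) (a_ l))
 (fun l j (x : M) (y : Y) => dmove ci cc cr (G j) (k_ l) (a_ l) (x, y)) (fun l => move ci cc cr (k_ l) (a_ l))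
 eta c delta delta' s0 (Num.max 0 C0) CG r0 Smax x0 P eta01 d'0 s00 r00
 C00 io_c Wc Gyc (fun l => field_cont (k := k_ l) (a := a_ l)) XWc
 (fun l s q => Hs (k_ l) (a_ l) s q) (fun l => move0 ci cc cr (k_ l) (a_ l)) Ist Wst
 (fun j => vgrad_step (@SD j)) Xu XWu Xb (fun j q p => Gbnd j (q, p)) CGd P0 Pst ch0 a0 amax afar CG0.
exists x, y;split=> // k a j;have := axk (enum_rank (k, a)) j.
by rewrite /act_x /k_ /a_ enum_rankK.
Qed.
End Criticality.

(** * The smoothed norm and the lifted Hamiltonian *)

Section StrictDifferentiabilityMore.
Variables (R : realType) (X : Top) (V : NM R) (c : X -> V) (x0 : X).
Lemma sdif_pair (W Z : NM R) (F : X -> W) (G : X -> Z) L K : sdif c F x0 L -> sdif c G x0 K ->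
 sdif c (fun x => (F x, G x)) x0 (fun v => (L v, K v)).
case=> [[L1 L2 [C C0 LC]] hL] [[K1 K2 [D D0 KD]] hK];split.
 split=> [u v|a v|];rewrite ?L1 ?K1 ?L2 ?K2 //.
 exists (C + D) => [|v];first exact: addr_ge0.
 rewrite norm_pair ge_max mulrDl;apply/andP;split.
 by rewrite ler_wpDr // mulr_ge0.
 by rewrite ler_wpDl // mulr_ge0.
move=> e e0;have [U nU HU] := hL e e0;have [U' nU' HU'] := hK e e0.
exists (U `&` U');first exact: filterI.
move=> x x' [Ux Ux'] [Ux1 Ux1'].
rewrite -[X in `|X|]/(F x' - F x - L (c x' - c x), G x' - G x - K (c x' - c x)).
by rewrite norm_pair ge_max HU // HU'.
Qed.
Lemma blin_fst (W : NM R) : blin (fun w : V * W => w.1).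
by split=> //;exists 1 => // w;rewrite mul1r -[X in _ <= X]/(Num.max _ _) le_max lexx. Qed.
Lemma blin_snd (W : NM R) : blin (fun w : V * W => w.2).
by split=> //;exists 1 => // w;rewrite mul1r -[X in _ <= X]/(Num.max _ _) le_max lexx orbT. Qed.
Lemma blinZ (W : NM R) (a : R) (L : V -> W) : blin L -> blin (fun v => a *: L v).
case=> h1 h2 [C C0 h3];split=> [u v|b v|];rewrite ?h1 ?scalerDr ?h2 // ?scalerA 1?mulrC //.
exists (`|a| * C) => [|v];first exact: mulr_ge0.
by rewrite normrZ -mulrA ler_wpM2l.
Qed.
Lemma sdift_sdif (T : Top) (W : NM R) (F : T -> X -> W) t L : sdift c F t x0 L -> sdif c (F t) x0 L.
case=> bL h;split=> // e e0;have [Q [[A1 B1] /= [nA nB] HQ] H] := h e e0.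
exists B1 => // x x' Bx Bx';apply: H;apply: HQ;split=> //=;exact: nbhs_singleton.
Qed.
End StrictDifferentiabilityMore.
Lemma sdif_sqrt R (s0 : R) : 0 < s0 -> sdif id (@Num.sqrt R) s0 (fun v => v * (2 * Num.sqrt s0)^-1).
move=> s00;have r0 : 0 < Num.sqrt s0 by rewrite sqrtr_gt0.
set a := (2 * Num.sqrt s0)^-1;have a0 : 0 <= a by rewrite invr_ge0 mulr_ge0 // sqrtr_ge0.
split.
 split=> [u v|b v|];rewrite ?mulrDl // -?mulrA //.
 by exists a => // v;rewrite normrM mulrC (ger0_norm a0).
move=> e e0.
have fc : {for (s0, s0), continuous (fun p : R * R => (Num.sqrt p.2 + Num.sqrt p.1)^-1)}.
 have c1 : {for (s0, s0), continuous (fun p : R * R => Num.sqrt p.2 + Num.sqrt p.1)}.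
 by apply: ctD;[apply: (ct_comp (f := @Num.sqrt R) (a := snd)) | apply: (ct_comp (f := @Num.sqrt R) (a := fst))];
 [exact: sqrt_continuous|exact: ct_p2|exact: sqrt_continuous|exact: ct_p1].
 apply: (ct_comp (f := fun u : R => u^-1)) c1;apply: inv_continuous.
 by rewrite /= gt_eqF // addr_gt0.
have := near_dist fc e0;case=> -[A B] /= [nA nB] HAB.
exists (A `&` B `&` [set s | 0 < s]).
 apply: filterI;first exact: filterI.
 exact: lt_nbhsr.
move=> s s' [[As Bs] s1] [[As' Bs'] s1'] /=.
have := HAB (s, s') (conj As Bs');rewrite /= => /ltW h.
have p1 : 0 < Num.sqrt s by rewrite sqrtr_gt0.
have p2 : 0 < Num.sqrt s' by rewrite sqrtr_gt0.
have -> : Num.sqrt s' - Num.sqrt s = (s' - s) * (Num.sqrt s' + Num.sqrt s)^-1.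
 apply: (canRL (mulfK _));first by rewrite gt_eqF // addr_gt0.
 by rewrite -subr_sqr !sqr_sqrtr // ltW.
rewrite -mulrBr normrM mulrC ler_wpM2r // /a.
by rewrite (_ : 2 * Num.sqrt s0 = Num.sqrt s0 + Num.sqrt s0) //;ring.
Qed.

Section Bracket.
Variables (R : realType) (K : nat).
Local Notation Y := 'rV[R]_K.
(** A smooth substitute for the norm: it dominates |y|, grows linearly and has bounded gradient. *)
Definition bracket (y : Y) : R := Num.sqrt (1 + dotv y y).
Lemma sdif_dotv (X : Top) (V : NM R) (c : X -> V) (x0 : X) (F G : X -> Y) L1 L2 :
 cts x0 c -> sdif c F x0 L1 -> sdif c G x0 L2 ->
 sdif c (fun x => dotv (F x) (G x)) x0 (fun v => dotv (L1 v) (G x0) + dotv (F x0) (L2 v)).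
move=> cc dF dG;apply: sdif_eq (sdif_entry 0 0 (sdif_mulmx cc dF (sdif_tr dG))) => v.
by rewrite mxE.
Qed.
Lemma sdif_bracket (y : Y) : sdif id bracket y (fun v => (bracket y)^-1 * dotv y v).
have d1 := sdif_dotv (@cvg_id _ _) (sdif_coord id y) (sdif_coord id y).
have d2 := sdifD (sdif_cst id y (1 : R)) d1.
have s0 : 0 < 1 + dotv y y by rewrite ltr_wpDr // dotv_ge0.
have yc : cts y (fun y : Y => 1 + dotv y y) by exact: sdif_cvg (@cvg_id _ _) d2.
apply: sdif_eq (sdif_comp (d := id) (h := fun y => 1 + dotv y y) (G := @Num.sqrt R) yc d2 (sdif_sqrt s0)) => v /=.
rewrite add0r (dotvC v y) -/(bracket y);have b0 : 0 < bracket y by rewrite sqrtr_gt0.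
field;by rewrite gt_eqF.
Qed.
Lemma bracket_ge1 (y : Y) : 1 <= bracket y.
by rewrite -[leLHS]sqrtr1 ler_wsqrtr // lerDl dotv_ge0. Qed.
Lemma bracket_ge (y : Y) : `|y| <= bracket y.
rewrite -[leLHS]ger0_norm // -sqrtr_sqr ler_wsqrtr //.
by apply: le_trans (dotv_ge_norm y) _;rewrite lerDr.
Qed.
Lemma bracket_le (y : Y) : bracket y <= 1 + K%:R * `|y|.
rewrite -[leRHS]ger0_norm ?addr_ge0 ?mulr_ge0 // -sqrtr_sqr ler_wsqrtr //.
have := le_trans (ler_norm _) (dotv_norm y y);have := normr_ge0 y.
have [K0|K0] := posnP K;first by have -> : K%:R = 0 :> R by [rewrite K0];nra.
have : 1 <= K%:R :> R by rewrite ler1n. nra.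
Qed.
Lemma bracket_grad (y v : Y) : `|(bracket y)^-1 * dotv y v| <= K%:R * `|v|.
have b1 := bracket_ge1 y;have b0 : 0 < bracket y by apply: lt_le_trans b1.
rewrite normrM gtr0_norm ?invr_gt0 // mulrC ler_pdivrMr //.
apply: le_trans (dotv_norm _ _) _;rewrite -!mulrA ler_wpM2l // mulrC ler_wpM2l //;exact: bracket_ge.
Qed.
End Bracket.

Section Lift.
Variables (R : realType) (n : nat) (M : Top) (A : SA R n M)
 (HM : CCM A)
 (m : nat) (ci : 'I_m -> chart_index A) (cc : 'I_m -> 'rV[R]_n) (cr : 'I_m -> R)
 (gc : good_cover ci cc cr).
Local Notation V := 'rV[R]_n.
Implicit Types (i j : chart_index A) (x : M) (k : 'I_m).
Local Notation E := (d_iota ci cc cr).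
Local Notation KY := (m * (1 + n))%N.
Local Notation Y := 'rV[R]_KY.
Lemma d_iota_transition i j x : cdom i x -> cdom j x -> E i x = transition_jacobian i j x *m E j x.
move=> ix jx;have h := sdif_recoord (sdif_transition ix jx) (sdif_iota HM gc jx).
have U := sdif_uniq (lsurj_chart ix) (sdif_iota HM gc ix) h.
apply/row_matrixP => a;rewrite !rowE mulmxA;exact: U.
Qed.
Lemma cot_chartK i (w : cotangent A) : cdom i (base w) -> cot_chart_inv i (cot_chart i w) = w.
case: w => x p /= ix;rewrite /cot_chart_inv /cot_chart /= chartK //;congr Cotangent.
by rewrite -mulmxA -trmx_mul (transition_jacobianK (mem_chart_at A x) ix) trmx1 mulmx1.
Qed.
Lemma cot_chart_invK i (w : V * V) : cimg i w.1 -> cot_chart i (cot_chart_inv i w) = w.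
case: w => q p /= iq;have ix := chart_inv_dom iq.
rewrite /cot_chart_inv /cot_chart /= chart_invK //;congr pair.
by rewrite -mulmxA -trmx_mul (transition_jacobianK ix (mem_chart_at A _)) trmx1 mulmx1.
Qed.
(** The covector y o d iota at x; ambient vectors that differ by a normal one have the same lift. *)
Definition lift (z : M * Y) : cotangent A := Cotangent A z.1 (z.2 *m (E (chart_at A z.1) z.1)^T).
Definition lcoord i (z : M * Y) : V * V := (chart i z.1, z.2 *m (E i z.1)^T).
Lemma cot_chart_lift i z : cdom i z.1 -> cot_chart i (lift z) = lcoord i z.
move=> iz;rewrite /cot_chart /lcoord /lift /=;congr pair.
by rewrite -mulmxA -trmx_mul -d_iota_transition //;exact: mem_chart_at.
Qed.
Lemma lift_lcoord i z : cdom i z.1 -> lift z = cot_chart_inv i (lcoord i z).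
by move=> iz;rewrite -cot_chart_lift // cot_chartK. Qed.
Definition dE i x : V -> 'M[R]_(n, KY) := gradL (chart i) (E i) x.
Lemma sdif_dE i x : cdom i x -> sdif (chart i) (E i) x (dE i x).
by move=> ix;apply: gradLP;exact: (sdif_d_iota HM gc). Qed.
Lemma sdif_pchart_fst (W : NM R) i (f : M -> W) (z : M * Y) L : sdif (chart i) f z.1 L ->
 sdif (pchart i) (fun z => f z.1) z (fun v => L v.1).
move=> df;have bL : blin L by case: df.
have := sdif_comp (c := @pchart R n M A Y i) (d := chart i) (h := fst) (G := f) (x0 := z) (L := fst).
move=> /(_ L (@ct_p1 _ _ z));apply=> //.
exact: (sdif_lin (K := fst) (blin_fst V Y) (sdif_coord _ _)).
Qed.
Lemma sdif_lcoord i z : cdom i z.1 -> sdif (pchart i) (lcoord i) z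
 (fun v => (v.1, v.2 *m (E i z.1)^T + z.2 *m (dE i z.1 v.1)^T)).
move=> iz;apply: sdif_pair.
 exact: (sdif_lin (K := fst) (blin_fst V Y) (sdif_coord _ _)).
have d2 : sdif (pchart i) (fun z : M * Y => z.2) z snd.
 exact: (sdif_lin (K := snd) (blin_snd V Y) (sdif_coord _ _)).
exact: (sdif_mulmx (pchart_ct iz) d2 (sdif_tr (sdif_pchart_fst (sdif_dE iz)))).
Qed.
Variable Ht : R -> cotangent A -> R.
Definition hloc i t (w : V * V) : R := Ht t (cot_chart_inv i w).
Variables (SDT : forall i t w, cimg i w.1 -> exists L, sdift id (hloc i) t w L).
Lemma lsurj_id (W : NM R) (w : W) : lsurj id w.
move=> v U nU;have c1 : {for (0 : R), continuous (fun s : R => w + s *: v)}.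
 by apply: ctD;[exact: ct_cst|apply: ctZ;[exact: cvg_id|exact: ct_cst]].
have : \forall s \near (0 : R), U (w + s *: v) by apply: c1;rewrite scale0r addr0.
case/nbhs_ballP => e /= e0 He;near=> s.
exists (w + s *: v) => //;apply: He;rewrite -ball_normE /= sub0r normrN gtr0_norm.
 by near: s;exact: nbhs_right_lt.
by near: s;exact: nbhs_right_gt.
Unshelve. all: by end_near. Qed.
Definition dH i t (w : V * V) : V * V -> R := gradL id (hloc i t) w.
Definition Hq i t w : V := \row_a dH i t w (delta_mx 0 a, 0).
Definition Hp i t w : V := \row_a dH i t w (0, delta_mx 0 a).
Lemma sdift_dH i t w : cimg i w.1 -> sdift id (hloc i) t w (dH i t w).
move=> iw;have [L dL] := SDT t iw;have d := sdift_sdif dL.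
have ls : lsurj id w by exact: lsurj_id.
have U := gradLE ls d.
by have -> : dH i t w = L by apply/funext.
Qed.
Lemma dHE i t w v u : cimg i w.1 -> dH i t w (v, u) = dotv (Hq i t w) v + dotv (Hp i t w) u.
move=> iw;have [bL _] := sdift_dH t iw;have [hD _ _] := bL.
have -> : (v, u) = (v, 0) + (0, u) :> V * V by rewrite -[RHS]/(v + 0, 0 + u) addr0 add0r.
rewrite hD;congr (_ + _).
 apply: (blin_dotv (f := fun v => dH i t w (v, 0)) v).
 apply: (blin_comp (K := fun v : V => ((v, 0) : V * V)) bL).
 split=> [a b|a b|];first by rewrite -[RHS]/(a + b, 0 + 0) addr0.
 by rewrite -[RHS]/(a *: b, a *: 0) scaler0.
 by exists 1 => // b;rewrite norm_pair0 mul1r.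
apply: (blin_dotv (f := fun u => dH i t w (0, u)) u).
exact: (blin_comp (K := fun u : V => ((0, u) : V * V)) bL (blin_0pair V V)).
Qed.
Lemma dH_cont i t w v : cimg i w.1 -> {for (t, w), continuous (fun p : R * (V * V) => dH i p.1 p.2 v)}.
move=> iw;apply/cvgrPdist_le => e e0.
have e1 : 0 < e / (`|v| + 1) by rewrite divr_gt0 // ltr_wpDl.
have [Q nQ HQ] := sdift_grad e1 (sdift_dH t iw).
have nimg : \forall p \near (t, w), cimg i p.2.1.
 apply: (@ct_p21 _ _ _ (t, w));apply: open_nbhs_nbhs;split=> //;exact: open_chart_img.
near=> p;rewrite distrC;have Qp : Q (p.1, p.2) by rewrite -surjective_pairing;near: p.
have ip : cimg i p.2.1 by near: p.
have ls : lsurj id p.2 by exact: lsurj_id.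
have h : `|dH i p.1 p.2 v - dH i t w v| <= e / (`|v| + 1) * `|v| := HQ p.1 p.2 _ v Qp ls (sdift_dH p.1 ip).
apply: (le_trans h).
by rewrite mulrAC ler_pdivrMr ?ltr_wpDl // ler_wpM2l ?lerDl // ltW.
Unshelve. all: by end_near. Qed.
Lemma Hq_cont i t w : cimg i w.1 -> {for (t, w), continuous (fun p : R * (V * V) => Hq i p.1 p.2)}.
move=> iw;apply: continuous_mx => b a.
rewrite (_ : (fun p => _) = (fun p : R * (V * V) => dH i p.1 p.2 (delta_mx 0 a, 0)));last by apply/funext => p;rewrite mxE.
exact: dH_cont.
Qed.
Lemma Hp_cont i t w : cimg i w.1 -> {for (t, w), continuous (fun p : R * (V * V) => Hp i p.1 p.2)}.
move=> iw;apply: continuous_mx => b a.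
rewrite (_ : (fun p => _) = (fun p : R * (V * V) => dH i p.1 p.2 (0, delta_mx 0 a)));last by apply/funext => p;rewrite mxE.
exact: dH_cont.
Qed.
Variable kappa : R.
(** The pulled back Hamiltonian is constant along normal directions. The added term controls the
    normal part of y, is zero at y = 0, and disappears as [kappa] tends to 0. *)
Definition Hk t (z : M * Y) : R := Ht t (lift z) + kappa * (bracket z.2 - 1).
Lemma sdif_Hk i t z : cdom i z.1 -> sdif (pchart i) (Hk t) z
 (fun v => dotv (Hq i t (lcoord i z)) v.1 + dotv (Hp i t (lcoord i z)) (v.2 *m (E i z.1)^T + z.2 *m (dE i z.1 v.1)^T)
 + kappa * ((bracket z.2)^-1 * dotv z.2 v.2)).
move=> iz;have iw : cimg i (lcoord i z).1 by exact: chart_imgP.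
have lc : cts z (lcoord i) by exact: sdif_cvg (pchart_ct iz) (sdif_lcoord iz).
have d1 := sdif_comp (d := id) (h := lcoord i) (G := hloc i t) lc (sdif_lcoord iz) (sdift_sdif (sdift_dH t iw)).
have d2 := sdif_comp (d := id) (h := snd) (G := @bracket R KY) (c := @pchart R n M A Y i) (x0 := z) (L := snd) (@ct_p2 _ _ z).
have d3 := d2 _ (sdif_lin (K := snd) (blin_snd V Y) (sdif_coord _ _)) (sdif_bracket z.2).
have d4 := sdifD d3 (sdif_cst (pchart i) z (- 1 : R)).
have bk : blin (fun a : R => kappa * a) by exact: (blinZ kappa (blin_id (R : NM R))).
have d5 := sdif_lin bk d4.
apply: (@sdif_near _ _ _ _ _ _ (fun z => hloc i t (lcoord i z) + kappa * (bracket z.2 - 1))).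
 by apply: filterS (near_pdom iz) => z' iz';rewrite /Hk (lift_lcoord iz').
apply: sdif_eq (sdifD d1 d5) => v;rewrite /= addr0;congr (_ + _).
by rewrite dHE.
Qed.
End Lift.
Lemma compact_ub_rel R (Z : Top) (K : set Z) (P : Z -> R -> Prop) : compact K ->
 (forall z (C C' : R), C <= C' -> P z C -> P z C') ->
 (forall z, K z -> exists C : R, \forall z' \near z, P z' C) ->
 exists2 C : R, 0 < C & forall z, K z -> P z C.
move=> cK mono fC;have : \forall C \near +oo, K `<=` [set z | P z C].
 have /compact_near_coveringP := cK;apply => z Kz;have [C HC] := fC z Kz.
 exists ([set z' | P z' C], [set C' | C <= C']).
 by split=> //;apply: nbhs_pinfty_ge;exact: num_real.
 by move=> [z' C'] /= [h1 h2];exact: mono h2 h1.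
move=> h;have [C [HC C0]] : exists C : R, (K `<=` [set z | P z C]) /\ 0 < C.
 near (+oo : set_system R) => C;exists C;split;near: C => //;apply: nbhs_pinfty_gt;exact: num_real.
by exists C.
Unshelve. all: by end_near. Qed.
Lemma near_bnd R (Z : Top) (W : NM R) (f : Z -> W) z : cts z f ->
 \forall z' \near z, `|f z'| <= `|f z| + 1.
move=> fc;have : \forall z' \near z, `|f z'| < `|f z| + 1 by apply: near_lt (ct_norm fc) _;rewrite ltrDl.
by apply: filterS => z' /ltW.
Qed.
Lemma fin_ub R (I : finType) (f : I -> R) : exists2 C : R, 0 < C & forall i, f i <= C.
exists (1 + \sum_i `|f i|);first by rewrite ltr_wpDr // sumr_ge0.
move=> i;rewrite (bigD1 i) //= addrCA;apply: le_trans (ler_norm _) _;rewrite lerDl.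
by apply: addr_ge0 => //;apply: sumr_ge0.
Qed.
Lemma le_sum2 R (I J : finType) (f : I -> J -> R) k a : (forall k a, 0 <= f k a) -> f k a <= \sum_k \sum_a f k a.
move=> f0;rewrite (bigD1 k) //= (bigD1 a) //= -addrA lerDl;apply: addr_ge0;first by apply: sumr_ge0.
by apply: sumr_ge0 => k' _;apply: sumr_ge0.
Qed.

(** * Uniform constants of the embedding and of the Hamiltonian *)

Section Constants.
Variables (R : realType) (n : nat) (M : Top) (A : SA R n M)
 (HM : CCM A)
 (m : nat) (ci : 'I_m -> chart_index A) (cc : 'I_m -> 'rV[R]_n) (cr : 'I_m -> R)
 (gc : good_cover ci cc cr).
Local Notation V := 'rV[R]_n.
Implicit Types (i j : chart_index A) (x : M) (k : 'I_m).
Local Notation iota := (iota_emb ci cc cr).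
Local Notation E := (d_iota ci cc cr).
Local Notation xi := (xi ci cc cr).
Local Notation KY := (m * (1 + n))%N.
Local Notation Y := 'rV[R]_KY.
Let cM : compact [set: M]. by case: HM. Qed.
Let io_c := iota_cont HM gc.
Let io_i := iota_inj gc.
Let cr0 k : 0 < cr k. by case: gc. Qed.
Lemma E_ct i x : cdom i x -> cts x (E i).
by move=> ix;exact: sdif_cvg (chart_ct ix) (sdif_dE HM gc ix). Qed.
Lemma dE_bnd i x : cdom i x -> exists C : R, \forall x' \near x, `|E i x'| <= C /\ forall v, `|dE ci cc cr i x' v| <= C * `|v|.
move=> ix;have h1 := near_bnd (E_ct ix).
have d := sdif_dE HM gc ix;have [U nU HU] := sdif_grad ltr01 d.
have [[_ _ [C C0 HC]] _] := d;exists (`|E i x| + 1 + (C + 1)).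
have idom := nbhs_chart_dom ix.
near=> x';have ix' : cdom i x' by near: x'.
split;first by apply: le_trans (_ : `|E i x| + 1 <= _);[near: x'|rewrite lerDl addr_ge0].
move=> v;have Ux : U x' by near: x'.
have := HU x' _ v Ux (lsurj_chart ix') (sdif_dE HM gc ix') => h2.
have h3 := HC v;have := ler_distD 0 (dE ci cc cr i x' v) (dE ci cc cr i x v).
rewrite mul1r in h2;have h4 : `|dE ci cc cr i x' v| <= `|dE ci cc cr i x' v - dE ci cc cr i x v| + `|dE ci cc cr i x v|.
 by rewrite -{1}[dE ci cc cr i x' v](subrK (dE ci cc cr i x v)) ler_normD.
move=> _;apply: le_trans h4 _;apply: le_trans (lerD h2 h3) _.
rewrite -[X in X + _]mul1r -mulrDl ler_wpM2r //;have := normr_ge0 (E i x);lra.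
Unshelve. all: by end_near. Qed.
Lemma E_bnd : exists2 C : R, 0 < C & forall k x, xi k x != 0 ->
 `|E (ci k) x| <= C /\ forall v, `|dE ci cc cr (ci k) x v| <= C * `|v|.
have /choice[CC HCC] : forall k, exists C : R, forall x, xi k x != 0 ->
 `|E (ci k) x| <= C /\ forall v, `|dE ci cc cr (ci k) x v| <= C * `|v|.
 move=> k;have [|x _|C _ HC] := @compact_ub_rel R M setT (fun x C => xi k x != 0 ->
 `|E (ci k) x| <= C /\ forall v, `|dE ci cc cr (ci k) x v| <= C * `|v|) cM;last by exists C => x;exact: HC.
 move=> x C C' CC' h /h[h1 h2];split;first exact: le_trans CC'.
 by move=> v;apply: le_trans (h2 v) _;rewrite ler_wpM2r.
 have [b0|b0] := eqVneq (beta ci cc cr k x) 0.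
 by exists 0;apply: filterS (xi_near0 HM gc b0) => x' ->;rewrite eqxx.
 have [kx _] : cdom (ci k) x /\ beta ci cc cr k x = height cc cr k (chart (ci k) x).
 by apply: beta_gt0;rewrite lt_neqAle eq_sym b0 beta_ge0.
 by have [C HC] := dE_bnd kx;exists C;apply: filterS HC.
have [C C0 HC] := fin_ub CC;exists C => // k x xk;have [h1 h2] := HCC k x xk.
split;first exact: le_trans (HC k).
by move=> v;apply: le_trans (h2 v) _;rewrite ler_wpM2r.
Qed.
(** Size of the tangential part of y, measured by its values on the finitely many move fields. *)
Definition tang x (y : Y) : R := \sum_k \sum_a `|dotv y (field ci cc cr k a x)|.
Lemma tang_ge k a x (y : Y) : `|dotv y (field ci cc cr k a x)| <= tang x y.
exact: (le_sum2 (f := fun k a => `|dotv y (field ci cc cr k a x)|) k a (fun k a => normr_ge0 _)).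
Qed.
Lemma tang_ge0 x (y : Y) : 0 <= tang x y.
by apply: sumr_ge0 => k _;apply: sumr_ge0 => a _;exact: normr_ge0. Qed.
Lemma tang_chart k x (y : Y) : cdom (ci k) x -> xi k x = 1 -> `|y *m (E (ci k) x)^T| <= tang x y.
move=> kx x1;apply: mx_norm_le => [|i a];first exact: tang_ge0.
rewrite ord1;apply: le_trans (tang_ge k a x y);rewrite (fieldE HM gc) // x1 scale1r.
by rewrite dotvC dotv_mul dotv_delta.
Qed.
Definition gram i x : 'M[R]_n := E i x *m (E i x)^T.
Lemma gram_unit i x : cdom i x -> gram i x \in unitmx.
move=> ix;rewrite -row_free_unit -kermx_eq0;apply/eqP/row_matrixP => a;rewrite row0.
have h : row a (kermx (gram i x)) *m gram i x = 0 by rewrite -row_mul mulmx_ker row0.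
set v := row a _ in h *;apply: (d_iota_inj gc ix).
have : dotv (v *m E i x) (v *m E i x) = 0.
 by rewrite dotv_mul -mulmxA -/(gram i x) h dotv0r.
move=> h0;apply/eqP;rewrite -normr_le0 -[_ <= 0]andTb;have := dotv_ge_norm (v *m E i x);rewrite h0 => h1.
by have := normr_ge0 (v *m E i x);nra.
Qed.
Lemma gram_ct i x : cdom i x -> cts x (fun x => invmx (gram i x)).
move=> ix;have d := sdif_dE HM gc ix.
exact: sdif_cvg (chart_ct ix) (sdif_invmx (chart_ct ix) (sdif_mulmx (chart_ct ix) d (sdif_tr d)) (gram_unit ix)).
Qed.
(* Splitting off the component of y normal to the image of the embedding. *)
Lemma normal_split : exists2 C : R, 0 < C & forall x (y : Y), exists w : Y,
 [/\ forall i v, cdom i x -> dotv w (v *m E i x) = 0, dotv w y = dotv w w & `|y - w| <= C * tang x y].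
pose P x (C : R) := forall y : Y, exists w : Y,
 [/\ forall i v, cdom i x -> dotv w (v *m E i x) = 0, dotv w y = dotv w w & `|y - w| <= C * tang x y].
have [|x _|C C0 HC] := @compact_ub_rel R M setT P cM;last by exists C => // x;exact: HC.
 move=> x C C' CC' h y;have [w [h1 h2 h3]] := h y;exists w;split=> //.
 apply: le_trans h3 _;rewrite ler_wpM2r //;exact: tang_ge0.
have [k hk] := beta_cover gc x;have b0 : 0 < beta ci cc cr k x by apply: lt_trans hk;rewrite divr_gt0.
have [kx _] := beta_gt0 b0.
have nk : \forall x' \near x, cr k / 2 < beta ci cc cr k x'.
 have bc : cts x (fun x => - beta ci cc cr k x) by apply: ctN;exact: (beta_cont HM gc).
 have : \forall x' \near x, - beta ci cc cr k x' < - (cr k / 2) by apply: near_lt bc _;rewrite ltrN2.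
 by apply: filterS => x';rewrite ltrN2.
have n1 := near_bnd (E_ct kx);have n2 := near_bnd (gram_ct kx);have idom := nbhs_chart_dom kx.
set C1 := _ + 1 in n1;set C2 := _ + 1 in n2.
exists (n%:R * (n%:R * C2) * C1).
near=> x' => y;have kx' : cdom (ci k) x' by near: x'.
have xi1' : xi k x' = 1 by apply: (xi1 gc);near: x'.
have h1 : `|E (ci k) x'| <= C1 by near: x'.
have h2 : `|invmx (gram (ci k) x')| <= C2 by near: x'.
pose u : V := y *m (E (ci k) x')^T *m invmx (gram (ci k) x').
have wE : (y - u *m E (ci k) x') *m (E (ci k) x')^T = 0.
 by rewrite mulmxBl -[u *m _ *m _]mulmxA -/(gram _ _) /u -mulmxA mulVmx ?gram_unit // mulmx1 subrr.
have nT i v : cdom i x' -> dotv (y - u *m E (ci k) x') (v *m E i x') = 0.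
 move=> ix';rewrite (d_iota_transition HM gc ix' kx') mulmxA dotvC dotv_mul dotvC.
 by rewrite wE dotv0l.
exists (y - u *m E (ci k) x');split=> //.
 by rewrite [RHS]dotvBr nT // subr0.
rewrite opprB addrC subrK.
apply: le_trans (mulmx_norm _ _) _.
have h3 := tang_chart y kx' xi1'.
have h4 : `|u| <= n%:R * C2 * tang x' y.
 apply: le_trans (mulmx_norm _ _) _;rewrite -!mulrA ler_wpM2l // mulrC.
 by apply: ler_pM.
rewrite -!mulrA ler_wpM2l // mulrA.
have -> : n%:R * C2 * (C1 * tang x' y) = (n%:R * C2 * tang x' y) * C1 by ring.
by apply: ler_pM.
Unshelve. all: by end_near. Qed.
(** Inverse estimate for an immersion: the matrix E^T (E E^T)^-1 bounds |v| by B |v E|, and with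
    strictness tolerance 1 / (2 (B + 1)) the error is absorbed on the left. *)
Lemma chart_lip i x : cdom i x -> exists2 C : R, 0 < C & exists2 U : set M, nbhs x U &
 forall x1 x2, U x1 -> U x2 -> `|chart i x2 - chart i x1| <= C * `|iota x2 - iota x1|.
move=> ix;have [bL dL] := sdif_iota HM gc ix.
pose B := n%:R * (KY%:R * `|(E i x)^T|) * `|invmx (gram i x)|.
have B0 : 0 <= B by rewrite /B !mulr_ge0.
have key (v : V) : `|v| <= B * `|v *m E i x|.
 have E1 : v = v *m E i x *m (E i x)^T *m invmx (gram i x).
 by rewrite -[v *m _ *m _]mulmxA -/(gram _ _) mulmxK // gram_unit.
 rewrite {1}E1;apply: le_trans (mulmx_norm _ _) _.
 have h := mulmx_norm (v *m E i x) (E i x)^T.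
 rewrite /B [X in _ <= X]mulrAC ler_wpM2r // -[X in _ <= X]mulrA ler_wpM2l //.
 by rewrite mulrAC.
have e0 : 0 < (2 * (B + 1))^-1 by rewrite invr_gt0 mulr_gt0 // ltr_wpDl.
have [U nU HU] := dL _ e0;exists (2 * (B + 1));first by rewrite mulr_gt0 // ltr_wpDl.
exists U => // x1 x2 U1 U2;have := HU _ _ U1 U2;set v := chart i x2 - _.
set c := iota x2 - _ => h;have := key v;set q := v *m E i x in h * => h1.
have h2 : `|q| <= `|c| + (2 * (B + 1))^-1 * `|v|.
 have := ler_distD c q 0;rewrite !subr0 distrC;lra.
have h3 : B * `|q| <= B * `|c| + 2^-1 * `|v|.
 apply: le_trans (ler_wpM2l B0 h2) _;rewrite mulrDr lerD2l mulrA ler_wpM2r //.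
 rewrite invfM mulrCA ler_piMr ?invr_ge0 // ler_pdivrMr ?ltr_wpDl //;lra.
have := normr_ge0 c;nra.
Qed.
End Constants.
Lemma norm_trmx_le R p q (B : 'M[R]_(p, q)) : `|B^T| <= `|B|.
by apply: mx_norm_le => // i j;rewrite mxE;exact: mx_entry_le. Qed.
Lemma norm_delta_le R q (a : 'I_q) : `|delta_mx 0 a : 'rV[R]_q| <= 1.
by apply: mx_norm_le => // i j;rewrite mxE;case: (_ && _);rewrite ?normr1 ?normr0. Qed.
Lemma clamp_lip R (a b : R) :
 `|Num.max 0 (Num.min 1 a) - Num.max 0 (Num.min 1 b)| <= `|a - b|.
wlog ab : a b / b <= a => [H|].
 by have [h|/ltW h] := leP b a;[exact: H|rewrite distrC [leRHS]distrC;exact: H].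
rewrite [leRHS]ger0_norm ?subr_ge0 //.
have h : Num.max 0 (Num.min 1 b) <= Num.max 0 (Num.min 1 a) by apply: le_max2 => //;exact: le_min2.
rewrite ger0_norm ?subr_ge0 // lerBlDr ge_max.
have m0 : 0 <= Num.max 0 (Num.min 1 b) by rewrite le_max lexx.
apply/andP;split;first lra.
have m1 : Num.min 1 a <= 1 by rewrite ge_min lexx.
have m2 : 1 <= Num.max 0 1 :> R by rewrite le_max lexx orbT.
have [b1|b1] := leP 1 b;first by lra.
rewrite ge_min;apply/orP;right.
have : b <= Num.max 0 b by rewrite le_max lexx orbT. lra.
Qed.
Lemma max0_lip R (a b : R) : `|Num.max 0 a - Num.max 0 b| <= `|a - b|.
wlog ab : a b / b <= a => [H|].
 by have [h|/ltW h] := leP b a;[exact: H|rewrite distrC [leRHS]distrC;exact: H].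
have h : Num.max 0 b <= Num.max 0 a by apply: le_max2.
rewrite !ger0_norm ?subr_ge0 // lerBlDr ge_max.
have m0 : 0 <= Num.max 0 b by rewrite le_max lexx.
have : b <= Num.max 0 b by rewrite le_max lexx orbT.
by move=> h1;apply/andP;split;lra.
Qed.

Section Bounds.
Variables (R : realType) (n : nat) (M : Top) (A : SA R n M)
 (HM : CCM A)
 (m : nat) (ci : 'I_m -> chart_index A) (cc : 'I_m -> 'rV[R]_n) (cr : 'I_m -> R)
 (gc : good_cover ci cc cr).
Local Notation V := 'rV[R]_n.
Implicit Types (i j : chart_index A) (x : M) (k : 'I_m).
Local Notation iota := (iota_emb ci cc cr).
Local Notation E := (d_iota ci cc cr).
Local Notation dE := (dE ci cc cr).
Local Notation xi := (xi ci cc cr).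
Local Notation field := (field ci cc cr).
Local Notation KY := (m * (1 + n))%N.
Let cM : compact [set: M]. by case: HM. Qed.
Let io_c := iota_cont HM gc.
Let io_i := iota_inj gc.
Let cr0 k : 0 < cr k. by case: gc. Qed.
(** One constant is both the slope and the inverse of the radius; the property is then monotone in
    it and compactness applies. *)
Lemma global_lip (W : NM R) (f : M -> W) :
 (forall x, exists C : R, exists2 U : set M, nbhs x U &
 forall x1 x2, U x1 -> U x2 -> `|f x2 - f x1| <= C * `|iota x2 - iota x1|) ->
 exists2 C : R, 0 < C & forall x x', `|iota x' - iota x| < C^-1 -> `|f x' - f x| <= C * `|iota x' - iota x|.
move=> H;pose P x (C : R) := 0 < C /\ forall x', `|iota x' - iota x| < C^-1 -> `|f x' - f x| <= C * `|iota x' - iota x|.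
have [|x _|C C0 HC] := @compact_ub_rel R M setT P cM;last by exists C => // x;case: (HC x).
 move=> x C C' CC' [C0 h];have C'0 : 0 < C' by apply: lt_le_trans CC'.
 split=> // x' hx;apply: le_trans (h _ _) _;last by rewrite ler_wpM2r.
 by apply: lt_le_trans hx _;rewrite lef_pV2.
have [C [U nU HU]] := H x;have [r r0 Hr] := iota_ball cM io_c io_i nU.
have r2 : 0 < r / 2 by rewrite divr_gt0.
pose C' := 1 + `|C| + (r / 2)^-1.
have i0 : 0 < (r / 2)^-1 by rewrite invr_gt0.
have C'0 : 0 < C' by rewrite /C';have := normr_ge0 C;lra.
have n1 : \forall x1 \near x, `|iota x1 - iota x| < r / 2 by apply: near_dist r2;exact: io_c.
exists C';apply: filterS n1 => x1 h1;split=> // x2 h2.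
have h3 : `|iota x2 - iota x1| < r / 2.
 apply: lt_le_trans h2 _;rewrite -[leRHS]invrK lef_pV2 ?posrE //.
 by rewrite /C';have := normr_ge0 C;lra.
apply: le_trans (HU _ _ _ _) _.
- by apply: Hr;lra.
- by apply: Hr;have := ler_distD (iota x1) (iota x2) (iota x);lra.
- by rewrite ler_wpM2r // /C';have := ler_norm C;lra.
Qed.
Lemma field_lip : exists2 C : R, 0 < C & forall k a x x', `|iota x' - iota x| < C^-1 ->
 `|field k a x' - field k a x| <= C * `|iota x' - iota x|.
have key k a : exists2 C : R, 0 < C & forall x x', `|iota x' - iota x| < C^-1 ->
 `|field k a x' - field k a x| <= C * `|iota x' - iota x|.
 apply: global_lip => x;have [b0|b0] := eqVneq (beta ci cc cr k x) 0.
 exists 0;exists [set y | xi k y = 0];first exact: (xi_near0 HM gc).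
 have f0 y : xi k y = 0 -> field k a y = 0.
 by move=> y0;rewrite /field /Submission.field /dmove y0 scale0r;case: ifP.
 by move=> x1 x2 /= /f0 -> /f0 ->;rewrite subrr normr0 mul0r.
 have [kx _] : cdom (ci k) x /\ beta ci cc cr k x = height cc cr k (chart (ci k) x).
 by apply: beta_gt0;rewrite lt_neqAle eq_sym b0 beta_ge0.
 have [C1 C10 [U1 nU1 H1]] := chart_lip HM gc kx.
 have dh := sdif_of_chart kx (sdif_height cc cr k (chart (ci k) x)).
 have [C2 C20 [U2 nU2 H2]] := sdif_lip dh.
 have [C3 C30 [U3 nU3 H3]] := sdif_lip (sdif_dE HM gc kx).
 have n4 := near_bnd (E_ct HM gc kx);have n5 := nbhs_chart_dom kx.
 pose B := `|E (ci k) x| + 1;have B0 : 0 <= B by rewrite addr_ge0.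
 pose c4 := 4 / cr k;have c40 : 0 <= c4 by rewrite divr_ge0 // ltW.
 exists (c4 * (C2 * C1) * (n%:R * B) + n%:R * (C3 * C1)).
 exists (U1 `&` U2 `&` U3 `&` [set x' | `|E (ci k) x'| <= B /\ cdom (ci k) x']).
 by do ![apply: filterI => //].
 move=> x1 x2 [[[u1 u2] u3] [b1 k1]] [[[v1 v2] v3] [b2 k2]].
 have hc := H1 _ _ u1 v1;set d := `|iota x2 - iota x1| in hc *.
 have hh : `|height cc cr k (chart (ci k) x2) - height cc cr k (chart (ci k) x1)| <= C2 * C1 * d.
 by apply: le_trans (H2 _ _ u2 v2) _;rewrite -mulrA ler_wpM2l // ltW.
 have hE : `|E (ci k) x2 - E (ci k) x1| <= C3 * C1 * d.
 by apply: le_trans (H3 _ _ u3 v3) _;rewrite -mulrA ler_wpM2l // ltW.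
 have hx : `|xi k x2 - xi k x1| <= c4 * (C2 * C1 * d).
 rewrite /xi /Submission.xi;apply: le_trans (clamp_lip _ _) _.
 rewrite (_ : _ - _ - _ = c4 * (beta ci cc cr k x2 - beta ci cc cr k x1));last by rewrite /c4;ring.
 rewrite normrM (ger0_norm c40) ler_wpM2l //.
 rewrite !betaE //;apply: le_trans (max0_lip _ _) _;exact: hh.
 rewrite !(fieldE HM gc) //.
 have -> : xi k x2 *: ((delta_mx 0 a : V) *m E (ci k) x2) - xi k x1 *: ((delta_mx 0 a : V) *m E (ci k) x1) =
 (xi k x2 - xi k x1) *: ((delta_mx 0 a : V) *m E (ci k) x2) + xi k x1 *: ((delta_mx 0 a : V) *m (E (ci k) x2 - E (ci k) x1)).
 by rewrite scalerBl mulmxBr scalerBr addrA subrK.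
 apply: le_trans (ler_normD _ _) _;rewrite !normrZ mulrDl;apply: lerD.
 rewrite mulrAC;apply: ler_pM => //;first by rewrite -mulrA.
 apply: le_trans (mulmx_norm _ _) _;rewrite -mulrA ler_wpM2l //.
 by rewrite -[leRHS]mul1r;apply: ler_pM => //;exact: norm_delta_le.
 have /andP[x0 x1'] := xi_itv ci cc cr k x1;rewrite (ger0_norm x0).
 apply: le_trans (_ : 1 * `|(delta_mx 0 a : V) *m (E (ci k) x2 - E (ci k) x1)| <= _);first exact: ler_wpM2r.
 rewrite mul1r;apply: le_trans (mulmx_norm _ _) _;rewrite -!mulrA ler_wpM2l //.
 rewrite -[leRHS]mul1r;apply: ler_pM => //;first exact: norm_delta_le.
 by rewrite mulrA.
have /choice[CC HCC] : forall ka : 'I_m * 'I_n, exists C : R, 0 < C /\ forall x x', `|iota x' - iota x| < C^-1 ->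
 `|field ka.1 ka.2 x' - field ka.1 ka.2 x| <= C * `|iota x' - iota x|.
 by move=> ka;have [C C0 HC] := key ka.1 ka.2;exists C.
have [C C0 HC] := fin_ub CC;exists C => // k a x x' h.
have [h0 h1] := HCC (k, a);apply: le_trans (h1 x x' _) _.
 by apply: lt_le_trans h _;rewrite lef_pV2 ?posrE //;exact: (HC (k, a)).
by rewrite ler_wpM2r //;exact: (HC (k, a)).
Qed.
(** Makes the pairing of a chord with a normal vector small relative to the chord, uniformly on
    M. *)
Lemma chord_tangent (e : R) : 0 < e -> exists2 d : R, 0 < d & forall x x', `|iota x' - iota x| < d ->
 exists i (v : V), cdom i x /\ `|iota x' - iota x - v *m E i x| <= e * `|iota x' - iota x|.
move=> e0;pose Q x x' := exists i (v : V), cdom i x /\ `|iota x' - iota x - v *m E i x| <= e * `|iota x' - iota x|.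
have [|d d0 Hd] := @unif_base R M KY cM iota io_c io_i Q;last by exists d.
move=> x0;have ix := mem_chart_at A x0;set i := chart_at A x0 in ix.
have [C C0 [U nU HU]] := chart_lip HM gc ix.
pose e1 := e / ((1 + n%:R) * C);have e10 : 0 < e1 by rewrite divr_gt0 // mulr_gt0 // ltr_wpDr.
have [U' nU' HU'] := (sdif_iota HM gc ix).2 _ e10.
have n1 := near_dist (E_ct HM gc ix) e10.
exists (U `&` U' `&` [set x | `|E i x - E i x0| < e1] `&` cdom i).
 apply: filterI;last exact: nbhs_chart_dom.
 by do ![apply: filterI => //].
move=> x x' [[[u1 u2] u3] u4] [[[v1 v2] v3] v4].
exists i, (chart i x' - chart i x);split=> //.
have h1 := HU _ _ u1 v1;have h2 := HU' _ _ u2 v2.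
set D := chart i x' - chart i x in h1 h2 *;set c := iota x' - iota x in h1 h2 *.
rewrite (_ : c - D *m E i x = (c - D *m E i x0) - D *m (E i x - E i x0));last by rewrite mulmxBr opprB addrA subrK.
apply: le_trans (ler_normB _ _) _.
have h3 : `|D *m (E i x - E i x0)| <= n%:R * e1 * `|D|.
 apply: le_trans (mulmx_norm _ _) _;rewrite -[leRHS]mulrA -[leLHS]mulrA ler_wpM2l // mulrC ler_wpM2r //.
 exact: ltW u3.
apply: le_trans (lerD h2 h3) _;rewrite -mulrDl.
apply: le_trans (_ : (e1 + n%:R * (e1)) * (C * `|c|) <= _).
 apply: ler_wpM2l;last exact: h1.
 by apply: addr_ge0;[exact: ltW|apply: mulr_ge0 => //;exact: ltW].
rewrite mulrA ler_wpM2r //.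
have n0 : 0 < 1 + n%:R :> R by rewrite ltr_wpDr.
rewrite (_ : _ * C = e) // /e1;field;by rewrite !gt_eqF.
Qed.
Variables (Ht : R -> cotangent A -> R)
 (SDT : forall i t w, cimg i w.1 -> exists L, sdift id (hloc Ht i) t w L)
 (CH : R)
 (CH0 : 0 < CH)
 (BD : forall t k x, 0 <= t <= 1 -> xi k x != 0 -> forall p v u : V,
 `|dH Ht (ci k) t (chart (ci k) x, p) (v, u)| <= CH * ((1 + `|p|) * `|v| + `|u|)).
Local Notation Hk := (Hk ci cc cr Ht).
Lemma SD_Hk kappa t i z : cdom i z.1 -> exists L, sdif (pchart i) (Hk kappa t) z L.
by move=> iz;eexists;exact: (sdif_Hk HM gc SDT). Qed.
Lemma gradL_Hk kappa t i z v u : cdom i z.1 -> gradL (pchart i) (Hk kappa t) z (v, u) =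
 dotv (Hq Ht i t (lcoord ci cc cr i z)) v + dotv (Hp Ht i t (lcoord ci cc cr i z)) (u *m (E i z.1)^T + z.2 *m (dE i z.1 v)^T)
 + kappa * ((bracket z.2)^-1 * dotv z.2 u).
by move=> iz;exact: (gradLE (lsurj_pchart iz) (sdif_Hk HM gc SDT kappa t iz) (v, u)). Qed.
Lemma vgrad_Hk kappa t i z : cdom i z.1 ->
 vgrad A (Hk kappa t) z = Hp Ht i t (lcoord ci cc cr i z) *m E i z.1 + (kappa / bracket z.2) *: z.2.
move=> iz;apply/rowP => a;rewrite -[LHS]dotv_delta dotvC -(vgradE (@SD_Hk kappa t) _ iz) gradL_Hk //.
have -> : dE i z.1 0 = 0 by apply: blin0;case: (sdif_dE HM gc iz).
rewrite trmx0 mulmx0 addr0 dotv0r add0r !mxE;congr (_ + _).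
 by rewrite dotvC dotv_mul trmxK dotv_delta mxE.
by rewrite dotvC dotv_delta mulrA.
Qed.
Lemma vgrad_bnd : exists2 C : R, 0 < C & forall kappa t z, 0 <= kappa <= 1 -> 0 <= t <= 1 -> `|vgrad A (Hk kappa t) z| <= C.
have [C C0 HC] := E_bnd HM gc;exists (n%:R * CH * C + 1);first by rewrite ltr_wpDl // !mulr_ge0 // ltW.
move=> kappa t z /andP[k0 k1] t01;have [k hk] := beta_cover gc z.1.
have b0 : 0 < beta ci cc cr k z.1 by apply: lt_trans hk;rewrite divr_gt0.
have [kx _] := beta_gt0 b0.
have xk : xi k z.1 != 0 by rewrite (xi1 gc) // oner_eq0.
rewrite (vgrad_Hk _ _ kx);apply: le_trans (ler_normD _ _) _;apply: lerD.
 apply: le_trans (mulmx_norm _ _) _;apply: ler_pM => //.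
 rewrite ler_wpM2l //;apply: mx_norm_le => [|i a];first exact: ltW.
 rewrite mxE;apply: le_trans (BD t01 xk _ _ _) _;rewrite normr0 mulr0 add0r.
 by rewrite -[leRHS]mulr1 ler_wpM2l ?norm_delta_le // ltW.
 by case: (HC k z.1 xk).
have b1 := bracket_ge1 z.2;have bp : 0 < bracket z.2 by apply: lt_le_trans b1.
have c0 : 0 <= kappa / bracket z.2 by rewrite divr_ge0 // ltW.
rewrite normrZ (ger0_norm c0) mulrAC ler_pdivrMr // mul1r.
apply: le_trans (bracket_ge z.2);by rewrite ler_piMl.
Qed.
Lemma dmove_bnd : exists2 C : R, 0 < C & forall kappa t k a z, 0 <= t <= 1 ->
 `|dmove ci cc cr (Hk kappa t) k a z| <= C * (1 + `|z.2|).
have [C C0 HC] := E_bnd HM gc.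
have CK0 : 0 <= KY%:R * C by rewrite mulr_ge0 // ltW.
exists (CH * (1 + KY%:R * C + KY%:R * C)).
 by rewrite mulr_gt0 // -addrA;apply: ltr_wpDr => //;exact: addr_ge0.
move=> kappa t k a z t01.
have r0 : 0 <= CH * (1 + KY%:R * C + KY%:R * C) * (1 + `|z.2|).
 by rewrite mulr_ge0 // ?addr_ge0 // mulr_ge0 ?addr_ge0 // ltW.
rewrite /dmove;case: asboolP => [kx|_];last by rewrite normr0.
have [->|xk] := eqVneq (xi k z.1) 0;first by rewrite scale0r normr0.
have [hE hdE] := HC k z.1 xk.
have /andP[x0 x1] := xi_itv ci cc cr k z.1.
rewrite normrZ (ger0_norm x0).
set G := gradL _ _ _ _.
apply: le_trans (_ : 1 * `|G| <= _);first exact: ler_wpM2r.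
rewrite mul1r /G gradL_Hk // dotv0r !mulr0 addr0 mul0mx add0r.
have iw : cimg (ci k) (lcoord ci cc cr (ci k) z).1 by exact: chart_imgP.
rewrite -(dHE SDT _ _ _ iw);apply: le_trans (BD t01 xk _ _ _) _.
set p := z.2 *m (E (ci k) z.1)^T;set q := z.2 *m _.
have hp : `|p| <= KY%:R * C * `|z.2|.
 apply: le_trans (mulmx_norm _ _) _;rewrite mulrAC ler_wpM2r // ler_wpM2l //.
 exact: le_trans (norm_trmx_le _) hE.
have hq : `|q| <= KY%:R * C * `|z.2|.
 apply: le_trans (mulmx_norm _ _) _;rewrite mulrAC ler_wpM2r // ler_wpM2l //.
 apply: le_trans (norm_trmx_le _) _;apply: le_trans (hdE _) _.
 by rewrite -[leRHS]mulr1 ler_wpM2l ?norm_delta_le // ltW.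
have hd := norm_delta_le R a;rewrite -mulrA ler_wpM2l ?(ltW CH0) //.
have h1 : (1 + `|p|) * `|delta_mx 0 a : V| <= 1 + `|p| by rewrite ler_piMr // addr_ge0.
set D1 := (1 + `|p|) * _ in h1 *.
move: hp hq h1 CK0 (normr_ge0 z.2);move: D1 (`|p|) (`|q|) (`|z.2|) (KY%:R * C) => D1 D2 D3 D4 D5 *.
nra.
Qed.
End Bounds.

(** * A priori bounds for almost orbits *)

Section CyclicGrowth.
Variables (R : realType) (N : nat).
Lemma iter_ordS k (i : 'I_N.+1) : val (iter k (@ordS N.+1) i) = ((i + k) %% N.+1)%N.
elim: k => [|k IH];first by rewrite addn0 modn_small.
by rewrite iterS /= IH -addn1 modnDml addn1 addnS.
Qed.
Lemma reach_ordS (i j : 'I_N.+1) : exists2 k, (k <= N)%N & j = iter k (@ordS N.+1) i.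
have [ij|ji] := leqP i j.
 exists (j - i)%N;first by have := ltn_ord j;lia.
 by apply: val_inj;rewrite iter_ordS subnKC // modn_small.
exists (j + N.+1 - i)%N;first by have := ltn_ord i;lia.
apply: val_inj;rewrite iter_ordS subnKC ?modnDr ?modn_small //.
by have := ltn_ord i;lia.
Qed.
(** Discrete Gronwall inequality. A forward step multiplies by at most 1 / (1 - tau C) <= 1 + 2 tau
    C, and on a cycle every node is reached from any other in at most N forward steps. *)
Lemma cyclic_growth (S : 'I_N.+1 -> R) (C : R) : 0 <= C -> (forall j, 0 < S j) -> N.+1%:R^-1 * C <= 1 / 2 ->
 (forall j, S j <= S (ord_pred j) + N.+1%:R^-1 * C * S j) -> forall i j, S j <= expR (2 * C) * S i.
set tau := N.+1%:R^-1;move=> C0 S0 tC H i j;have [k kN ->] := reach_ordS i j.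
have t0 : 0 <= tau by rewrite invr_ge0.
have u0 : 0 <= tau * C by rewrite mulr_ge0.
pose q := 1 + 2 * (tau * C);have q1 : 1 <= q by rewrite /q;lra.
have step l : S (ordS l) <= q * S l.
 have := H (ordS l);rewrite ordSK => h;have := S0 (ordS l);rewrite /q.
 set u := tau * C in u0 h tC *;move: h;move: (S (ordS l)) (S l) => a b h a0.
 have h1 : (1 + 2 * u) * ((1 - u) * a) <= (1 + 2 * u) * b by rewrite ler_wpM2l;lra.
 have h2 : 0 <= u * (1 - 2 * u) * a by rewrite mulr_ge0 ?(ltW a0) // mulr_ge0 //;lra.
 nra.
have it l : S (iter l (@ordS N.+1) i) <= q ^+ l * S i.
 elim: l => [|l IH];first by rewrite expr0 mul1r.
 rewrite iterS exprS -mulrA;apply: le_trans (step _) _;rewrite ler_wpM2l //;lra.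
apply: le_trans (it k) _;rewrite ler_wpM2r ?(ltW (S0 i)) //.
apply: le_trans (_ : q ^+ N.+1 <= _);first by rewrite ler_weXn2l // ltnW.
have -> : 2 * C = (2 * (tau * C)) *+ N.+1.
 have n0 : N.+1%:R != 0 :> R by rewrite pnatr_eq0.
 rewrite -[RHS]mulr_natr (_ : 2 * (tau * C) * N.+1%:R = 2 * C * (tau * N.+1%:R));last by ring.
 by rewrite /tau mulVf // mulr1.
rewrite -[X in expR X]mulr_natl expRM_natl;apply: lerXn2r;rewrite ?nnegrE ?expR_ge0 //;first lra.
exact: expR_ge1Dx.
Qed.
End CyclicGrowth.
Lemma grow_aux (R : realFieldType) (a1 a2 a3 a4 a5 t C : R) : a1 <= t * (C * (1 + a4)) -> a5 <= t * (1 + a4) ->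
 a2 <= a5 -> a3 <= a2 + a1 -> a3 <= t * (C + 1) * (1 + a4).
lra. Qed.
Lemma grow_aux2 (R : realFieldType) (a t b x z w : R) : a - t <= z -> t <= b + x -> x + z <= w -> 1 + a <= 1 + b + w.
lra. Qed.

Section Apriori.
Variables (R : realType) (n : nat) (M : Top) (A : SA R n M)
 (HM : CCM A)
 (m : nat) (ci : 'I_m -> chart_index A) (cc : 'I_m -> 'rV[R]_n) (cr : 'I_m -> R)
 (gc : good_cover ci cc cr).
Local Notation V := 'rV[R]_n.
Local Notation iota := (iota_emb ci cc cr).
Local Notation E := (d_iota ci cc cr).
Local Notation xi := (xi ci cc cr).
Local Notation field := (field ci cc cr).
Local Notation tang := (tang ci cc cr).
Local Notation KY := (m * (1 + n))%N.
Local Notation Y := 'rV[R]_KY.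
Variables (Ht : R -> cotangent A -> R)
 (SDT : forall i t w, cimg i w.1 -> exists L, sdift id (hloc Ht i) t w L)
 (CH : R)
 (CH0 : 0 < CH)
 (BD : forall t k x, 0 <= t <= 1 -> xi k x != 0 -> forall p v u : V,
 `|dH Ht (ci k) t (chart (ci k) x, p) (v, u)| <= CH * ((1 + `|p|) * `|v| + `|u|)).
Local Notation Hk := (Hk ci cc cr Ht).
(* The time of the node 0 is 1, so that the cyclic sequence of nodes starts at
 the end of the unit interval. *)
Definition node N (j : 'I_N.+1) : R := if j == ord0 then 1 else j%:R / N.+1%:R.
Lemma node_itv N (j : 'I_N.+1) : 0 <= node j <= 1.
rewrite /node;case: eqP => _;first by rewrite ler01 lexx.
by rewrite divr_ge0 // ler_pdivrMr ?ltr0n // mul1r ler_nat ltnW.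
Qed.
(** Discrete Hamilton equations with errors of the order of the squared step. The weight 1 + |y|
    keeps the first error small when it is paired with y in the action. *)
Definition almost_orbit (kappa : R) N (x : 'I_N.+1 -> M) (y : 'I_N.+1 -> Y) : Prop :=
 (forall j, (1 + `|y j|) * `|chord iota x j - N.+1%:R^-1 *: vgrad A (Hk kappa (node j)) (x j, y j)| <= N.+1%:R^-1 ^+ 2) /\
 (forall k a j, `|dotv (y (ord_pred j) - y j) (field k a (x j)) -
 N.+1%:R^-1 * dmove ci cc cr (Hk kappa (node j)) k a (x j, y j)| <= N.+1%:R^-1 ^+ 2).
Lemma sum2_norm (I J : finType) (f g : I -> J -> R) (b : R) : (forall k a, `|f k a - g k a| <= b) ->
 \sum_k \sum_a `|f k a| <= \sum_k \sum_a `|g k a| + (#|I| * #|J|)%:R * b.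
move=> H;have -> : (#|I| * #|J|)%:R * b = \sum_(k : I) \sum_(a : J) b.
 under eq_bigr do rewrite sumr_const.
 by rewrite sumr_const -mulrnA mulr_natl mulnC.
rewrite -big_split /=;apply: ler_sum => k _;rewrite -big_split /=;apply: ler_sum => a _.
by rewrite -lerBlDl;apply: le_trans (H k a);exact: lerB_dist.
Qed.
Lemma chord_bnd : exists2 C : R, 0 < C & forall kappa N (x : 'I_N.+1 -> M) (y : 'I_N.+1 -> Y), 0 <= kappa <= 1 ->
 almost_orbit kappa x y -> forall j, `|chord iota x j| <= N.+1%:R^-1 * C.
have [C C0 HC] := vgrad_bnd HM gc SDT CH0 BD;exists (C + 1);first by rewrite addr_gt0.
move=> kappa N x y k01 [h1 _] j;set tau := N.+1%:R^-1 in h1 *.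
have t0 : 0 < tau by rewrite invr_gt0 ltr0n.
have t1 : tau <= 1 by rewrite invf_le1 ?ltr0n // ler1n.
have h2 := HC kappa (node j) (x j, y j) k01 (node_itv j).
have := h1 j;set d := chord iota x j - _ => h.
have -> : chord iota x j = d + tau *: vgrad A (Hk kappa (node j)) (x j, y j) by rewrite subrK.
apply: le_trans (ler_normD _ _) _;rewrite normrZ (gtr0_norm t0).
move: h h2 (normr_ge0 d) (normr_ge0 (y j));move: (`|d|) (`|y j|) (`|vgrad _ _ _|) => D1 D2 D3 *;nra.
Qed.
(** The chord equation is paired with the normal part w of y. The chord is nearly tangent and [Hp]
    contributes a tangent vector, so essentially only kappa |w|^2 / <y> remains and |w| is at most
    half of 1 + |y|; the rest of y is bounded by [tang]. The constant is free of kappa, only the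
    admissible mesh depends on it. *)
Lemma tang_control : exists2 C : R, 0 < C & forall kappa, 0 < kappa <= 1 -> exists2 s : R, 0 < s &
 forall N (x : 'I_N.+1 -> M) (y : 'I_N.+1 -> Y), N.+1%:R^-1 <= s -> almost_orbit kappa x y ->
 forall j, 1 + `|y j| <= C * (1 + tang (x j) (y j)).
have [C5 C50 HC5] := chord_bnd;have [CN CN0 HCN] := normal_split HM gc.
exists (2 + 2 * CN);first by rewrite addr_gt0 // mulr_gt0.
move=> kappa /andP[k0 k1];pose K1 : R := KY%:R * (1 + KY%:R) + 1.
have K10 : 0 < K1 by rewrite ltr_wpDl // mulr_ge0 // addr_ge0.
have [d d0 Hd] := chord_tangent HM gc (divr_gt0 k0 (mulr_gt0 (mulr_gt0 (ltr0n R 4) K10) C50) : 0 < kappa / (4%:R * K1 * C5)).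
exists (Num.min (d / (2 * C5)) (kappa / (4 * K1))).
 by rewrite lt_min !divr_gt0 // mulr_gt0.
move=> N x y;set tau := N.+1%:R^-1;rewrite le_min => /andP[t1 t2] ao j.
have t0 : 0 < tau by rewrite invr_gt0 ltr0n.
have kk : 0 <= kappa <= 1 by rewrite ltW.
have hc := HC5 kappa N x y kk ao j;rewrite -/tau in hc.
have cd : `|chord iota x j| < d.
 apply: le_lt_trans hc _;apply: le_lt_trans (_ : d / (2 * C5) * C5 < _);first by rewrite ler_wpM2r // ltW.
 by rewrite invfM mulrA divfK ?gt_eqF // ltr_pdivrMr //;lra.
have [i [v [ix hv]]] := Hd _ _ cd;rewrite -/(chord iota x j) in hv.
have [w [wT wy yw]] := HCN (x j) (y j).
have b1 := bracket_ge1 (y j);have b2 := bracket_le (y j).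
have := ao.1 j;rewrite (vgrad_Hk HM gc SDT _ _ (ix : cdom i (x j, y j).1)) /= -/tau.
set P := Hp _ _ _ _ *m _;set b := bracket (y j) in b1 b2 *;set cj := chord iota x j in hc hv cd * => hD.
set D := cj - _ in hD.
have E1 : dotv w cj = tau * (kappa / b) * dotv w w + dotv w D.
 have -> : cj = tau *: (P + (kappa / b) *: y j) + D by rewrite addrC subrK.
 by rewrite dotvDr dotvZr dotvDr dotvZr (wT i _ ix) add0r wy mulrA.
have E2 : dotv w cj = dotv w (cj - v *m E i (x j)) by rewrite [RHS]dotvBr (wT i) // subr0.
have h1 : `|dotv w cj| <= KY%:R * `|w| * (kappa / (4%:R * K1 * C5) * (tau * C5)).
 rewrite E2;apply: le_trans (dotv_norm _ _) _;rewrite ler_wpM2l ?mulr_ge0 //.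
 apply: le_trans hv _;rewrite ler_wpM2l // divr_ge0 ?mulr_ge0 // ltW //.
have h2 : `|dotv w D| <= KY%:R * `|w| * tau ^+ 2.
 apply: le_trans (dotv_norm _ _) _;rewrite ler_wpM2l ?mulr_ge0 //.
 apply: le_trans hD;rewrite ler_peMl // lerDl //.
have h3 := dotv_ge_norm w.
have bp : 0 < b by apply: lt_le_trans b1.
have kb : 0 < kappa / b by rewrite divr_gt0.
have h4 : tau * (kappa / b) * `|w| ^+ 2 <= KY%:R * `|w| * (tau * (kappa / (2 * K1))).
 apply: le_trans (_ : tau * (kappa / b) * dotv w w <= _);first by rewrite ler_wpM2l // mulr_ge0 // ltW.
 have -> : tau * (kappa / b) * dotv w w = dotv w cj - dotv w D by rewrite E1 addrK.
 apply: le_trans (ler_norm _) _;apply: le_trans (ler_normB _ _) _.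
 apply: le_trans (lerD h1 h2) _;rewrite -mulrDr ler_wpM2l ?mulr_ge0 //.
 have -> : kappa / (4%:R * K1 * C5) * (tau * C5) = tau * (kappa / (4 * K1)) by field;rewrite !gt_eqF.
 rewrite expr2 -mulrDr ler_wpM2l ?(ltW t0) //.
 have -> : kappa / (2 * K1) = kappa / (4 * K1) + kappa / (4 * K1) by field;rewrite gt_eqF.
 lra.
have h5 : `|w| <= (1 + `|y j|) / 2.
 have [->|w0] := eqVneq `|w| 0;first by rewrite divr_ge0 // addr_ge0.
 have wp : 0 < `|w| by rewrite lt_neqAle eq_sym w0 normr_ge0.
 have h6 : kappa / b * `|w| <= KY%:R * (kappa / (2 * K1)).
 rewrite -(ler_pM2l (mulr_gt0 t0 wp));move: h4;set X1 := _ * `|w| ^+ 2;set X2 := _ * _.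
 rewrite (_ : tau * `|w| * (kappa / b * `|w|) = X1);last by rewrite /X1;ring.
 by rewrite (_ : tau * `|w| * (KY%:R * (kappa / (2 * K1))) = X2) // /X2;ring.
 have h7 : `|w| <= KY%:R * b / (2 * K1).
 rewrite -(ler_pM2l kb);apply: le_trans h6 _.
 rewrite (_ : kappa / b * _ = KY%:R * (kappa / (2 * K1))) //;field;by rewrite !gt_eqF.
 apply: le_trans h7 _;rewrite ler_pdivrMr ?mulr_gt0 //.
 have -> : (1 + `|y j|) / 2 * (2 * K1) = (1 + `|y j|) * K1 by field.
 have K0 : 0 <= KY%:R :> R by [].
 have y0 := normr_ge0 (y j);rewrite /K1.
 apply: le_trans (_ : KY%:R * (1 + KY%:R * `|y j|) <= _);first by rewrite ler_wpM2l.
 move: K0 y0;move: (KY%:R) (`|y j|) => a1 a2 *;nra.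
have h8 : `|y j| <= `|w| + CN * tang (x j) (y j).
 rewrite -{1}(subrK w (y j)) addrC;apply: le_trans (ler_normD _ _) _;by rewrite lerD2l.
have T0 := tang_ge0 ci cc cr (x j) (y j).
move: h5 h8 T0;move: (`|y j|) (`|w|) (tang _ _) => a1 a2 a3 *;nra.
Qed.
Lemma tang_diff (x x' : M) (y : Y) (C : R) : (forall k a, `|field k a x' - field k a x| <= C) ->
 `|tang x' y - tang x y| <= (m * n)%:R * (KY%:R * `|y| * C).
move=> H;have key k a : `|dotv y (field k a x') - dotv y (field k a x)| <= KY%:R * `|y| * C.
 by rewrite -dotvBr;apply: le_trans (dotv_norm _ _) _;rewrite ler_wpM2l // mulr_ge0.
have h1 := sum2_norm key.
have h2 : \sum_k \sum_a `|dotv y (field k a x)| <= \sum_k \sum_a `|dotv y (field k a x')| + (#|'I_m| * #|'I_n|)%:R * (KY%:R * `|y| * C).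
 by apply: sum2_norm => k a;rewrite distrC.
rewrite !card_ord in h1 h2;rewrite ler_norml;apply/andP;split.
 by rewrite -/(tang x y) -/(tang x' y) in h2;move: h2;move: (tang x y) (tang x' y) (_ * _) => a b c;lra.
by rewrite -/(tang x y) -/(tang x' y) in h1;move: h1;move: (tang x y) (tang x' y) (_ * _) => a b c;lra.
Qed.
(** The momentum equation has at most linear growth in y, which [tang_control] bounds by the
    tangential size, so that size obeys the Gronwall inequality. Thus one bounded node bounds all of
    them, uniformly in kappa. *)
Lemma apriori : exists2 C : R, 0 < C & forall kappa, 0 < kappa <= 1 -> exists2 s : R, 0 < s &
 forall N (x : 'I_N.+1 -> M) (y : 'I_N.+1 -> Y), N.+1%:R^-1 <= s -> almost_orbit kappa x y ->
 forall i j, 1 + `|y j| <= C * (1 + tang (x i) (y i)).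
have [C5 C50 HC5] := chord_bnd;have [C3 C30 HC3] := tang_control.
have [CF CF0 HCF] := field_lip HM gc;have [CD CD0 HCD] := dmove_bnd HM gc SDT CH0 BD.
pose L : R := (m * n)%:R;have L0 : 0 <= L by [].
pose C6 := L * KY%:R * CF * C5.
have C60 : 0 <= C6 by rewrite !mulr_ge0 // ltW.
pose C7 := L * (CD + 1) + C6;have C70 : 0 <= C7 by rewrite addr_ge0 // mulr_ge0 // addr_ge0 // ltW.
pose C8 := C7 * C3 * 2;have C80 : 0 <= C8 by rewrite !mulr_ge0 // ltW.
exists (4 * C3 * expR (2 * C8));first by rewrite !mulr_gt0 // expR_gt0.
move=> kappa kk;have [s s0 Hs] := HC3 kappa kk.
(* The four bounds serve [tang_control], the local Lipschitz bound of the fields, the comparison of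
   [S] with [tang], and the Gronwall lemma. *)
exists (Num.min s (Num.min ((2 * CF * C5)^-1) (Num.min ((2 * (C6 * C3 + 1))^-1) ((2 * (C8 + 1))^-1)))).
 by rewrite !lt_min s0 !invr_gt0 !mulr_gt0 //= ltr_wpDl // mulr_ge0 // ltW.
move=> N x y;rewrite !le_min => /and4P[t1 t2 t3 t4] ao.
have ct := Hs N x y t1 ao;have kk' : 0 <= kappa <= 1 by case/andP: kk => /ltW -> ->.
have cb := HC5 kappa N x y kk' ao;have [ao1 ao2] := ao.
set tau := N.+1%:R^-1 in t1 t2 t3 t4 cb ao2.
have t0 : 0 < tau by rewrite invr_gt0 ltr0n.
have tau1 : tau <= 1 by rewrite invf_le1 ?ltr0n // ler1n.
(* Measured at the next node: the momentum equation at x_j compares y_j with its predecessor, and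
   [S] of the predecessor is evaluated at that same x_j. *)
pose S j := 1 + tang (x (ordS j)) (y j).
have T0 j l := tang_ge0 ci cc cr (x j) (y l).
have tC6 : tau * (C6 * C3) <= 1 / 2.
 have : tau * (2 * (C6 * C3 + 1)) <= 1.
 by rewrite -ler_pdivlMr ?mul1r // mulr_gt0 // ltr_wpDl // mulr_ge0 // ltW.
 by have := mulr_ge0 C60 (ltW C30);move: (C6 * C3) (tau) t0 => a b;nra.
have tC8 : tau * C8 <= 1 / 2.
 have : tau * (2 * (C8 + 1)) <= 1 by rewrite -ler_pdivlMr ?mul1r // mulr_gt0 // ltr_wpDl.
 by move: (C8) C80 (tau) t0 => a ? b;nra.
have fstep j : `|tang (x (ordS j)) (y j) - tang (x j) (y j)| <= tau * C6 * (1 + `|y j|).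
 apply: le_trans (tang_diff (y j) (C := CF * (tau * C5)) _) _.
 move=> k a;apply: le_trans (HCF k a _ _ _) _;last exact: (ler_wpM2l (ltW CF0) (cb j)).
 apply: le_lt_trans (cb j) _;apply: le_lt_trans (_ : (2 * CF * C5)^-1 * C5 < _);first by rewrite ler_wpM2r // ltW.
 have -> : (2 * CF * C5)^-1 * C5 = CF^-1 / 2 by field;rewrite !gt_eqF.
 have : 0 < CF^-1 by rewrite invr_gt0.
 by move: (CF^-1) => z9;lra.
 rewrite (_ : _ * (_ * _) = tau * C6 * `|y j|);last by rewrite /C6 /L;ring.
 by apply: ler_wpM2l;[exact: (mulr_ge0 (ltW t0) C60)|rewrite lerDr].
have TS j : 1 + tang (x j) (y j) <= 2 * S j.
 have h1 := fstep j;have h2 := ct j;rewrite ler_norml /S in h1 *.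
 have h3 : tau * C6 * (1 + `|y j|) <= 1 / 2 * (1 + tang (x j) (y j)).
 apply: le_trans (ler_wpM2l (mulr_ge0 (ltW t0) C60) h2) _.
 by rewrite mulrA -[tau * C6 * C3]mulrA ler_wpM2r // addr_ge0.
 case/andP: h1 => h1 _;move: h1 h3;move: (_ * (1 + `|y j|)) (tang _ _) (tang _ _) => a b c;lra.
have ST j : S j <= 2 * (1 + tang (x j) (y j)).
 have h1 := fstep j;have h2 := ct j;rewrite ler_norml /S in h1 *.
 have h3 : tau * C6 * (1 + `|y j|) <= 1 / 2 * (1 + tang (x j) (y j)).
 apply: le_trans (ler_wpM2l (mulr_ge0 (ltW t0) C60) h2) _.
 by rewrite mulrA -[tau * C6 * C3]mulrA ler_wpM2r // addr_ge0.
 have T1 := T0 j j;case/andP: h1 => _ h1;move: h1 h3 T1;move: (_ * (1 + `|y j|)) (tang _ _) (tang _ _) => a b c;lra.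
have grow j : S j <= S (ord_pred j) + tau * C8 * S j.
 have h1 := fstep j;have h2 := ct j;have h3 := TS j.
 have key k a : `|dotv (y j) (field k a (x j)) - dotv (y (ord_pred j)) (field k a (x j))| <= tau * (CD + 1) * (1 + `|y j|).
 rewrite -dotvBl -opprB dotvNl normrN.
 have := ao2 k a j;have := HCD kappa (node j) k a (x j, y j) (node_itv j).
 set D := dmove _ _ _ _ _ _ _ => /= hD;set e := dotv _ _ => he.
 have h10 := ler_normD (e - tau * D) (tau * D);rewrite subrK normrM (gtr0_norm t0) in h10.
 have h8 := ler_wpM2l (ltW t0) hD.
 have h9 : tau ^+ 2 <= tau * (1 + `|y j|) by rewrite expr2 ler_wpM2l ?(ltW t0) // ler_wpDr.
 exact: grow_aux h8 h9 he h10.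
 have := sum2_norm key;rewrite !card_ord -/(tang (x j) (y j)) -/(tang (x j) (y (ord_pred j))) -/L => h4.
 have h5 : S (ord_pred j) = 1 + tang (x j) (y (ord_pred j)) by rewrite /S ord_predK.
 rewrite h5.
 have h6 : tau * C7 * (1 + `|y j|) <= tau * C8 * S j.
 rewrite /C8 -!mulrA ler_wpM2l ?(ltW t0) // ler_wpM2l //;apply: le_trans h2 _.
 by rewrite ler_wpM2l // ltW.
 rewrite ler_norml in h1;case/andP: h1 => _ h1.
 have E7 : tau * C7 * (1 + `|y j|) = L * (tau * (CD + 1) * (1 + `|y j|)) + tau * C6 * (1 + `|y j|) by rewrite /C7;ring.
 rewrite E7 in h6;exact: (grow_aux2 h1 h4 h6).
have Spos j : 0 < S j by rewrite /S ltr_wpDr.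
move=> i j;apply: le_trans (ct j) _.
have g := cyclic_growth C80 Spos tC8 grow i j.
have h1 := TS j;have h2 := ST i;have e0 := expR_gt0 (2 * C8).
apply: le_trans (_ : C3 * (2 * (expR (2 * C8) * (2 * (1 + tang (x i) (y i))))) <= _);last first.
 by rewrite le_eqVlt;apply/orP;left;apply/eqP;ring.
rewrite ler_wpM2l ?(ltW C30) //;apply: le_trans h1 _;rewrite ler_wpM2l //.
by apply: le_trans g _;rewrite ler_wpM2l // ltW.
Qed.
End Apriori.
Lemma telescope_bound R (W : NM R) (u : nat -> W) (B : W) (b : R) k j : (k <= j)%N ->
 (forall l, (k < l <= j)%N -> `|u l - u l.-1 - B| <= b) -> `|u j - u k - (j - k)%:R *: B| <= (j - k)%:R * b.
elim: j => [|j IH] kj H;first by move: kj;rewrite leqn0 => /eqP ->;rewrite subrr subnn scale0r subr0 normr0 mul0r.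
move: kj;rewrite leq_eqVlt => /orP[/eqP ->|kj];first by rewrite subrr subnn scale0r subr0 normr0 mul0r.
rewrite subSn // -!natr1 scalerDl scale1r mulrDl mul1r.
have -> : u j.+1 - u k - ((j - k)%:R *: B + B) = (u j - u k - (j - k)%:R *: B) + (u j.+1 - u j - B).
 have -> : u j.+1 - u k = (u j.+1 - u j) + (u j - u k) by rewrite addrA subrK.
 by rewrite [_ *: B + B]addrC opprD addrACA addrC.
apply: le_trans (ler_normD _ _) _;apply: lerD.
 by apply: IH => // l /andP[kl lj];apply: H;rewrite kl (leq_trans lj).
by apply: (H j.+1);rewrite leqnn andbT.
Qed.
Lemma between_dist (R : realFieldType) (a b x t d : R) : `|a - t| < d -> `|b - t| < d -> a <= x <= b -> `|x - t| < d.
by rewrite !ltr_norml => /andP[? ?] /andP[? ?] /andP[? ?];apply/andP;split;lra. Qed.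

(** * Limits of discrete curves along an ultrafilter *)

Section Mesh.
Variables (R : realType) (U : set_system nat)
 (UU : UltraFilter U)
 (N_ : nat -> nat).
Definition mesh nu : R := (N_ nu).+1%:R^-1.
Variables (mesh0 : forall e : R, 0 < e -> \forall nu \near U, mesh nu < e).
Definition idx nu (t : R) : nat := Num.truncn ((N_ nu).+1%:R * t).
Lemma mesh_gt0 nu : 0 < mesh nu. by rewrite invr_gt0 ltr0n. Qed.
Lemma idx_itv nu t : 0 <= t -> (idx nu t)%:R * mesh nu <= t < (idx nu t)%:R * mesh nu + mesh nu.
move=> t0;have n0 : 0 < (N_ nu).+1%:R :> R by rewrite ltr0n.
have h : 0 <= (N_ nu).+1%:R * t by rewrite mulr_ge0 // ltW.
have := truncn_itv h;rewrite -/(idx nu t) => /andP[h1 h2];apply/andP;split.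
 by rewrite ler_pdivrMr // mulrC.
rewrite -[X in _ + X]mul1r -mulrDl ltr_pdivlMr // mulrC natr1;exact: h2.
Qed.
Lemma idx_le nu t : 0 <= t <= 1 -> (idx nu t <= (N_ nu).+1)%N.
case/andP => t0 t1;have /andP[h _] := idx_itv nu t0.
have n0 : 0 < (N_ nu).+1%:R :> R by rewrite ltr0n.
by rewrite -(ler_nat R) -[leRHS]mulr1 -ler_pdivrMl // mulrC;apply: le_trans t1.
Qed.
Lemma idx_mono nu t t' : t <= t' -> (idx nu t <= idx nu t')%N.
by move=> tt;apply: le_truncn;rewrite ler_wpM2l. Qed.
(* The index pairs (nu, j) with j / (N_ nu + 1) close to t. *)
Definition around (t : R) : set_system (nat * nat) := fun S => exists2 d : R, 0 < d &
 \forall nu \near U, forall j, (0 < j <= (N_ nu).+1)%N -> `|j%:R * mesh nu - t| < d -> S (nu, j).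
Global Instance around_filter t : Filter (around t).
split.
- by exists 1 => //;apply: nearW.
- move=> P Q [d d0 h] [d' d'0 h'];exists (Num.min d d');first by rewrite lt_min d0.
 apply: filterS2 h h' => nu h h' j jN;rewrite lt_min => /andP[jd jd'].
 by split;[exact: h|exact: h'].
- move=> P Q PQ [d d0 h];exists d => //;apply: filterS h => nu h j jN jd;apply: PQ;exact: h.
Qed.
Lemma around_U t (S : nat -> Prop) : (\forall nu \near U, S nu) -> \forall p \near around t, S p.1.
by move=> h;exists 1 => //;apply: filterS h => nu h j _ _. Qed.
Lemma around_range t : \forall p \near around t, (0 < p.2 <= (N_ p.1).+1)%N.
by exists 1 => //;apply: nearW. Qed.
Lemma around_time t (e : R) : 0 < e -> \forall p \near around t, `|p.2%:R * mesh p.1 - t| < e.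
by move=> e0;exists e => //;apply: nearW. Qed.
Lemma window nu (t d : R) j l : 0 <= t <= 1 -> mesh nu < d / 2 -> `|j%:R * mesh nu - t| < d / 2 ->
 (minn (idx nu t) j <= l <= maxn (idx nu t) j)%N -> `|l%:R * mesh nu - t| < d.
move=> /andP[t0 _] h2 jd /andP[l1 l2];have m0 := mesh_gt0 nu.
have /andP[k1 k2] : (idx nu t)%:R * mesh nu <= t < (idx nu t)%:R * mesh nu + mesh nu by exact: idx_itv.
move: jd;rewrite !ltr_norml => /andP[a b];have [kj|jk] := leqP (idx nu t) j.
 have e1 : (idx nu t)%:R * mesh nu <= l%:R * mesh nu by rewrite ler_wpM2r ?(ltW m0) // ler_nat;lia.
 have e3 : l%:R * mesh nu <= j%:R * mesh nu by rewrite ler_wpM2r ?(ltW m0) // ler_nat;lia.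
 by apply/andP;split;lra.
have e1 : j%:R * mesh nu <= l%:R * mesh nu by rewrite ler_wpM2r ?(ltW m0) // ler_nat;lia.
have e3 : l%:R * mesh nu <= (idx nu t)%:R * mesh nu by rewrite ler_wpM2r ?(ltW m0) // ler_nat;lia.
by apply/andP;split;lra.
Qed.
Lemma mesh_bound (W : NM R) (u : nat -> W) nu (C : R) a b j : (forall l, (minn a j < l <= maxn a j)%N ->
 `|u l - u l.-1| <= C * mesh nu) -> b = j -> `|u b - u a| <= `|b%:R * mesh nu - a%:R * mesh nu| * C.
move=> H ->;have m0 := mesh_gt0 nu;have [aj|ja] := leqP a j.
 have := @telescope_bound R W u 0 (C * mesh nu) a j aj;rewrite scaler0 subr0 => h;apply: le_trans (h _) _.
 by move=> l /andP[l1 l2];rewrite subr0;apply: H;lia.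
 rewrite natrB // ger0_norm;last by rewrite subr_ge0 ler_wpM2r ?(ltW m0) // ler_nat.
 by rewrite le_eqVlt;apply/orP;left;apply/eqP;ring.
have := @telescope_bound R W u 0 (C * mesh nu) j a (ltnW ja);rewrite scaler0 subr0 distrC => h;apply: le_trans (h _) _.
 by move=> l /andP[l1 l2];rewrite subr0;apply: H;lia.
rewrite natrB 1?ltnW // distrC ger0_norm;last by rewrite subr_ge0 ler_wpM2r ?(ltW m0) // ler_nat ltnW.
by rewrite le_eqVlt;apply/orP;left;apply/eqP;ring.
Qed.
(** A Lipschitz bound on one-step increments upgrades the limit at the single index of t to a limit
    over all indices whose time is near t. *)
Lemma around_cvg (W : NM R) (u : nat -> nat -> W) (u0 : W) (t C : R) : 0 <= t <= 1 -> 0 <= C ->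
 (\forall p \near around t, `|u p.1 p.2 - u p.1 p.2.-1| <= C * mesh p.1) ->
 (fun nu => u nu (idx nu t)) @ U --> u0 -> (fun p => u p.1 p.2) @ around t --> u0.
move=> t01 C0 [d d0 hd] cu;have t0 : 0 <= t by case/andP: t01.
apply/cvgrPdist_lt => e e0;have e2 : 0 < e / 2 by rewrite divr_gt0.
have n1 : \forall nu \near U, `|u0 - u nu (idx nu t)| < e / 2 by move/cvgrPdist_lt: cu;apply.
have C1 : 0 < C + 1 by rewrite ltr_wpDl.
pose d' := Num.min (d / 2) (e / (4 * (C + 1))).
have d'0 : 0 < d' by rewrite lt_min !divr_gt0 // mulr_gt0.
have dd : d' <= d / 2 by rewrite ge_min lexx.
have de : d' * (4 * (C + 1)) <= e by rewrite -ler_pdivlMr ?mulr_gt0 // ge_min lexx orbT.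
exists d' => //;apply: filterS3 n1 (mesh0 d'0) hd => nu h1 h2 h3 j jN jd /=.
have h4 : `|u nu j - u nu (idx nu t)| <= `|j%:R * mesh nu - (idx nu t)%:R * mesh nu| * C.
 apply: (@mesh_bound _ _ nu C (idx nu t) j j) => // l /andP[l1 l2];apply: h3.
 by have kN := idx_le nu t01;case/andP: jN => j0 jN;clear - l1 l2 kN jN;lia.
 apply: (@window nu t d j) => //;first exact: lt_le_trans h2 dd.
 exact: lt_le_trans jd dd.
 by clear - l1 l2;lia.
have h5 : `|j%:R * mesh nu - (idx nu t)%:R * mesh nu| <= 2 * d'.
 have /andP[k1 k2] := idx_itv nu t0;clear h1 h3 h4;move: jd;rewrite ltr_norml ler_norml => /andP[a b].
 by apply/andP;split;lra.
have h6 : `|u nu j - u nu (idx nu t)| < e / 2.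
 apply: le_lt_trans h4 _;have := normr_ge0 (j%:R * mesh nu - (idx nu t)%:R * mesh nu).
 move: h5 de d'0 e0 C0;clear;move: (`|_ - _|) => a;move: (d') => b *;nra.
have := ler_distD (u nu (idx nu t)) u0 (u nu j);rewrite [`|u nu (idx nu t) - u nu j|]distrC => h7.
by apply: le_lt_trans h7 _;rewrite [ltRHS](splitr e) ltrD.
Qed.
(** Increments equal to mesh times B up to o(mesh) telescope over any index interval near t. The
    estimate survives in the limit, where it is strict differentiability of f at t. *)
Lemma around_derive (W : NM R) (u : nat -> nat -> W) (f : R -> W) (t : R) (B : W) : 0 <= t <= 1 ->
 (forall e : R, 0 < e -> \forall p \near around t, `|u p.1 p.2 - u p.1 p.2.-1 - mesh p.1 *: B| <= e * mesh p.1) ->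
 (exists2 d : R, 0 < d & forall s, 0 <= s <= 1 -> `|s - t| < d -> (fun nu => u nu (idx nu s)) @ U --> f s) ->
 forall e : R, 0 < e -> exists2 d : R, 0 < d & forall s s', 0 <= s <= 1 -> 0 <= s' <= 1 -> `|s - t| < d -> `|s' - t| < d ->
 `|f s' - f s - (s' - s) *: B| <= e * `|s' - s|.
move=> t01 H [d1 d10 cf] e e0;have [d2 d20 hd2] := H e e0.
pose d := Num.min d1 d2;have d0 : 0 < d by rewrite lt_min d10.
have hd : \forall nu \near U, forall j, (0 < j <= (N_ nu).+1)%N -> `|j%:R * mesh nu - t| < d ->
 `|u nu j - u nu j.-1 - mesh nu *: B| <= e * mesh nu.
 apply: filterS hd2 => nu h j jN;rewrite lt_min => /andP[_ jd];exact: h.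
have {}cf s : 0 <= s <= 1 -> `|s - t| < d -> (fun nu => u nu (idx nu s)) @ U --> f s.
 by move=> s01;rewrite lt_min => /andP[sd _];exact: cf.
exists d => //.
suff key s s' : 0 <= s <= 1 -> 0 <= s' <= 1 -> `|s - t| < d -> `|s' - t| < d -> s <= s' ->
 `|f s' - f s - (s' - s) *: B| <= e * `|s' - s|.
 move=> s s' s01 s01' sd sd';have [ss|/ltW ss] := leP s s';first exact: key.
 have := key s' s s01' s01 sd' sd ss;rewrite [`|s - s'|]distrC;congr (_ <= _).
 by rewrite -[s - s']opprB scaleNr opprK -normrN opprD opprB.
move=> s01 s01' sd sd' ss;have s0 : 0 <= s by case/andP: s01. have s0' : 0 <= s' by case/andP: s01'.
have ci s1 : 0 <= s1 <= 1 -> (fun nu => (idx nu s1)%:R * mesh nu) @ U --> s1.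
 move=> /andP[s10 _];apply/cvgrPdist_lt => r r0;apply: filterS (mesh0 r0) => nu h.
 have /andP[a b] := idx_itv nu s10;rewrite ger0_norm ?subr_ge0 //;lra.
have cD : (fun nu => (idx nu s')%:R * mesh nu - (idx nu s)%:R * mesh nu) @ U --> s' - s.
 by apply: cvgB;exact: ci.
have cL : (fun nu => `|u nu (idx nu s') - u nu (idx nu s) - ((idx nu s')%:R * mesh nu - (idx nu s)%:R * mesh nu) *: B|) @ U
 --> `|f s' - f s - (s' - s) *: B|.
 by apply: cvg_norm;apply: cvgB;[apply: cvgB;exact: cf|apply: cvgZr_tmp;exact: cD].
have cR : (fun nu => e * ((idx nu s')%:R * mesh nu - (idx nu s)%:R * mesh nu)) @ U --> e * `|s' - s|.
 by rewrite ger0_norm ?subr_ge0 //;apply: cvgMl_tmp;exact: cD.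
apply: ler_cvg_to cL cR _;apply: filterS hd => nu hd.
have m0 := mesh_gt0 nu;have kj := idx_mono nu ss.
have := @telescope_bound R W (u nu) (mesh nu *: B) (e * mesh nu) _ _ kj.
rewrite scalerA natrB // mulrBl => h;apply: le_trans (h _) _;last by rewrite mulrCA mulrBl.
move=> l /andP[kl lj];apply: hd.
 by have lN := idx_le nu s01';clear - kl lj lN;lia.
have /andP[a1 a2] := idx_itv nu s0;have /andP[b1 b2] := idx_itv nu s0'.
have e1 : (idx nu s)%:R * mesh nu + mesh nu <= l%:R * mesh nu.
 by rewrite -[X in _ + X]mul1r -mulrDl ler_wpM2r ?(ltW m0) // natr1 ler_nat.
have e3 : l%:R * mesh nu <= (idx nu s')%:R * mesh nu by rewrite ler_wpM2r ?(ltW m0) // ler_nat.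
apply: (between_dist sd sd');rewrite (le_trans e3 b1) andbT.
exact: le_trans (ltW a2) e1.
Qed.
Lemma idx0 nu : idx nu 0 = 0%N.
by rewrite /idx mulr0 truncn0. Qed.
Lemma idx1 nu : idx nu 1 = (N_ nu).+1.
by rewrite /idx mulr1 natrK. Qed.
(** [around] only sees indices j >= 1; the predecessor clause at j = 1 recovers the index 0. *)
Lemma around_at t (S : nat -> nat -> Prop) : (\forall p \near around t, S p.1 p.2 /\ S p.1 p.2.-1) ->
 exists2 d : R, 0 < d & \forall nu \near U, forall s j, 0 <= s <= 1 -> `|s - t| < d ->
 j%:R * mesh nu <= s <= j%:R * mesh nu + mesh nu -> S nu j.
case=> d d0 h;have d2 : 0 < d / 2 by rewrite divr_gt0.
exists (d / 2) => //;apply: filterS2 h (mesh0 d2) => nu h hm s j /andP[s0 s1] sd /andP[js sj].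
have m0 := mesh_gt0 nu.
have w l : s - mesh nu <= l%:R * mesh nu <= s + mesh nu -> `|l%:R * mesh nu - t| < d.
 move: sd;rewrite !ltr_norml => /andP[? ?] /andP[? ?];apply/andP;split;lra.
have jN : (j <= (N_ nu).+1)%N.
 have : j%:R * mesh nu <= 1 by apply: le_trans s1.
 by rewrite /mesh ler_pdivrMr ?ltr0n // mul1r ler_nat.
case: j js sj jN => [|j] js sj jN.
 have [] := h 1%N;rewrite ?ltnS //=;apply: w;rewrite mul1r;move: sj js;rewrite mul0r => ? ?.
 by apply/andP;split;lra.
have [] := h j.+1;rewrite ?jN //;apply: w;apply/andP;split;first lra.
by apply: le_trans js _;rewrite lerDl ltW.
Qed.
(** Errors that are o(mesh), uniformly over the indices whose time is near t. *)
Definition osm (t : R) (W : NM R) (f : nat * nat -> W) :=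
 forall e : R, 0 < e -> \forall p \near around t, `|f p| <= e * mesh p.1.
Lemma osmD t (W : NM R) (f g : nat * nat -> W) : osm t f -> osm t g -> osm t (fun p => f p + g p).
move=> hf hg e e0;have e2 : 0 < e / 2 by rewrite divr_gt0.
apply: filterS2 (hf _ e2) (hg _ e2) => p h1 h2;apply: le_trans (ler_normD _ _) _.
by rewrite [e]splitr mulrDl lerD.
Qed.
Lemma osm_le t (W W' : NM R) (f : nat * nat -> W) (g : nat * nat -> W') (C : R) :
 (\forall p \near around t, `|f p| <= C * `|g p|) -> osm t g -> osm t f.
move=> h hg e e0;have c0 : 0 < `|C| + 1 by rewrite ltr_wpDl.
apply: filterS2 h (hg _ (divr_gt0 e0 c0)) => p h1 h2;apply: le_trans h1 _.
apply: le_trans (_ : (`|C| + 1) * `|g p| <= _).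
 by rewrite ler_wpM2r //;apply: le_trans (ler_norm C) _;rewrite lerDl.
by apply: le_trans (ler_wpM2l (ltW c0) h2) _;rewrite mulrA mulrCA mulfV ?mulr1 // gt_eqF.
Qed.
Lemma osmN t (W : NM R) (f : nat * nat -> W) : osm t f -> osm t (fun p => - f p).
by move=> hf e e0;apply: filterS (hf e e0) => p;rewrite normrN. Qed.
Lemma osm_cvg0 t (W : NM R) (f : nat * nat -> W) (g : nat * nat -> R) (C : R) :
 g @ around t --> (0 : R) -> (\forall p \near around t, `|f p| <= `|g p| * (C * mesh p.1)) -> osm t f.
move=> g0 h e e0;have c0 : 0 < `|C| + 1 by rewrite ltr_wpDl.
have n1 : \forall p \near around t, `|0 - g p| < e / (`|C| + 1).
 by move/cvgrPdist_lt: g0;apply;rewrite divr_gt0.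
apply: filterS2 h n1 => p h1;rewrite sub0r normrN => h2;apply: le_trans h1 _.
have m0 := mesh_gt0 p.1.
apply: le_trans (_ : `|g p| * ((`|C| + 1) * mesh p.1) <= _).
 by rewrite ler_wpM2l // ler_wpM2r ?(ltW m0) //;apply: le_trans (ler_norm C) _;rewrite lerDl.
by rewrite mulrA ler_wpM2r ?(ltW m0) // -ler_pdivlMr // ltW.
Qed.
Lemma osm_mesh t (W : NM R) (f : nat * nat -> W) : f @ around t --> (0 : W) -> osm t (fun p => mesh p.1 *: f p).
move=> f0;apply: (@osm_cvg0 _ _ _ (fun p => `|f p|) 1).
 by rewrite -(@normr0 _ W);apply: cvg_norm.
by apply: nearW => p;rewrite normrZ normr_id mul1r mulrC gtr0_norm ?mesh_gt0.
Qed.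
Lemma mesh_cvg0 t : (fun p : nat * nat => mesh p.1) @ around t --> (0 : R).
apply/cvgrPdist_lt => e e0;apply: filterS (@around_U t _ (mesh0 e0)) => p.
by rewrite sub0r normrN gtr0_norm ?mesh_gt0.
Qed.
Lemma time_cvg t : (fun p : nat * nat => p.2%:R * mesh p.1) @ around t --> t.
by apply/cvgrPdist_lt => e e0;apply: filterS (around_time t e0) => p;rewrite distrC. Qed.
Lemma osm_rV t d (f : nat * nat -> 'rV[R]_d) : (forall b, osm t (fun p => f p 0 b)) -> osm t f.
move=> h e e0;have : \forall p \near around t, forall b, `|f p 0 b| <= e * mesh p.1.
 by apply: filter_forall => b;exact: h.
apply: filterS => p hp;apply: mx_norm_le => [|i b];first by rewrite mulr_ge0 ?ltW ?mesh_gt0.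
by rewrite ord1.
Qed.
(** A cluster point along an ultrafilter is a limit. Hence limits exist at all times at once,
    without extracting subsequences. *)
Lemma ultra_lim (T : Top) (K : set T) (f : nat -> T) : compact K -> (\forall nu \near U, K (f nu)) ->
 exists2 p, K p & f @ U --> p.
move=> cK Kf;have [p [Kp cp]] := cK (f @ U) _ Kf.
exists p => // B nB;have [//|h] := in_ultra_setVsetC (f @^-1` B) UU.
by have [q [nb b]] := cp (~` B) B h nB;case: nb.
Qed.
End Mesh.
Lemma act_alg (R : realFieldType) (dy m hl k b dp yy D0 : R) :
 dy - m * (hl + k * (b - 1)) - m * D0 =
 dy - m * (dp + k / b * yy) + m * (dp - hl - D0) + m * (k * (b^-1 * yy - (b - 1))).
by ring. Qed.
Lemma pn_alg (R : realFieldType) (A1 A2 A3 B m hq h2 a : R) :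
 A1 - B + m * a = A1 - A2 + (A2 - m * A3) - (B - m * (hq + h2)) + (m * (a - hq) + m * (A3 - h2)).
by ring. Qed.
Lemma ltW_idx R (N_ : nat -> nat) nu (s : R) : 0 <= s ->
 (idx N_ nu s)%:R * mesh R N_ nu <= s <= (idx N_ nu s)%:R * mesh R N_ nu + mesh R N_ nu.
by move=> s0;have /andP[h1 h2] := idx_itv N_ nu s0;rewrite h1 ltW. Qed.
Lemma dist_thirds R (V : NM R) (a b c d : V) (r : R) :
 `|a - b| < r / 3 -> `|c - b| < r / 3 -> `|c - d| < r / 3 -> `|a - d| < r.
move=> h1 h2 h3;have h4 := ler_distD b a d;have h5 := ler_distD c b d;rewrite [`|b - c|]distrC in h5;lra.
Qed.

(** * Hamilton's equations for the limit curve *)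

Section LimitOrbit.
Variables (R : realType) (n : nat) (M : Top) (A : SA R n M)
 (HM : CCM A)
 (m : nat) (ci : 'I_m -> chart_index A) (cc : 'I_m -> 'rV[R]_n) (cr : 'I_m -> R)
 (gc : good_cover ci cc cr).
Local Notation V := 'rV[R]_n.
Local Notation iota := (iota_emb ci cc cr).
Local Notation E := (d_iota ci cc cr).
Local Notation dE := (dE ci cc cr).
Local Notation xi := (xi ci cc cr).
Local Notation lift := (lift ci cc cr).
Local Notation lcoord := (lcoord ci cc cr).
Local Notation KY := (m * (1 + n))%N.
Local Notation Y := 'rV[R]_KY.
Variables (Ht : R -> cotangent A -> R)
 (SDT : forall i t w, cimg i w.1 -> exists L, sdift id (hloc Ht i) t w L)
 (HtC : forall i t w, cimg i w.1 -> {for (t, w), continuous (fun p : R * (V * V) => hloc Ht i p.1 p.2)})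
 (CH : R)
 (CH0 : 0 < CH)
 (BD : forall t k x, 0 <= t <= 1 -> xi k x != 0 -> forall p v u : V,
 `|dH Ht (ci k) t (chart (ci k) x, p) (v, u)| <= CH * ((1 + `|p|) * `|v| + `|u|)).
Local Notation Hk := (Hk ci cc cr Ht).
Let cM : compact [set: M]. by case: HM. Qed.
Let io_c := iota_cont HM gc.
Let io_i := iota_inj gc.
(** Symmetry of the second derivative of [iota]; it makes the second-order terms of the momentum
    equation cancel. *)
Lemma dE_sym i x (v w : V) : cdom i x -> v *m dE i x w = w *m dE i x v.
move=> ix;apply/rowP => l.
pose F (q : V) := iota (chart_inv i q) 0 l.
pose DF (q u : V) := (u *m E i (chart_inv i q)) 0 l.
pose D2 (u v : V) := (u *m dE i x v) 0 l.
have := @sdif_Schwarz R V F DF (chart i x) D2 _ _ v w;apply.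
 apply: filterS (open_nbhs_nbhs (conj (@open_chart_img _ _ _ A i) (chart_imgP ix))) => q iq.
 have iq' := chart_inv_dom iq;rewrite -{1}(chart_invK iq).
 exact: (sdif_entry 0 l (sdif_in_chart iq' (sdif_iota HM gc iq'))).
move=> u;have d := sdif_in_chart ix (sdif_lin (blin_mulmxl KY u) (sdif_dE HM gc ix)).
exact: (sdif_entry 0 l d).
Qed.
Lemma dE_ct i x v : cdom i x -> cts x (fun x => dE i x v).
move=> ix;apply: gradL_cont;apply: filterS (nbhs_chart_dom ix) => y iy.
by split;[exact: lsurj_chart|exact: (sdif_d_iota HM gc)].
Qed.
Lemma cycS_pos N (j : nat) : (0 < j)%N -> cyc N j = ordS (cyc N j.-1).
by case: j => // j _;rewrite -cycS -PoszD addn1. Qed.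
Lemma node_cyc N (j : nat) : (0 < j <= N.+1)%N -> node R (cyc N j) = j%:R * N.+1%:R^-1.
case/andP => j0;rewrite leq_eqVlt => /orP[/eqP ->|jN].
 have -> : cyc N N.+1 = ord0 by apply: val_inj;rewrite /cyc modzz /= inordK.
 by rewrite /node eqxx mulfV // pnatr_eq0.
have cj : val (cyc N j) = j by rewrite (cyc_nat jN) /= (inordK jN).
rewrite /node;case: eqP => [h|_];last by rewrite cj.
by move: cj j0;rewrite h /= => <-.
Qed.
Variables (U : set_system nat) (UU : UltraFilter U) (N_ : nat -> nat)
 (mesh0 : forall e : R, 0 < e -> \forall nu \near U, mesh R N_ nu < e)
 (kappa_ : nat -> R) (x_ : forall nu, 'I_(N_ nu).+1 -> M) (y_ : forall nu, 'I_(N_ nu).+1 -> Y) (Rb : R)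
 (k01 : forall nu, 0 <= kappa_ nu <= 1)
 (kappa0 : kappa_ @ U --> (0 : R))
 (Hao : forall nu, almost_orbit ci cc cr Ht (kappa_ nu) (@x_ nu) (@y_ nu))
 (Hy : forall nu j, `|y_ (nu := nu) j| <= Rb).
Local Notation mesh := (mesh R N_).
Local Notation around := (around U N_).
Local Notation idx := (idx N_).
Local Notation osm := (osm U N_).
Definition Xc nu (j : nat) : M := x_ (cyc (N_ nu) j).
Definition Xn nu (j : nat) : M := x_ (ordS (cyc (N_ nu) j)).
Definition Yc nu (j : nat) : Y := y_ (cyc (N_ nu) j).
Lemma Xn_pred nu j : (0 < j)%N -> Xn nu j.-1 = Xc nu j.
by move=> j0;rewrite /Xn /Xc [in RHS]cycS_pos. Qed.
Lemma Yc_pred nu j : (0 < j)%N -> Yc nu j.-1 = y_ (ord_pred (cyc (N_ nu) j)).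
by move=> j0;rewrite /Yc [in RHS]cycS_pos // ordSK. Qed.
Lemma chord_XX nu (j : nat) : chord iota (@x_ nu) (cyc (N_ nu) j) = iota (Xn nu j) - iota (Xc nu j).
by []. Qed.
(** Limits are chosen as functions of the whole sequence. At times 0 and 1 the indices agree modulo
    N + 1, so the sequences are equal and the limit curve closes up. *)
Lemma limits_ex : exists (xx : R -> M) (yy : R -> Y), [/\ forall t, (fun nu => Xn nu (idx nu t)) @ U --> xx t,
 forall t, (fun nu => Yc nu (idx nu t)) @ U --> yy t, xx 1 = xx 0 & yy 1 = yy 0].
have /choice[lx Hlx] : forall f : nat -> M, exists p : M, f @ U --> p.
 by move=> f;have [|p _ fp] := ultra_lim UU (f := f) cM;[exact: nearW|exists p].
have /choice[ly Hly] : forall f : nat -> Y, exists p : Y, (forall nu, `|f nu| <= Rb) -> f @ U --> p.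
 move=> f;have [h|h] := pselect (forall nu, `|f nu| <= Rb);last by exists 0.
 have [|p _ fp] := ultra_lim UU (f := f) (@closed_ball0_compact R KY Rb);last by exists p.
 by apply: nearW => nu;exact: h.
have E1 nu : cyc (N_ nu) (idx nu (1 : R)) = cyc (N_ nu) (idx nu (0 : R)).
 rewrite idx0 idx1;have -> : ((N_ nu).+1 : int) = 0 + (N_ nu).+1%:Z by rewrite add0r.
 by rewrite cycD.
exists (fun t => lx (fun nu => Xn nu (idx nu t))), (fun t => ly (fun nu => Yc nu (idx nu t)));split.
- by move=> t;exact: Hlx.
- by move=> t;apply: Hly => nu;exact: Hy.
- by congr lx;apply/funext => nu;rewrite /Xn E1.
- by congr ly;apply/funext => nu;rewrite /Yc E1.
Qed.
Variables (xx : R -> M) (yy : R -> Y)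
 (cX : forall t, (fun nu => Xn nu (idx nu t)) @ U --> xx t)
 (cY : forall t, (fun nu => Yc nu (idx nu t)) @ U --> yy t).
Let UF : ProperFilter U. exact: ultra_proper. Qed.
Lemma iota_cvg_lift (T : Type) (F : set_system T) (FF : Filter F) (f : T -> M) x0 :
 (fun p => iota (f p)) @ F --> iota x0 -> f @ F --> x0.
move=> h B nB;have [d d0 Hd] := iota_ball cM io_c io_i nB.
have : \forall p \near F, `|iota x0 - iota (f p)| < d by move/cvgrPdist_lt: h;apply.
by apply: filterS => p hp;apply: Hd;rewrite distrC.
Qed.
Lemma chord_mesh : exists2 C : R, 0 < C & forall nu j, `|iota (Xn nu j) - iota (Xc nu j)| <= C * mesh nu.
have [C C0 HC] := chord_bnd HM gc SDT CH0 BD;exists C => // nu j.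
by rewrite mulrC -chord_XX;exact: (HC _ _ _ _ (k01 nu) (Hao nu)).
Qed.
Lemma Xn_around t : 0 <= t <= 1 -> (fun p : nat * nat => Xn p.1 p.2) @ around t --> xx t.
move=> t01;have [C C0 HC] := chord_mesh;apply: iota_cvg_lift.
apply: (around_cvg UU mesh0 (u := fun nu j => iota (Xn nu j)) (C := C)) => //;first exact: ltW.
 by apply: filterS (around_range UU N_ t) => p /andP[p0 _];rewrite Xn_pred.
have := cX (t := t) => h B /io_c nB;exact: (h _ nB).
Qed.
Lemma Xc_around t : 0 <= t <= 1 -> (fun p : nat * nat => Xc p.1 p.2) @ around t --> xx t.
move=> t01;have [C C0 HC] := chord_mesh;apply: iota_cvg_lift.
have h1 : (fun p : nat * nat => iota (Xn p.1 p.2)) @ around t --> iota (xx t).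
 by move=> B /io_c nB;exact: (Xn_around t01 nB).
have h2 : (fun p : nat * nat => iota (Xc p.1 p.2) - iota (Xn p.1 p.2)) @ around t --> (0 : Y).
 have mc : (fun p : nat * nat => mesh p.1) @ around t --> (0 : R) by apply: mesh_cvg0.
 apply/cvgrPdist_lt => e e0.
 have m1 : \forall p \near around t, `|0 - mesh p.1| < e / C by move/cvgrPdist_lt: mc;apply;rewrite divr_gt0.
 apply: filterS m1 => p;rewrite !sub0r !normrN gtr0_norm ?mesh_gt0 // ltr_pdivlMr // => h'.
 by rewrite distrC;apply: le_lt_trans (HC _ _) _;rewrite mulrC.
have -> : (fun p : nat * nat => iota (Xc p.1 p.2)) = (fun p => iota (Xc p.1 p.2) - iota (Xn p.1 p.2) + iota (Xn p.1 p.2)).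
 by apply/funext => p;rewrite subrK.
by rewrite -[iota (xx t)]add0r;apply: cvgD.
Qed.

Section At.
Variables (t0 : R) (i : chart_index A)
 (t01 : 0 <= t0 <= 1)
 (ix : cdom i (xx t0)).
Local Notation x0 := (xx t0).
Local Notation p0 := (yy t0 *m (E i x0)^T).
Local Notation w0 := (chart i x0, p0).
Local Notation F := (around t0).
Lemma near_Xc (S : M -> Prop) : (\forall x \near x0, S x) -> \forall p \near F, S (Xc p.1 p.2).
by move=> h;exact: (Xc_around t01 h). Qed.
Lemma near_Xn (S : M -> Prop) : (\forall x \near x0, S x) -> \forall p \near F, S (Xn p.1 p.2).
by move=> h;exact: (Xn_around t01 h). Qed.
Lemma cvg_Xc (W : NM R) (f : M -> W) : cts x0 f -> (fun p => f (Xc p.1 p.2)) @ F --> f x0.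
by move=> fc B nB;exact: (Xc_around t01 (fc _ nB)). Qed.
Definition Dx (p : nat * nat) : V := chart i (Xn p.1 p.2) - chart i (Xc p.1 p.2).
(** Chart components of a covector at the next node, as opposed to [Pc] at its own node; the
    momentum equation at x_j compares [Pn] of index j - 1 with [Pc] of index j. *)
Definition Pn nu j : V := Yc nu j *m (E i (Xn nu j))^T.
Definition Pc (p : nat * nat) : V := Yc p.1 p.2 *m (E i (Xc p.1 p.2))^T.
Lemma Dx_bnd : exists2 C : R, 0 < C & \forall p \near F, `|Dx p| <= C * mesh p.1.
have [C C0 HC] := chord_mesh;have [B B0 [S1 nS1 HS1]] := chart_lip HM gc ix.
exists (B * C);first exact: mulr_gt0.
apply: filterS2 (near_Xc nS1) (near_Xn nS1) => p h1 h2;rewrite /Dx.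
by apply: le_trans (HS1 _ _ h1 h2) _;rewrite -mulrA ler_wpM2l // ltW.
Qed.
Lemma strict_osm (W : NM R) (f : M -> W) L : sdif (chart i) f x0 L ->
 osm t0 (fun p => f (Xn p.1 p.2) - f (Xc p.1 p.2) - L (Dx p)).
move=> [_ d] e e0;have [C C0 HC] := Dx_bnd.
have [S1 nS1 HS1] := d _ (divr_gt0 e0 C0).
apply: filterS3 HC (near_Xc nS1) (near_Xn nS1) => p h1 h2 h3.
apply: le_trans (HS1 _ _ h2 h3) _;rewrite -/(Dx p).
apply: le_trans (_ : e / C * (C * mesh p.1) <= _);first by rewrite ler_wpM2l // divr_ge0 // ltW.
by rewrite mulrA divfK // gt_eqF.
Qed.
Lemma Rb0 : 0 <= Rb. by apply: le_trans (Hy (nu := 0) ord0). Qed.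
Lemma EE_bnd : exists2 C : R, 0 < C & \forall p \near F, `|E i (Xn p.1 p.2) - E i (Xc p.1 p.2)| <= C * mesh p.1.
have [C C0 HC] := Dx_bnd;have [B B0 [S1 nS1 HS1]] := sdif_lip (sdif_dE HM gc ix).
exists (B * C);first exact: mulr_gt0.
apply: filterS3 HC (near_Xc nS1) (near_Xn nS1) => p h h1 h2.
by apply: le_trans (HS1 _ _ h1 h2) _;rewrite -mulrA ler_wpM2l // ltW.
Qed.
(** The momentum equation is known along the move fields. Near the limit point some cutoff equals 1,
    the fields of that chart form a basis of the tangent space, and linearity carries the equation
    to chart i. *)
Lemma transfer : exists2 C : R, 0 < C & \forall p \near F, forall w : V,
 `|dotv (Yc p.1 p.2.-1 - Yc p.1 p.2) (w *m E i (Xc p.1 p.2)) - mesh p.1 *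
 (dotv (Hq Ht i (p.2%:R * mesh p.1) (chart i (Xc p.1 p.2), Pc p)) w +
 dotv (Hp Ht i (p.2%:R * mesh p.1) (chart i (Xc p.1 p.2), Pc p)) (Yc p.1 p.2 *m (dE i (Xc p.1 p.2) w)^T))|
 <= C * `|w| * mesh p.1 ^+ 2.
have [k hk] := beta_cover gc x0;have cr0 : 0 < cr k by case: gc.
have b0 : 0 < beta ci cc cr k x0 by apply: lt_trans hk;rewrite divr_gt0.
have [kx _] := beta_gt0 b0.
have nk : \forall x \near x0, cr k / 2 < beta ci cc cr k x.
 have bc : cts x0 (fun x => - beta ci cc cr k x) by apply: ctN;exact: (beta_cont HM gc).
 have : \forall x \near x0, - beta ci cc cr k x < - (cr k / 2) by apply: near_lt bc _;rewrite ltrN2.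
 by apply: filterS => x';rewrite ltrN2.
have [LJ dJ] := sdif_jacobian ix kx.
have nJ := near_bnd (sdif_cvg (chart_ct ix) dJ);set BJ := _ + 1 in nJ.
have BJ0 : 0 <= BJ by rewrite addr_ge0.
exists (n%:R * (n%:R * BJ) + 1);first by rewrite ltr_wpDl // !mulr_ge0.
have nS : \forall x \near x0, [/\ cdom i x, cr k / 2 < beta ci cc cr k x & `|transition_jacobian i (ci k) x| <= BJ].
 by apply: filterS3 (nbhs_chart_dom ix) nk nJ => x h1 h2 h3.
apply: filterS2 (near_Xc nS) (around_range UU N_ t0) => p [ixp bp Jp] pr w.
set x := Xc p.1 p.2 in ixp bp Jp *;set y := Yc p.1 p.2.
have kxp : cdom (ci k) x.
 by have b1 : 0 < beta ci cc cr k x by [apply: lt_trans bp;rewrite divr_gt0];case: (beta_gt0 b1).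
have xk : xi k x = 1 by apply: (xi1 gc).
have [p1 _] := andP pr;rewrite Yc_pred //.
set Dy := _ - y;set kap := kappa_ p.1;set G := Hk kap (node R (cyc (N_ p.1) p.2)).
pose f (v : V) := dotv Dy (v *m E (ci k) x) - mesh p.1 * gradL (pchart (ci k)) G (x, y) (v, 0).
have bf : blin f.
 have b1 : blin (fun v : V => dotv Dy (v *m E (ci k) x)).
 split=> [a b|a b|];first by rewrite mulmxDl dotvDr.
 by rewrite -scalemxAl dotvZr.
 exists (KY%:R * `|Dy| * (n%:R * `|E (ci k) x|)) => [|v];first by rewrite !mulr_ge0.
 apply: le_trans (dotv_norm _ _) _;rewrite -[leRHS]mulrA ler_wpM2l ?mulr_ge0 //.
 by apply: le_trans (mulmx_norm _ _) _;rewrite mulrAC.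
 have b2 : blin (fun v : V => ((v, 0) : V * Y)).
 split=> [a b|a b|];first by rewrite -[RHS]/(a + b, 0 + 0) addr0.
 by rewrite -[RHS]/(a *: b, a *: 0) scaler0.
 by exists 1 => // b;rewrite norm_pair0 mul1r.
 have b3 := blin_comp (pgrad_blin (SD_Hk HM gc SDT kap (node R (cyc (N_ p.1) p.2))) (kxp : cdom (ci k) (x, y).1)) b2.
 have E4 : f = (fun v => dotv Dy (v *m E (ci k) x) + - mesh p.1 *: (gradL (pchart (ci k)) G (x, y) \o (fun v : V => ((v, 0) : V * Y))) v).
 by apply/funext => v;rewrite /f /= scaleNr.
 by rewrite E4;exact: blinD b1 (blinZ (- mesh p.1) b3).
have fb v : `|f v| <= n%:R * (mesh p.1 ^+ 2) * `|v|.
 rewrite (blin_dotv v bf);apply: le_trans (dotv_norm _ _) _;rewrite ler_wpM2r // ler_wpM2l //.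
 apply: mx_norm_le => [|l a];first by rewrite exprn_ge0 // ltW ?mesh_gt0.
 rewrite mxE;have := (Hao p.1).2 k a (cyc (N_ p.1) p.2).
 by rewrite (fieldE HM gc) // /dmove asboolT // xk !scale1r.
have := fb (w *m transition_jacobian i (ci k) x).
rewrite /f -mulmxA -(d_iota_transition HM gc ixp kxp).
rewrite -(gradL_transition (SD_Hk HM gc SDT kap _) w 0 (ixp : cdom i (x, y).1) kxp).
rewrite (gradL_Hk HM gc SDT) // dotv0r !mulr0 addr0 mul0mx add0r node_cyc // => h.
apply: le_trans h _;apply: le_trans (_ : n%:R * mesh p.1 ^+ 2 * (n%:R * `|w| * BJ) <= _).
 apply: ler_wpM2l;first by rewrite mulr_ge0 // exprn_ge0 // ltW // mesh_gt0.
 by apply: le_trans (mulmx_norm _ _) _;rewrite ler_wpM2l ?mulr_ge0.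
have -> : n%:R * mesh p.1 ^+ 2 * (n%:R * `|w| * BJ) = n%:R * (n%:R * BJ) * `|w| * mesh p.1 ^+ 2 by ring.
by apply: ler_wpM2r;[rewrite exprn_ge0 // ltW // mesh_gt0|rewrite ler_wpM2r // lerDl].
Qed.
Lemma cvg_F (Z : Top) (W : Top) (f : nat * nat -> Z) (z0 : Z) (h : Z -> W) :
 f @ F --> z0 -> cts z0 h -> (fun p => h (f p)) @ F --> h z0.
by move=> cf ch B nB;exact: (cf _ (ch _ nB)). Qed.
Lemma Pn_pred nu j : (0 < j)%N -> Pn nu j.-1 = Yc nu j.-1 *m (E i (Xc nu j))^T.
by move=> j0;rewrite /Pn Xn_pred. Qed.
Lemma Pn_diff nu j : (0 < j)%N -> Pn nu j - Pn nu j.-1 =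
 Yc nu j *m (E i (Xn nu j) - E i (Xc nu j))^T - (Yc nu j.-1 - Yc nu j) *m (E i (Xc nu j))^T.
move=> j0;rewrite Pn_pred // /Pn linearB /= mulmxBr mulmxBl opprB addrA subrK //.
Qed.
Lemma entry_dotv d (y : Y) (B : 'M[R]_(d, KY)) b : (y *m B^T) 0 b = dotv y (delta_mx 0 b *m B).
by rewrite dotvC dotv_mul dotv_delta. Qed.
Lemma Pn_init : (fun nu => Pn nu (idx nu t0)) @ U --> p0.
have c1 : (fun nu => (Yc nu (idx nu t0), Xn nu (idx nu t0)) : Y * M) @ U --> (yy t0, x0).
 exact: cvg_pair (cY (t := t0)) (cX (t := t0)).
have hc : {for (yy t0, x0), continuous (fun q : Y * M => q.1 *m (E i q.2)^T)}.
 apply: continuous_mx => a b.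
 rewrite (_ : (fun q => _) = (fun q : Y * M => dotv q.1 (delta_mx 0 b *m E i q.2)));last first.
 by apply/funext => q;rewrite ord1 entry_dotv.
 apply: continuous_dotv;first exact: ct_p1.
 apply: (ct_comp (f := fun B : 'M[R]_(n, KY) => delta_mx 0 b *m B) (a := fun q : Y * M => E i q.2)).
 exact: (sdif_cvg (c := id) (@cvg_id _ _) (sdif_lin (blin_mulmxl KY (delta_mx 0 b)) (sdif_coord id _))).
 by apply: (ct_comp (f := E i) (a := snd));[exact: (E_ct HM gc)|exact: ct_p2].
by move=> B nB;exact: (c1 _ (hc _ nB)).
Qed.
Lemma Hq_bnd : exists2 C : R, 0 < C & \forall p \near F,
 `|(Yc p.1 p.2.-1 - Yc p.1 p.2) *m (E i (Xc p.1 p.2))^T| <= C * mesh p.1.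
have [k hk] := beta_cover gc x0;have cr0 : 0 < cr k by case: gc.
have b0 : 0 < beta ci cc cr k x0 by apply: lt_trans hk;rewrite divr_gt0.
have [kx _] := beta_gt0 b0.
have nk : \forall x \near x0, cr k / 2 < beta ci cc cr k x.
 have bc : cts x0 (fun x => - beta ci cc cr k x) by apply: ctN;exact: (beta_cont HM gc).
 have : \forall x \near x0, - beta ci cc cr k x < - (cr k / 2) by apply: near_lt bc _;rewrite ltrN2.
 by apply: filterS => x';rewrite ltrN2.
have [LJ dJ] := sdif_jacobian ix kx.
have nJ := near_bnd (sdif_cvg (chart_ct ix) dJ);set BJ := _ + 1 in nJ.
have BJ0 : 0 <= BJ by rewrite addr_ge0.
have [CD CD0 HCD] := dmove_bnd HM gc SDT CH0 BD;have RR := Rb0.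
exists (n%:R * (CD * (1 + Rb) + 1) * BJ + 1);first by rewrite ltr_wpDl // !mulr_ge0 // addr_ge0 // mulr_ge0 ?addr_ge0 // ltW.
have nS : \forall x \near x0, [/\ cdom i x, cr k / 2 < beta ci cc cr k x & `|transition_jacobian i (ci k) x| <= BJ].
 by apply: filterS3 (nbhs_chart_dom ix) nk nJ => x h1 h2 h3.
have m1 : \forall p \near F, mesh p.1 < 1 by exact: around_U (mesh0 ltr01).
apply: filterS3 (near_Xc nS) (around_range UU N_ t0) m1 => p [ixp bp Jp] pr m1.
have kxp : cdom (ci k) (Xc p.1 p.2).
 by have b1 : 0 < beta ci cc cr k (Xc p.1 p.2) by [apply: lt_trans bp;rewrite divr_gt0];case: (beta_gt0 b1).
have xk : xi k (Xc p.1 p.2) = 1 by apply: (xi1 gc).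
have [p1 _] := andP pr;have mp := mesh_gt0 R N_ p.1.
rewrite (d_iota_transition HM gc ixp kxp) trmx_mul mulmxA.
set q := _ *m (E (ci k) _)^T.
have hq : `|q| <= mesh p.1 * (CD * (1 + Rb) + 1).
 apply: mx_norm_le => [|l a];first by rewrite mulr_ge0 ?(ltW mp) // addr_ge0 // mulr_ge0 ?addr_ge0 // ltW.
 rewrite ord1 /q entry_dotv Yc_pred //.
 have := (Hao p.1).2 k a (cyc (N_ p.1) p.2);rewrite (fieldE HM gc) // xk scale1r.
 have := HCD (kappa_ p.1) (node R (cyc (N_ p.1) p.2)) k a (Xc p.1 p.2, Yc p.1 p.2) (node_itv R _).
 rewrite -/(mesh p.1) -/(Xc p.1 p.2) -/(Yc p.1 p.2) /=.
 have hy : `|Yc p.1 p.2| <= Rb by exact: Hy.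
 set D := dmove _ _ _ _ _ _ _;set e := dotv _ _ => h1 h2.
 have h3 : `|D| <= CD * (1 + Rb) by apply: le_trans h1 _;rewrite ler_wpM2l ?(ltW CD0) // lerD2l.
 have h4 := ler_wpM2l (ltW mp) h3.
 have h5 := ler_normD (e - mesh p.1 * D) (mesh p.1 * D);rewrite subrK normrM (gtr0_norm mp) in h5.
 apply: le_trans h5 _;rewrite mulrDr addrC;apply: lerD => //.
 by apply: le_trans h2 _;rewrite expr2 ler_wpM2l ?ltW.
apply: le_trans (mulmx_norm _ _) _.
apply: le_trans (_ : n%:R * (mesh p.1 * (CD * (1 + Rb) + 1)) * BJ <= _).
 by apply: ler_pM => //;[rewrite ler_wpM2l|exact: le_trans (norm_trmx_le _) Jp].
rewrite (_ : n%:R * _ * BJ = n%:R * (CD * (1 + Rb) + 1) * BJ * mesh p.1);last by ring.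
by rewrite ler_wpM2r ?(ltW mp) // lerDl.
Qed.
Lemma YE_bnd : exists2 C : R, 0 < C & \forall p \near F,
 `|Yc p.1 p.2 *m (E i (Xn p.1 p.2) - E i (Xc p.1 p.2))^T| <= C * mesh p.1.
have [C C0 HC] := EE_bnd;have RR := Rb0;exists (KY%:R * Rb * C + 1);first by rewrite ltr_wpDl // !mulr_ge0 // ltW.
apply: filterS HC => p h;have mp := mesh_gt0 R N_ p.1;apply: le_trans (mulmx_norm _ _) _.
apply: le_trans (_ : KY%:R * Rb * (C * mesh p.1) <= _).
 apply: ler_pM => //;[by rewrite ler_wpM2l //;exact: Hy|exact: le_trans (norm_trmx_le _) h].
by rewrite mulrA ler_wpM2r ?(ltW mp) // lerDl.
Qed.
Lemma Pn_around : (fun p : nat * nat => Pn p.1 p.2) @ F --> p0.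
have [C1 C10 H1] := Hq_bnd;have [C2 C20 H2] := YE_bnd.
apply: (around_cvg UU mesh0 (u := Pn) (C := C2 + C1)) => //;first by rewrite addr_ge0 // ltW.
 apply: filterS3 H1 H2 (around_range UU N_ t0) => p h1 h2 /andP[pp _].
 rewrite Pn_diff //;apply: le_trans (ler_normB _ _) _;by rewrite mulrDl lerD.
exact: Pn_init.
Qed.
Lemma Pc_around : Pc @ F --> p0.
have [C2 C20 H2] := YE_bnd;have mc : (fun p : nat * nat => mesh p.1) @ F --> (0 : R) by apply: mesh_cvg0.
have h0 : (fun p : nat * nat => Yc p.1 p.2 *m (E i (Xn p.1 p.2) - E i (Xc p.1 p.2))^T) @ F --> (0 : V).
 apply/cvgrPdist_lt => e e0.
 have m1 : \forall p \near F, `|0 - mesh p.1| < e / C2 by move/cvgrPdist_lt: mc;apply;rewrite divr_gt0.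
 apply: filterS2 m1 H2 => p;rewrite !sub0r !normrN gtr0_norm ?mesh_gt0 // ltr_pdivlMr // => h1 h2.
 by apply: le_lt_trans h2 _;rewrite mulrC.
have -> : Pc = (fun p => Pn p.1 p.2 - Yc p.1 p.2 *m (E i (Xn p.1 p.2) - E i (Xc p.1 p.2))^T).
 by apply/funext => p;rewrite /Pc /Pn linearB /= mulmxBr opprB addrC subrK.
by rewrite -[p0]subr0;apply: cvgB => //;exact: Pn_around.
Qed.
Definition tw (p : nat * nat) : R * (V * V) := (p.2%:R * mesh p.1, (chart i (Xc p.1 p.2), Pc p)).
Lemma tw_cvg : tw @ F --> (t0, w0).
have c1 : (fun p : nat * nat => p.2%:R * mesh p.1) @ F --> t0 by exact: time_cvg.
have c2 : (fun p : nat * nat => chart i (Xc p.1 p.2)) @ F --> chart i x0 by apply: cvg_Xc;exact: chart_ct.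
exact: cvg_pair c1 (cvg_pair c2 Pc_around).
Qed.
Let iw : cimg i w0.1. exact: chart_imgP. Qed.
Lemma Hp_around : (fun p => Hp Ht i (tw p).1 (tw p).2) @ F --> Hp Ht i t0 w0.
have hc : {for (t0, w0), continuous (fun q : R * (V * V) => Hp Ht i q.1 q.2)} by apply: Hp_cont => //;exact: iw.
exact: (cvg_F (h := fun q : R * (V * V) => Hp Ht i q.1 q.2) tw_cvg hc).
Qed.
Lemma Hq_around : (fun p => Hq Ht i (tw p).1 (tw p).2) @ F --> Hq Ht i t0 w0.
have hc : {for (t0, w0), continuous (fun q : R * (V * V) => Hq Ht i q.1 q.2)} by apply: Hq_cont => //;exact: iw.
exact: (cvg_F (h := fun q : R * (V * V) => Hq Ht i q.1 q.2) tw_cvg hc).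
Qed.
Lemma hloc_around : (fun p => hloc Ht i (tw p).1 (tw p).2) @ F --> hloc Ht i t0 w0.
have hc : {for (t0, w0), continuous (fun q : R * (V * V) => hloc Ht i q.1 q.2)} by apply: HtC;exact: iw.
exact: (cvg_F (h := fun q : R * (V * V) => hloc Ht i q.1 q.2) tw_cvg hc).
Qed.
Definition chord_err (p : nat * nat) : Y := iota (Xn p.1 p.2) - iota (Xc p.1 p.2) -
 mesh p.1 *: (Hp Ht i (tw p).1 (tw p).2 *m E i (Xc p.1 p.2) + (kappa_ p.1 / bracket (Yc p.1 p.2)) *: Yc p.1 p.2).
Lemma chord_errP : \forall p \near F, (1 + `|Yc p.1 p.2|) * `|chord_err p| <= mesh p.1 ^+ 2.
apply: filterS2 (near_Xc (nbhs_chart_dom ix)) (around_range UU N_ t0) => p ixp pr.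
have := (Hao p.1).1 (cyc (N_ p.1) p.2).
rewrite chord_XX (vgrad_Hk HM gc SDT _ _ (ixp : cdom i (x_ (cyc (N_ p.1) p.2), y_ (cyc (N_ p.1) p.2)).1)) /=.
by rewrite node_cyc.
Qed.
Lemma osm_mesh2 (W : NM R) (f : nat * nat -> W) : (\forall p \near F, `|f p| <= mesh p.1 ^+ 2) -> osm t0 f.
move=> h;apply: (osm_cvg0 UU (g := fun p => mesh p.1) (C := 1));first exact: mesh_cvg0.
by apply: filterS h => p;rewrite mul1r (gtr0_norm (mesh_gt0 _ _ _)) expr2.
Qed.
Lemma osm_chord_err : osm t0 chord_err.
apply: osm_mesh2;apply: filterS chord_errP => p;apply: le_trans.
by rewrite ler_peMl // lerDl.
Qed.
Lemma kappa_F : (fun p : nat * nat => kappa_ p.1) @ F --> (0 : R).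
apply/cvgrPdist_lt => e e0;have h : \forall nu \near U, `|0 - kappa_ nu| < e by move/cvgrPdist_lt: kappa0;apply.
exact: (around_U UU N_ t0 h).
Qed.
Lemma kappa_term_bnd p : `|(kappa_ p.1 / bracket (Yc p.1 p.2)) *: Yc p.1 p.2| <= `|kappa_ p.1|.
have b1 := bracket_ge1 (Yc p.1 p.2);have bp : 0 < bracket (Yc p.1 p.2) by apply: lt_le_trans b1.
rewrite normrZ normrM (gtr0_norm (_ : 0 < (bracket _)^-1)) ?invr_gt0 // -mulrA ler_piMr //.
by rewrite mulrC ler_pdivrMr // mul1r;exact: bracket_ge.
Qed.
(** Discrete form of q' = H_p: the chord equation multiplied by the right inverse [G] of d iota at
    the limit point, the kappa term being o(mesh). *)
Lemma osm_Dx : osm t0 (fun p => Dx p - mesh p.1 *: Hp Ht i t0 w0).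
pose E0 := E i x0;pose G := E0^T *m invmx (gram ci cc cr i x0).
have EG : E0 *m G = 1%:M by rewrite mulmxA -/(gram ci cc cr i x0) mulmxV // (gram_unit gc).
set b0 := Hp Ht i t0 w0.
have o1 := strict_osm (sdif_iota HM gc ix).
have o2 : osm t0 (fun p => mesh p.1 *: ((Hp Ht i (tw p).1 (tw p).2 *m E i (Xc p.1 p.2) - b0 *m E0) + (kappa_ p.1 / bracket (Yc p.1 p.2)) *: Yc p.1 p.2)).
 apply: osm_mesh;rewrite -[X in _ --> X]addr0;apply: cvgD.
 rewrite -[X in _ --> X](subrr (b0 *m E0));apply: cvgB;last exact: cvg_cst.
 have c1 : (fun p => (Hp Ht i (tw p).1 (tw p).2, E i (Xc p.1 p.2)) : V * 'M[R]_(n, KY)) @ F --> (b0, E0).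
 by have cE := cvg_Xc (E_ct HM gc ix);exact: cvg_pair Hp_around cE.
 have hc : {for (b0, E0), continuous (fun q : V * 'M[R]_(n, KY) => q.1 *m q.2)}.
 apply: (sdif_cvg (c := id) (@cvg_id _ _)).
 by apply: sdif_mulmx;[exact: cvg_id|exact: (sdif_lin (blin_fst _ _) (sdif_coord id _))|exact: (sdif_lin (blin_snd _ _) (sdif_coord id _))].
 exact: (cvg_F (h := fun q : V * 'M[R]_(n, KY) => q.1 *m q.2) c1 hc).
 apply/cvgrPdist_lt => e e0;have h : \forall p \near F, `|0 - kappa_ p.1| < e by move/cvgrPdist_lt: kappa_F;apply.
 apply: filterS h => p;rewrite !sub0r !normrN;apply: le_lt_trans;exact: kappa_term_bnd.
have o3 := osmD UU (osmD UU osm_chord_err o2) (osmN UU o1).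
apply: (osm_le UU (C := KY%:R * `|G|)) o3;apply: nearW => p.
rewrite -[Dx p - _]mulmx1 -EG mulmxA.
set a := (Dx p - _) *m E0;set b := _ + - _.
have -> : a = b.
 rewrite /a /b /chord_err mulmxBl -scalemxAl.
 set c1 := iota _ - iota _;set h1 := Hp _ _ _ _ *m _;set k1 := (_ / _) *: _.
 rewrite addrAC scalerDr scalerDr scalerBr;rewrite opprB.
 by apply/rowP => l;rewrite !mxE;ring.
apply: le_trans (mulmx_norm _ _) _;by rewrite mulrAC.
Qed.
(** Discrete form of p' = - H_q. The increment of p combines the change of d iota along the chord
    with the increment of y; the second derivatives of [iota] produced by both cancel by
    [dE_sym]. *)
Lemma osm_Pn : osm t0 (fun p => Pn p.1 p.2 - Pn p.1 p.2.-1 - mesh p.1 *: (- Hq Ht i t0 w0)).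
set a0 := Hq Ht i t0 w0;set b0 := Hp Ht i t0 w0;have RR := Rb0.
apply: osm_rV => b;pose eb : V := delta_mx 0 b.
have [C C0 HT] := transfer.
(* Five errors: linearization of d iota, replacement of the chart increment by mesh times [Hp], the
   momentum equation, and the convergence of [Hq] and of [Hp] with the second derivative. *)
pose o1 p := dotv (Yc p.1 p.2) (eb *m (E i (Xn p.1 p.2) - E i (Xc p.1 p.2) - dE i x0 (Dx p))).
pose o2 p := dotv (Yc p.1 p.2) (eb *m dE i x0 (Dx p - mesh p.1 *: b0)).
pose o3 p := dotv (Yc p.1 p.2.-1 - Yc p.1 p.2) (eb *m E i (Xc p.1 p.2)) - mesh p.1 *
 (dotv (Hq Ht i (tw p).1 (tw p).2) eb + dotv (Hp Ht i (tw p).1 (tw p).2) (Yc p.1 p.2 *m (dE i (Xc p.1 p.2) eb)^T)).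
pose o4 p := mesh p.1 *: ((a0 - Hq Ht i (tw p).1 (tw p).2) 0 b).
pose o5 p := mesh p.1 * dotv (Yc p.1 p.2) (b0 *m dE i x0 eb - Hp Ht i (tw p).1 (tw p).2 *m dE i (Xc p.1 p.2) eb).
have [bd _] := sdif_dE HM gc ix;have [hD hZ [Cd Cd0 HCd]] := bd.
have ybnd (f : nat * nat -> Y) : osm t0 f -> osm t0 (fun p => dotv (Yc p.1 p.2) (f p)).
 apply: (osm_le UU (C := KY%:R * Rb));apply: nearW => p;apply: le_trans (dotv_norm _ _) _.
 by rewrite ler_wpM2r // ler_wpM2l //;exact: Hy.
have h1 : osm t0 o1.
 apply: ybnd;apply: (osm_le UU (C := n%:R * `|eb|)) (strict_osm (sdif_dE HM gc ix)).
 by apply: nearW => p;exact: mulmx_norm.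
have h2 : osm t0 o2.
 apply: ybnd;apply: (osm_le UU (C := n%:R * `|eb| * Cd)) osm_Dx;apply: nearW => p.
 by apply: le_trans (mulmx_norm _ _) _;rewrite -[leRHS]mulrA ler_wpM2l ?mulr_ge0.
have h3 : osm t0 o3.
 apply: (osm_cvg0 UU (g := fun p => mesh p.1) (C := C));first exact: mesh_cvg0.
 apply: filterS HT => p hp;apply: le_trans (hp eb) _;have mp := mesh_gt0 R N_ p.1.
 have he : `|eb| <= 1 by exact: norm_delta_le.
 rewrite (gtr0_norm mp) expr2;have -> : C * `|eb| * (mesh p.1 * mesh p.1) = `|eb| * (mesh p.1 * (C * mesh p.1)) by ring.
 by apply: ler_piMl he;exact: (mulr_ge0 (ltW mp) (mulr_ge0 (ltW C0) (ltW mp))).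
have h4 : osm t0 o4.
 apply: osm_mesh;rewrite -[X in _ --> X](_ : (a0 - a0) 0 b = 0);last by rewrite subrr mxE.
 have c1 : (fun p => a0 - Hq Ht i (tw p).1 (tw p).2) @ F --> a0 - a0 by apply: cvgB;[exact: cvg_cst|exact: Hq_around].
 exact: (cvg_F (h := fun v : V => v 0 b) c1 (sdif_cvg (c := id) (@cvg_id _ _) (sdif_entry 0 b (sdif_coord id _)))).
have h5 : osm t0 o5.
 apply: (osm_le UU (C := 1) (g := fun p => dotv (Yc p.1 p.2) (mesh p.1 *: (b0 *m dE i x0 eb - Hp Ht i (tw p).1 (tw p).2 *m dE i (Xc p.1 p.2) eb)))).
 by apply: nearW => p;rewrite dotvZr mul1r.
 apply: ybnd;apply: osm_mesh;rewrite -[X in _ --> X](subrr (b0 *m dE i x0 eb));apply: cvgB;first exact: cvg_cst.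
 have c1 : (fun p => (Hp Ht i (tw p).1 (tw p).2, dE i (Xc p.1 p.2) eb) : V * 'M[R]_(n, KY)) @ F --> (b0, dE i x0 eb).
 have dct : cts x0 (fun x => dE i x eb) by exact: dE_ct.
 by have cE := cvg_Xc dct;exact: cvg_pair Hp_around cE.
 have hc : {for (b0, dE i x0 eb), continuous (fun q : V * 'M[R]_(n, KY) => q.1 *m q.2)}.
 apply: (sdif_cvg (c := id) (@cvg_id _ _)).
 by apply: sdif_mulmx;[exact: cvg_id|exact: (sdif_lin (blin_fst _ _) (sdif_coord id _))|exact: (sdif_lin (blin_snd _ _) (sdif_coord id _))].
 exact: (cvg_F (h := fun q : V * 'M[R]_(n, KY) => q.1 *m q.2) c1 hc).
have hall := osmD UU (osmD UU (osmD UU h1 h2) (osmN UU h3)) (osmD UU h4 h5).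
apply: (osm_le UU (C := 1)) hall;apply: filterS (around_range UU N_ t0) => p /andP[p1 _].
rewrite mul1r le_eqVlt;apply/orP;left;apply/eqP;congr (`|_|).
rewrite Pn_diff //.
have sub_e (u v : V) : (u - v) 0 b = u 0 b - v 0 b by rewrite !mxE.
have -> (u v z : V) : (u - v - mesh p.1 *: - z) 0 b = u 0 b - v 0 b + mesh p.1 * z 0 b by rewrite !mxE;ring.
rewrite !entry_dotv -/eb.
have E1 : o1 p = dotv (Yc p.1 p.2) (eb *m (E i (Xn p.1 p.2) - E i (Xc p.1 p.2))) - dotv (Yc p.1 p.2) (eb *m dE i x0 (Dx p)).
 by rewrite /o1 mulmxBr dotvBr.
have E2 : o2 p = dotv (Yc p.1 p.2) (eb *m dE i x0 (Dx p)) - mesh p.1 * dotv (Yc p.1 p.2) (b0 *m dE i x0 eb).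
 by rewrite /o2 (blinB _ _ bd) hZ mulmxBr -scalemxAr dotvBr dotvZr (dE_sym b0 eb ix).
have E3 : o3 p = dotv (Yc p.1 p.2.-1 - Yc p.1 p.2) (eb *m E i (Xc p.1 p.2)) - mesh p.1 *
 (Hq Ht i (tw p).1 (tw p).2 0 b + dotv (Yc p.1 p.2) (Hp Ht i (tw p).1 (tw p).2 *m dE i (Xc p.1 p.2) eb)).
 have g1 : dotv (Hq Ht i (tw p).1 (tw p).2) eb = Hq Ht i (tw p).1 (tw p).2 0 b by rewrite dotvC dotv_delta.
 have g2 : dotv (Hp Ht i (tw p).1 (tw p).2) (Yc p.1 p.2 *m (dE i (Xc p.1 p.2) eb)^T) =
 dotv (Yc p.1 p.2) (Hp Ht i (tw p).1 (tw p).2 *m dE i (Xc p.1 p.2) eb) by rewrite -dotv_mul dotvC.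
 by rewrite /o3 g1 g2.
have E4 : o4 p = mesh p.1 * (a0 0 b - Hq Ht i (tw p).1 (tw p).2 0 b) by rewrite /o4 sub_e.
have E5 : o5 p = mesh p.1 * (dotv (Yc p.1 p.2) (b0 *m dE i x0 eb) - dotv (Yc p.1 p.2) (Hp Ht i (tw p).1 (tw p).2 *m dE i (Xc p.1 p.2) eb)).
 by rewrite /o5 dotvBr.
rewrite E1 E2 E3 E4 E5;exact: pn_alg.
Qed.
(** A one-step action is mesh times the Lagrangian p H_p - H up to o(mesh); the penalty is
    negligible because y is bounded and kappa tends to 0. *)
Lemma osm_action : osm t0 (fun p => dotv (Yc p.1 p.2) (iota (Xn p.1 p.2) - iota (Xc p.1 p.2))
 - mesh p.1 * Hk (kappa_ p.1) (p.2%:R * mesh p.1) (Xc p.1 p.2, Yc p.1 p.2)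
 - mesh p.1 * (dotv p0 (Hp Ht i t0 w0) - hloc Ht i t0 w0)).
have RR := Rb0;pose y p := Yc p.1 p.2;pose hp p := Hp Ht i (tw p).1 (tw p).2;pose hl p := hloc Ht i (tw p).1 (tw p).2.
pose o1 p := dotv (y p) (chord_err p).
pose o2 p := mesh p.1 *: (dotv (Pc p) (hp p) - hl p - (dotv p0 (Hp Ht i t0 w0) - hloc Ht i t0 w0)).
pose o3 p := mesh p.1 * (kappa_ p.1 * ((bracket (y p))^-1 * dotv (y p) (y p) - (bracket (y p) - 1))).
have h1 : osm t0 o1.
 apply: (osm_le UU (C := KY%:R * Rb)) osm_chord_err;apply: nearW => p;apply: le_trans (dotv_norm _ _) _.
 by rewrite ler_wpM2r // ler_wpM2l //;exact: Hy.
have h2 : osm t0 o2.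
 apply: osm_mesh;rewrite -[X in _ --> X](subrr (dotv p0 (Hp Ht i t0 w0) - hloc Ht i t0 w0)).
 apply: cvgB;last exact: cvg_cst.
 apply: cvgB;last exact: hloc_around.
 have c1 : (fun p => (Pc p, hp p) : V * V) @ F --> (p0, Hp Ht i t0 w0) by exact: cvg_pair Pc_around Hp_around.
 apply: (cvg_F (h := fun q : V * V => dotv q.1 q.2) c1).
 by apply: continuous_dotv;[exact: ct_p1|exact: ct_p2].
have h3 : osm t0 o3.
 apply: (osm_cvg0 UU (g := fun p => kappa_ p.1) (C := KY%:R * Rb + KY%:R * Rb));first exact: kappa_F.
 apply: nearW => p;have mp := mesh_gt0 R N_ p.1;rewrite !normrM (gtr0_norm mp) mulrCA ler_wpM2l // mulrC ler_wpM2r ?(ltW mp) //.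
 apply: le_trans (ler_normB _ _) _;have yb : `|y p| <= Rb by exact: Hy.
 have b1 := bracket_ge1 (y p);apply: lerD.
 by apply: le_trans (bracket_grad _ _) _;rewrite ler_wpM2l.
 rewrite ger0_norm ?subr_ge0 // lerBlDl;apply: le_trans (bracket_le _) _;by rewrite lerD2l ler_wpM2l.
have hall := osmD UU (osmD UU h1 h2) h3.
apply: (osm_le UU (C := 1)) hall;apply: filterS (near_Xc (nbhs_chart_dom ix)) => p ixp.
rewrite mul1r le_eqVlt;apply/orP;left;apply/eqP;congr (`|_|).
have -> : Hk (kappa_ p.1) (p.2%:R * mesh p.1) (Xc p.1 p.2, y p) = hl p + kappa_ p.1 * (bracket (y p) - 1).
 by rewrite /Hk /Submission.Hk (lift_lcoord HM gc (ixp : cdom i (Xc p.1 p.2, y p).1)).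
have E1 : o1 p = dotv (y p) (iota (Xn p.1 p.2) - iota (Xc p.1 p.2)) -
 mesh p.1 * (dotv (Pc p) (hp p) + kappa_ p.1 / bracket (y p) * dotv (y p) (y p)).
 have -> : dotv (Pc p) (hp p) = dotv (y p) (hp p *m E i (Xc p.1 p.2)) by rewrite [RHS]dotvC dotv_mul dotvC.
 rewrite /o1 /chord_err -/(y p) -/(hp p);move: (iota _ - iota _) => cd.
 by rewrite dotvBr dotvZr dotvDr dotvZr.
have E2 : o2 p = mesh p.1 * (dotv (Pc p) (hp p) - hl p - (dotv p0 (Hp Ht i t0 w0) - hloc Ht i t0 w0)) by [].
rewrite E1 E2 /o3;exact: act_alg.
Qed.
Lemma xx_near (S : M -> Prop) : (\forall x \near x0, S x) -> exists2 d : R, 0 < d & forall s, 0 <= s <= 1 -> `|s - t0| < d -> S (xx s).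
move=> nS;have [r r0 Hr] := iota_ball cM io_c io_i nS;have r2 : 0 < r / 2 by rewrite divr_gt0.
have nb : \forall x \near x0, `|iota x - iota x0| < r / 2 by apply: near_dist r2;exact: io_c.
have [|d d0 hd] := around_at UU mesh0 (t := t0) (S := fun nu j => `|iota (Xn nu j) - iota x0| < r / 2).
 by apply: filterS3 (near_Xn nb) (near_Xc nb) (around_range UU N_ t0) => p h1 h2 /andP[p1 _];rewrite Xn_pred.
exists d => // s s01 sd;apply: Hr;apply: le_lt_trans (_ : r / 2 < r);last by rewrite ltr_pdivrMr // ltr_pMr // ltr1n.
have cs : (fun nu => `|iota (Xn nu (idx nu s)) - iota x0|) @ U --> `|iota (xx s) - iota x0|.
 by apply: cvg_norm;apply: cvgB;[move=> B /io_c nB;exact: (cX (t := s) nB)|exact: cvg_cst].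
apply: ler_cvg_to cs (cvg_cst _) _;apply: filterS hd => nu h;apply: ltW;apply: (h s) => //.
by apply: ltW_idx;case/andP: s01.
Qed.
Lemma deriv_q (e : R) : 0 < e -> exists2 d : R, 0 < d & forall s s', 0 <= s <= 1 -> 0 <= s' <= 1 -> `|s - t0| < d -> `|s' - t0| < d ->
 `|chart i (xx s') - chart i (xx s) - (s' - s) *: Hp Ht i t0 w0| <= e * `|s' - s|.
apply: (around_derive UU mesh0 (u := fun nu j => chart i (Xn nu j)) (f := fun s => chart i (xx s))) => //.
 by move=> r r0;apply: filterS2 (osm_Dx r0) (around_range UU N_ t0) => p h /andP[p1 _];rewrite Xn_pred.
have [d d0 hd] := xx_near (nbhs_chart_dom ix);exists d => // s s01 sd.
by move=> B nB;exact: (cX (t := s) (chart_ct (hd s s01 sd) nB)).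
Qed.
End At.
Lemma deriv_p (t0 : R) i : 0 <= t0 <= 1 -> cdom i (xx t0) -> forall e : R, 0 < e -> exists2 d : R, 0 < d &
 forall s s', 0 <= s <= 1 -> 0 <= s' <= 1 -> `|s - t0| < d -> `|s' - t0| < d ->
 `|yy s' *m (E i (xx s'))^T - yy s *m (E i (xx s))^T -
 (s' - s) *: - Hq Ht i t0 (chart i (xx t0), yy t0 *m (E i (xx t0))^T)| <= e * `|s' - s|.
move=> t01 ix;apply: (around_derive UU mesh0 (u := Pn i) (f := fun s => yy s *m (E i (xx s))^T)) => //.
 exact: osm_Pn.
have [d d0 hd] := xx_near t01 (nbhs_chart_dom ix);exists d => // s s01 sd.
by apply: Pn_init;exact: hd.
Qed.
Definition inc nu (j : nat) : R := dotv (Yc nu j) (iota (Xn nu j) - iota (Xc nu j)) -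
 mesh nu * Hk (kappa_ nu) (j%:R * mesh nu) (Xc nu j, Yc nu j).
(** The indices start at 1, in accordance with [node], which puts node 0 at time 1; the sum up to N
    + 1 is the full action. *)
Definition An nu (j : nat) : R := \sum_(l < j) inc nu l.+1.
(** The limit of the running sums is an antiderivative of the Lagrangian, so the action of the limit
    needs no comparison of sums with integrals. *)
Lemma deriv_a (aa : R -> R) : (forall s, 0 <= s <= 1 -> (fun nu => An nu (idx nu s)) @ U --> aa s) ->
 forall (t0 : R) i, 0 <= t0 <= 1 -> cdom i (xx t0) -> forall e : R, 0 < e -> exists2 d : R, 0 < d &
 forall s s', 0 <= s <= 1 -> 0 <= s' <= 1 -> `|s - t0| < d -> `|s' - t0| < d ->
 `|aa s' - aa s - (s' - s) * (dotv (yy t0 *m (E i (xx t0))^T) (Hp Ht i t0 (chart i (xx t0), yy t0 *m (E i (xx t0))^T)) -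
 hloc Ht i t0 (chart i (xx t0), yy t0 *m (E i (xx t0))^T))| <= e * `|s' - s|.
move=> cA t0 i t01 ix;apply: (around_derive UU mesh0 (u := An) (f := aa)) => //.
 move=> r r0;apply: filterS2 (osm_action t01 ix r0) (around_range UU N_ t0) => p h /andP[p1 _].
 apply: le_trans h;rewrite le_eqVlt;apply/orP;left;apply/eqP;congr (`|_|);congr (_ - _).
 by case: (p.2) p1 => // j _;rewrite /An big_ord_recr /= addrAC subrr add0r.
by exists 1 => // s s01 _;exact: cA.
Qed.
Lemma lift_ct : continuous (fun q : R * (M * Y) => Ht q.1 (lift q.2)).
case=> t [x y];have ix := mem_chart_at A x;set i := chart_at A x in ix.
suff : {for (t, (x, y)), continuous (fun q : R * (M * Y) => Ht q.1 (lift q.2))} by [].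
apply: (@ct_near _ _ _ (fun q => hloc Ht i q.1 (lcoord i q.2))).
 have h : \forall q \near (t, (x, y)), cdom i q.2.1 by exact: (@ct_p21 _ _ _ (t, (x, y)) _ (nbhs_chart_dom ix)).
 by apply: filterS h => q iq;rewrite (lift_lcoord HM gc iq).
apply: (ct_comp (f := fun q : R * (V * V) => hloc Ht i q.1 q.2) (a := fun q : R * (M * Y) => (q.1, lcoord i q.2))).
 by apply: HtC;exact: chart_imgP.
apply: ct_pair;first exact: ct_p1.
apply: (ct_comp (f := lcoord i) (a := snd));last exact: ct_p2.
exact: (sdif_cvg (pchart_ct (ix : cdom i (x, y).1)) (sdif_lcoord HM gc (ix : cdom i (x, y).1))).
Qed.
Lemma inc_bnd : exists2 C : R, 0 < C & forall nu j, (0 < j <= (N_ nu).+1)%N -> `|inc nu j| <= C * mesh nu.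
have [C C0 HC] := chord_mesh;have RR := Rb0.
have [B B0 HB] : exists2 B : R, 0 < B & forall q, @box R M KY Rb q -> `|Ht q.1 (lift q.2)| <= B.
 apply: compact_ub;first exact: box_compact.
 move=> q _;exists (`|Ht q.1 (lift q.2)| + 1);exact: (near_bnd (lift_ct (x := q))).
exists (KY%:R * Rb * C + (B + KY%:R * Rb) + 1).
 by rewrite ltr_wpDl // addr_ge0 ?addr_ge0 ?mulr_ge0 // ltW.
move=> nu j /andP[j0 jN];have mp := mesh_gt0 R N_ nu;have yb : `|Yc nu j| <= Rb by exact: Hy.
have t01 : 0 <= j%:R * mesh nu <= 1.
 by rewrite mulr_ge0 ?(ltW mp) //= ler_pdivrMr ?ltr0n // mul1r ler_nat.
apply: le_trans (ler_normB _ _) _;rewrite normrM (gtr0_norm mp).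
have h1 : `|dotv (Yc nu j) (iota (Xn nu j) - iota (Xc nu j))| <= KY%:R * Rb * C * mesh nu.
 apply: le_trans (dotv_norm _ _) _;rewrite -[leRHS]mulrA;apply: ler_pM => //;by rewrite ler_wpM2l.
have h2 : `|Hk (kappa_ nu) (j%:R * mesh nu) (Xc nu j, Yc nu j)| <= B + KY%:R * Rb.
 apply: le_trans (ler_normD _ _) _;apply: lerD.
 by apply: (HB (j%:R * mesh nu, (Xc nu j, Yc nu j)));rewrite /box /= in_itv.
 have b1 := bracket_ge1 (Yc nu j);have /andP[k0 k1] := k01 nu.
 rewrite normrM (ger0_norm k0) (ger0_norm (_ : 0 <= bracket _ - 1)) ?subr_ge0 //.
 apply: le_trans (_ : 1 * (bracket (Yc nu j) - 1) <= _);first by rewrite ler_wpM2r ?subr_ge0.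
 by rewrite mul1r lerBlDl;apply: le_trans (bracket_le _) _;rewrite lerD2l ler_wpM2l.
apply: le_trans (lerD h1 (ler_wpM2l (ltW mp) h2)) _.
rewrite [mesh nu * _]mulrC -mulrDl ler_wpM2r ?(ltW mp) // lerDl //.
Qed.
Lemma An_lim : exists aa : R -> R, forall s, 0 <= s <= 1 -> (fun nu => An nu (idx nu s)) @ U --> aa s.
have [C C0 HC] := inc_bnd.
have /choice[aa Haa] : forall s : R, exists a : R, 0 <= s <= 1 -> (fun nu => An nu (idx nu s)) @ U --> a.
 move=> s;have [s01|] := boolP (0 <= s <= 1);last by exists 0.
 have [|a _ ha] := ultra_lim UU (f := fun nu => An nu (idx nu s)) (@segment_compact R (- C) C);last by exists a.
 apply: nearW => nu;rewrite /= in_itv /= -ler_norml.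
 have iN := idx_le N_ nu s01;have mp := mesh_gt0 R N_ nu.
 apply: le_trans (ler_norm_sum _ _ _) _;apply: le_trans (_ : \sum_(l < idx nu s) C * mesh nu <= _).
 by apply: ler_sum => l _;apply: HC;rewrite /= (leq_trans _ iN).
 rewrite sumr_const card_ord -mulr_natr -mulrA ler_piMr ?(ltW C0) // mulrC.
 by rewrite ler_pdivrMr ?ltr0n // mul1r ler_nat.
by exists aa.
Qed.
Lemma An_action nu : An nu (N_ nu).+1 =
 action iota (fun j (x : M) (y : Y) => mesh nu * Hk (kappa_ nu) (node R j) (x, y)) (@x_ nu) (@y_ nu).
rewrite /action (reindex (@ordS (N_ nu).+1)) /=;last by apply: onW_bij;exact: ordS_bij.
apply: eq_bigr => l _;rewrite /inc /Yc /Xc /Xn.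
have cl : cyc (N_ nu) l.+1 = ordS l by rewrite cycS_pos //= cyc_ord.
by rewrite cl;have := @node_cyc (N_ nu) l.+1 (ltn_ord l);rewrite cl => ->.
Qed.
(** Compactness of [0, 1] turns local convergence into uniform closeness, which is what identifies
    the homotopy class of the limit. *)
Lemma xx_follows (r : R) : 0 < r -> \forall nu \near U, forall (j : 'I_(N_ nu).+1) (t : R), 0 <= t <= 1 ->
 j%:R <= (N_ nu).+1%:R * t <= j%:R + 1 -> `|iota (xx t) - iota (x_ j)| < r.
move=> r0;have r3 : 0 < r / 3 by rewrite divr_gt0.
have [C C0 HC] := chord_mesh.
have : \forall nu \near U, `[0, 1]%classic `<=` [set t : R | 0 <= t <= 1 -> forall j : 'I_(N_ nu).+1,
 j%:R <= (N_ nu).+1%:R * t <= j%:R + 1 -> `|iota (xx t) - iota (x_ j)| < r].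
 have /compact_near_coveringP := @segment_compact R 0 1;apply => t0;rewrite /= in_itv /= => t01.
 have nb : \forall x \near xx t0, `|iota x - iota (xx t0)| < r / 3 by apply: near_dist r3;exact: io_c.
 have [d d0 hd] := xx_near t01 nb.
 have [|d' d'0 hd'] := around_at UU mesh0 (t := t0) (S := fun nu j => `|iota (Xn nu j) - iota (xx t0)| < r / 3).
 by apply: filterS3 (near_Xn t01 nb) (near_Xc t01 nb) (around_range UU N_ t0) => p h1 h2 /andP[p1 _];rewrite Xn_pred.
 have dd0 : 0 < Num.min d d' by rewrite lt_min d0.
 exists ([set t : R | `|t - t0| < Num.min d d'], [set nu | (forall (s : R) j, 0 <= s <= 1 -> `|s - t0| < d' ->
 j%:R * mesh nu <= s <= j%:R * mesh nu + mesh nu -> `|iota (Xn nu j) - iota (xx t0)| < r / 3) /\ mesh nu < r / 3 / C]).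
 split;last exact: filterI hd' (mesh0 (divr_gt0 r3 C0)).
 by apply/nbhs_ballP;exists (Num.min d d') => //= s;rewrite /ball /= distrC.
 move=> [t nu] /= [ht [h1 h2]] t01' j jt;move: ht;rewrite lt_min => /andP[ht1 ht2].
 have hx := hd t t01' ht1.
 have hj : `|iota (Xn nu j) - iota (xx t0)| < r / 3.
 have n0 : 0 < (N_ nu).+1%:R :> R by rewrite ltr0n.
 apply: (h1 t) => //;rewrite -[X in _ <= _ <= _ + X]mul1r -mulrDl /mesh ler_pdivrMr // ler_pdivlMr // [t * _]mulrC;exact: jt.
 have hc : `|iota (Xn nu j) - iota (x_ j)| < r / 3.
 have := HC nu j;rewrite /Xc cyc_ord => h;apply: le_lt_trans h _.
 by rewrite mulrC -ltr_pdivlMr.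
 exact: dist_thirds hx hj hc.
move=> h;apply: filterS h => nu h j t t01 jt;apply: h => //=;by rewrite in_itv.
Qed.
End LimitOrbit.

(** * The ramp as a function of the squared norm, and the dual metric *)

Section ParametricMore.
Variables (R : realType) (T T' X : Top) (V W : NM R) (c : X -> V) (t0 : T) (x0 : X).
Lemma sdift_time (F : T' -> X -> W) (h : T -> T') L :
 cts t0 h -> sdift c F (h t0) x0 L -> sdift c (fun t => F (h t)) t0 x0 L.
move=> hc [bL H];split=> // e e0;have [Q nQ HQ] := H e e0.
exists [set p | Q (h p.1, p.2)] => [|t x x'];last exact: HQ.
have hp : {for (t0, x0), continuous (fun p : T * X => (h p.1, p.2))}.
 by apply: ct_pair;[apply: (ct_comp (f := h)) => //;exact: ct_p1|exact: ct_p2].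
exact: hp nQ.
Qed.
Lemma sdift_near (F G : T -> X -> W) L : (\forall p \near (t0, x0), F p.1 p.2 = G p.1 p.2) ->
 sdift c F t0 x0 L -> sdift c G t0 x0 L.
move=> FG [bL H];split=> // e e0;have [Q nQ HQ] := H e e0.
exists (Q `&` [set p | F p.1 p.2 = G p.1 p.2]);first exact: filterI.
by move=> t x x' [q1 e1] [q2 e2];move: (HQ t x x' q1 q2) e1 e2 => /= h <- <-.
Qed.
End ParametricMore.
Lemma half_root (R : realFieldType) (q h s : R) : q != 0 -> s = q * q -> (2 * q)^-1 * h * (2 * s) = q * h.
by move=> q0 ->;field. Qed.
(** Below [rho] the ramp vanishes identically, which takes care of the square root at 0; elsewhere
    [c] is h'(r) / (2 r) and its bounds are those of the ramp. *)
Lemma sdif_ramp R (rho a s0 : R) : 0 < rho -> 0 < a -> 0 <= s0 ->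
 exists c, [/\ sdif id (fun s => hramp rho a (Num.sqrt s)) s0 (fun v => v * c), 0 <= c,
 c * (2 * Num.sqrt s0) <= 1 & c * (2 * s0) - hramp rho a (Num.sqrt s0) <= rho + a].
move=> r0 a0 s00;have [h|h] := ltP (Num.sqrt s0) rho.
 exists 0;split;rewrite ?mul0r //.
 apply: (sdif_near (F := fun=> 0));last by apply: sdif_eq (sdif_cst _ _ _) => v;rewrite mulr0.
 have : \forall s \near s0, Num.sqrt s < rho by apply: near_lt h;exact: sqrt_continuous.
 by apply: filterS => s /ltW sr;rewrite hramp0.
 by rewrite (hramp0 _ (ltW h)) subr0 addr_ge0 // ltW.
have q0 : 0 < Num.sqrt s0 by exact: lt_le_trans h.
have s0p : 0 < s0 by rewrite -sqrtr_gt0.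
have /andP[b0 b1] := hramp_bounds rho (Num.sqrt s0) a0.
have qq : s0 = Num.sqrt s0 * Num.sqrt s0 by rewrite -expr2 sqr_sqrtr.
have E2 : (2 * Num.sqrt s0)^-1 * (2 * Num.sqrt s0) = 1 by rewrite mulVf // mulf_neq0 ?gt_eqF // pnatr_eq0.
exists ((2 * Num.sqrt s0)^-1 * hramp' rho a (Num.sqrt s0));split.
- apply: sdif_eq (sdif_comp (d := id) (h := @Num.sqrt R) (@sqrt_continuous R s0) (sdif_sqrt s0p) (sdif_hramp rho _ a0)) => v /=.
 by rewrite -mulrA.
- by rewrite mulr_ge0 // invr_ge0 mulr_ge0 // ltW.
- by rewrite mulrAC E2 mul1r.
- rewrite (half_root _ (lt0r_neq0 q0) qq);apply: hramp_action => //;exact: ltW.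
Qed.
Lemma congruence_inv (R : comUnitRingType) n (T T' G G' : 'M[R]_n) : T *m T' = 1%:M -> T' *m T = 1%:M ->
 G \in unitmx -> G' = T' *m G *m T'^T -> T^T *m invmx G *m T = invmx G'.
move=> TT' T'T uG ->;set B := _ *m T.
have h : B *m (T' *m G *m T'^T) = 1%:M.
 by rewrite /B !mulmxA -[_ *m T *m T']mulmxA TT' mulmx1 mulmxKV // -trmx_mul T'T trmx1.
have [_ u] := mulmx1_unit h.
by rewrite -[LHS]mulmx1 -(mulmxV u) mulmxA h mul1mx.
Qed.
Lemma dotv_congruence R n (T G G' : 'M[R]_n) (p q : 'rV[R]_n) : T^T *m G *m T = G' -> p = q *m T^T ->
 dotv (p *m G) p = dotv (q *m G') q.
by move=> <- ->;rewrite [LHS]dotvC dotv_mul trmxK dotvC !mulmxA. Qed.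
Lemma near_gt R (Z : Top) (f : Z -> R) (z : Z) (a : R) : cts z f ->
 a < f z -> \forall z' \near z, a < f z'.
by move=> fc;exact: cvgr_gt fc a. Qed.
Lemma near_comp (T U : Top) (f : T -> U) (x : T) (Q : set U) : cts x f ->
 (\forall q \near f x, Q q) -> \forall x' \near x, Q (f x').
by move=> fc;apply: fc. Qed.
Lemma near_mono (T : Top) (z : T) (P Q : set T) : (forall x, P x -> Q x) ->
 (\forall x \near z, P x) -> \forall x \near z, Q x.
by move=> PQ;exact: filterS. Qed.
Lemma near_mono2 (T : Top) (z : T) (P P' Q : set T) : (forall x, P x -> P' x -> Q x) ->
 (\forall x \near z, P x) -> (\forall x \near z, P' x) -> \forall x \near z, Q x.
by move=> PQ;exact: filterS2. Qed.
(** Growth of dH in the ramp: the factor [c] has size at most 1 / r and the differential of the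
    squared norm carries an extra factor of size r, so the product grows linearly. *)
Lemma far_alg (R' : realFieldType) (s c Q r P N U d D k : R') : 0 <= c -> 0 <= s -> s <= Q -> c * (2 * r) <= 1 -> P <= k * r -> 0 <= k -> 0 <= D ->
 0 <= P -> 0 <= N -> 0 <= U -> d <= D * ((P * N + U) * P) -> s * (d * c) <= Q * (D * k) * ((1 + P) * N + U).
move=> c0 s0 sQ cr Pr k0 D0 P0 N0 U0 dD.
have cP : c * P <= k.
 have r1 : c * r <= 1 by lra.
 by apply: le_trans (ler_wpM2l c0 Pr) _;rewrite mulrCA ler_piMr.
have S0 : 0 <= P * N + U by rewrite addr_ge0 ?mulr_ge0.
have h1 : d * c <= D * k * (P * N + U).
 apply: le_trans (ler_wpM2r c0 dD) _.
 rewrite (_ : _ * _ * c = D * (c * P) * (P * N + U));last by ring.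
 by rewrite ler_wpM2r // ler_wpM2l.
have Q0 := le_trans s0 sQ.
have h2 : 0 <= D * k * (P * N + U) by rewrite !mulr_ge0.
apply: le_trans (ler_wpM2l s0 h1) _;apply: le_trans (ler_wpM2r h2 sQ) _.
rewrite -!mulrA;do 3 (rewrite ler_wpM2l //);by rewrite lerD2r mulrDl mul1r lerDr.
Qed.

Section Cometric.
Variables (R : realType) (n : nat) (M : Top) (A : SA R n M) (g : RM A).
Local Notation V := 'rV[R]_n.
Implicit Types (i j : chart_index A).
Lemma metric_unit i q : cimg i q -> g i q \in unitmx.
move=> iq;rewrite -row_free_unit -kermx_eq0;apply/eqP/row_matrixP => a;rewrite row0.
have h : row a (kermx (g i q)) *m g i q = 0 by rewrite -row_mul mulmx_ker row0.
set v := row a _ in h *;apply/eqP;apply: contraT => v0.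
by have := metric_pos g iq v0;rewrite h dotv0l ltxx.
Qed.
Lemma cometric_sym i q : cimg i q -> (invmx (g i q))^T = invmx (g i q).
by move=> iq;rewrite trmx_inv (Defs.metric_sym g iq). Qed.
Definition cosq i (w : V * V) : R := dotv (w.2 *m invmx (g i w.1)) w.2.
Lemma metric_ge0 i q v : cimg i q -> 0 <= dotv (v *m g i q) v.
move=> iq;have [->|v0] := eqVneq v 0;first by rewrite dotv0r.
by rewrite ltW // (metric_pos g).
Qed.
Lemma cosqE i w : cimg i w.1 -> let u := w.2 *m invmx (g i w.1) in cosq i w = dotv (u *m g i w.1) u.
by move=> iw u;rewrite /cosq dotvC /u mulmxKV // metric_unit. Qed.
Lemma cosq_ge0 i w : cimg i w.1 -> 0 <= cosq i w.
by move=> iw;rewrite cosqE // metric_ge0. Qed.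
(** Positivity of the metric on g(v, v) u - g(u, v) v, where u is the vector dual to the
    covector. *)
Lemma cauchy_schwarz i w v : cimg i w.1 -> dotv w.2 v ^+ 2 <= cosq i w * dotv (v *m g i w.1) v.
move=> iw;have [->|v0] := eqVneq v 0;first by rewrite !dotv0r expr0n mulr0.
rewrite cosqE //;set u := w.2 *m _;have bp := metric_pos g iw v0.
have uv : dotv (u *m g i w.1) v = dotv w.2 v by rewrite /u mulmxKV // metric_unit.
have vu : dotv (v *m g i w.1) u = dotv w.2 v by rewrite dotv_mul (Defs.metric_sym g iw) dotvC.
have h := metric_ge0 (dotv (v *m g i w.1) v *: u - dotv w.2 v *: v) iw.
rewrite mulmxBl -!scalemxAl dotvBl !dotvBr !dotvZl !dotvZr uv vu in h.
move: (dotv (v *m _) v) (dotv (u *m _) u) (dotv w.2 v) bp h => b s p bp h.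
have h2 : 0 <= b * (s * b - p ^+ 2) by apply: le_trans h _;rewrite le_eqVlt;apply/orP;left;apply/eqP;ring.
by rewrite (pmulr_rge0 _ bp) subr_ge0 in h2.
Qed.
Lemma cosq_transition i j (z : cotangent A) : cdom i (base z) -> cdom j (base z) ->
 cosq i (cot_chart i z) = cosq j (cot_chart j z).
move=> iz jz;set T := transition_jacobian i j (base z);set T' := transition_jacobian j i (base z).
have TT' : T *m T' = 1%:M by exact: transition_jacobianK.
have T'T : T' *m T = 1%:M by exact: transition_jacobianK.
have HB := congruence_inv TT' T'T (metric_unit (chart_imgP iz)) (metric_transition g jz iz).
have e : (cot_chart i z).2 = (cot_chart j z).2 *m T^T.
 by rewrite /cot_chart /= -mulmxA -trmx_mul (transition_jacobian_comp iz jz (mem_chart_at A _)).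
exact: (dotv_congruence HB e).
Qed.
Lemma cot_norm_chart i (z : cotangent A) : cdom i (base z) -> cot_norm g z = Num.sqrt (cosq i (cot_chart i z)).
by move=> iz;rewrite (cosq_transition iz (mem_chart_at A (base z))). Qed.
Lemma cot_norm_inv i w : cimg i w.1 -> cot_norm g (cot_chart_inv i w) = Num.sqrt (cosq i w).
by move=> iw;rewrite (@cot_norm_chart i) ?cot_chart_invK //;exact: chart_inv_dom. Qed.
Definition dmetric i q : V -> 'M[R]_n := gradL id (g i) q.
Lemma sdif_metric i q : cimg i q -> sdif id (g i) q (dmetric i q).
move=> iq;apply: gradLP;have [U [oU Uq _ CkU]] := smooth_on_open (@open_chart_img _ _ _ A i) (metric_smooth g (i:=i)) iq.
exists (fun v => \matrix_(a, b) 'D_v (fun q => g i q a b) q);apply: sdif_mx => a b.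
by apply: sdif_eq (C1_sdif oU Uq (Ck_on_entry a b oU (CkU 1%N))) => v;rewrite mxE.
Qed.
Definition dcosq i (w v : V * V) : R := let G := invmx (g i w.1) in
 dotv (v.2 *m G + w.2 *m - (G *m dmetric i w.1 v.1 *m G)) w.2 + dotv (w.2 *m G) v.2.
Lemma sdif_cosq i w : cimg i w.1 -> sdif id (cosq i) w (dcosq i w).
move=> iw;have ci : cts w (@id (V * V)) by exact: cvg_id.
have d1 : sdif id (fun w : V * V => w.1) w fst by exact: (sdif_lin (K := fst) (blin_fst V V) (sdif_coord _ _)).
have d2 : sdif id (fun w : V * V => w.2) w snd by exact: (sdif_lin (K := snd) (blin_snd V V) (sdif_coord _ _)).
have d3 := sdif_comp (d := id) (h := fst) (@ct_p1 _ _ w) d1 (sdif_metric iw).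
have d4 := sdif_invmx ci d3 (metric_unit iw).
exact: (sdif_dotv ci (sdif_mulmx ci d2 d4) d2).
Qed.
Lemma cosq_cont i w : cimg i w.1 -> cts w (cosq i).
move=> iw;exact: sdif_cvg (@cvg_id _ _) (sdif_cosq iw). Qed.
Lemma dcosq_fibre i w u : cimg i w.1 -> dcosq i w (0, u) = 2 * dotv (w.2 *m invmx (g i w.1)) u.
move=> iw;have [bL _] := sdif_metric iw;rewrite /dcosq /= (blin0 bL) mulmx0 mul0mx oppr0 mulmx0 addr0.
by rewrite dotv_mul cometric_sym // dotvC;ring.
Qed.
Lemma metric_bnd i q : cimg i q -> exists C : R, \forall q' \near q,
 [/\ `|g i q'| <= C, `|invmx (g i q')| <= C & forall v, `|dmetric i q' v| <= C * `|v|].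
move=> iq;have d := sdif_metric iq;have ci : cts q (@id V) by exact: cvg_id.
have h1 := near_bnd (sdif_cvg ci d);have h2 := near_bnd (sdif_cvg ci (sdif_invmx ci d (metric_unit iq))).
have [U nU HU] := sdif_grad ltr01 d;have [[_ _ [C C0 HC]] _] := d.
exists (`|g i q| + 1 + (`|invmx (g i q)| + 1) + (C + 1)).
have idom : \forall q' \near q, cimg i q' by apply: open_nbhs_nbhs;split=> //;exact: open_chart_img.
near=> q';have iq' : cimg i q' by near: q'.
have n1 := normr_ge0 (g i q);have n2 := normr_ge0 (invmx (g i q)).
split.
- by apply: le_trans (_ : `|g i q| + 1 <= _);[near: q'|lra].
- by apply: le_trans (_ : `|invmx (g i q)| + 1 <= _);[near: q'|lra].
move=> v;have Uq : U q' by near: q'.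
have h3 := HU q' _ v Uq (@lsurj_id _ _ q') (sdif_metric iq');rewrite mul1r in h3.
have h4 := ler_normD (dmetric i q' v - dmetric i q v) (dmetric i q v);rewrite subrK in h4.
apply: le_trans h4 _;apply: le_trans (lerD h3 (HC v)) _.
rewrite -[X in X + _]mul1r -mulrDl ler_wpM2r //;lra.
Unshelve. all: by end_near. Qed.
Lemma cosq_lower i w C : cimg i w.1 -> `|g i w.1| <= C -> `|w.2| ^+ 2 <= (n%:R * (n%:R * C)) * cosq i w.
move=> iw gC;have [->|p0] := eqVneq w.2 0.
 by rewrite normr0 expr0n mulr_ge0 ?cosq_ge0 // !mulr_ge0 //;apply: le_trans gC.
have pp : 0 < `|w.2| by rewrite normr_gt0.
have h1 := cauchy_schwarz w.2 iw;have h2 := dotv_ge_norm w.2;have s0 := cosq_ge0 iw.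
have h3 : dotv (w.2 *m g i w.1) w.2 <= n%:R * (n%:R * C) * `|w.2| ^+ 2.
 rewrite [leRHS](_ : _ = n%:R * (n%:R * C * `|w.2|) * `|w.2|);last by ring.
 apply: le_trans (ler_norm _) _;apply: le_trans (dotv_norm _ _) _;rewrite ler_wpM2r // ler_wpM2l //.
 by apply: le_trans (mulmx_norm _ _) _;rewrite mulrAC ler_wpM2r // ler_wpM2l.
have h4 : (`|w.2| ^+ 2) ^+ 2 <= dotv w.2 w.2 ^+ 2 by rewrite lerXn2r ?nnegrE ?dotv_ge0 // sqr_ge0.
have h5 := le_trans h4 (le_trans h1 (ler_wpM2l s0 h3)).
rewrite -(ler_pM2r (exprn_gt0 2 pp)) -expr2 (_ : _ * cosq i w * _ = cosq i w * (n%:R * (n%:R * C) * `|w.2| ^+ 2)) //;ring.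
Qed.
Lemma dcosq_upper i w C : cimg i w.1 -> `|invmx (g i w.1)| <= C -> (forall v, `|dmetric i w.1 v| <= C * `|v|) ->
 forall v u, `|dcosq i w (v, u)| <= (n%:R ^+ 4 * C ^+ 3 + 2 * n%:R ^+ 2 * C) * ((`|w.2| * `|v| + `|u|) * `|w.2|).
move=> iw gC dC v u;have C0 : 0 <= C by apply: le_trans gC.
set p := w.2;set G := invmx _ in gC *;set D := dmetric i w.1 v.
have hpG (q : V) : `|q *m G| <= n%:R * C * `|q|.
 by apply: le_trans (mulmx_norm _ _) _;rewrite mulrAC ler_wpM2r // ler_wpM2l.
have h1 : `|dotv (u *m G) p| <= n%:R * (n%:R * C * `|u|) * `|p|.
 by apply: le_trans (dotv_norm _ _) _;rewrite ler_wpM2r // ler_wpM2l.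
have h2 : `|dotv (p *m G) u| <= n%:R * (n%:R * C * `|p|) * `|u|.
 by apply: le_trans (dotv_norm _ _) _;rewrite ler_wpM2r // ler_wpM2l.
have h3 : `|p *m (G *m D *m G)| <= n%:R * C * (n%:R * (n%:R * C * `|p|) * (C * `|v|)).
 have h5 := hpG (p *m (G *m D));rewrite -mulmxA in h5;apply: (le_trans h5).
 rewrite ler_wpM2l ?mulr_ge0 // mulmxA.
 apply: le_trans (mulmx_norm _ _) _;by apply: ler_pM;[rewrite mulr_ge0|exact: normr_ge0|rewrite ler_wpM2l|exact: dC].
have h4 : `|dotv (p *m (G *m D *m G)) p| <= n%:R * (n%:R * C * (n%:R * (n%:R * C * `|p|) * (C * `|v|))) * `|p|.
 by apply: le_trans (dotv_norm _ _) _;rewrite ler_wpM2r // ler_wpM2l.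
rewrite /dcosq /= -/G -/p -/D mulmxN dotvDl dotvNl.
have tri (a b c : R) : `|a - b + c| <= `|a| + `|b| + `|c|.
 by apply: le_trans (ler_normD _ _) _;rewrite lerD2r;exact: ler_normB.
apply: le_trans (tri _ _ _) _;apply: le_trans (lerD (lerD h1 h4) h2) _.
rewrite -subr_ge0;move: (n%:R : R) (ler0n R n) (`|p|) (`|v|) (`|u|) (normr_ge0 p) (normr_ge0 v) (normr_ge0 u) => N N0 P Vv Uu P0 V0 U0.
rewrite (_ : _ - _ = N ^+ 4 * C ^+ 3 * Uu * P + 2 * N ^+ 2 * C * P * Vv * P);last by ring.
by rewrite addr_ge0 // !mulr_ge0 ?exprn_ge0.
Qed.
End Cometric.

(** * The ramped Hamiltonian *)

Section Ramped.
Variables (R : realType) (n : nat) (M : Top) (A : SA R n M) (g : RM A)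
 (HM : CCM A).
Local Notation V := 'rV[R]_n.
Implicit Types (i j : chart_index A).
Variables (H : R -> cotangent A -> R)
 (H_smooth : smooth_hamiltonian g H)
 (rho : R)
 (rho01 : 0 <= rho < 1)
 (H_far : forall t z, 0 <= t <= 1 -> cot_norm g z < 1 -> rho < cot_norm g z -> H t z = 0)
 (sigma : R -> R) (rho' a : R)
 (sigma_cont : continuous sigma)
 (sigma_ge0 : forall t, 0 <= sigma t)
 (rho'_gt : rho < rho')
 (a_gt0 : 0 < a).
Local Notation cosq := (cosq g).
Local Notation dcosq := (dcosq g).
Let rho'0 : 0 < rho'. by case/andP: rho01 => h _;exact: le_lt_trans h rho'_gt. Qed.
(** Extension by zero in space and by the end values in time, so that t may be any real number. *)
Definition ext0 t (z : cotangent A) : R := if cot_norm g z < 1 then H (clip t) z else 0.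
Definition ramped t (z : cotangent A) : R := ext0 t z + sigma t * hramp rho' a (cot_norm g z).
Lemma ext0_far t z : rho < cot_norm g z -> ext0 t z = 0.
by move=> rz;rewrite /ext0;case: ifP => // z1;apply: H_far => //;exact: clip_itv. Qed.
Lemma near_img (t : R) i (w : V * V) : cimg i w.1 -> \forall p \near (t, w), cimg i p.2.1.
by move=> iw;apply: (@ct_p21 _ _ _ (t, w));apply: open_nbhs_nbhs;split=> //;exact: open_chart_img. Qed.
Lemma sqrt_cosq_cont (t : R) i (w : V * V) : cimg i w.1 -> {for (t, w), continuous (fun p : R * (V * V) => Num.sqrt (cosq i p.2))}.
move=> iw;apply: (ct_comp (f := @Num.sqrt R));first exact: sqrt_continuous.
by apply: (ct_comp (f := cosq i));[exact: cosq_cont|exact: ct_p2].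
Qed.
(** Beyond [rho] the extension vanishes locally; at norm at most [rho], which is below 1, it is
    locally a smooth map composed with [clip] in time. *)
Lemma ext0_loc i t w : cimg i w.1 -> (exists L, sdift id (hloc ext0 i) t w L) /\
 {for (t, w), continuous (fun p : R * (V * V) => hloc ext0 i p.1 p.2)}.
move=> iw;have [rw|wr] := ltP rho (Num.sqrt (cosq i w)).
 have nz : \forall p \near (t, w), (0 : R) = hloc ext0 i p.1 p.2.
 have h : \forall p \near (t, w), rho < Num.sqrt (cosq i p.2) by exact: (near_gt (f := fun p : R * (V * V) => Num.sqrt (cosq i p.2)) (@sqrt_cosq_cont t i w iw) rw).
 apply: filterS2 h (near_img t iw) => p h ip;rewrite /hloc ext0_far //.
 by rewrite cot_norm_inv.
 split;last by apply: ct_near nz _;exact: ct_cst.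
 exists (fun=> 0);apply: sdift_near nz _;exact: (sdif_sdift _ (sdif_cst id w (0 : R))).
have w1 : Num.sqrt (cosq i w) < 1 by case/andP: rho01 => _;exact: le_lt_trans.
have Dw : [set p : R * (V * V) | cimg i p.2.1 /\ ham_domain g (p.1, cot_chart_inv i p.2)] (clip t, w).
 by split=> //;split;rewrite /= ?in_itv /= ?clip_itv // /disc_cotangent /= cot_norm_inv.
have [U [G [oU Uw CkG GH]]] := H_smooth Dw.
have nU : \forall p \near (t, w), U (clip p.1, p.2).
 have hp : {for (t, w), continuous (fun p : R * (V * V) => (clip p.1, p.2))}.
 by apply: ct_pair;[apply: ct_clip;exact: ct_p1|exact: ct_p2].
 by apply: hp;exact: open_nbhs_nbhs.
have nE : \forall p \near (t, w), G (clip p.1, p.2) = hloc ext0 i p.1 p.2.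
 have h : \forall p \near (t, w), Num.sqrt (cosq i p.2) < 1 by exact: (near_lt (f := fun p : R * (V * V) => Num.sqrt (cosq i p.2)) (@sqrt_cosq_cont t i w iw) w1).
 have key p : U (clip p.1, p.2) -> Num.sqrt (cosq i p.2) < 1 -> cimg i p.2.1 -> G (clip p.1, p.2) = hloc ext0 i p.1 p.2.
 move=> Up p1 ip;have pn : cot_norm g (cot_chart_inv i p.2) < 1 by rewrite cot_norm_inv.
 rewrite /hloc /ext0 pn;apply: (GH (clip p.1, p.2) Up).
 by split=> //;split;[rewrite /= in_itv /= clip_itv|].
 by near=> p;apply: key;near: p;[exact: nU|exact: h|exact: near_img].
have cc : cts t (@clip R) by apply: (ct_clip (f := id));exact: cvg_id.
split.
 exists (fun v => 'D_(0, v) G (clip t, w));apply: (sdift_near nE).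
 exact: (sdift_time (h := @clip R) cc (C1_sdift oU Uw (CkG 1%N))).
apply: (ct_near nE);apply: (ct_comp (f := G));first exact: (CkG 0%N).
by apply: ct_pair;[apply: ct_clip;exact: ct_p1|exact: ct_p2].
Unshelve. all: by end_near. Qed.
Lemma ramped_loc i t w : cimg i w.1 -> exists L0 c, [/\ sdift id (hloc ext0 i) t w L0,
 sdift id (hloc ramped i) t w (fun v => L0 v + sigma t * (dcosq i w v * c)), 0 <= c, c * (2 * Num.sqrt (cosq i w)) <= 1 &
 c * (2 * cosq i w) - hramp rho' a (Num.sqrt (cosq i w)) <= rho' + a].
move=> iw;have [[L0 d0] _] := ext0_loc t iw.
have [c [dc c0 c1 c2]] := sdif_ramp rho'0 a_gt0 (cosq_ge0 g iw).
exists L0, c;split=> //.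
have d1 := sdif_comp (d := id) (h := cosq i) (cosq_cont iw) (sdif_cosq g iw) dc.
have d2 := sdift_scale (s := sigma) (t0 := t) (@sigma_cont t) d1.
apply: sdift_near (sdiftD d0 d2).
by apply: filterS (near_img t iw) => p ip;rewrite /hloc /ramped cot_norm_inv.
Qed.
Lemma ramped_SDT i t w : cimg i w.1 -> exists L, sdift id (hloc ramped i) t w L.
by move=> iw;have [L0 [c [_ d _ _ _]]] := ramped_loc t iw;eexists;exact: d. Qed.
Lemma ramped_cont i t w : cimg i w.1 -> {for (t, w), continuous (fun p : R * (V * V) => hloc ramped i p.1 p.2)}.
move=> iw;have [_ h] := ext0_loc t iw;have [c [dc _ _ _]] := sdif_ramp rho'0 a_gt0 (cosq_ge0 g iw).
apply: (ct_near (f := fun p : R * (V * V) => hloc ext0 i p.1 p.2 + sigma p.1 * hramp rho' a (Num.sqrt (cosq i p.2)))).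
 by apply: filterS (near_img t iw) => p ip;rewrite /hloc /ramped cot_norm_inv.
apply: ctD => //;apply: ctM;first by apply: (ct_comp (f := sigma));[exact: sigma_cont|exact: ct_p1].
apply: (ct_comp (f := fun s => hramp rho' a (Num.sqrt s)));first exact: (sdif_cvg (@cvg_id _ _) dc).
by apply: (ct_comp (f := cosq i));[exact: cosq_cont|exact: ct_p2].
Qed.
(** Beyond [rho] only the ramp is left, a function of time and of the squared norm, so dH is a
    multiple of the differential of the squared norm. *)
Lemma dH_ramped_far i t w : cimg i w.1 -> rho < Num.sqrt (cosq i w) -> exists c, [/\ forall v,
 dH ramped i t w v = sigma t * (dcosq i w v * c), 0 <= c, c * (2 * Num.sqrt (cosq i w)) <= 1 &
 c * (2 * cosq i w) - hramp rho' a (Num.sqrt (cosq i w)) <= rho' + a].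
move=> iw rw;have [L0 [c [d0 d1 c0 c1 c2]]] := ramped_loc t iw;exists c;split=> // v.
have ls := @lsurj_id _ _ w;have := gradLE ls (sdift_sdif d1);rewrite /dH => ->.
have nz : \forall w' \near w, (0 : R) = hloc ext0 i t w'.
 have h : \forall w' \near w, rho < Num.sqrt (cosq i w').
 refine (near_gt (f := fun w' : V * V => Num.sqrt (cosq i w')) _ rw).
 by apply: (ct_comp (f := @Num.sqrt R));[exact: sqrt_continuous|exact: cosq_cont].
 have h2 : \forall w' \near w, cimg i w'.1.
 by apply: (@ct_p1 _ _ w);apply: open_nbhs_nbhs;split=> //;exact: open_chart_img.
 by apply: filterS2 h h2 => w' h' iw';rewrite /hloc ext0_far // cot_norm_inv.
have -> : L0 v = 0 by rewrite (sdif_uniq ls (sdift_sdif d0) (sdif_near nz (sdif_cst _ _ _))).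
by rewrite add0r.
Qed.
(** Euler's identity for the quadratic squared norm turns p H_p into sigma times r h'(r), and the
    action bound of the ramp applies. *)
Lemma Hp_ramped_far i t w : cimg i w.1 -> rho < Num.sqrt (cosq i w) ->
 dotv w.2 (Hp ramped i t w) - hloc ramped i t w <= sigma t * (rho' + a).
move=> iw rw;have [c [dh c0 c1 c2]] := dH_ramped_far t iw rw.
have -> : dotv w.2 (Hp ramped i t w) = sigma t * (c * (2 * cosq i w)).
 rewrite dotvC -[LHS]add0r -{1}(dotv0r (Hq ramped i t w)) -dHE //;last exact: ramped_SDT.
 by rewrite dh dcosq_fibre // -/(cosq i w);congr (_ * _);rewrite mulrC.
rewrite /hloc /ramped ext0_far ?cot_norm_inv // add0r -mulrBr;exact: ler_wpM2l.
Qed.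
Lemma ramped_ge t z : ext0 t z + sigma t * (cot_norm g z - (rho' + a)) <= ramped t z.
by rewrite lerD2l ler_wpM2l // hramp_ge. Qed.
Variables (m : nat) (ci : 'I_m -> chart_index A) (cc : 'I_m -> V) (cr : 'I_m -> R)
 (gc : good_cover ci cc cr).
Local Notation xi := (xi ci cc cr).
Lemma metric_bnd_cover : exists2 C : R, 0 < C & forall k x, xi k x != 0 -> let q := chart (ci k) x in
 [/\ `|g (ci k) q| <= C, `|invmx (g (ci k) q)| <= C & forall v, `|dmetric g (ci k) q v| <= C * `|v|].
pose P k x (C : R) := xi k x != 0 -> let q := chart (ci k) x in
 [/\ `|g (ci k) q| <= C, `|invmx (g (ci k) q)| <= C & forall v, `|dmetric g (ci k) q v| <= C * `|v|].
have mono k x (C C' : R) : C <= C' -> P k x C -> P k x C'.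
 move=> CC' h /h[h1 h2 h3];split;[exact: le_trans CC'|exact: le_trans CC'|].
 by move=> v;apply: le_trans (h3 v) _;rewrite ler_wpM2r.
have cM : compact [set: M] by case: HM.
have /choice[CC HCC] : forall k, exists C : R, forall x, P k x C.
 move=> k;have [|x _|C _ HC] := @compact_ub_rel R M setT (P k) cM;last by exists C => x;exact: HC.
 by move=> x;exact: mono.
 have [b0|b0] := eqVneq (beta ci cc cr k x) 0.
 by exists 0;apply: filterS (xi_near0 HM gc b0) => x' xz;rewrite /P xz eqxx.
 have [kx _] : cdom (ci k) x /\ beta ci cc cr k x = height cc cr k (chart (ci k) x).
 by apply: beta_gt0;rewrite lt_neqAle eq_sym b0 beta_ge0.
 have [C HC] := metric_bnd g (chart_imgP kx);exists C.
 pose Q q := [/\ `|g (ci k) q| <= C, `|invmx (g (ci k) q)| <= C & forall v, `|dmetric g (ci k) q v| <= C * `|v|].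
 have HQ : nbhs (chart (ci k) x) Q by exact: HC.
 have h2 := near_comp (chart_ct kx) HQ.
 by apply: (@filterS _ _ _ _ _ _ h2) => x' h _.
have [C C0 HC] := fin_ub CC;exists C => // k x;exact: mono (HC k) (HCC k x).
Qed.
Lemma dH_bnd_ball r : exists2 C : R, 0 < C & forall t k x (p : V), 0 <= t <= 1 -> xi k x != 0 -> `|p| <= r ->
 forall v u, `|dH ramped (ci k) t (chart (ci k) x, p) (v, u)| <= C * (`|v| + `|u|).
pose P k (z : R * (M * V)) (C : R) := xi k z.2.1 != 0 -> forall v u,
 `|dH ramped (ci k) z.1 (chart (ci k) z.2.1, z.2.2) (v, u)| <= C * (`|v| + `|u|).
have mono k z (C C' : R) : C <= C' -> P k z C -> P k z C'.
 by move=> CC' h /h h3 v u;apply: le_trans (h3 v u) _;rewrite ler_wpM2r ?addr_ge0.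
have cK : compact (`[0, 1]%classic `*` ([set: M] `*` [set p : V | `|p| <= r]) : set (R * (M * V))).
 apply: compact_setX;first exact: segment_compact.
 by apply: compact_setX;[case: HM|exact: closed_ball0_compact].
have /choice[CC HCC] : forall k, exists C : R, forall z, (`[0, 1]%classic `*` ([set: M] `*` [set p : V | `|p| <= r])) z -> P k z C.
 move=> k;have [|[t [x p]] _|C _ HC] := compact_ub_rel (P := P k) cK;last by exists C.
 by move=> z;exact: mono.
 have [b0|b0] := eqVneq (beta ci cc cr k x) 0.
 exists 0;apply: (near_mono (P := fun z : R * (M * V) => xi k z.2.1 = 0));first by move=> z xz;rewrite /P xz eqxx.
 exact: (near_comp (f := fun z : R * (M * V) => z.2.1) (@ct_p21 _ _ _ (t, (x, p))) (xi_near0 HM gc b0)).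
 have [kx _] : cdom (ci k) x /\ beta ci cc cr k x = height cc cr k (chart (ci k) x).
 by apply: beta_gt0;rewrite lt_neqAle eq_sym b0 beta_ge0.
 have iw : cimg (ci k) (chart (ci k) x, p).1 by exact: chart_imgP.
 have d := sdift_dH ramped_SDT t iw;have [Q nQ HQ] := sdift_grad ltr01 d.
 have [[_ _ [C C0 HC]] _] := d;exists (1 + C).
 have hc : {for (t, (x, p)), continuous (fun z : R * (M * V) => (z.1, (chart (ci k) z.2.1, z.2.2)))}.
 apply: ct_pair;first exact: ct_p1.
 apply: ct_pair;last exact: (@ct_p22 _ _ _ (t, (x, p))).
 by apply: ct_chart => //;exact: (@ct_p21 _ _ _ (t, (x, p))).
 have nd := near_comp (f := fun z : R * (M * V) => z.2.1) (@ct_p21 _ _ _ (t, (x, p))) (nbhs_chart_dom kx).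
 apply: near_mono2 (near_comp hc nQ) nd => z Qz kz _ v u.
 have iz : cimg (ci k) (chart (ci k) z.2.1, z.2.2).1 by exact: chart_imgP.
 have h1 := HQ z.1 (chart (ci k) z.2.1, z.2.2) _ (v, u) Qz (@lsurj_id _ _ _) (sdift_dH ramped_SDT z.1 iz).
 have nb : `|((v, u) : V * V)| <= `|v| + `|u| by rewrite norm_pair ge_max lerDl lerDr !normr_ge0.
 have h2 := HC (v, u).
 have tri (a1 b1 N S : R) : `|a1 - b1| <= 1 * N -> `|b1| <= C * N -> N <= S -> `|a1| <= (1 + C) * S.
 move=> h3 h4 h5;rewrite -(subrK b1 a1);apply: le_trans (ler_normD _ _) _;apply: le_trans (lerD h3 h4) _.
 by rewrite -mulrDl ler_wpM2l // addr_ge0.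
 exact: tri h1 h2 nb.
have [C C0 HC] := fin_ub CC;exists C => // t k x p t01 xk pr v u.
by apply: (mono k (t, (x, p)) _ _ (HC k)) => //;apply: HCC;split=> //=;rewrite in_itv.
Qed.
(** [k1] compares components with the dual norm. Components of size at most [k1 * rho] are handled
    by compactness; all others have norm beyond [rho], where dH is explicit. *)
Lemma ramped_BD : exists2 CH : R, 0 < CH & forall t k x, 0 <= t <= 1 -> xi k x != 0 -> forall p v u : V,
 `|dH ramped (ci k) t (chart (ci k) x, p) (v, u)| <= CH * ((1 + `|p|) * `|v| + `|u|).
have [C C0 HC] := metric_bnd_cover.
have [Q Q0 HQ] : exists2 Q : R, 0 < Q & forall t, 0 <= t <= 1 -> sigma t <= Q.
 have [t _|Q Q0 HQ] := @compact_ub R R _ sigma (@segment_compact R 0 1).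
 exists (sigma t + 1);apply: filterS (near_lt (@sigma_cont t) (_ : sigma t < sigma t + 1)) => [t' /ltW //|].
 by rewrite ltrDl.
 by exists Q => // t t01;apply: HQ;rewrite /= in_itv.
pose k2 : R := 1 + n%:R * (n%:R * C);pose k1 := Num.sqrt k2.
have k2p : 0 < k2 by rewrite ltr_wpDr // !mulr_ge0 // ltW.
have k1p : 0 < k1 by rewrite sqrtr_gt0.
have [D D0 HD] := dH_bnd_ball (k1 * rho).
pose D1 : R := n%:R ^+ 4 * C ^+ 3 + 2 * n%:R ^+ 2 * C.
have D10 : 0 <= D1 by rewrite addr_ge0 // !mulr_ge0 ?exprn_ge0 // ltW.
exists (D + Q * (D1 * k1));first by rewrite ltr_wpDr // !mulr_ge0 // ltW.
move=> t k x t01 xk p v u;have [kx _] := xi_supp gc xk.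
have iw : cimg (ci k) (chart (ci k) x, p).1 by exact: chart_imgP.
have [g1 g2 g3] := HC k x xk.
have S0 : 0 <= (1 + `|p|) * `|v| + `|u| by rewrite addr_ge0 // mulr_ge0 // addr_ge0.
have low : `|p| <= k1 * Num.sqrt (cosq (ci k) (chart (ci k) x, p)).
 rewrite -sqrtrM ?(ltW k2p) // -(@ger0_norm _ `|p|) // -sqrtr_sqr ler_wsqrtr //.
 apply: le_trans (cosq_lower iw g1) _;rewrite ler_wpM2r ?cosq_ge0 //;by rewrite lerDr.
have [pr|rp] := leP `|p| (k1 * rho).
 apply: le_trans (HD t k x p t01 xk pr v u) _;apply: ler_pM;rewrite ?addr_ge0 ?(ltW D0) //.
 by rewrite lerDl !mulr_ge0 // ltW.
 by rewrite lerD2r -[leLHS]mul1r ler_wpM2r // lerDl.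
have rw : rho < Num.sqrt (cosq (ci k) (chart (ci k) x, p)).
 by rewrite -(ltr_pM2l k1p);exact: lt_le_trans low.
have [c [dh c0 c1 _]] := dH_ramped_far t iw rw.
rewrite dh !normrM (ger0_norm c0) (ger0_norm (sigma_ge0 t)).
have h := far_alg c0 (sigma_ge0 t) (HQ t t01) c1 low (ltW k1p) D10 (normr_ge0 p) (normr_ge0 v) (normr_ge0 u)
 (dcosq_upper iw g2 g3 v u).
by apply: le_trans h _;rewrite ler_wpM2r // lerDr ltW.
Qed.
End Ramped.

(** * Strict derivatives on the unit interval and integrals *)

Lemma unif_line R (Q : R -> R -> Prop) :
 (forall t : R, 0 <= t <= 1 -> exists2 U : set R, nbhs t U & forall s s', U s -> U s' -> Q s s') ->
 exists2 d : R, 0 < d & forall s s', 0 <= s <= 1 -> `|s' - s| < d -> Q s s'.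
move=> H;have h : \forall d \near (0 : R)^'+, `[0, 1]%classic `<=` [set s : R | forall s', `|s' - s| < d -> Q s s'].
 have /compact_near_coveringP := @segment_compact R 0 1;apply => t;rewrite /= in_itv /= => t01.
 have [U /nbhs_ballP[r /= r0 Hr] HU] := H t t01.
 have r2 : 0 < r / 2 by rewrite divr_gt0.
 exists ([set s : R | `|s - t| < r / 2], [set d : R | d < r / 2]).
 split;last exact: nbhs_right_lt.
 by apply/nbhs_ballP;exists (r / 2) => //= s;rewrite /ball /= distrC.
 move=> [s d] /= [h1 h2] s' ss';apply: HU;apply: Hr;rewrite -ball_normE /= distrC.
 by apply: lt_trans h1 _;lra.
 have := ler_distD s s' t;lra.
near (0 : R)^'+ => d;exists d;first by near: d;exact: nbhs_right_gt.
have K : `[0, 1]%classic `<=` [set s : R | forall s', `|s' - s| < d -> Q s s'] by near: d.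
by move=> s s' s01 ss';apply: K => //=;rewrite in_itv.
Unshelve. all: by end_near. Qed.
Lemma step_in R (t r : R) : 0 <= t <= 1 -> 0 < r -> r <= 1 / 2 -> exists2 s, 0 <= s <= 1 & `|s - t| = r.
move=> /andP[t0 t1] r0 r2;have [h|h] := leP t (1 / 2).
 exists (t + r);last by rewrite addrAC subrr add0r gtr0_norm.
 by apply/andP;split;lra.
exists (t - r);last by rewrite addrAC subrr add0r normrN gtr0_norm.
by apply/andP;split;lra.
Qed.

Section Growth.
Variables (R : realType) (W : NM R).
(** Strict differentiability at t0 relative to [0, 1], hence one-sided at the end points. *)
Definition growth (f : R -> W) (B : W) (t0 : R) : Prop := forall e : R, 0 < e -> exists2 d : R, 0 < d &
 forall s s', 0 <= s <= 1 -> 0 <= s' <= 1 -> `|s - t0| < d -> `|s' - t0| < d ->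
 `|f s' - f s - (s' - s) *: B| <= e * `|s' - s|.
Lemma blin_line (B : W) : blin (fun h : R => h *: B).
split=> [u v|a v|];first exact: scalerDl.
 by rewrite -scalerA.
by exists `|B| => // v;rewrite normrZ mulrC.
Qed.
Lemma growth_sdif f B (t0 : R) : growth f B (clip t0) ->
 sdif (@clip R) (fun s : R => f (clip s)) t0 (fun h : R => h *: B).
move=> H;split;first exact: blin_line.
move=> e e0;have [d d0 Hd] := H e e0;exists [set s : R | `|clip s - clip t0| < d].
 apply: (near_dist (f := @clip R)) d0;apply: (ct_clip (f := id));exact: cvg_id.
by move=> s s' h h';apply: Hd => //;exact: clip_itv.
Qed.
(** The estimates at two nearby times are compared on one common increment, whose other end
    [step_in] finds inside [0, 1]. *)
Lemma growth_cont (f B : R -> W) : (forall t, 0 <= t <= 1 -> growth f (B t) t) ->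
 continuous (fun s : R => B (clip s)).
move=> H t0;have t01 := clip_itv t0;apply/cvgrPdist_le => e e0.
have e2 : 0 < e / 2 by rewrite divr_gt0.
have [d d0 Hd] := H _ t01 _ e2.
have hn : \forall s \near t0, `|clip s - clip t0| < d / 2.
 by apply: (near_dist (f := @clip R));[apply: (ct_clip (f := id));exact: cvg_id|rewrite divr_gt0].
apply: filterS hn => s hs;have s01 := clip_itv s;rewrite distrC.
have hs' : `|clip s - clip t0| < d by apply: lt_trans hs _;lra.
have [d' d'0 Hd'] := H _ s01 _ e2.
pose r := Num.min (Num.min (d / 2) d') 1 / 2.
have m0 : 0 < Num.min (Num.min (d / 2) d') 1 by rewrite !lt_min d'0 ltr01 divr_gt0.
have r0 : 0 < r by rewrite divr_gt0.
have [r1 r2 r3] : [/\ r < d / 2, r < d' & r <= 1 / 2].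
 have h1 : Num.min (Num.min (d / 2) d') 1 <= d / 2 by rewrite !ge_min lexx.
 have h2 : Num.min (Num.min (d / 2) d') 1 <= d' by rewrite !ge_min lexx orbT.
 have h3 : Num.min (Num.min (d / 2) d') 1 <= 1 by rewrite !ge_min lexx orbT.
 rewrite /r;split;lra.
have [u u01 ur] := step_in s01 r0 r3.
have ut : `|u - clip t0| < d by have := ler_distD (clip s) u (clip t0);lra.
have z0 : `|clip s - clip s| < d' by rewrite subrr normr0.
have h1 := Hd (clip s) u s01 u01 hs' ut;have h2 := Hd' (clip s) u s01 u01 z0;rewrite ur in h1 h2.
have {}h2 := h2 r2.
have h3 : `|(u - clip s) *: (B (clip s) - B (clip t0))| <= e * r.
 rewrite scalerBr;set X := f u - f (clip s) in h1 h2.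
 have := ler_distD X ((u - clip s) *: B (clip s)) ((u - clip s) *: B (clip t0)).
 rewrite [`|_ - X|]distrC;lra.
by rewrite normrZ ur mulrC ler_pM2r in h3.
Qed.
End Growth.
Lemma growth_integral R (f B : R -> R) : (forall t, 0 <= t <= 1 -> growth f (B t : R^o) t) ->
 {within `[0, 1]%classic, continuous B} /\
 (\int[lebesgue_measure]_(t in `[0, 1]%classic) B t)%R = f 1 - f 0.
move=> H;have Bc : continuous (fun s : R => B (clip s)) := growth_cont (W := R^o) H.
have Bw : {within `[0, 1]%classic, continuous B}.
 apply: (@subspace_eq_continuous _ _ _ (fun s => B (clip s)));last exact: continuous_subspaceT.
 by move=> s;rewrite inE /= in_itv /= => s01;rewrite clip_id.
split=> //.
have fd (s : R) : 0 < s < 1 -> is_derive s 1 f (B s).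
 move=> /andP[s0 s1];have s01 : 0 <= s <= 1 by rewrite !ltW.
 apply: (@cvg_growth R R^o f s (B s)) => e e0;have [d d0 Hd] := H s s01 e e0.
 exists (Num.min d (Num.min s (1 - s)));first by rewrite !lt_min d0 s0 subr_gt0.
 move=> h;rewrite !lt_min => /and3P[h1 h2 h3];have h4 := ler_norm h;have h5 := ler_norm (- h);rewrite normrN in h5.
 have := Hd s (s + h) s01;rewrite subrr normr0 [s + h - s]addrAC subrr add0r;apply => //.
 by apply/andP;split;lra.
have fcc : continuous (fun s : R => f (clip s)).
 move=> t0;have := growth_sdif (W := R^o) (H _ (clip_itv t0));apply: sdif_cvg.
 by apply: (ct_clip (f := id));exact: cvg_id.
have F2 := @continuous_FTC2 R B f 0 1 ltr01 Bw.
rewrite /Rintegral F2 //.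
- split;first by move=> s;rewrite in_itv /= => /fd [].
 + have h := cvg_at_right_filter (fcc 0);rewrite clip_le0 // in h.
 apply: cvg_trans h;apply: near_eq_cvg;near=> s;rewrite clip_id //;apply/andP;split;apply: ltW;near: s.
 exact: nbhs_right_gt.
 by apply: nbhs_right_lt;exact: ltr01.
 + have h := cvg_at_left_filter (fcc 1);rewrite clip_ge1 // in h.
 apply: cvg_trans h;apply: near_eq_cvg;near=> s;rewrite clip_id //;apply/andP;split;apply: ltW;near: s.
 by apply: nbhs_left_gt;exact: ltr01.
 exact: nbhs_left_lt.
- by move=> s;rewrite in_itv /= => /fd hs;rewrite derive1E;exact: (@derive_val _ _ _ _ _ _ _ hs).
Unshelve. all: by end_near. Qed.
(** On each cell the mean value theorem for an antiderivative gives a value of sigma, compared with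
    the value at the right end; that is where [node] lies after a cyclic shift. *)
Lemma riemann_node R (sigma : R -> R) (e : R) : continuous sigma -> 0 < e -> exists2 s : R, 0 < s &
 forall N, N.+1%:R^-1 <= s -> N.+1%:R^-1 * \sum_(j < N.+1) sigma (node R j) <=
 (\int[lebesgue_measure]_(t in `[0, 1]%classic) sigma t)%R + e.
move=> sc e0;have e2 : 0 < e / 2 by rewrite divr_gt0.
have [|d d0 Hd] := @unif_line R (fun t t' => `|sigma t' - sigma t| <= e).
 move=> t _;have hn := near_dist (@sc t) e2;eexists;first exact: hn.
 move=> s s' /= h1 h2;have := ler_distD (sigma t) (sigma s') (sigma s);rewrite [`|sigma t - _|]distrC;lra.
(* Integrating from -1 makes 0 and 1 interior points. *)
pose G (x : R) := (\int[lebesgue_measure]_(t in `[(-1)%R, x]%classic) sigma t)%R.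
have Gd (x : R) : -1 < x -> x < 2 -> is_derive x 1 G (sigma x).
 move=> x1 x2;have [|dG G'] := @continuous_FTC1_closed R sigma (-1) x 2 x2 _ x1 (@sc x).
 apply: continuous_compact_integrable;first exact: segment_compact.
 exact: continuous_subspaceT.
 split;[exact: dG|rewrite -derive1E;exact: G'].
have Gc (x : R) : -1 < x -> x < 2 -> cts x G.
 by move=> x1 x2;have [dG _] := Gd x x1 x2;apply: differentiable_continuous;apply/derivable1_diffP.
have -> : (\int[lebesgue_measure]_(t in `[0, 1]%classic) sigma t)%R = G 1 - G 0.
 have := @continuous_FTC2 R sigma G 0 1 ltr01 (continuous_subspaceT sc);rewrite /Rintegral => -> //.
 - split;first by move=> x;rewrite in_itv /= => /andP[x0 x1];have [] // := Gd x;lra.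
 + by apply: cvg_at_right_filter;apply: Gc;lra.
 + by apply: cvg_at_left_filter;apply: Gc;lra.
 - move=> x;rewrite in_itv /= => /andP[x0 x1];rewrite derive1E.
 by apply: (@derive_val _ _ _ _ _ _ _ (Gd x _ _));lra.
exists (d / 2);first by rewrite divr_gt0.
move=> N Ns;set tau := N.+1%:R^-1 in Ns *;have t0 : 0 < tau by rewrite invr_gt0 ltr0n.
have n1 : tau * N.+1%:R = 1 by rewrite mulVf // pnatr_eq0.
have -> : G 1 - G 0 = \sum_(j < N.+1) (G (j.+1%:R * tau) - G (j%:R * tau)).
 have := telescope_sumr (fun j : nat => G (j%:R * tau)) (leq0n N.+1);rewrite big_mkord => ->.
 by rewrite mul0r [N.+1%:R * tau]mulrC n1.
rewrite (reindex (@ordS N.+1)) /=;last by apply: onW_bij;exact: ordS_bij.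
rewrite mulr_sumr;have -> : e = \sum_(j < N.+1) (tau * e).
 by rewrite sumr_const card_ord -mulr_natr mulrAC n1 mul1r.
rewrite -big_split /=;apply: ler_sum => j _.
have -> : node R (ordS j) = j.+1%:R * tau.
 have cl : cyc N j.+1 = ordS j by rewrite cycS_pos //= cyc_ord.
 by rewrite -cl node_cyc //= ltn_ord.
have jt0 : 0 <= j%:R * tau by rewrite mulr_ge0 // ltW.
have jt1 : j.+1%:R * tau <= 1 by rewrite -[leRHS]n1 mulrC ler_pM2l // ler_nat.
have jt : j.+1%:R * tau = j%:R * tau + tau by rewrite -natr1 mulrDl mul1r.
have [|x||c] := @MVT R G sigma (j%:R * tau) (j.+1%:R * tau).
- by rewrite jt ltrDl.
- by rewrite in_itv /= => /andP[h1 h2];apply: Gd;lra.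
- apply: derivable_within_continuous => x;rewrite in_itv /= => /andP[h1 h2].
 by have [] // := Gd x;lra.
rewrite in_itv /= => /andP[c1 c2] ->;rewrite jt [X in sigma c * X]addrAC subrr add0r [sigma c * _]mulrC -mulrDr ler_pM2l //.
have := Hd c (j.+1%:R * tau);rewrite jt;move: c1 c2;rewrite jt => c1 c2.
move=> h;have : `|j%:R * tau + tau - c| < d by rewrite ltr_norml;apply/andP;split;lra.
move=> /h h';have /h' : 0 <= c <= 1 by apply/andP;split;lra.
by rewrite ler_norml;lra.
Qed.
Lemma dist_halves_vec R (W : NM R) (a b c : W) (e v : R) : `|a - b| <= e / 2 * v -> `|c - b| <= e / 2 * v ->
 `|a - c| <= e * v.
move=> h1 h2;have := ler_distD b a c;rewrite [`|b - c|]distrC;lra. Qed.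

Section MatrixContinuity.
Variables (R : realType) (T : Top) (t : T).
Lemma ct_entry p q (f : T -> 'M[R]_(p, q)) a b : cts t f -> cts t (fun t => f t a b).
by move=> fc;apply: (ct_comp (f := fun B : 'M[R]_(p, q) => B a b)) fc;exact: coord_continuous. Qed.
Lemma ct_mulmx p q r (f : T -> 'M[R]_(p, q)) (h : T -> 'M[R]_(q, r)) : cts t f -> cts t h ->
 cts t (fun t => f t *m h t).
move=> fc hc;apply: continuous_mx => a b.
rewrite (_ : (fun t => _) = fun t => \sum_k f t a k * h t k b);last by apply/funext => s;rewrite mxE.
by apply: continuous_sum_ord => k;apply: ctM;exact: ct_entry.
Qed.
Lemma ct_dotv n (f h : T -> 'rV[R]_n) : cts t f -> cts t h ->
 cts t (fun t => dotv (f t) (h t)).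
move=> fc hc;rewrite (_ : (fun t => _) = fun t => \sum_k f t 0 k * h t 0 k);last by apply/funext => s;rewrite dotvE.
by apply: continuous_sum_ord => k;apply: ctM;exact: ct_entry.
Qed.
End MatrixContinuity.
Lemma C1_curve R n (f : R -> 'rV[R]_n) (U : set R) t : open U -> U t -> Ck_on 1 U f ->
 sdif (@id R) f t (fun h : R => h *: derive1 f t) /\ cts t (derive1 f).
move=> oU Ut CkU;have [df dD] := CkU.
have nU : nbhs t U by exact: open_nbhs_nbhs.
split;last first.
 rewrite (_ : derive1 f = 'D_1 f);first exact: dD.
 by apply/funext => s;rewrite derive1E.
pose L (v : R) : 'rV[R]_n := \row_a 'D_v (fun s => f s 0 a) t.
have d1 : sdif (@id R) f t L.
 apply: sdif_mx => b a;rewrite ord1.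
 have [da dDa] := Ck_on_entry 0 a oU CkU.
 have [|||||bL H] := @C1_strict R R R id 1 (fun _ => 1) (fun v _ => v) (fun s => f s 0 a) t.
 - exact: blin_id.
 - by move=> v;rewrite big_ord1 [_ *: _]mulr1.
 - by [].
 - by apply: filterS nU => z;exact: da.
 - by move=> _;exact: dDa.
 apply: (sdif_eq (L := fun v : R => 'D_v (fun s => f s 0 a) t));first by move=> v;rewrite /L mxE.
 split=> // e e0;have [r r0 Hr] := H e e0;exists (ball t r);first exact: nbhsx_ballx.
 move=> x x';rewrite -!ball_normE /= => xr x'r.
 by have := Hr x (x' - x);rewrite /= [x + (x' - x)]addrC subrK;apply;rewrite distrC.
have [[LD LZ _] H] := d1.
have Lh (h : R) : L h = h *: L 1.
 transitivity (L (h * 1));first by rewrite mulr1.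
 exact: (LZ h 1).
have hd : is_derive t 1 f (L 1).
 apply: cvg_growth => e e0;have [S /nbhs_ballP[r /= r0 Hr] HS] := H e e0;exists r => // h hr.
 have -> : h *: L 1 = L (t + h - t) by rewrite -Lh addrAC subrr add0r.
 have -> : `|h| = `|t + h - t| by rewrite addrAC subrr add0r.
 apply: HS;apply: Hr;rewrite -ball_normE /=;first by rewrite subrr normr0.
 by rewrite opprD addrA subrr add0r normrN.
apply: sdif_eq d1 => h;rewrite Lh derive1E;congr (_ *: _);symmetry;exact: (@derive_val _ _ _ _ _ _ _ hd).
Qed.

(** * Speed and chords of a smooth curve *)

Section SmoothCurve.
Variables (R : realType) (n : nat) (M : Top) (A : SA R n M) (g : RM A)
 (HM : CCM A).
Local Notation V := 'rV[R]_n.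
Implicit Types (i j : chart_index A).
Variables (gamma : R -> M)
 (gamma_smooth : smooth_curve A gamma).
Definition vel i t : V := derive1 (chart i \o gamma) t.
Definition energy i t : R := dotv (vel i t *m g i (chart i (gamma t))) (vel i t).
Definition speed t : R := Num.sqrt (energy (chart_at A (gamma t)) t).
Let gc0 : continuous gamma. by case: gamma_smooth. Qed.
Lemma curve_loc i t : cdom i (gamma t) -> sdif (@id R) (chart i \o gamma) t (fun h : R => h *: vel i t) /\
 cts t (vel i).
move=> it;have oD : open (gamma @^-1` cdom i).
 by apply: open_comp;[move=> s _;exact: gc0|exact: open_chart_dom].
have [_ sm] := gamma_smooth;have [U [oU Ut _ CkU]] := smooth_on_open oD (sm i) it.
exact: C1_curve oU Ut (CkU 1%N).
Qed.
Lemma vel_transition i j t : cdom i (gamma t) -> cdom j (gamma t) ->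
 vel j t = vel i t *m transition_jacobian i j (gamma t).
move=> it jt;have [di _] := curve_loc it;have [dj _] := curve_loc jt.
have d := sdif_comp (d := chart i) (h := gamma) (@gc0 t) di (sdif_transition it jt).
have := sdif_uniq (@lsurj_id _ _ t) dj d (1 : R);by rewrite /= !scale1r.
Qed.
Lemma energy_transition i j t : cdom i (gamma t) -> cdom j (gamma t) -> energy i t = energy j t.
move=> it jt;rewrite /energy (vel_transition it jt) (metric_transition g it jt).
move: (vel i t) (transition_jacobian _ _ _) (g j _) => v T G.
by rewrite [RHS]dotvC [RHS]dotv_mul [RHS]dotvC !mulmxA.
Qed.
Lemma speedE i t : cdom i (gamma t) -> speed t = Num.sqrt (energy i t).
by move=> it;rewrite /speed (energy_transition (mem_chart_at A (gamma t)) it). Qed.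
Lemma speed_ge0 t : 0 <= speed t. exact: sqrtr_ge0. Qed.
Lemma energy_speed i t : cdom i (gamma t) -> energy i t = speed t ^+ 2.
by move=> it;rewrite (speedE it) sqr_sqrtr //;apply: metric_ge0;exact: chart_imgP. Qed.
Lemma speed_cont : continuous speed.
move=> t;set i := chart_at A (gamma t);have it : cdom i (gamma t) by exact: mem_chart_at.
have [di cv] := curve_loc it.
have nd : \forall s \near t, cdom i (gamma s) by exact: near_comp (@gc0 t) (nbhs_chart_dom it).
suff : cts t speed by [].
apply: (@ct_near _ _ _ (fun s => Num.sqrt (energy i s))).
 by apply: (near_mono (P := fun s => cdom i (gamma s))) nd => s /speedE ->.
apply: (ct_comp (f := @Num.sqrt R));first exact: sqrt_continuous.
have cg : cts t (fun s => g i (chart i (gamma s))).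
 apply: (ct_comp (f := g i));last exact: ct_chart it (@gc0 t).
 exact: sdif_cvg (@cvg_id _ _) (sdif_metric g (chart_imgP it)).
exact: ct_dotv (ct_mulmx cv cg) cv.
Qed.
Variables (m : nat) (ci : 'I_m -> chart_index A) (cc : 'I_m -> V) (cr : 'I_m -> R)
 (gc : good_cover ci cc cr).
Local Notation iota := (iota_emb ci cc cr).
Local Notation E := (d_iota ci cc cr).
Lemma curve_chord (e : R) : 0 < e -> exists2 d : R, 0 < d & forall t t', 0 <= t <= 1 -> `|t' - t| < d ->
 exists i (v : V), [/\ cdom i (gamma t), dotv (v *m g i (chart i (gamma t))) v = speed t ^+ 2 &
 `|iota (gamma t') - iota (gamma t) - (t' - t) *: (v *m E i (gamma t))| <= e * `|t' - t|].
move=> e0;have e2 : 0 < e / 2 by rewrite divr_gt0.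
apply: unif_line => t _;set i := chart_at A (gamma t);have it : cdom i (gamma t) by exact: mem_chart_at.
have [di cv] := curve_loc it.
have d := sdif_comp (d := chart i) (h := gamma) (@gc0 t) di (sdif_iota HM gc it).
have [_ H] := d;have [U nU HU] := H _ e2.
have cE : cts t (fun s => E i (gamma s)) by apply: ct_comp (@gc0 t);exact: (E_ct HM gc it).
have cw : cts t (fun s => vel i s *m E i (gamma s)) by exact: ct_mulmx cv cE.
have nw := near_dist cw e2.
have nd : \forall s \near t, cdom i (gamma s) by exact: near_comp (@gc0 t) (nbhs_chart_dom it).
exists (U `&` [set s | `|vel i s *m E i (gamma s) - vel i t *m E i (gamma t)| < e / 2] `&` [set s | cdom i (gamma s)]).
 by apply: filterI => //;exact: filterI.
move=> s s' [[Us ws] ds] [[Us' _] _];exists i, (vel i s);split=> //;first exact: energy_speed.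
have := HU s s' Us Us';rewrite /= -scalemxAl => h1.
have h2 : `|(s' - s) *: (vel i s *m E i (gamma s)) - (s' - s) *: (vel i t *m E i (gamma t))| <= e / 2 * `|s' - s|.
 by rewrite -scalerBr normrZ mulrC ler_wpM2r // ltW.
exact: dist_halves_vec h1 h2.
Qed.
End SmoothCurve.
Lemma gradL_scale R (X : Top) (V : NM R) (c : X -> V) (F : X -> R) (z : X) (s : R) v :
 lsurj c z -> (exists L, sdif c F z L) -> gradL c (fun z => s * F z) z v = s * gradL c F z v.
move=> ls /gradLP d;have bk : blin (fun a : R => s * a) by exact: (blinZ s (blin_id (R : NM R))).
exact: (gradLE ls (sdif_lin bk d)).
Qed.

Section Scaling.
Variables (R : realType) (n : nat) (M : Top) (A : SA R n M) (m : nat).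
Local Notation Y := 'rV[R]_(m * (1 + n)).
Variables (F : M * Y -> R) (s : R)
 (SD : forall (i : chart_index A) z, cdom i z.1 -> exists L, sdif (pchart i) F z L).
Lemma vgrad_scale z : vgrad A (fun z => s * F z) z = s *: vgrad A F z.
apply/rowP => a;have iz := mem_chart_at A z.1.
have h := gradL_scale s ((0, delta_mx 0 a) : 'rV[R]_n * Y) (lsurj_pchart iz) (SD iz).
by rewrite /vgrad mxE [RHS]mxE [X in _ = _ * X]mxE;exact: h.
Qed.
Lemma dmove_scale (ci : 'I_m -> chart_index A) (cc : 'I_m -> 'rV[R]_n) (cr : 'I_m -> R) k a z :
 dmove ci cc cr (fun z => s * F z) k a z = s * dmove ci cc cr F k a z.
rewrite /dmove;case: asboolP => kz;last by rewrite mulr0.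
have h := gradL_scale s ((delta_mx 0 a, 0) : 'rV[R]_n * Y) (lsurj_pchart kz) (SD kz).
rewrite (_ : gradL _ (fun z => s * F z) z _ = s * gradL (pchart (ci k)) F z (delta_mx 0 a, 0));last exact: h.
exact: mulrCA.
Qed.
End Scaling.
(** The left side equals k (1 - 1 / b): the penalty raises the action density by at most kappa. *)
Lemma bracket_gain (R : realFieldType) (k b yy : R) : 0 <= k -> 1 <= b -> b * b = 1 + yy -> k / b * yy - k * (b - 1) <= k.
move=> k0 b1 bb;have b0 : b != 0 by rewrite gt_eqF // (lt_le_trans ltr01 b1).
have -> : k / b * yy = k * (b - b^-1) by rewrite (_ : yy = b * b - 1);[field|rewrite bb;ring].
have bi : 0 <= b^-1 by rewrite invr_ge0;lra.
have : 0 <= k * b^-1 by rewrite mulr_ge0.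
lra.
Qed.
Lemma dotv_expand R K n (y D : 'rV[R]_K) (t : R) (P : 'rV[R]_n) (B : 'M[R]_(n, K)) (k : R) :
 dotv y (D + t *: (P *m B + k *: y)) = dotv y D + t * (dotv (y *m B^T) P + k * dotv y y).
by rewrite dotvDr dotvZr dotvDr dotvZr [dotv y (P *m B)]dotvC dotv_mul [dotv P _]dotvC. Qed.
Lemma far_sum (R : realFieldType) (B S k t Y t2 c : R) : B * 4 + k * t <= k * t * Y -> S <= B -> 0 <= B -> 0 <= k * t ->
 t <= 1 -> t2 <= t -> t <= c -> t * (B - k / 2 * Y) + S <= c - t2.
move=> h1 h2 B0 kt0 t1 ht tc;have h3 : t * B <= B by rewrite ler_piMl.
lra.
Qed.
Lemma delta_small (R : realFieldType) (t C d t2 : R) : t * (4 * (C + 2)) < d -> t2 <= t -> 0 < t -> t * C + t2 < d / 4.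
lra. Qed.
Lemma final_contradiction (R : realFieldType) (c t2 a k K t rr l X : R) : c - t2 <= a + k + K * t -> a <= rr * (l + X) ->
 rr * X <= (c - l * rr) / 4 -> t * (8 * (K + 1)) < c - l * rr -> t2 <= t -> k <= (c - l * rr) / 4 -> 0 < c - l * rr -> False.
lra. Qed.

(** * Existence of bounded discrete orbits *)

Section Discrete.
Variables (R : realType) (n : nat) (M : Top) (A : SA R n M)
 (HM : CCM A)
 (m : nat) (ci : 'I_m -> chart_index A) (cc : 'I_m -> 'rV[R]_n) (cr : 'I_m -> R)
 (gc : good_cover ci cc cr).
Local Notation V := 'rV[R]_n.
Local Notation iota := (iota_emb ci cc cr).
Local Notation E := (d_iota ci cc cr).
Local Notation lift := (lift ci cc cr).
Local Notation lcoord := (lcoord ci cc cr).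
Local Notation KY := (m * (1 + n))%N.
Local Notation Y := 'rV[R]_KY.
Variables (Ht : R -> cotangent A -> R)
 (SDT : forall i t w, cimg i w.1 -> exists L, sdift id (hloc Ht i) t w L)
 (CH : R)
 (CH0 : 0 < CH)
 (BD : forall t k x, 0 <= t <= 1 -> xi ci cc cr k x != 0 -> forall p v u : V,
 `|dH Ht (ci k) t (chart (ci k) x, p) (v, u)| <= CH * ((1 + `|p|) * `|v| + `|u|))
 (c rho rr C0 CT l : R) (nrm : cotangent A -> R) (sigma : R -> R) (gamma : R -> M)
 (c_gt0 : 0 < c)
 (rho0 : 0 <= rho)
 (rr0 : 0 <= rr)
 (C00 : 0 <= C0)
 (CT0 : 0 < CT)
 (sigma_cont : continuous sigma)
 (sigma_ge0 : forall t, 0 <= sigma t)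
 (lE : (\int[lebesgue_measure]_(t in `[0, 1]%classic) sigma t)%R = l)
 (l_small : l * rr < c)
 (zero_le : forall t x, 0 <= t <= 1 -> Ht t (lift (x, 0)) <= - c)
 (tang_le : forall x y, tang ci cc cr x y <= CT * nrm (lift (x, y)))
 (low : forall t x y, 0 <= t <= 1 -> sigma t * (nrm (lift (x, y)) - rr) - C0 <= Ht t (lift (x, y)))
 (out : forall t i x y, 0 <= t <= 1 -> cdom i x -> rho < nrm (lift (x, y)) ->
 dotv (y *m (E i x)^T) (Hp Ht i t (lcoord i (x, y))) - Ht t (lift (x, y)) <= sigma t * rr)
 (gamma_cont : continuous gamma)
 (gamma_per : forall t, gamma (t + 1) = gamma t)
 (chords : forall e : R, 0 < e -> exists2 d : R, 0 < d & forall (t h : R) (y : Y), 0 <= t <= 1 -> 0 < h < d ->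
 dotv y (iota (gamma (t + h)) - iota (gamma t)) <= h * (sigma t * nrm (lift (gamma t, y)) + e * `|y|))
 (alpha : set (R -> M)) (ecl dcl : R)
 (ecl0 : 0 < ecl)
 (dcl0 : 0 < dcl)
 (alpha_gamma : alpha gamma)
 (step : forall N (x x' : 'I_N.+1 -> M),
 (exists2 f : R -> M, alpha f & follows ci cc cr ecl f x) ->
 (forall j, `|iota (x' j) - iota (x j)| < dcl) -> (forall j, `|iota (x' (ordS j)) - iota (x' j)| < dcl) ->
 exists2 f : R -> M, alpha f & follows ci cc cr ecl f x').
Local Notation Hk := (Hk ci cc cr Ht).
Local Notation act kappa N := (action iota (fun (j : 'I_N.+1) (x : M) (y : Y) => N.+1%:R^-1 * Hk kappa (node R j) (x, y))).
Let io_c := iota_cont HM gc.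
Lemma gamma_node N (j : 'I_N.+1) : gamma (node R j) = gamma (j%:R * N.+1%:R^-1).
by rewrite /node;case: eqP => [->|//];rewrite mul0r -[in LHS](add0r 1) gamma_per. Qed.
Lemma node_ordS N (j : 'I_N.+1) : node R (ordS j) = j%:R * N.+1%:R^-1 + N.+1%:R^-1.
have cl : cyc N j.+1 = ordS j by rewrite cycS_pos //= cyc_ord.
by rewrite -cl node_cyc //= ?ltn_ord // -natr1 mulrDl mul1r.
Qed.
Lemma sum_mesh N (a : R) : \sum_(j < N.+1) N.+1%:R^-1 * a = a.
by rewrite sumr_const card_ord -[LHS]mulr_natr mulrAC mulVf ?mul1r // pnatr_eq0. Qed.
Lemma node_left N (j : 'I_N.+1) : 0 <= (j%:R * N.+1%:R^-1 : R) <= 1.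
by rewrite mulr_ge0 ?invr_ge0 //= ler_pdivrMr ?ltr0n // mul1r ler_nat ltnW.
Qed.
Lemma gamma_unif (e : R) : 0 < e -> exists2 d : R, 0 < d & forall t t', 0 <= t <= 1 -> `|t' - t| < d ->
 `|iota (gamma t') - iota (gamma t)| < e.
move=> e0;have e2 : 0 < e / 2 by rewrite divr_gt0.
apply: unif_line => t _;have ic : cts t (fun t => iota (gamma t)).
 by apply: (ct_comp (f := iota));[exact: io_c|exact: gamma_cont].
have hn := near_dist ic e2;eexists;first exact: hn.
move=> s s' /= h1 h2;have := ler_distD (iota (gamma t)) (iota (gamma s')) (iota (gamma s)).
rewrite [`|iota (gamma t) - _|]distrC;lra.
Qed.
(** The Lagrangian bound summed over nodes that all lie beyond [rho]. The three terms come from the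
    ramp, the penalty, and the error of the chord equation paired with y. *)
Lemma far_step kappa N (x : 'I_N.+1 -> M) (y : 'I_N.+1 -> Y) : 0 <= kappa -> almost_orbit ci cc cr Ht kappa x y ->
 (forall i, rho < nrm (lift (x i, y i))) ->
 act kappa N x y <= rr * (N.+1%:R^-1 * \sum_(j < N.+1) sigma (node R j)) + kappa + KY%:R * N.+1%:R^-1.
move=> k0 [ao _] far;set tau : R := N.+1%:R^-1 in ao *.
have t0 : 0 < tau by rewrite invr_gt0 ltr0n.
have key j : dotv (y j) (chord iota x j) - tau * Hk kappa (node R j) (x j, y j) <=
 tau * (rr * sigma (node R j) + kappa + KY%:R * tau).
 have ij := mem_chart_at A (x j);set i := chart_at A (x j) in ij.
 have := ao j;rewrite (vgrad_Hk HM gc SDT kappa (node R j) (i := i) (z := (x j, y j)) ij).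
 set D := chord iota x j - _ => hD.
 have -> : chord iota x j = D + tau *: (Hp Ht i (node R j) (lcoord i (x j, y j)) *m E i (x j) + (kappa / bracket (y j)) *: y j).
 by rewrite /D subrK.
 rewrite dotv_expand.
 have o := out (node_itv R j) ij (far j).
 have b1 := bracket_ge1 (y j).
 have bb : bracket (y j) * bracket (y j) = 1 + dotv (y j) (y j).
 by rewrite -expr2 /bracket sqr_sqrtr // addr_ge0 // dotv_ge0.
 have bg := bracket_gain k0 b1 bb.
 have dd : dotv (y j) D <= KY%:R * tau ^+ 2.
 apply: le_trans (ler_norm _) _;apply: le_trans (dotv_norm _ _) _;rewrite -mulrA ler_wpM2l //.
 by apply: le_trans hD;rewrite ler_wpM2r // lerDr.
 have alg (a b d h k q s K : R) : a <= K * tau ^+ 2 -> b - h <= s * rr -> q - k <= kappa ->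
 a + tau * (b + q) - tau * (h + k) <= tau * (rr * s + kappa + K * tau).
 move=> h1 h2 h3;have := ler_wpM2l (ltW t0) (lerD h2 h3);lra.
 exact: (alg _ _ 0 _ _ _ _ _ dd o bg).
rewrite /action;apply: le_trans (ler_sum _ (fun j _ => key j)) _.
rewrite (eq_bigr (fun j => rr * (tau * sigma (node R j)) + tau * (kappa + KY%:R * tau)));last by move=> j _;ring.
by rewrite big_split /= sum_mesh -!mulr_sumr addrA.
Qed.
(** On the discretized geodesic the chord pairing is at most speed times norm plus kappa |y| / 2.
    The ramp cancels the first part up to a constant, and half of the penalty survives. *)
Lemma near_step kappa (Q d : R) N (y : 'I_N.+1 -> Y) : 0 < kappa <= 1 -> (forall t, 0 <= t <= 1 -> sigma t <= Q) ->
 (forall (t h : R) (y : Y), 0 <= t <= 1 -> 0 < h < d ->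
 dotv y (iota (gamma (t + h)) - iota (gamma t)) <= h * (sigma t * nrm (lift (gamma t, y)) + kappa / 2 * `|y|)) ->
 N.+1%:R^-1 < d ->
 forall j, dotv (y j) (chord iota (fun j => gamma (node R j)) j) - N.+1%:R^-1 * Hk kappa (node R j) (gamma (node R j), y j) <=
 N.+1%:R^-1 * (Q * rr + C0 + 1 - kappa / 2 * `|y j|).
move=> /andP[k0 k1] HQ Hd td j;set tau : R := N.+1%:R^-1 in td *.
have t0 : 0 < tau by rewrite invr_gt0 ltr0n.
have -> : chord iota (fun j => gamma (node R j)) j = iota (gamma (node R j + tau)) - iota (gamma (node R j)).
 rewrite /chord node_ordS;congr (iota _ - _);rewrite /node;case: eqP => [->|//].
 by rewrite mul0r add0r [1 + _]addrC gamma_per.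
have h1 : dotv (y j) (iota (gamma (node R j + tau)) - iota (gamma (node R j))) <=
 tau * (sigma (node R j) * nrm (lift (gamma (node R j), y j)) + kappa / 2 * `|y j|).
 by apply: Hd;[exact: node_itv|rewrite t0].
have h2 := low (gamma (node R j)) (y j) (node_itv R j).
have h3 := HQ _ (node_itv R j);have h4 := bracket_ge (y j).
rewrite /Hk /=;move: h1 h2 h3 h4;move: (dotv _ _) (Ht _ _) (bracket _) (nrm _) (sigma _) (`|y j|) => D h b N0 s Y0 h1 h2 h3 h4.
have h5 : kappa * Y0 <= kappa * b by rewrite ler_wpM2l // ltW.
have h6 : s * rr <= Q * rr by rewrite ler_wpM2r.
have h7 : (s * N0 + kappa / 2 * Y0) - (h + kappa * (b - 1)) <= Q * rr + C0 + 1 - kappa / 2 * Y0 by lra.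
have := ler_wpM2l (ltW t0) h7;rewrite [X in X <= _]mulrBr;lra.
Qed.
(** If the almost critical loop had a covector larger than [Rb], then [apriori] would put every node
    beyond [rho], and [far_step] would bound the action by nearly l rr, below its level near c.
    Hence a bound independent of kappa and N. *)
Lemma discrete_orbits : exists Rb kappa1, [/\ 0 < kappa1 <= 1 & forall kappa, 0 < kappa <= kappa1 -> forall Nmin, exists N,
 (Nmin <= N)%N /\ exists (x : 'I_N.+1 -> M) (y : 'I_N.+1 -> Y), [/\ almost_orbit ci cc cr Ht kappa x y,
 forall j, `|y j| <= Rb, c - N.+1%:R^-1 ^+ 2 <= act kappa N x y & exists2 f : R -> M, alpha f & follows ci cc cr ecl f x]].
have [Ca Ca0 HCa] := apriori HM gc SDT CH0 BD.
have [CV CV0 HCV] := vgrad_bnd HM gc SDT CH0 BD.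
have [Q Q0 HQ] : exists2 Q : R, 0 < Q & forall t, 0 <= t <= 1 -> sigma t <= Q.
 have [t _|Q Q0 HQ] := @compact_ub R R _ sigma (@segment_compact R 0 1).
 exists (sigma t + 1);apply: filterS (near_lt (@sigma_cont t) (_ : sigma t < sigma t + 1)) => [t' /ltW //|].
 by rewrite ltrDl.
 by exists Q => // t t01;apply: HQ;rewrite /= in_itv.
(* This gap is shared among the Riemann sum error, kappa and the mesh terms. *)
pose D := c - l * rr;have D0 : 0 < D by rewrite subr_gt0.
have [dg dg0 Hdg] : exists2 d : R, 0 < d & forall t t', 0 <= t <= 1 -> `|t' - t| < d -> `|iota (gamma t') - iota (gamma t)| < Num.min ecl dcl.
 by apply: gamma_unif;rewrite lt_min ecl0.
have e1 : 0 < D / (4 * (rr + 1)) by rewrite divr_gt0 // mulr_gt0 // ltr_wpDl.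
have [sr sr0 Hsr] := riemann_node sigma_cont e1.
exists (Ca * (1 + CT * rho)), (Num.min 1 (D / 4));split;first by rewrite lt_min ltr01 divr_gt0 //= ge_min lexx.
move=> kappa /andP[k0];rewrite le_min => /andP[k1 kD] Nmin.
have k01 : 0 < kappa <= 1 by rewrite k0.
have [sa sa0 Hsa] := HCa kappa k01.
have [dc dc0 Hdc] := chords (divr_gt0 k0 (ltr0Sn R 1)).
(* Keeps the mesh times the gradient bound, plus the tolerance, below a quarter of the chord
   bound. *)
pose s4 := dcl / (4 * (CV + 2));have s40 : 0 < s4 by rewrite divr_gt0 // mulr_gt0 // addr_gt0.
pose s5 := D / (8 * (KY%:R + 1));have s50 : 0 < s5 by rewrite divr_gt0 // mulr_gt0 // ltr_wpDl.
have [N [NN [[n1 n2 n3 n4 n5] [n6 n7]]]] : exists N : nat, (Nmin <= N)%N /\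
 [/\ N.+1%:R^-1 < sa, N.+1%:R^-1 < dc, N.+1%:R^-1 < sr, N.+1%:R^-1 < s4 & N.+1%:R^-1 < s5] /\ (N.+1%:R^-1 < dg /\ N.+1%:R^-1 < c).
 near \oo => N;exists N;split;first by near: N;exact: nbhs_infty_ge.
 split;split;near: N.
 - exact: (near_infty_natSinv_lt (PosNum sa0)).
 - exact: (near_infty_natSinv_lt (PosNum dc0)).
 - exact: (near_infty_natSinv_lt (PosNum sr0)).
 - exact: (near_infty_natSinv_lt (PosNum s40)).
 - exact: (near_infty_natSinv_lt (PosNum s50)).
 - exact: (near_infty_natSinv_lt (PosNum dg0)).
 - exact: (near_infty_natSinv_lt (PosNum c_gt0)).
exists N;split=> //.
set tau : R := N.+1%:R^-1 in n1 n2 n3 n4 n5 n6 n7 *.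
have t0 : 0 < tau by rewrite invr_gt0 ltr0n.
have t1 : tau <= 1 by rewrite invf_le1 ?ltr0n // ler1n.
pose G (j : 'I_N.+1) (z : M * Y) := tau * Hk kappa (node R j) z.
have SDH (j : 'I_N.+1) i (z : M * Y) (iz : cdom i z.1) := SD_Hk HM gc SDT kappa (node R j) iz.
have vG j z : vgrad A (G j) z = tau *: vgrad A (Hk kappa (node R j)) z by apply: vgrad_scale => i' z';exact: SDH.
have dG j k a z : dmove ci cc cr (G j) k a z = tau * dmove ci cc cr (Hk kappa (node R j)) k a z by apply: dmove_scale => i' z';exact: SDH.
have k01' : 0 <= kappa <= 1 by rewrite ltW.
have ns (y : 'I_N.+1 -> Y) := near_step y k01 HQ Hdc n2.
have gn := gamma_node.
pose x0 (j : 'I_N.+1) := gamma (node R j).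
(* Radius at which the penalty of a single node outweighs the positive contributions of all
   nodes. *)
pose r0 := (Q * rr + C0 + 1) * 4 / (kappa * tau) + 1.
have B0 : 0 <= Q * rr + C0 + 1 by rewrite !addr_ge0 // mulr_ge0 // ltW.
have kt0 : 0 < kappa * tau by rewrite mulr_gt0.
have actle y : act kappa N x0 y <= \sum_j tau * (Q * rr + C0 + 1 - kappa / 2 * `|y j|).
 by apply: ler_sum => j _;exact: ns.
(* The tolerance is the squared mesh, as [almost_orbit] demands; the homotopy class is the property
   carried through the descent. *)
have [|||||||||||||x [y [Px _ hact ay axk]]] := @almost_critical R n M A HM m ci cc cr gc N.+1 G _ (tau ^+ 2) c dcl dcl r0
 (Q * rr + C0 + 1) (tau * CV) x0 (fun x => exists2 f : R -> M, alpha f & follows ci cc cr ecl f x).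
- move=> j i z iz;have [L d] := SDH j i z iz;have bk : blin (fun a : R => tau * a) by exact: (blinZ tau (blin_id (R : NM R))).
 by eexists;exact: (sdif_lin bk d).
- by rewrite exprn_gt0 //= exprn_ile1 // ltW.
- by [].
- by rewrite ltr_wpDl // divr_ge0 ?mulr_ge0 // ltW.
- by rewrite mulr_ge0 // ltW.
- by move=> j z;rewrite vG normrZ gtr0_norm // ler_wpM2l ?(ltW t0) // HCV // node_itv.
- have h : tau * (4 * (CV + 2)) < dcl by rewrite -ltr_pdivlMr // mulr_gt0 // addr_gt0.
 have h2 : tau ^+ 2 <= tau by rewrite expr2 ler_piMl // ltW.
 exact: delta_small h h2 t0.
- exists gamma => // j t /andP[jt1 jt2];rewrite /x0 gn;apply: lt_le_trans (_ : Num.min ecl dcl <= _);last by rewrite ge_min lexx.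
 apply: Hdg;first exact: node_left.
 have tN : tau * N.+1%:R = 1 by rewrite mulVf // pnatr_eq0.
 have g1 := ler_wpM2l (ltW t0) jt1;have g2 := ler_wpM2l (ltW t0) jt2.
 rewrite [tau * (_ * t)]mulrA tN mul1r in g1 g2;rewrite mulrC -/tau;apply: le_lt_trans n6;rewrite ler_norml;apply/andP;split;lra.
- by move=> x x' Px h1 h2 h3;exact: step Px h1 h3.
- move=> j;rewrite /chord /x0 node_ordS gn;apply: lt_le_trans (_ : Num.min ecl dcl <= _);last by rewrite ge_min lexx orbT.
 by apply: Hdg;[exact: node_left|rewrite addrAC subrr add0r gtr0_norm].
- move=> x;rewrite /action -[leLHS](sum_mesh N);apply: ler_sum => j _.
 have e0 : dotv (0 : Y) (chord iota x j) = 0 by exact: dotv0l.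
 have b0 : bracket (0 : Y) = 1 by rewrite /bracket dotv0l addr0 sqrtr1.
 rewrite -[leRHS]/(dotv (0 : Y) (chord iota x j) - tau * (Ht (node R j) (lift (x j, 0)) + kappa * (bracket (0 : Y) - 1))).
 rewrite e0 b0 subrr mulr0 addr0 sub0r -mulrN ler_wpM2l ?(ltW t0) //.
 by rewrite lerNr;apply: zero_le;exact: node_itv.
- move=> y;apply: le_trans (actle y) _;rewrite -[leRHS](sum_mesh N);apply: ler_sum => j _.
 by rewrite ler_wpM2l ?(ltW t0) // lerBlDr lerDl mulr_ge0 // divr_ge0 // ltW.
- move=> y j yj;apply: le_trans (actle y) _;rewrite (bigD1 j) //=.
 have h1 : \sum_(i < N.+1 | i != j) tau * (Q * rr + C0 + 1 - kappa / 2 * `|y i|) <= Q * rr + C0 + 1.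
 rewrite -[leRHS](sum_mesh N) [leRHS](bigD1 j) //= ler_wpDl ?mulr_ge0 ?(ltW t0) //;apply: ler_sum => i _.
 by rewrite ler_wpM2l ?(ltW t0) // lerBlDr lerDl mulr_ge0 // divr_ge0 // ltW.
 have t2 : tau ^+ 2 <= tau by rewrite expr2 ler_piMl // ltW.
 have hk : kappa * tau * r0 = (Q * rr + C0 + 1) * 4 + kappa * tau by rewrite /r0;field;rewrite !gt_eqF.
 have hy := ler_wpM2l (ltW kt0) yj;rewrite hk in hy.
 exact: (far_sum hy h1 B0 (ltW kt0) t1 t2 (ltW n7)).
exists x, y;have ao : almost_orbit ci cc cr Ht kappa x y.
 split=> [j|k a j];last by have := axk k a j;rewrite dG.
 rewrite -[X in X * _](ger0_norm (_ : 0 <= 1 + `|y j|)) ?addr_ge0 // -normrZ;apply: mx_norm_le;first exact: exprn_ge0 (ltW t0).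
 by move=> i a;rewrite ord1 mxE -vG;exact: ay.
split=> // j;rewrite leNgt;apply/negP => Rbig.
have far i : rho < nrm (lift (x i, y i)).
 have h1 := Hsa N x y (ltW n1) ao i j;have h2 := tang_le (x i) (y i).
 have h3 : Ca * (1 + CT * rho) < Ca * (1 + CT * nrm (lift (x i, y i))).
 apply: lt_le_trans (_ : 1 + `|y j| <= _);first by apply: lt_trans Rbig _;rewrite ltrDr.
 by apply: le_trans h1 _;rewrite ler_wpM2l ?(ltW Ca0) // lerD2l.
 by rewrite ltr_pM2l // ltrD2l ltr_pM2l // in h3.
have h1 := far_step (ltW k0) ao far;have h2 := Hsr N (ltW n3).
have h3 : rr * (tau * \sum_(j < N.+1) sigma (node R j)) <= rr * (l + D / (4 * (rr + 1))) by rewrite ler_wpM2l // -lE.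
have h4 : rr * (D / (4 * (rr + 1))) <= D / 4.
 rewrite (_ : rr * (D / (4 * (rr + 1))) = D / 4 * (rr / (rr + 1)));last by field;rewrite gt_eqF // ltr_wpDl.
 by rewrite ler_piMr ?divr_ge0 ?(ltW D0) // ler_pdivrMr ?ltr_wpDl // mul1r lerDl.
have h5 : tau * (8 * (KY%:R + 1)) < D by rewrite -ltr_pdivlMr // mulr_gt0 // ltr_wpDl.
have h6 : tau ^+ 2 <= tau by rewrite expr2 ler_piMl // ltW.
by have := final_contradiction (le_trans hact h1) h3 h4 h5 h6 kD D0.
Unshelve. all: by end_near. Qed.
End Discrete.

(** * The hypotheses of the discrete argument for the ramped Hamiltonian *)

Section Concrete.
Variables (R : realType) (n : nat) (M : Top) (A : SA R n M) (g : RM A)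
 (HM : CCM A).
Local Notation V := 'rV[R]_n.
Implicit Types (i j : chart_index A).
Variables (m : nat) (ci : 'I_m -> chart_index A) (cc : 'I_m -> V) (cr : 'I_m -> R)
 (gc : good_cover ci cc cr).
Local Notation iota := (iota_emb ci cc cr).
Local Notation E := (d_iota ci cc cr).
Local Notation lift := (lift ci cc cr).
Local Notation lcoord := (lcoord ci cc cr).
Local Notation KY := (m * (1 + n))%N.
Local Notation Y := 'rV[R]_KY.
Variables (H : R -> cotangent A -> R)
 (H_smooth : smooth_hamiltonian g H)
 (rho : R)
 (rho01 : 0 <= rho < 1)
 (H_far : forall t z, 0 <= t <= 1 -> cot_norm g z < 1 -> rho < cot_norm g z -> H t z = 0)
 (rho' a : R)
 (rho'_gt : rho < rho')
 (a_gt0 : 0 < a)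
 (gamma : R -> M)
 (gamma_smooth : smooth_curve A gamma).
Local Notation sigma := (speed g gamma).
Local Notation Ht := (ramped g H sigma rho' a).
Let sc : continuous sigma. exact: speed_cont. Qed.
Let s0 : forall t, 0 <= sigma t := speed_ge0 g gamma.
Lemma cot_norm_lift i x (y : Y) : cdom i x -> cot_norm g (lift (x, y)) = Num.sqrt (cosq g i (lcoord i (x, y))).
by move=> ix;rewrite (@cot_norm_chart _ _ _ _ g i) // cot_chart_lift. Qed.
Lemma tang_cot : exists2 C : R, 0 < C & forall x (y : Y), tang ci cc cr x y <= C * cot_norm g (lift (x, y)).
have [C C0 HC] := metric_bnd_cover g HM gc.
pose k2 : R := 1 + n%:R * (n%:R * C);pose k1 := Num.sqrt k2.
have k2p : 0 < k2 by rewrite ltr_wpDr // !mulr_ge0 // ltW.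
have k1p : 0 < k1 by rewrite sqrtr_gt0.
exists (1 + (m * n)%:R * k1);first by rewrite ltr_wpDr // mulr_ge0 // ltW.
move=> x y;have N0 : 0 <= cot_norm g (lift (x, y)) by exact: sqrtr_ge0.
have key k b : `|dotv y (field ci cc cr k b x)| <= k1 * cot_norm g (lift (x, y)).
 have z0 : 0 <= k1 * cot_norm g (lift (x, y)) by rewrite mulr_ge0 // ltW.
 have [kx|nkx] := pselect (cdom (ci k) x);last by rewrite /field /dmove asboolF // dotv0r normr0.
 rewrite (fieldE HM gc) //;have [x0|xk] := eqVneq (xi ci cc cr k x) 0;first by rewrite x0 scale0r dotv0r normr0.
 have /andP[x0 x1] := xi_itv ci cc cr k x.
 rewrite dotvZr normrM (ger0_norm x0);apply: le_trans (_ : 1 * `|dotv y (delta_mx 0 b *m E (ci k) x)| <= _).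
 by rewrite ler_wpM2r.
 rewrite mul1r dotvC dotv_mul dotv_delta;apply: le_trans (mx_entry_le _ _ _) _.
 have iw : cimg (ci k) (lcoord (ci k) (x, y)).1 by exact: chart_imgP.
 have [g1 _ _] := HC k x xk;have lw := cosq_lower iw g1.
 rewrite (cot_norm_lift _ kx) -sqrtrM ?(ltW k2p) // -[leLHS](@ger0_norm _ `|_|) // -sqrtr_sqr ler_wsqrtr //.
 by apply: le_trans lw _;rewrite ler_wpM2r ?cosq_ge0 // lerDr.
rewrite /tang;apply: le_trans (ler_sum _ (fun k _ => ler_sum _ (fun b _ => key k b))) _.
rewrite !sumr_const !card_ord -mulrnA -[leLHS]mulr_natr mulrDl mul1r natrM.
by rewrite [n%:R * m%:R]mulrC -natrM [leLHS]mulrC mulrA lerDr.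
Qed.
Lemma ramped_zero t x : 0 <= t <= 1 -> Ht t (lift (x, 0)) = H t (zero_section A x).
move=> t01;have -> : lift (x, 0) = zero_section A x by rewrite /lift /zero_section /= mul0mx.
have -> : Ht t (zero_section A x) = H (clip t) (zero_section A x).
 have z0 : cot_norm g (zero_section A x) = 0 by rewrite /cot_norm /= mul0mx dotv0r sqrtr0.
 rewrite /ramped /ext0 z0 ltr01 hramp0 ?mulr0 ?addr0 //.
 by apply: ltW;apply: le_lt_trans rho'_gt;case/andP: rho01.
by rewrite clip_id.
Qed.
(** The lift does not see the normal part of y. At norm at most [rho], y can be replaced by a
    representative in a fixed ball, where compactness applies; beyond [rho] the value is 0. *)
Lemma ext0_bnd : exists2 C : R, 0 <= C & forall t x (y : Y), 0 <= t <= 1 -> `|ext0 g H t (lift (x, y))| <= C.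
have [C C0 HC] := normal_split HM gc;have [CT CT0 HCT] := tang_cot.
have cM : compact [set: M] by case: HM.
have lc := lift_ct HM gc (ramped_cont H_smooth rho01 H_far sc rho'_gt a_gt0).
have [z _|B B0 HB] := @compact_ub R _ (@box R M KY (C * (CT * rho))) (fun q => `|Ht q.1 (lift q.2)|) (@box_compact R M KY cM _).
 exists (`|Ht z.1 (lift z.2)| + 1);exact: near_bnd (lc z).
exists B;first exact: ltW.
move=> t x y t01;have [far|near] := ltP rho (cot_norm g (lift (x, y))).
 by rewrite (ext0_far H_far _ far) normr0 ltW.
have [w [h1 _ h3]] := HC x y.
have e : lift (x, y) = lift (x, y - w).
 rewrite /lift /= mulmxBl;congr Cotangent.
 have -> : w *m (E (chart_at A x) x)^T = 0.
 apply/rowP => b;rewrite [RHS]mxE -dotv_delta dotvC dotv_mul trmxK;exact: h1 (mem_chart_at A x).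
 by rewrite subr0.
have -> : ext0 g H t (lift (x, y)) = Ht t (lift (x, y - w)).
 by rewrite -e /ramped hramp0 ?mulr0 ?addr0 // (le_trans near) // ltW.
apply: (HB (t, (x, y - w)));split;first by rewrite /= in_itv.
split=> //=;apply: le_trans h3 _;rewrite ler_wpM2l ?(ltW C0) //;apply: le_trans (HCT x y) _.
by rewrite ler_wpM2l // ltW.
Qed.
Lemma ramped_low : exists2 C : R, 0 <= C & forall t x (y : Y), 0 <= t <= 1 ->
 sigma t * (cot_norm g (lift (x, y)) - (rho' + a)) - C <= Ht t (lift (x, y)).
have [C C0 HC] := ext0_bnd;exists C => // t x y t01.
have h : ext0 g H t (lift (x, y)) + sigma t * (cot_norm g (lift (x, y)) - (rho' + a)) <= Ht t (lift (x, y)) by exact: ramped_ge.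
apply: le_trans h;rewrite addrC lerD2r.
by have := HC t x y t01;rewrite ler_norml => /andP[].
Qed.
Lemma ramped_out t i x (y : Y) : cdom i x -> rho < cot_norm g (lift (x, y)) ->
 dotv (y *m (E i x)^T) (Hp Ht i t (lcoord i (x, y))) - Ht t (lift (x, y)) <= sigma t * (rho' + a).
move=> ix;rewrite (cot_norm_lift _ ix) => far.
have iw : cimg i (lcoord i (x, y)).1 by exact: chart_imgP.
have := Hp_ramped_far H_smooth rho01 H_far sc s0 rho'_gt a_gt0 t iw far.
by rewrite /hloc -lift_lcoord.
Qed.
(** Cauchy-Schwarz between the velocity and the lifted covector, plus the error of the chord. *)
Lemma curve_chords (e : R) : 0 < e -> exists2 d : R, 0 < d & forall (t h : R) (y : Y), 0 <= t <= 1 -> 0 < h < d ->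
 dotv y (iota (gamma (t + h)) - iota (gamma t)) <= h * (sigma t * cot_norm g (lift (gamma t, y)) + e * `|y|).
move=> e0;have e1 : 0 < e / (KY%:R + 1) by rewrite divr_gt0 // ltr_wpDl.
have [d d0 Hd] := curve_chord g HM gamma_smooth gc e1;exists d => // t h y t01 /andP[h0 hd].
have th : t + h - t = h by rewrite addrAC subrr add0r.
have [|i [v [it vE hv]]] := Hd t (t + h) t01;first by rewrite th gtr0_norm.
rewrite th (gtr0_norm h0) in hv;set D := _ - _ - _ in hv.
have -> : iota (gamma (t + h)) - iota (gamma t) = D + h *: (v *m E i (gamma t)) by rewrite subrK.
rewrite dotvDr dotvZr.
have h1 : dotv y D <= h * (e * `|y|).
 apply: le_trans (ler_norm _) _;apply: le_trans (dotv_norm _ _) _.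
 apply: le_trans (_ : KY%:R * `|y| * (e / (KY%:R + 1) * h) <= _);first by rewrite ler_wpM2l // mulr_ge0.
 rewrite [leLHS](_ : _ = h * (e * `|y|) * (KY%:R / (KY%:R + 1)));last by field;rewrite gt_eqF // ltr_wpDl.
 by rewrite ler_piMr ?mulr_ge0 ?(ltW h0) ?(ltW e0) // ler_pdivrMr ?ltr_wpDl // mul1r lerDl.
have h2 : dotv y (v *m E i (gamma t)) <= sigma t * cot_norm g (lift (gamma t, y)).
 have iw : cimg i (lcoord i (gamma t, y)).1 by exact: chart_imgP.
 have cs := cauchy_schwarz g v iw;rewrite /= vE in cs.
 rewrite dotvC dotv_mul dotvC (cot_norm_lift _ it) mulrC;apply: le_trans (ler_norm _) _.
 by rewrite -sqrtr_sqr -[X in _ * X](ger0_norm (s0 t)) -sqrtr_sqr -sqrtrM ?cosq_ge0 // ler_wsqrtr.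
have := ler_wpM2l (ltW h0) h2;move: h1;move: (dotv y D) (dotv y _) (cot_norm g _) => X1 X2 X3 h1 h3;lra.
Qed.
End Concrete.

(** * Ordinary and one-sided derivatives, and closing a path into a loop *)

Lemma sdif_derive R (V W : NM R) (F : V -> W) (x v : V) L : sdif id F x L -> 'D_v F x = L v.
move=> d;have d' : sdif id F (x + (0 * 1) *: v) L by rewrite mul0r scale0r addr0.
have [_ e] := sdif_derive_line d';rewrite scale1r in e;rewrite -e /derive.
apply: (congr1 (fun f : R -> W => lim (f @ 0^'))).
by apply/funext => h;rewrite /= mul0r scale0r !addr0 -[h *: 1]/(h * 1) !mulr1 [x + _]addrC.
Qed.
Lemma sdif_diff R (V W : NM R) (F : V -> W) (x : V) L : sdif id F x L -> 'd F x = L :> (V -> W).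
move=> [bL H];have [LD LZ _] := bL.
have lin : linear L by move=> a u v;rewrite LD LZ.
pose l : {linear V -> W} := HB.pack L (GRing.isLinear.Build R V W *:%R L lin).
apply: (@diff_unique R V W F l x).
 move=> u;exact: sdif_cvg (@cvg_id _ _) (sdif_lin bL (sdif_coord id u)).
apply/eqaddoP => e e0;have [S /nbhs_ballP[r /= r0 Hr] HS] := H e e0.
have hb : \forall h \near (0 : V), `|h - 0| < r by apply: (near_dist (f := id)) r0;exact: cvg_id.
apply: filterS hb => h;rewrite subr0 => hr.
have := HS x (h + x) _ _;rewrite /= addrK => HS'.
have -> : (F \o shift x - (cst (F x) + l)) h = F (h + x) - F x - L h by rewrite -[LHS]/(F (h + x) - (F x + L h)) opprD addrA.
apply: HS';apply: Hr;rewrite -ball_normE /=;first by rewrite subrr normr0.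
by rewrite opprD addrCA subrr addr0 normrN.
Qed.
Lemma within_unit_proper R (t : R) : 0 <= t <= 1 -> ProperFilter (within `[0, 1]%classic t^').
move=> t01;apply: Build_ProperFilter_ex => P.
rewrite /within /= /dnbhs /within /= => /nbhs_ballP[r /= r0 Hr].
have m0 : 0 < Num.min r 1 by rewrite lt_min r0 ltr01.
have [h1 h2] : Num.min r 1 <= r /\ Num.min r 1 <= 1 by rewrite !ge_min !lexx orbT.
have [||s s01 sr] := @step_in R t (Num.min r 1 / 2) t01;[by rewrite divr_gt0|lra|].
exists s;apply: Hr.
- by rewrite -ball_normE /= distrC sr;move: (Num.min r 1) m0 h1 h2 => q m0 h1 h2;lra.
- by apply/negP => /eqP st;move: sr;rewrite st subrr normr0;move: (Num.min r 1) m0 => q m0;lra.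
- by rewrite /= in_itv.
Qed.

Section GrowthDerivative.
Variables (R : realType) (W : NM R).
Lemma growth_has_deriv (f : R -> W) B t : growth f B t -> 0 <= t <= 1 -> has_deriv_in `[0, 1]%classic f t B.
move=> H t01;apply/cvgrPdist_le => e e0;have [d d0 Hd] := H e e0.
rewrite !near_withinE;have hb : \forall s \near t, `|s - t| < d by apply: (near_dist (f := id)) d0;exact: cvg_id.
apply: filterS hb => s sd st;rewrite /= in_itv /= => s01.
have st0 : s - t != 0 by rewrite subr_eq0.
have h := Hd t s t01 s01;rewrite subrr normr0 in h;have {}h := h d0 sd.
by rewrite -[B](scalerK st0) -scalerBr normrZ normfV mulrC ler_pdivrMr ?normr_gt0 // distrC.
Qed.
Lemma growth_deriv_in (f : R -> W) B t : growth f B t -> 0 <= t <= 1 -> deriv_in `[0, 1]%classic f t = B.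
move=> H t01;have PF := within_unit_proper t01;rewrite /deriv_in.
by apply: cvg_lim;[exact: norm_hausdorff|exact: growth_has_deriv].
Qed.
Lemma growth_near (f h : R -> W) B t : (exists2 d : R, 0 < d & forall s, 0 <= s <= 1 -> `|s - t| < d -> f s = h s) ->
 growth f B t -> growth h B t.
move=> [d d0 Hd] H e e0;have [d' d'0 Hd'] := H e e0;exists (Num.min d d');first by rewrite lt_min d0.
move=> s s' s0 s0';rewrite !lt_min => /andP[h1 h2] /andP[h3 h4];rewrite -!Hd //;exact: Hd'.
Qed.
Lemma growth_pair (W' : NM R) (f : R -> W) (f' : R -> W') B B' t : growth f B t -> growth f' B' t ->
 growth (fun s => (f s, f' s)) (B, B') t.
move=> H H' e e0;have [d d0 Hd] := H e e0;have [d' d'0 Hd'] := H' e e0.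
exists (Num.min d d');first by rewrite lt_min d0.
move=> s s' s0 s0';rewrite !lt_min => /andP[h1 h2] /andP[h3 h4].
rewrite -[X in `|X|]/(f s' - f s - (s' - s) *: B, f' s' - f' s - (s' - s) *: B') norm_pair ge_max.
by rewrite Hd // Hd'.
Qed.
End GrowthDerivative.
Lemma max0_sqr_gt0 (R : realDomainType) (u : R) : (0 < Num.max 0 u ^+ 2) = (0 < u).
have [h|] := boolP (0 < u);first by rewrite max_r ?(ltW h) // exprn_gt0.
by rewrite -leNgt => h;rewrite max_l // expr0n ltxx.
Qed.
Lemma escape_gt0 (R : realDomainType) (r N : R) : 0 <= r -> 0 <= N -> (0 < Num.max 0 (N ^+ 2 + - r ^+ 2) ^+ 2) = (r < N).
by move=> r0 N0;rewrite max0_sqr_gt0 subr_gt0 ltr_pXn2r ?nnegrE. Qed.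
(** Periodic extension through the fractional part; at integers the two branches are glued by
    [f 1 = f 0]. *)
Lemma frac_loop R (M : Top) (f : R -> M) : continuous (fun s : R => f (clip s)) -> f 1 = f 0 ->
 exists2 h : R -> M, is_loop h & forall t, 0 <= t <= 1 -> h t = f t.
move=> fc f10;pose k (t : R) := f (clip (t - (Num.floor t)%:~R)).
have fr (t : R) : 0 <= t - (Num.floor t)%:~R < 1.
 by rewrite subr_ge0 floor_le ltrBlDl -[X in _ + X]/(1%:~R) -intrD floorD1_gt.
have kE (t : R) (z : int) : z%:~R <= t < (z + 1)%:~R -> k t = f (clip (t - z%:~R)).
 by move=> h;rewrite /k (@floor_def _ t z).
exists k.
 split=> t;last first.
 rewrite /k;have -> : Num.floor (t + 1) = Num.floor t + 1 by rewrite -[1 in LHS]/(1%:~R) floorDrz ?intr_int ?intrKfloor.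
 by rewrite intrD opprD addrACA subrr addr0.
 set z := Num.floor t;have zt : z%:~R <= t by exact: floor_le.
 have tz : t < (z + 1)%:~R by exact: floorD1_gt.
 suff : cts t k by [].
 apply: (@ct_near _ _ _ (fun v : R => if v - z%:~R <= 0 then f (clip (v - (z - 1)%:~R)) else f (clip (v - z%:~R)))).
 have n1 : \forall v \near t, (z - 1)%:~R < v by apply: lt_nbhsr;apply: lt_le_trans zt;rewrite ltr_int;lia.
 have n2 : \forall v \near t, v < (z + 1)%:~R by apply: (near_lt (f := id)) tz;exact: cvg_id.
 apply: filterS2 n1 n2 => v v1 v2;rewrite subr_le0;have [h|h] := leP v z%:~R;last by rewrite (kE v z) // ltW.
 move: h;rewrite le_eqVlt => /orP[/eqP ->|h];last by rewrite (kE v (z - 1)) // subrK h ltW.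
 rewrite (kE _ z);last by rewrite lexx ltr_int;lia.
 by rewrite subrr intrB opprB addrCA subrr addr0 clip_ge1 // clip_le0.
 have sc (w : R) : cts t (fun v : R => f (clip (v - w))).
 apply: (ct_comp (f := fun s : R => f (clip s)) (a := fun v => v - w));first exact: fc.
 by apply: ctB;[exact: cvg_id|exact: ct_cst].
 apply: ct_glue;[exact: sc|exact: sc| |].
 by apply: ctB;[exact: cvg_id|exact: ct_cst].
 by move=> e;rewrite e intrB opprB addrCA e addr0 clip_ge1 // clip_le0.
move=> t /andP[t0];rewrite le_eqVlt => /orP[/eqP ->|t1].
 by rewrite (kE 1 1) ?subrr ?clip_le0 // lexx /= -[X in X < _]/(1%:~R) ltr_int.
by rewrite (kE t 0) ?subr0 ?clip_id ?t0 ?ltW // add0r.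
Qed.

(** * The limit curve solves the original system *)

Section Conclusion.
Variables (R : realType) (n : nat) (M : Top) (A : SA R n M) (g : RM A)
 (HM : CCM A).
Local Notation V := 'rV[R]_n.
Implicit Types (i j : chart_index A).
Variables (m : nat) (ci : 'I_m -> chart_index A) (cc : 'I_m -> V) (cr : 'I_m -> R)
 (gc : good_cover ci cc cr).
Local Notation E := (d_iota ci cc cr).
Local Notation lift := (lift ci cc cr).
Local Notation lcoord := (lcoord ci cc cr).
Local Notation Y := 'rV[R]_(m * (1 + n)).
Variables (H : R -> cotangent A -> R)
 (H_smooth : smooth_hamiltonian g H)
 (rho : R)
 (rho01 : 0 <= rho < 1)
 (H_far : forall t z, 0 <= t <= 1 -> cot_norm g z < 1 -> rho < cot_norm g z -> H t z = 0)
 (rho' a : R)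
 (rho'_gt : rho < rho')
 (rho'_lt1 : rho' < 1)
 (a_gt0 : 0 < a)
 (gamma : R -> M)
 (gamma_smooth : smooth_curve A gamma).
Local Notation sigma := (speed g gamma).
Local Notation Ht := (ramped g H sigma rho' a).
Variables (c : R) (xx : R -> M) (yy : R -> Y) (aa : R -> R).
Local Notation W := (fun i t => lcoord i (xx t, yy t)).
Variables (length_lt : (\int[lebesgue_measure]_(t in `[0, 1]%classic) sigma t)%R * (rho' + a) < c)
 (GQ : forall t i, 0 <= t <= 1 -> cdom i (xx t) -> growth (fun s => chart i (xx s)) (Hp Ht i t (W i t)) t)
 (GP : forall t i, 0 <= t <= 1 -> cdom i (xx t) ->
 growth (fun s => yy s *m (E i (xx s))^T) (- Hq Ht i t (W i t)) t)
 (GA : forall t i, 0 <= t <= 1 -> cdom i (xx t) ->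
 growth aa (dotv (W i t).2 (Hp Ht i t (W i t)) - hloc Ht i t (W i t) : R^o) t)
 (XN : forall (t : R) (S : M -> Prop), 0 <= t <= 1 -> (\forall x \near xx t, S x) ->
 exists2 d : R, 0 < d & forall s, 0 <= s <= 1 -> `|s - t| < d -> S (xx s))
 (x10 : xx 1 = xx 0)
 (y10 : yy 1 = yy 0)
 (aa_ge : c <= aa 1 - aa 0).
Let sc : continuous sigma. exact: speed_cont. Qed.
Let s0 : forall t, 0 <= sigma t. exact: speed_ge0. Qed.
Let SDT : forall i t w, cimg i w.1 -> exists L, sdift id (hloc Ht i) t w L.
by move=> i t w;exact: (ramped_SDT H_smooth rho01 H_far sc rho'_gt a_gt0). Qed.
(** [clip] makes the curve a continuous map on all of R, constant outside [0, 1]. *)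
Definition orbit t : cotangent A := lift (xx (clip t), yy (clip t)).
Lemma xx_clip_cont : continuous (fun s : R => xx (clip s)).
move=> t S nS;have [d d0 Hd] := XN (clip_itv t) nS.
have hb : \forall s \near t, `|clip s - clip t| < d.
 by apply: (near_dist (f := @clip R)) d0;apply: (ct_clip (f := id));exact: cvg_id.
by apply: (near_mono (P := fun s : R => `|clip s - clip t| < d)) hb => s;apply: Hd;exact: clip_itv.
Qed.
Lemma sdif_W i t : cdom i (xx (clip t)) -> sdif (@clip R) (fun s => W i (clip s)) t
 (fun h : R => (h *: Hp Ht i (clip t) (W i (clip t)), h *: - Hq Ht i (clip t) (W i (clip t)))).
move=> it;have t01 := clip_itv t;apply: sdif_pair.
 exact: (growth_sdif (GQ t01 it)).
exact: (growth_sdif (GP t01 it)).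
Qed.
Let clipc (t : R) : cts t (@clip R).
by apply: (ct_clip (f := id));exact: cvg_id. Qed.
Lemma W_cont i t : cdom i (xx (clip t)) -> cts t (fun s : R => W i (clip s)).
by move=> it;exact: sdif_cvg (@clipc t) (sdif_W it). Qed.
Lemma near_xx i t : cdom i (xx (clip t)) -> \forall s \near t, cdom i (xx (clip s)).
by move=> it;exact: near_comp (@xx_clip_cont t) (nbhs_chart_dom it). Qed.
Lemma orbit_norm i t : cdom i (xx (clip t)) -> cot_norm g (orbit t) = Num.sqrt (cosq g i (W i (clip t))).
by move=> it;exact: cot_norm_lift. Qed.
(** Positive exactly where the norm exceeds [rho]; the outer square makes it differentiable across
    that level. *)
Definition escape t : R := Num.max 0 (cot_norm g (orbit t) ^+ 2 + - rho ^+ 2) ^+ 2.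
(** dH vanishes on its own Hamiltonian vector, and beyond [rho] it is a multiple of the differential
    of the squared norm. If the factor is zero, then dH and the vector itself vanish. *)
Lemma dcosq_orbit i t : cdom i (xx (clip t)) -> rho < Num.sqrt (cosq g i (W i (clip t))) -> forall h : R,
 dcosq g i (W i (clip t)) (h *: Hp Ht i (clip t) (W i (clip t)), h *: - Hq Ht i (clip t) (W i (clip t))) = 0.
move=> it far h;set w := W i (clip t) in far *;set t' := clip t.
have iw : cimg i w.1 by exact: chart_imgP.
have [k [dk _ _ _]] := dH_ramped_far H_smooth rho01 H_far sc rho'_gt a_gt0 t' iw far.
have := dHE SDT t' (h *: Hp Ht i t' w) (h *: - Hq Ht i t' w) iw.
rewrite dk !dotvZr dotvNr [dotv (Hp _ _ _ _) _]dotvC mulrN subrr mulrCA => hz.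
have [k0|k0] := eqVneq (sigma t' * k) 0;last first.
 by move/eqP: hz;rewrite mulf_eq0 (negbTE k0) orbF => /eqP.
have dz v : dH Ht i t' w v = 0 by rewrite dk mulrCA k0 mulr0.
have -> : Hp Ht i t' w = 0 by apply/rowP => b;rewrite !mxE dz.
have -> : Hq Ht i t' w = 0 by apply/rowP => b;rewrite !mxE dz.
have [bL _] := sdif_cosq g iw;rewrite oppr0 scaler0;exact: blin0 bL.
Qed.
Lemma escape_const t : escape t = escape 0.
apply: is_derive_0_is_cst => {}t.
set i := chart_at A (xx (clip t));have it : cdom i (xx (clip t)) by exact: mem_chart_at.
set w := W i (clip t);have iw : cimg i w.1 by exact: chart_imgP.
have d1 := sdif_comp (d := id) (h := fun s : R => W i (clip s)) (W_cont it) (sdif_W it) (sdif_cosq g iw).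
have d2 := sdifD d1 (sdif_cst (@clip R) t (- rho ^+ 2)).
have c2 : cts t (fun s : R => cosq g i (W i (clip s)) + - rho ^+ 2) by exact: sdif_cvg (@clipc t) d2.
have d3 := sdif_comp (d := id) (h := fun s : R => cosq g i (W i (clip s)) + - rho ^+ 2) c2 d2 (sdif_max2 _).
have d4 : sdif (@clip R) escape t (fun=> 0).
 apply: (sdif_near (F := fun s => Num.max 0 (cosq g i (W i (clip s)) + - rho ^+ 2) ^+ 2)).
 apply: (near_mono (P := fun s => cdom i (xx (clip s)))) (near_xx it) => s is_.
 have iws : cimg i (W i (clip s)).1 by exact: chart_imgP.
 by rewrite /escape (orbit_norm is_) sqr_sqrtr // cosq_ge0.
 apply: sdif_eq d3 => h /=;rewrite addr0;have [le|gt] := leP (cosq g i w) (rho ^+ 2).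
 by rewrite max_l ?mulr0 // subr_le0.
 rewrite (dcosq_orbit it) ?mul0r //;rewrite -(@ltr_pXn2r _ 2) ?nnegrE ?sqrtr_ge0 ?sqr_sqrtr ?cosq_ge0 //.
 by case/andP: rho01.
have [_ H4] := d4;apply: cvg_growth => e e0;have [S /nbhs_ballP[r /= r0 Hr] HS] := H4 e e0;exists r => // h hr.
rewrite scaler0;apply: le_trans (HS t (t + h) _ _) _.
- by apply: Hr;rewrite -ball_normE /= subrr normr0.
- by apply: Hr;rewrite -ball_normE /= opprD addrA subrr add0r normrN.
rewrite ler_wpM2l ?(ltW e0) //;have := clamp_lip (t + h) t.
by rewrite [t + h - t]addrAC subrr add0r.
Qed.
Definition lagrangian t : R := let i := chart_at A (xx t) in dotv (W i t).2 (Hp Ht i t (W i t)) - hloc Ht i t (W i t).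
Lemma lagrangian_growth t : 0 <= t <= 1 -> growth aa (lagrangian t : R^o) t.
by move=> t01;apply: GA => //;exact: mem_chart_at. Qed.
Lemma lagrangian_far (s : R) : rho < cot_norm g (lift (xx s, yy s)) -> lagrangian s <= (rho' + a) * sigma s.
move=> fs;have is_ := mem_chart_at A (xx s);rewrite [leRHS]mulrC.
have h : dotv (yy s *m (E (chart_at A (xx s)) (xx s))^T) (Hp Ht (chart_at A (xx s)) s (W (chart_at A (xx s)) s)) - Ht s (lift (xx s, yy s)) <= sigma s * (rho' + a).
 first [exact: (ramped_out HM gc H_smooth rho01 H_far rho'_gt a_gt0 gamma_smooth s is_ fs)
 | exact: (ramped_out HM H_smooth rho01 H_far rho'_gt a_gt0 gamma_smooth s is_ fs)
 | by apply: ramped_out fs => //;exact: H_far].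
by rewrite /lagrangian /hloc -lift_lcoord.
Qed.
(** By conservation of [escape] one point beyond [rho] puts the whole orbit there. Then the
    Lagrangian is at most (rho' + a) times the speed of the geodesic, and integrating contradicts an
    action of at least c. *)
Lemma orbit_slow t : cot_norm g (orbit t) <= rho.
have r0 : 0 <= rho by case/andP: rho01.
have n0 s : 0 <= cot_norm g (orbit s) by exact: sqrtr_ge0.
rewrite leNgt;apply/negP => far.
have pos : 0 < escape t by rewrite /escape (escape_gt0 r0 (n0 t)).
have allfar s : rho < cot_norm g (orbit s).
 have es : 0 < escape s by rewrite (escape_const s) -(escape_const t).
 by rewrite -(escape_gt0 r0 (n0 s));exact: es.
have cs : continuous (fun s : R => (rho' + a) * sigma s).
 move=> s;suff : cts s (fun s : R => (rho' + a) * sigma s) by [].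
 by apply: ctM;[exact: ct_cst|exact: sc].
have [Bw BI] := growth_integral lagrangian_growth.
have : (\int[lebesgue_measure]_(t in `[0, 1]%classic) lagrangian t)%R <=
 (\int[lebesgue_measure]_(t in `[0, 1]%classic) ((rho' + a) * sigma t))%R.
 apply: le_Rintegral => //.
 - by apply: continuous_compact_integrable => //;exact: segment_compact.
 - apply: continuous_compact_integrable;first exact: segment_compact.
 exact: (continuous_subspaceT cs).
 - move=> s;rewrite /= in_itv /= => s01.
 have fs : rho < cot_norm g (lift (xx s, yy s)) by have := allfar s;rewrite /orbit clip_id.
 exact: lagrangian_far.
rewrite RintegralZl //;last first.
 by apply: continuous_compact_integrable;[exact: segment_compact|exact: continuous_subspaceT].
rewrite BI => h;have := lt_le_trans length_lt (le_trans aa_ge h).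
by rewrite mulrC ltxx.
Qed.
Lemma hloc_slow i t w : 0 <= t <= 1 -> cimg i w.1 -> Num.sqrt (cosq g i w) <= rho' ->
 hloc Ht i t w = H t (cot_chart_inv i w).
move=> t01 iw le;rewrite /hloc /ramped /ext0 cot_norm_inv // hramp0 // mulr0 addr0.
by rewrite (le_lt_trans le rho'_lt1) clip_id.
Qed.
Lemma orbit_cont : continuous orbit.
apply/continuousP => B oB;rewrite openE => t Bt;rewrite /interior.
set i := chart_at A (xx (clip t));have it : cdom i (xx (clip t)) by exact: mem_chart_at.
have oW : open [set w : V * V | cimg i w.1 /\ B (cot_chart_inv i w)] by exact: oB.
have Wt : [set w : V * V | cimg i w.1 /\ B (cot_chart_inv i w)] (W i (clip t)).
 by split;[exact: chart_imgP|rewrite -lift_lcoord].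
have nW := near_comp (W_cont it) (open_nbhs_nbhs (conj oW Wt)).
apply: near_mono2 nW (near_xx it) => s [_ Bs] is_.
by rewrite /= /orbit (lift_lcoord _ _ _ (i := i)).
Qed.
Lemma orbit_growth i t : 0 <= t <= 1 -> cdom i (xx t) ->
 growth (cot_chart i \o orbit) (Hp Ht i t (W i t), - Hq Ht i t (W i t)) t.
move=> t01 it;apply: growth_near (growth_pair (GQ t01 it) (GP t01 it)).
have [d d0 Hd] := XN t01 (nbhs_chart_dom it);exists d => // s s01 st.
by rewrite /= /orbit clip_id // cot_chart_lift //;exact: Hd.
Qed.
Lemma orbit_periodic : periodic_orbit g H orbit.
split.
- exact/continuous_subspaceT/orbit_cont.
- by move=> t _;rewrite /disc_cotangent /=;apply: le_lt_trans (orbit_slow t) _;case/andP: rho01.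
- by rewrite /orbit clip_le0 // clip_ge1 // x10 y10.
move=> t i;rewrite /= in_itv /= => t01;rewrite /orbit /= clip_id // => it.
have iw : cimg i (W i t).1 by exact: chart_imgP.
exists (Hp Ht i t (W i t), - Hq Ht i t (W i t));last exact: growth_has_deriv (orbit_growth t01 it) t01.
move=> v;rewrite (cot_chart_lift _ _ _ (i := i)) // /omega_can /ext_deriv1.
have dl (u b : V * V) : 'D_u (fun w' : V * V => liouville w' b) (W i t) = dotv u.2 b.1.
 have bs : blin (fun w' : V * V => dotv w'.2 b.1).
 split=> [x y|k x|];[exact: dotvDl|exact: dotvZl|exists (n%:R * `|b.1|);first exact: mulr_ge0].
 move=> x;apply: le_trans (dotv_norm _ _) _;rewrite mulrAC ler_wpM2l ?mulr_ge0 //.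
 by rewrite [x]surjective_pairing norm_pair le_max lexx orbT.
 exact: (sdif_derive u (sdif_lin bs (sdif_coord id (W i t)))).
rewrite !dl /=.
(* The orbit has norm at most [rho], strictly below [rho'], so the ramped Hamiltonian equals H on a
   neighbourhood and the differentials agree. *)
have dF : sdif id (H t \o cot_chart_inv i) (W i t) (dH Ht i t (W i t)).
 apply: sdif_near (sdift_sdif (sdift_dH SDT t iw)).
 have lt : Num.sqrt (cosq g i (W i t)) < rho'.
 by apply: le_lt_trans rho'_gt;have := orbit_slow t;rewrite (@orbit_norm i) clip_id.
 have h1 : \forall w \near W i t, Num.sqrt (cosq g i w) < rho'.
 apply: (near_lt (f := fun w => Num.sqrt (cosq g i w))) lt.
 by apply: (ct_comp (f := @Num.sqrt R));[exact: sqrt_continuous|exact: cosq_cont].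
 have h2 : \forall w \near W i t, cimg i w.1.
 by apply: (@ct_p1 _ _ (W i t));apply: open_nbhs_nbhs;split=> //;exact: open_chart_img.
 by apply: near_mono2 h1 h2 => w w1 w2;rewrite (hloc_slow t01 w2) // ltW.
rewrite (sdif_diff dF) [v in LHS]surjective_pairing (dHE SDT) // dotvNl [dotv v.2 _]dotvC.
by rewrite opprB opprK addrC.
Qed.
(** The ramp vanishes on the orbit, so the integrand is the Lagrangian, and [aa] is an
    antiderivative of it. *)
Lemma orbit_action : c <= symplectic_action H orbit.
have [_ BI] := growth_integral lagrangian_growth;apply: (le_trans aa_ge);rewrite -BI.
rewrite /symplectic_action le_eqVlt;apply/orP;left;apply/eqP/eq_Rintegral => t;rewrite inE => tI.
have t01 : 0 <= t <= 1 by move: tI;rewrite /= in_itv.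
have ot : orbit t = lift (xx t, yy t) by rewrite /orbit clip_id.
set i := chart_at A (base (orbit t));have ii : i = chart_at A (xx t) by rewrite /i ot.
have it : cdom i (xx t) by rewrite ii;exact: mem_chart_at.
have iw : cimg i (W i t).1 by exact: chart_imgP.
have gq : growth (fun s => chart i (base (orbit s))) (Hp Ht i t (W i t)) t.
 by apply: growth_near (GQ t01 it);exists 1 => // s s01 _;rewrite /orbit clip_id.
transitivity (dotv (cot_chart i (orbit t)).2 (deriv_in `[0, 1]%classic (fun s => chart i (base (orbit s))) t) - H t (orbit t));last by [].
rewrite (growth_deriv_in gq t01) /lagrangian -ii ot (cot_chart_lift _ _ _ (i := i)) //.
have le : Num.sqrt (cosq g i (W i t)) <= rho'.
 by apply: le_trans (ltW rho'_gt);have := orbit_slow t;rewrite (@orbit_norm i) clip_id.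
by rewrite (hloc_slow t01 iw le) -lift_lcoord.
Qed.
End Conclusion.

(** * Radius of the support, and short loops *)

Section Support.
Variables (R : realType) (n : nat) (M : Top) (A : SA R n M) (g : RM A)
 (H : R -> cotangent A -> R).
Lemma open_disc r : open [set z : cotangent A | cot_norm g z < r].
have oB : cot_open [set z : cotangent A | cot_norm g z < r];last exact: oB.
move=> i;rewrite openE => w [iw wr];have wr' : Num.sqrt (cosq g i w) < r by rewrite -(cot_norm_inv g iw).
have sq : cts w (fun w => Num.sqrt (cosq g i w)).
 by apply: (ct_comp (f := @Num.sqrt R));[exact: sqrt_continuous|exact: cosq_cont].
have h1 := near_lt sq wr'.
have h2 := near_comp (@ct_p1 _ _ w) (open_nbhs_nbhs (conj (@open_chart_img _ _ _ A i) iw)).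
have key w' : Num.sqrt (cosq g i w') < r -> cimg i w'.1 -> cimg i w'.1 /\ cot_norm g (cot_chart_inv i w') < r.
 by move=> w1 w2;rewrite (cot_norm_inv g w2).
exact: (near_mono2 key h1 h2).
Qed.
(** The function 1 / (1 - |z|) is locally bounded on the open disc bundle, hence bounded by some C
    on the compact support; the radius is 1 - 1 / C, truncated at 0. *)
Lemma support_radius : compactly_supported g H -> exists2 rho : R, 0 <= rho < 1 &
 forall t z, 0 <= t <= 1 -> cot_norm g z < 1 -> rho < cot_norm g z -> H t z = 0.
move=> cK;have [z [_ [_ zd]]|C C0 HC] := @compact_ub R _ _ (fun p : R * cotangent A => (1 - cot_norm g p.2)^-1) cK.
 have z1 : cot_norm g z.2 < 1 by exact: zd.
 exists (2 / (1 - cot_norm g z.2)).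
 have nz : \forall z' \near z, cot_norm g z'.2 < (1 + cot_norm g z.2) / 2.
 apply: (near_comp (f := fun p : R * cotangent A => p.2) (@ct_p2 _ _ z) (Q := fun w => cot_norm g w < _)).
 by apply: open_nbhs_nbhs;split;[exact: open_disc|move: z1 => /=;lra].
 apply: near_mono nz => z' h;rewrite -[leRHS]invf_div lef_pV2 ?posrE;move: (cot_norm g z'.2) (cot_norm g z.2) z1 h => u v *;lra.
exists (Num.max 0 (1 - C^-1)).
 by rewrite le_max lexx /= gt_max ltr01 /= ltrBlDr ltrDl invr_gt0.
move=> t z t01 z1;rewrite gt_max => /andP[_ far];apply/eqP;apply: contraT => Hz.
have dz : ham_domain g (t, z) by split;rewrite /= ?in_itv.
have Kz : (closure [set p | ham_domain g p /\ H p.1 p.2 != 0] `&` ham_domain g) (t, z).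
 by split=> //;apply: subset_closure.
have := HC _ Kz;rewrite /= => h.
have p1 : 0 < 1 - cot_norm g z by rewrite subr_gt0.
have h2 : C^-1 <= 1 - cot_norm g z by rewrite -[leRHS]invrK lef_pV2 ?posrE ?invr_gt0.
lra.
Qed.
End Support.
Lemma short_alg (R : realFieldType) (e N1 d : R) : e * (8 * (N1 + 1)) = d -> 0 <= e -> 0 <= e * N1 ->
 (e + e) * N1 + e <= 3 / 8 * d.
by move=> <- h1 h2;lra. Qed.
Lemma mesh_cell (R : realFieldType) (s k t N d : R) : t * N = 1 -> 0 < t -> t < d -> k <= s * N -> s * N < k + 1 ->
 `|s - k * t| < d.
move=> tN t0 td h1 h2;have e : s * N * t = s by rewrite -mulrA [N * t]mulrC tN mulr1.
have a := ler_wpM2r (ltW t0) h1;have b : s * N * t < (k + 1) * t by rewrite ltr_pM2r.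
rewrite e in a b;rewrite mulrDl mul1r in b;rewrite ltr_norml;apply/andP;split;lra.
Qed.

Section ShortLoops.
Variables (R : realType) (n : nat) (M : Top) (A : SA R n M) (g : RM A)
 (HM : CCM A)
 (m : nat) (ci : 'I_m -> chart_index A) (cc : 'I_m -> 'rV[R]_n) (cr : 'I_m -> R)
 (gc : good_cover ci cc cr).
Local Notation V := 'rV[R]_n.
Local Notation iota := (iota_emb ci cc cr).
Local Notation E := (d_iota ci cc cr).
Local Notation KY := (m * (1 + n))%N.
Local Notation Y := 'rV[R]_KY.
Lemma cot_norm_lift_bnd : exists2 N1 : R, 0 < N1 & forall x (y : Y), `|y| <= 1 -> cot_norm g (lift ci cc cr (x, y)) <= N1.
have [C C0 HC] := metric_bnd_cover g HM gc;have [D D0 HD] := E_bnd HM gc.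
pose B : R := KY%:R * D;pose S : R := n%:R * (n%:R * C * B) * B.
have B0 : 0 <= B by rewrite mulr_ge0 // ltW.
exists (1 + Num.sqrt S);first by rewrite ltr_wpDr // sqrtr_ge0.
move=> x y y1;have [k _ hk] : exists2 k, true & cr k / 2 < beta ci cc cr k x.
 by have [k hk] := beta_cover gc x;exists k.
have xk : xi ci cc cr k x != 0 by rewrite (xi1 gc hk) oner_neq0.
have [kx _] := xi_supp gc xk;have [_ g2 _] := HC k x xk;have [e1 _] := HD k x xk.
have -> : cot_norm g (lift ci cc cr (x, y)) = Num.sqrt (cosq g (ci k) (lcoord ci cc cr (ci k) (x, y))) by exact: cot_norm_lift.
apply: le_trans (_ : Num.sqrt S <= _);last by rewrite lerDr.
apply: ler_wsqrtr;apply: le_trans (ler_norm _) _;apply: le_trans (dotv_norm _ _) _.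
have hp : `|y *m (E (ci k) x)^T| <= B.
 apply: le_trans (mulmx_norm _ _) _;rewrite -mulrA ler_wpM2l //.
 by apply: le_trans (ler_wpM2r _ y1) _ => //;rewrite mul1r;apply: le_trans (norm_trmx_le _) e1.
apply: ler_pM;[by rewrite mulr_ge0|exact: normr_ge0| |exact: hp].
rewrite ler_wpM2l //;apply: le_trans (mulmx_norm _ _) _;rewrite mulrAC.
by apply: ler_pM;[rewrite mulr_ge0|exact: normr_ge0|rewrite ler_wpM2l|exact: hp].
Qed.
(** An ambient covector of norm at most 1 has dual norm at most [N1], so its value changes along the
    curve by at most [N1] times the length, up to Riemann sum errors. Testing with coordinate
    covectors bounds the displacement in the sup norm. *)
Lemma short_loop (d : R) : 0 < d -> exists2 e : R, 0 < e & forall gamma, smooth_curve A gamma -> (forall t, gamma (t + 1) = gamma t) ->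
 curve_length g gamma < e -> forall t, `|iota (gamma t) - iota (gamma 0)| < d.
move=> d0;have [N1 N10 HN1] := cot_norm_lift_bnd.
have e0 : 0 < d / (8 * (N1 + 1)) by rewrite divr_gt0 // mulr_gt0 // addr_gt0.
(* The same [e] bounds the length, the Riemann sum error and the chord error; the total (e + e) N1 +
   e stays below 3/8 d. *)
set e := d / _ in e0;exists e => // gamma gs gper le_e t.
have gcont : continuous gamma by case: gs.
have io_c := iota_cont HM gc.
suff key s : 0 <= s <= 1 -> `|iota (gamma s) - iota (gamma 0)| < d.
 have := key (t - (Num.floor t)%:~R);rewrite -(periodic_int (Num.floor t) (t - _) gper) subrK;apply.
 by rewrite subr_ge0 floor_le /= lerBlDl -[X in _ + X]/(1%:~R) -intrD ltW // floorD1_gt.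
move=> s01;have sc : continuous (speed g gamma) by exact: speed_cont.
have [sr sr0 Hsr] := riemann_node sc e0.
have [dc dc0 Hdc] := curve_chords g HM gc gs e0.
have d2 : 0 < d / 2 by rewrite divr_gt0.
have [du du0 Hdu] := gamma_unif HM gc gcont d2.
have [N [n1 [n2 n3]]] : exists N : nat, N.+1%:R^-1 < sr /\ (N.+1%:R^-1 < dc /\ N.+1%:R^-1 < du).
 near \oo => N;exists N;split;[|split];near: N.
 - exact: (near_infty_natSinv_lt (PosNum sr0)).
 - exact: (near_infty_natSinv_lt (PosNum dc0)).
 - exact: (near_infty_natSinv_lt (PosNum du0)).
set tau : R := N.+1%:R^-1 in n1 n2 n3;have t0 : 0 < tau by rewrite invr_gt0 ltr0n.
have tN : tau * N.+1%:R = 1 by rewrite mulVf // pnatr_eq0.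
have hs := Hsr N (ltW n1);rewrite -/tau in hs.
pose B j := tau * (speed g gamma (node R (inord j : 'I_N.+1)) * N1 + e).
have B0 j : 0 <= B j by rewrite mulr_ge0 ?(ltW t0) // addr_ge0 ?(ltW e0) // mulr_ge0 ?(ltW N10) // speed_ge0.
have stepj (y : Y) j : `|y| <= 1 -> (j < N.+1)%N ->
 dotv y (iota (gamma (j.+1%:R * tau))) - dotv y (iota (gamma (j%:R * tau))) <= B j.
 move=> y1 jN;have e1 : gamma (node R (inord j : 'I_N.+1)) = gamma (j%:R * tau).
 by rewrite (gamma_node gper) inordK.
 have e2 : gamma (node R (inord j : 'I_N.+1) + tau) = gamma (j.+1%:R * tau).
 rewrite -natr1 mulrDl mul1r /node;case: eqP => [h|_];last by rewrite inordK.
 have -> : j = 0%N by have := congr1 val h;rewrite /= inordK.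
 by rewrite mul0r add0r [1 + _]addrC gper.
 have h := Hdc (node R (inord j : 'I_N.+1)) tau y (node_itv R _) _;rewrite t0 n2 in h;have {}h := h isT.
 rewrite e1 e2 dotvBr in h;apply: le_trans h _;rewrite /B ler_wpM2l ?(ltW t0) //;apply: lerD.
 by rewrite ler_wpM2l ?speed_ge0 // HN1.
 by rewrite ler_piMr // ltW.
have total : \sum_(0 <= j < N.+1) B j <= (e + e) * N1 + e.
 rewrite big_mkord (eq_bigr (fun j : 'I_N.+1 => N1 * (tau * speed g gamma (node R j)) + tau * e));last first.
 by move=> j _;rewrite /B inord_val;ring.
 rewrite big_split /= (sum_mesh N e) -!mulr_sumr lerD2r mulrC ler_wpM2r ?(ltW N10) //.
 by apply: le_trans hs _;rewrite lerD2r;exact: ltW le_e.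
have part (y : Y) k : `|y| <= 1 -> (k <= N.+1)%N -> dotv y (iota (gamma (k%:R * tau)) - iota (gamma 0)) <= (e + e) * N1 + e.
 move=> y1 kN;apply: le_trans total;rewrite (big_cat_nat (n := k)) //=.
 apply: le_trans (_ : \sum_(0 <= j < k) B j <= _);last by rewrite lerDl;apply: sumr_ge0.
 have tel := telescope_sumr (fun j : nat => dotv y (iota (gamma (j%:R * tau)))) (leq0n k).
 rewrite mul0r in tel;rewrite dotvBr -tel big_nat_cond [leRHS]big_nat_cond.
 by apply: ler_sum => j /andP[/andP[_ jk] _];apply: stepj => //;exact: leq_trans jk kN.
have bnd : (e + e) * N1 + e <= 3 / 8 * d.
 have eN : e * (8 * (N1 + 1)) = d by rewrite /e divfK // gt_eqF // mulr_gt0 // addr_gt0.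
 exact: short_alg eN (ltW e0) (mulr_ge0 (ltW e0) (ltW N10)).
have [s0 s1] : 0 <= s /\ s <= 1 by apply/andP.
pose k := Num.truncn (s * N.+1%:R).
have sN0 : 0 <= s * N.+1%:R by rewrite mulr_ge0.
have /andP[k1 k2] := truncn_itv sN0.
have kN : (k <= N.+1)%N by rewrite -(ler_nat R);apply: le_trans k1 _;rewrite ler_piMl.
have ks : `|s - k%:R * tau| < du.
 by rewrite -[k.+1%:R]natr1 in k2;exact: mesh_cell tN t0 n3 k1 k2.
have k01 : 0 <= k%:R * tau <= 1.
 by rewrite mulr_ge0 ?(ltW t0) //= -[leRHS]tN mulrC ler_pM2l // ler_nat.
have hk : `|iota (gamma (k%:R * tau)) - iota (gamma 0)| <= 3 / 8 * d.
 apply: mx_norm_le => [|a b];first by rewrite mulr_ge0 // ltW.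
 rewrite ord1 -dotv_delta;set w := iota _ - iota _;rewrite ler_norml;apply/andP;split.
 rewrite lerNl -dotvNl;apply: le_trans bnd;apply: part => //;by rewrite normrN norm_delta_le.
 by apply: le_trans bnd;apply: part => //;exact: norm_delta_le.
have := Hdu (k%:R * tau) s k01 ks;have := ler_distD (iota (gamma (k%:R * tau))) (iota (gamma s)) (iota (gamma 0)).
move: hk d0;lra.
Unshelve. all: by end_near. Qed.
End ShortLoops.

(** * Choice of the constants and assembly of the limit orbit *)

Theorem theorem1 (R : realType) (n : nat) (M : topologicalType)
    (A : smooth_atlas R n M) (HM : closed_connected_manifold A)
    (g : riemannian_metric A)
    (alpha : set (R -> M))
    (alpha_class : free_homotopy_class alpha)
    (alpha_nontrivial : nontrivial_class alpha)
    (H : R -> cotangent A -> R)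
    (H_smooth : smooth_hamiltonian g H)
    (H_supp : compactly_supported g H)
    (c : R)
    (H_sup : sup [set H t (zero_section A x) | t in `[0, 1]%classic & x in [set: M]] = - c)
    (c_le : ((- c)%:E <= - ell g alpha)%E) :
  exists z : R -> cotangent A,
    [/\ periodic_orbit g H z,
        exists2 gamma, alpha gamma &
          forall t, `[0, 1]%classic t -> gamma t = base (z t) &
        c <= symplectic_action H z].
Proof.
have [m [ci [cc [cr gc]]]] := good_cover_ex HM.
have [rho rho01 H_far] := support_radius H_supp.
have [ecl ecl0 [Hclass [dcl dcl0 Hstep]]] := class_follow HM gc alpha_class.
have ell_le : (ell g alpha <= c%:E)%E by rewrite -leeN2 -EFinN.
have geo (b : R) : c < b -> exists2 gamma, periodic_geodesic g gamma /\ alpha gamma & curve_length g gamma < b.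
 move=> cb;have [|y [gamma hg <-] hb] := @ereal_inf_lt R [set (curve_length g x)%:E | x in [set x | periodic_geodesic g x /\ alpha x]] b%:E.
 by apply: le_lt_trans ell_le _;rewrite lte_fin.
 by exists gamma => //;rewrite -lte_fin.
(* If c <= 0, the class contains arbitrarily short closed geodesics. These stay near a point and are
   homotopic to a constant loop, against nontriviality. *)
have c_gt0 : 0 < c.
 rewrite ltNge;apply/negP => c0.
 have [d d0 Hd] := close_loops_homotopic HM gc;have [e e0 He] := short_loop g HM gc d0.
 have [gamma [[gper gs _] ag] gl] := geo e (le_lt_trans c0 e0).
 have lc : is_loop (cst (gamma 0) : R -> M) by split=> // t;exact: cst_continuous.
 apply: (alpha_nontrivial (gamma 0));apply: (class_homotopic alpha_class ag lc).
 apply: (Hd _ _ (class_loop alpha_class ag) lc) => t;rewrite distrC;exact: He.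
(* [rho'] and [rho' + a] divide the interval from [rho] to 1 into thirds; only rho < rho' and rho' +
   a < 1 are kept. *)
pose rho' := (2 * rho + 1) / 3;pose a := (1 - rho) / 3.
have [r0 r1] := andP rho01.
have rho'_gt : rho < rho' by rewrite /rho';lra.
have rho'_lt1 : rho' < 1 by rewrite /rho';lra.
have a_gt0 : 0 < a by rewrite /a;lra.
have rr0 : 0 < rho' + a by rewrite /rho' /a;lra.
have rr1 : rho' + a < 1 by rewrite /rho' /a;lra.
clearbody rho' a.
(* The infimum may equal c without being attained; the margin rho' + a < 1 leaves room for a
   geodesic whose length times rho' + a is below c. *)
have crr : c < c / (rho' + a) by rewrite ltr_pdivlMr // -[ltRHS]mulr1 ltr_pM2l.
have [gamma [[gper gs _] ag] gl] := geo _ crr.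
rewrite ltr_pdivlMr // in gl.
have sc : continuous (speed g gamma) by exact: speed_cont.
have s0 : forall t, 0 <= speed g gamma t by exact: speed_ge0.
have lE : (\int[lebesgue_measure]_(t in `[0, 1]%classic) speed g gamma t)%R = curve_length g gamma by [].
pose Ht := ramped g H (speed g gamma) rho' a.
have SDT : forall i t w, chart_img i w.1 -> exists L, sdift id (hloc Ht i) t w L.
 by move=> i t w;exact: (ramped_SDT H_smooth rho01 H_far sc rho'_gt a_gt0).
have HtC := ramped_cont H_smooth rho01 H_far sc rho'_gt a_gt0.
have [CH CH0 BD] := ramped_BD HM H_smooth rho01 H_far sc s0 rho'_gt a_gt0 gc.
have [CT CT0 tang_le] := tang_cot g HM gc.
have [C0 C00 low] := ramped_low HM gc H_smooth rho01 H_far rho'_gt a_gt0 gs.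
have cM : compact [set: M] by case: HM.
have lc := lift_ct HM gc HtC.
(* A real [sup] is an upper bound only for a bounded set, so boundedness of H on the zero section is
   established by compactness. *)
have [z _|B _ HB] := @compact_ub R _ (@box R M (m * (1 + n))%N 0) (fun q => `|Ht q.1 (lift ci cc cr q.2)|) (@box_compact R M _ cM _).
 exists (`|Ht z.1 (lift ci cc cr z.2)| + 1);exact: near_bnd (lc z).
have Hz t x : 0 <= t <= 1 -> Ht t (lift ci cc cr (x, 0)) = H t (zero_section A x).
 by exact: (ramped_zero g ci cc cr H rho01 a rho'_gt gamma x).
have zero_le t x : 0 <= t <= 1 -> Ht t (lift ci cc cr (x, 0)) <= - c.
 move=> t01;rewrite Hz // -H_sup;apply: ub_le_sup.
 exists B => w [u];rewrite /= in_itv /= => u01 [v _ <-];rewrite -Hz //;apply: le_trans (ler_norm _) _.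
 by apply: (HB (u, (v, 0)));split;rewrite /= ?in_itv //;split;rewrite /= ?normr0.
 by exists t;[rewrite /= in_itv|exists x].
have out t i x y : 0 <= t <= 1 -> chart_dom i x -> rho < cot_norm g (lift ci cc cr (x, y)) ->
 dotv (y *m (d_iota ci cc cr i x)^T) (Hp Ht i t (lcoord ci cc cr i (x, y))) - Ht t (lift ci cc cr (x, y)) <= speed g gamma t * (rho' + a).
 by move=> _ ix;exact: (ramped_out HM gc H_smooth rho01 H_far rho'_gt a_gt0 gs).
have gcont : continuous gamma by case: gs.
have chords e := @curve_chords R n M A g HM m ci cc cr gc gamma gs e.
have [Rb [kappa1 [/andP[k10 k11] Hdisc]]] := discrete_orbits HM gc SDT CH0 BD c_gt0 (ltW rr0) C00 CT0 sc lE gl zero_le tang_le low out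
 gcont gper chords ecl0 dcl0 ag (Hstep).
(* The penalty and the mesh tend to 0 together: the loop of index nu has at least nu + 1 nodes. *)
pose kap nu := kappa1 / nu.+1%:R.
have kap0 nu : 0 < kap nu <= kappa1.
 have n1 : 1 <= nu.+1%:R :> R by rewrite ler1n.
 by rewrite /kap divr_gt0 ?ltr0n //= ler_pdivrMr ?ltr0n // -[leLHS]mulr1 ler_pM2l.
have k01 nu : 0 <= kap nu <= 1 by case/andP: (kap0 nu) => h1 h2;rewrite ltW //= (le_trans h2).
have /choice[N_ HN] := fun nu => Hdisc (kap nu) (kap0 nu) nu.
pose x_ nu := sval (cid (proj2 (HN nu)));have Hx nu := svalP (cid (proj2 (HN nu))).
pose y_ nu := sval (cid (Hx nu));have Hxy nu := svalP (cid (Hx nu)).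
have Hao nu : almost_orbit ci cc cr Ht (kap nu) (x_ nu) (y_ nu) by case: (Hxy nu) => h _ _ _;exact: h.
have Hy nu j : `|y_ nu j| <= Rb by case: (Hxy nu) => _ h _ _;exact: h.
have [U [UU FU]] := @ultraFilterLemma nat \oo _.
have UP : ProperFilter U by exact: ultra_proper.
have mesh0 (e : R) : 0 < e -> \forall nu \near U, mesh R N_ nu < e.
 move=> e0;apply: FU;apply: filterS (near_infty_natSinv_lt (PosNum e0)) => nu;apply: le_lt_trans.
 by rewrite /mesh lef_pV2 ?posrE ?ltr0n // ler_nat ltnS;case: (HN nu).
have kappa0 : kap @ U --> (0 : R).
 apply/cvgrPdist_lt => e e0;apply: FU;apply: filterS (near_infty_natSinv_lt (PosNum e0)) => nu;apply: le_lt_trans.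
 have [h1 h2] := andP (kap0 nu);rewrite sub0r normrN gtr0_norm //.
 have q0 : 0 <= nu.+1%:R^-1 :> R by rewrite invr_ge0 ler0n.
 by rewrite /kap;exact: ler_piMl q0 k11.
have [xx [yy [cX cY x10 y10]]] := limits_ex HM UU x_ Hy.
have [aa Haa] := An_lim HM gc SDT HtC CH0 BD UU k01 Hao Hy.
have aa0 : aa 0 = 0.
 have h := Haa 0;rewrite lexx ler01 in h;have {}h := h isT.
 have e : (fun nu => An ci cc cr Ht kap x_ y_ nu (idx N_ nu (0 : R))) = fun=> 0.
 by apply/funext => nu;rewrite idx0 /An big_ord0.
 rewrite e in h;exact: (cvg_unique (@norm_hausdorff _ R) h (cvg_cst 0)).
(* Each discrete orbit has action at least c minus the squared mesh, and this defect vanishes in the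
   limit. *)
have aa_ge : c <= aa 1 - aa 0.
 rewrite aa0 subr0;apply/ler_addgt0Pr => e e0;have e2 : 0 < e / 2 by rewrite divr_gt0.
 have h := Haa 1;rewrite lexx ler01 in h;have /cvgrPdist_lt/(_ _ e2) h1 := h isT.
 have m0 : 0 < Num.min 1 (e / 2) by rewrite lt_min ltr01.
 have [nu [h2 h3]] := filter_ex (filterI h1 (mesh0 _ m0)).
 have [_ _ hact _] := Hxy nu;rewrite idx1 An_action in h2.
 move: h3;rewrite lt_min => /andP[h3 h4].
 have mp := mesh_gt0 R N_ nu;have h5 : mesh R N_ nu ^+ 2 <= mesh R N_ nu by rewrite expr2 ler_piMl // ltW.
 pose S := action (iota_emb ci cc cr) (fun j x y => mesh R N_ nu * Hk ci cc cr Ht (kap nu) (node R j) (x, y)) (x_ nu) (y_ nu).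
 have h6 : S - aa 1 <= `|aa 1 - S| by rewrite distrC;exact: ler_norm.
 have h7 : S - aa 1 < e / 2 := le_lt_trans h6 h2.
 have h8 : c - mesh R N_ nu ^+ 2 <= S := hact.
 clearbody S;clear -h4 h5 h7 h8;move: h4 h5 h7 h8;move: (mesh R N_ nu ^+ 2) (mesh R N_ nu) => q1 q2 h4 h5 h7 h8;lra.
have XN (t : R) (S : M -> Prop) (t01 : 0 <= t <= 1) (nS : \forall x \near xx t, S x) :=
 xx_near HM gc SDT CH0 BD UU mesh0 k01 Hao cX t01 nS.
have GQ t i (t01 : 0 <= t <= 1) (it : chart_dom i (xx t)) : growth (fun s => chart i (xx s)) (Hp Ht i t (lcoord ci cc cr i (xx t, yy t))) t.
 by move=> e e0;exact: (deriv_q HM gc SDT CH0 BD UU mesh0 k01 kappa0 Hao Hy cX cY t01 it e0).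
have GP t i (t01 : 0 <= t <= 1) (it : chart_dom i (xx t)) :
 growth (fun s => yy s *m (d_iota ci cc cr i (xx s))^T) (- Hq Ht i t (lcoord ci cc cr i (xx t, yy t))) t.
 by move=> e e0;exact: (deriv_p HM gc SDT CH0 BD UU mesh0 k01 kappa0 Hao Hy cX cY t01 it e0).
have GA t i (t01 : 0 <= t <= 1) (it : chart_dom i (xx t)) : growth aa (dotv (lcoord ci cc cr i (xx t, yy t)).2
 (Hp Ht i t (lcoord ci cc cr i (xx t, yy t))) - hloc Ht i t (lcoord ci cc cr i (xx t, yy t)) : R^o) t.
 by move=> e e0;exact: (deriv_a HM gc SDT HtC CH0 BD UU mesh0 k01 kappa0 Hao Hy cX cY Haa t01 it e0).
have [h hl hE] := frac_loop (xx_clip_cont XN) x10.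
exists (orbit ci cc cr xx yy);split.
- exact: (orbit_periodic HM gc H_smooth rho01 H_far rho'_gt rho'_lt1 a_gt0 gs gl GQ GP GA XN x10 y10 aa_ge).
- exists h;last by move=> t;rewrite /= in_itv /= => t01;rewrite hE // /orbit clip_id.
 (* A single fine discrete loop suffices: a member of the class follows its nodes, and so does the
    limit loop, which therefore lies in the class. *)
 have [nu hnu] := filter_ex (xx_follows HM gc SDT CH0 BD UU mesh0 k01 Hao cX ecl0).
 have [_ _ _ [f af ff]] := Hxy nu;apply: (Hclass (N_ nu) f h (x_ nu) af hl ff) => j t jt.
 have n0 : 0 < (N_ nu).+1%:R :> R by rewrite ltr0n.
 have t01 : 0 <= t <= 1.
 case/andP: jt => j1 j2;rewrite -(pmulr_rge0 _ n0) (le_trans _ j1) //= -(ler_pM2l n0) mulr1.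
 by apply: le_trans j2 _;rewrite natr1 ler_nat.
 by rewrite hE //;exact: hnu.
- exact: (orbit_action HM gc H_smooth rho01 H_far rho'_gt rho'_lt1 a_gt0 gs gl GQ GP GA XN aa_ge).
Qed.
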